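(* Let $(X,d,\mu)$ be a space of homogeneous type, let $1\le r<p<\infty$ and let $T$ be an $L^{r'}$-Hörmander singular operator. Let $W$ be an $n\times n$ matrix weight. (1) If $W\in A_{p/r}$, then for every $\vec f\in L^p(W)$ $$\|T\vec f\|_{L^p(W)}\lesssim [W]_{A_{\frac pr}}^{\frac1p}\,\big[W^{-\frac rp(\frac pr)'}\big]_{A^{sc}_{\infty,(\frac pr)'}}^{\frac1p}\,[W]_{A^{sc}_{\infty,\frac pr}}^{\frac1{p'}}\,\|\vec f\|_{L^p(W)}.$$ (2) If $1\le q<p$ with $\frac pq>r$ and $W\in A_q$, then for every $\vec f\in L^p(W)$ $$\|T\vec f\|_{L^p(W)}\lesssim \left(\frac{p}{rq}\right)'\,[W]_{A_q}^{\frac1p}\,[W]_{A^{sc}_{\infty,q}}^{\frac1{p'}}\,\|\vec f\|_{L^p(W)}.$$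
   Context: Space of homogeneous type $(X,d,\mu)$: $X$ is a set with a quasi-metric $d$, i.e. $d(x,y)\le c_d(d(x,z)+d(z,y))$ for some $c_d\ge1$, and a Borel measure $\mu$ with $\mu(B(x,2\rho))\le c_\mu\mu(B(x,\rho))$, where $B(x,\rho)=\{y:d(x,y)<\rho\}$. All balls are Borel sets with $0<\mu(B)<\infty$, and the Lebesgue differentiation theorem holds. For $B=B(x,\rho)$, $aB=B(x,a\rho)$. $\langle g\rangle_{t,B}=(\frac1{\mu(B)}\int_B|g|^td\mu)^{1/t}$ for $t<\infty$. For an exponent $t\in[1,\infty]$, $t'$ is the dual exponent, $\frac1t+\frac1{t'}=1$. For $1\le t\le\infty$, $T$ is an $L^t$-Hörmander singular operator if $T$ is linear, bounded on $L^2(X)$, and $Tf(x)=\int_XK(x,y)f(y)\,d\mu(y)$ for every continuous $f$ with bounded support and $x\notin\operatorname{supp}f$, where $K:X\times X\setminus\{(x,x)\}\to\mathbb{R}$ is a locally integrable kernel with $|K(x,y)|\le\frac{C}{\mu(B(x,d(x,y)))}$ and, for $t<\infty$, $$\sup_B\sup_{x,z\in\frac1{2c_d}B}\sum_{k=1}^\infty\mu(2^kB)\big\langle(K(x,\cdot)-K(z,\cdot))\chi_{2^kB\setminus2^{k-1}B}\big\rangle_{t,2^kB}<\infty,$$ $$\sup_B\sup_{x,z\in\frac1{2c_d}B}\sum_{k=1}^\infty\mu(2^kB)\big\langle(K(\cdot,x)-K(\cdot,z))\chi_{2^kB\setminus2^{k-1}B}\big\rangle_{t,2^kB}<\infty;$$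 for $t=\infty$ the averages $\langle\cdot\rangle_{t,2^kB}$ are replaced by the norms $\|\cdot\|_{L^\infty(2^kB)}$. $T$ acts on vector functions coordinatewise: $T\vec f=\sum_{j=1}^nT(\langle\vec f,\vec e_j\rangle)\vec e_j$, $\{\vec e_j\}$ an orthonormal basis of $\mathbb{R}^n$. For general $\vec f\in L^p(W)$, $T\vec f$ is understood via extension by density from $L^p(W)\cap L^2(X;\mathbb{R}^n)$. A matrix weight is a measurable function $W$ on $X$ with values in real $n\times n$ matrices that is symmetric and positive definite a.e.; $\|\vec f\|_{L^p(W)}=(\int_X|W^{\frac1p}\vec f|^pd\mu)^{1/p}$. $|\cdot|_{op}$ is the operator norm, and suprema are over balls $B$. For $1<u<\infty$, $$[W]_{A_u}=\sup_B\frac1{\mu(B)}\int_B\left(\frac1{\mu(B)}\int_B|W^{-\frac1u}(y)W^{\frac1u}(x)|_{op}^{u'}d\mu(y)\right)^{\frac u{u'}}d\mu(x),$$ and $[W]_{A_1}=\sup_B\operatorname{ess\,sup}_{y\in B}\frac1{\mu(B)}\int_B|W(x)W^{-1}(y)|_{op}\,d\mu(x)$. $W\in A_u$ means $[W]_{A_u}<\infty$. For a scalar weight $w$, $[w]_{A_\infty}=\sup_B\frac1{w(B)}\int_BM(w\chi_B)\,d\mu$ with $w(B)=\int_Bw\,d\mu$ and $M$ the Hardy–Littlewood maximal operator over balls containing the point. For a matrix weight $V$ and $1\le u<\infty$, $[V]_{A^{sc}_{\infty,u}}=\sup_{\vec e\ne0}\big[|V^{\frac1u}(\cdot)\vec e|^u\big]_{A_\infty}$.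 $\lesssim$ means inequality up to a constant independent of $\vec f$ and $W$ (it may depend on $n$, $T$, the space and the exponents). *)

(* Defs.v *)
From HB Require Import structures.
From mathcomp Require Import all_boot all_order all_algebra.
From mathcomp Require Import all_classical all_reals all_analysis.
From mathcomp Require Import ess_sup_inf hoelder.

Set Implicit Arguments.
Unset Strict Implicit.
Unset Printing Implicit Defensive.

Import Order.TTheory GRing.Theory Num.Theory.
Import numFieldNormedType.Exports.

Local Open Scope classical_set_scope.
Local Open Scope ring_scope.

(* The dual exponent of a real u > 1, as a real number. *)
Definition dual {R : realType} (u : R) : R := fine (hoelder_conjugate u%:E).

Section quasi_metric.
Context {R : realType} {X : Type}.
Variable dist : X -> X -> R.

Record quasi_metric (cd : R) : Prop := {
  qm_const : 1 <= cd;
  qm_ge0 : forall x y, 0 <= dist x y;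
  qm_eq0 : forall x y, dist x y = 0 <-> x = y;
  qm_sym : forall x y, dist x y = dist y x;
  qm_triangle : forall x y z, dist x y <= cd * (dist x z + dist z y) }.

Definition qball (x : X) (rho : R) : set X := [set y | dist x y < rho].

(* Balls of a quasi-metric need not be open for the topology they induce. *)
Definition qopen (U : set X) : Prop :=
  forall x, U x -> exists2 rho, 0 < rho & qball x rho `<=` U.

Definition qcontinuous (f : X -> R) : Prop :=
  forall V : set R, open V -> qopen (f @^-1` V).

Definition qclosure (A : set X) : set X :=
  [set x | forall U, qopen U -> U x -> U `&` A !=set0].

Definition qsupp (f : X -> R) : set X := qclosure [set x | f x != 0].

Definition qbounded (A : set X) : Prop :=
  exists x rho, A `<=` qball x rho.

End quasi_metric.

Section averages.
Context {R : realType} {dsp : measure_display} {X : measurableType dsp}.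
Variables (dist : X -> X -> R) (mu : {measure set X -> \bar R}).
Local Open Scope ereal_scope.

Definition avg (B : set X) (f : X -> \bar R) : \bar R :=
  (mu B)^-1 * \int[mu]_(y in B) f y.

(* Used only for f >= 0, as the restriction f \_ B is extended by 0. *)
Definition ess_sup_on (B : set X) (f : X -> \bar R) : \bar R :=
  ess_sup mu (f \_ B).

(* <g>_{t,B} for t < +oo, and the norm of g in L^oo(B) for t = +oo. *)
Definition tavg (t : \bar R) (B : set X) (g : X -> R) : \bar R :=
  match t with
  | t%:E => (avg B (fun y => (`|g y| `^ t)%:E)) `^ t^-1
  | +oo => ess_sup_on B (fun y => `|g y|%:E)
  | -oo => 0
  end.

Definition maximal (f : X -> R) (x : X) : \bar R :=
  ereal_sup [set s | exists c rho,
    [/\ (0 < rho)%R, qball dist c rho x &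
        s = avg (qball dist c rho) (fun y => `|f y|%:E)]].

Definition Ainfty (w : X -> R) : \bar R :=
  ereal_sup [set s | exists c rho, (0 < rho)%R /\
    let B := qball dist c rho in
    s = (\int[mu]_(x in B) (w x)%:E)^-1 *
        \int[mu]_(x in B) maximal (fun y => w y * \1_B y)%R x].

End averages.

Section homogeneous_type.
Context {R : realType} {dsp : measure_display} {X : measurableType dsp}.
Variables (dist : X -> X -> R) (cd : R) (mu : {measure set X -> \bar R}).
Local Open Scope ereal_scope.

Definition lebesgue_differentiation_holds : Prop :=
  forall f : X -> R, measurable_fun setT f ->
    (forall x rho, (0 < rho)%R -> mu.-integrable (qball dist x rho) (EFin \o f)) ->
    {ae mu, forall x,
      avg mu (qball dist x rho) (EFin \o f) @[rho --> (0:R)^'+] --> (f x)%:E}.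

Record homogeneous_type : Prop := {
  ht_quasi_metric : quasi_metric dist cd;
  ht_borel : @measurable dsp X = <<s [set U | qopen dist U] >>;
  ht_ball_measurable : forall x rho, (0 < rho)%R ->
    measurable (qball dist x rho);
  ht_ball_measure : forall x rho, (0 < rho)%R ->
    0 < mu (qball dist x rho) < +oo;
  ht_doubling : exists cmu : R, forall x rho, (0 < rho)%R ->
    mu (qball dist x (2 * rho)) <= cmu%:E * mu (qball dist x rho);
  ht_lebesgue : lebesgue_differentiation_holds }.

(* sup over B and x, z in (2 c_d)^-1 B of the sum over k >= 1 of
   mu(2^k B) <(K(x, .) - K(z, .)) 1_{2^k B \ 2^(k-1) B}>_{t, 2^k B} *)
Definition hormander_const (t : \bar R) (K : X -> X -> R) : \bar R :=
  ereal_sup [set s | exists c rho x z,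
    [/\ (0 < rho)%R, qball dist c (rho / (2 * cd)) x,
        qball dist c (rho / (2 * cd)) z &
        s = \sum_(1 <= k <oo)
          let B := qball dist c (2 ^+ k * rho) in
          let B' := qball dist c (2 ^+ k.-1 * rho) in
          mu B * tavg mu t B
            (fun y => (K x y - K z y) * \1_(B `\` B') y)%R]].

(* A kernel on X * X off the diagonal is encoded as a total function whose
   values on the diagonal play no role. *)
Record hormander_kernel (t : \bar R) (K : X -> X -> R) : Prop := {
  hk_measurable : measurable_fun [set xy : X * X | xy.1 <> xy.2]
    (fun xy => K xy.1 xy.2);
  hk_locally_integrable : forall x y, x <> y -> exists2 rho, (0 < rho)%R &
    (mu \x mu).-integrable (qball dist x rho `*` qball dist y rho)
      (fun xy => (K xy.1 xy.2)%:E);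
  hk_size : exists C : R, forall x y, x <> y ->
    `|K x y|%:E <= C%:E / mu (qball dist x (dist x y));
  hk_regular1 : hormander_const t K < +oo;
  hk_regular2 : hormander_const t (fun x y => K y x) < +oo }.

(* T acts on functions; only its action on L^2 modulo null sets matters. *)
Record hormander_operator (t : \bar R) (T : (X -> R) -> X -> R) : Prop := {
  ho_linear : forall (a : R) f g, f \in Lfun mu 2%:E -> g \in Lfun mu 2%:E ->
    {ae mu, forall x, T (fun y => a * f y + g y)%R x = (a * T f x + T g x)%R};
  ho_bounded : exists C : R, forall f, f \in Lfun mu 2%:E ->
    T f \in Lfun mu 2%:E /\
    Lnorm mu 2%:E (EFin \o T f) <= C%:E * Lnorm mu 2%:E (EFin \o f);
  ho_kernel : exists2 K, hormander_kernel t K &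
    forall f, qcontinuous dist f -> qbounded dist (qsupp dist f) ->
      f \in Lfun mu 2%:E ->
      {ae mu, forall x, ~ qsupp dist f x ->
        T f x = Rintegral mu setT (fun y => K x y * f y)%R} }.

End homogeneous_type.

Section matrices.
Context {R : realType} {n : nat}.

Definition enorm (v : 'cV[R]_n) : R := Num.sqrt (\sum_i v i 0 ^+ 2).

Definition opnorm (A : 'M[R]_n) : R :=
  sup [set enorm (A *m v) | v in [set v | enorm v <= 1]].

Definition posdef_sym (A : 'M[R]_n) : Prop :=
  A^T = A /\ forall v : 'cV[R]_n, v != 0 -> 0 < (v^T *m A *m v) 0 0.

(* A^s for A symmetric positive definite, by the spectral decomposition; the
   result does not depend on the chosen decomposition. *)
Definition mxpowR (A : 'M[R]_n) (s : R) : 'M[R]_n :=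
  xget 0 [set B | exists (O : 'M[R]_n) (d : 'rV[R]_n),
    [/\ O^T *m O = 1%:M, forall i, 0 < d 0 i,
        A = O^T *m diag_mx d *m O &
        B = O^T *m diag_mx (map_mx (fun a => a `^ s) d) *m O]].

End matrices.

Section matrix_weights.
Context {R : realType} {dsp : measure_display} {X : measurableType dsp}.
Context {n : nat}.
Variables (dist : X -> X -> R) (mu : {measure set X -> \bar R}).
Implicit Types (W V : X -> 'M[R]_n) (f g : X -> 'cV[R]_n).
Local Open Scope ereal_scope.

Definition matrix_weight W : Prop :=
  (forall i j, measurable_fun setT (fun x => W x i j)) /\
  {ae mu, forall x, posdef_sym (W x)}.

Definition Aconst1 W : \bar R :=
  ereal_sup [set s | exists c rho, (0 < rho)%R /\
    let B := qball dist c rho in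
    s = ess_sup_on mu B (fun y =>
          avg mu B (fun x => (opnorm (W x *m invmx (W y)))%:E))].

Definition Aconst_gt1 (u : R) W : \bar R :=
  ereal_sup [set s | exists c rho, (0 < rho)%R /\
    let B := qball dist c rho in
    s = avg mu B (fun x =>
          (avg mu B (fun y =>
             (opnorm (mxpowR (W y) (- u^-1) *m mxpowR (W x) u^-1)
                `^ dual u)%:E)) `^ (u / dual u))].

Definition Aconst (u : R) W : \bar R :=
  if u == 1%R then Aconst1 W else Aconst_gt1 u W.

Definition Asc (u : R) V : \bar R :=
  ereal_sup [set Ainfty dist mu (fun x => enorm (mxpowR (V x) u^-1 *m e) `^ u)%R
            | e in [set e : 'cV[R]_n | e != 0%R]].

Definition vmeasurable f : Prop :=
  forall i, measurable_fun setT (fun x => f x i 0%R).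

Definition normLp (p : R) W f : \bar R :=
  Lnorm mu p%:E (fun x => (enorm (mxpowR (W x) p^-1 *m f x))%:E).

Definition Lp_weighted (p : R) W f : Prop :=
  vmeasurable f /\ normLp p W f < +oo.

Definition L2vec f : Prop :=
  vmeasurable f /\ Lnorm mu 2%:E (fun x => (enorm (f x))%:E) < +oo.

Definition vec_op (T : (X -> R) -> X -> R) f : X -> 'cV[R]_n :=
  fun x => (\col_j T (fun y => f y j 0) x)%R.

Definition cvg_Lp (p : R) W (u : nat -> X -> 'cV[R]_n) f : Prop :=
  normLp p W (fun x => u k x - f x)%R @[k --> \oo] --> 0.

(* g is the value at f of the extension of T by density from
   L^p(W) `&` L^2(X; R^n) to L^p(W); it is determined up to a null set. *)
Definition density_extension (T : (X -> R) -> X -> R) (p : R) W f g : Prop :=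
  let approx (u : nat -> X -> 'cV[R]_n) :=
    (forall k, Lp_weighted p W (u k) /\ L2vec (u k)) /\ cvg_Lp p W u f in
  [/\ Lp_weighted p W g, exists u, approx u &
      forall u, approx u -> cvg_Lp p W (fun k => vec_op T (u k)) g].

End matrix_weights.

(* Main.v *)
(** By Frink's lemma a power of the quasi-metric is comparable to a metric, for which balls are open.
A Calderon-Zygmund decomposition gives the weak (1,1) bound for [T]; together with the Hoermander
condition it bounds the oscillation of [T f] away from a ball by [L^r] averages of [f], and a stopping
time dominates [T f] pointwise by such averages over a sparse family of balls. For vector functions
each average is measured through a reducing matrix of the weight on the ball. The sharp reverse
Hoelder inequality for the scalar weights [|W^(1/u) e|^u], a consequence of the Fujii-Wilson
condition, leaves room for Carleson embedding with maximal functions, whose norms give the powers of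
the characteristics. Bounded functions of bounded support are dense, which yields general [f]. *)
Require Import Defs.
From HB Require Import structures.
From mathcomp Require Import all_boot all_order all_algebra.
From mathcomp Require Import fingroup perm.
From mathcomp Require Import all_classical all_reals all_analysis.
From mathcomp Require Import ess_sup_inf hoelder measurable_realfun.
From mathcomp Require Import complex.
From mathcomp Require Import ring lra zify.

Set Implicit Arguments.
Unset Strict Implicit.
Unset Printing Implicit Defensive.

Import Order.TTheory GRing.Theory Num.Theory.
Import numFieldNormedType.Exports.

Local Open Scope classical_set_scope.
Local Open Scope ring_scope.

Local Notation mfun := (measurable_fun setT).
Local Notation meas X R := {measure set X -> \bar R}.
Local Notation mmx W := (forall i j, measurable_fun setT (fun x => W x i j)).
Local Notation pwcmp rho dist e := (forall x y, rho x y <= dist x y `^ e <= 2 * rho x y).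
Local Notation mfM := measurable_funM.
Local Notation ltleT := lt_le_trans.
Local Notation leltT := le_lt_trans.
Local Notation leMl := lee_wpmul2l.
Local Notation leMr := lee_wpmul2r.
Local Notation mfD := measurable_funD.
Local Notation mfB := measurable_funB.
Local Notation mcomp := measurableT_comp.
Local Notation eqint := eq_integral.
Local Notation intge0 := integral_ge0.
Local Notation leT := le_trans.
Local Notation mge0 := mulr_ge0.
Local Notation pge0 := powR_ge0.
Local Notation leF := lee_fin.
Local Notation wMl := ler_wpM2l.
Local Notation wMr := ler_wpM2r.
Local Notation mgt0 := mulr_gt0.
Local Notation mindic := measurable_indic.
Local Notation mcst := measurable_cst.
Local Notation ge0fin := ge0_fin_numE.
Local Notation imkcond := integral_mkcond.
Local Notation xge0 := exprn_ge0.
Local Notation xgt0 := exprn_gt0.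
Local Notation dgt0 := divr_gt0.
Local Notation lemu := le_measure.
Local Notation htbm := ht_ball_measurable.
Local Notation htbmu := ht_ball_measure.
Local Notation mbigcup := bigcup_measurable.
Local Notation pdsym := posdef_sym.
Local Notation supub := sup_upper_bound.
Local Notation lesers := lee_nneseries.
Local Notation msum := measurable_sum.
Local Notation intindic := integral_indic.
Local Notation esupub := ereal_sup_ubound.
Local Notation hconj := hoelder_conjugate.
Local Notation gtF := gt_eqF.
Local Notation pgt0 := powR_gt0.
Local Notation dge0 := divr_ge0.
Local Notation igt0 := invr_gt0.
Local Notation ige0 := invr_ge0.
Local Notation sge0 := sumr_ge0.
Local Notation age0 := addr_ge0.
Local Notation lepdM := ler_pdivrMr.
Local Notation rfType := realFieldType.
Local Notation mType := measurableType.
Local Notation htype := homogeneous_type.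
Local Notation dmx := delta_mx.
Local Notation htqm := ht_quasi_metric.
Local Notation subT := subset_trans.

(** Two quantities are tracked separately: the constant [A] of the class A_u, and Fujii-Wilson
    constants [S] of [|W^(1/u) e|^u] and [S'] of its dual. [A] enters through reducing matrices
    only. Since [W^(1/p) V^(-u/p)] is compared with the power [u/p] of [W^(1/u) V^(-1)], it gets the
    exponent [1/p]. [S] enters through the size [ep ~ 1/S] of the reverse Hoelder gain:
    integrability of the kernel factor in [L^(p(1+ep))] leaves the conjugate exponent [a < p'] for
    the dual function, with [p'/a = 1 + tau], [tau ~ 1/S]. The maximal theorem on [L^(1+tau)] costs
    [1/tau ~ S], and taking the root [1/p'] yields [S^(1/p')]. On the side of [f], the strict
    inequality [u r < p] of part (2) leaves room at the price of a constant; at the endpoint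
    [u r = p] of part (1) the room must come from a second reverse Hoelder gain, that of the dual
    weight, which costs [S'^(1/p)]. The suprema over all vectors may be infinite, whereas the
    extension of [T] must exist anyway; hence membership in A_u alone is first shown to give some
    finite [S] and [S'], and each bound is proved for every admissible pair. *)

Definition leU {d} {T : porderType d} := @le_trans d T.
Arguments leU {d T} y x z _ _.

Lemma eqW {d} {T : porderType d} (x y : T) : x = y -> (x <= y)%O.
by move->. Qed.

(** * Metrization of a quasi-metric *)

Section frink.
Context {R : realType} {X : Type}.
Implicit Types (D : X -> X -> R) (s : seq X).

Fixpoint chain D (x : X) s : R :=
 if s is y :: s' then D x y + chain D y s' else 0.

Definition chdist D (x y : X) : R :=
 inf [set chain D x (rcons s y) | s in setT].

Record is_metric D : Prop := {
 mtrefl : forall x, D x x = 0;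
 mtpos : forall x y, x <> y -> 0 < D x y;
 mtsym : forall x y, D x y = D y x;
 mttri : forall y x z, D x z <= D x y + D y z }.

Lemma mtge0 D : is_metric D -> forall x y, 0 <= D x y.
move=> mD x y; have := mttri mD y x x.
by rewrite (mtrefl mD) (mtsym mD y x); lra.
Qed.

Lemma chain_cat D x s t : chain D x (s ++ t) = chain D x s + chain D (last x s) t.
by elim: s x => [|y s ih] x /=; rewrite ?add0r // ih addrA. Qed.

Lemma chain_ge0 D x s : (forall x y, 0 <= D x y) -> 0 <= chain D x s.
by move=> D0; elim: s x => //= y s ih x; rewrite age0. Qed.

Lemma chain_rev D x y s : (forall x y, D x y = D y x) ->
 chain D x (rcons s y) = chain D y (rcons (rev s) x).
move=> Dsym; elim: s x => [|z s ih] x /=; first by rewrite Dsym.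
rewrite ih rev_cons -[in RHS]cats1 chain_cat last_rcons /= addr0 addrC.
by rewrite (Dsym x z).
Qed.

Lemma chain_split D x s t : size s != 0%N -> exists s1 z s2,
 [/\ s = s1 ++ z :: s2, s1 = [::] \/ chain D x s1 <= t &
  s2 = [::] \/ t <= chain D x (rcons s1 z)].
elim: s x t => // z [|w s] ih x t _.
 by exists [::], z, [::]; split => //; left.
have [h|h] := leP t (D x z).
 by exists [::], z, (w :: s); split; [|left|right; rewrite /= addr0].
have [//|s1 [v [s2 [-> h1 h2]]]] := ih z (t - D x z).
exists (z :: s1), v, s2; split=> //.
 right => /=; case: h1 => [->|]; last lra.
 by rewrite addr0 ltW.
by case: h2 => [->|h2]; [left|right => /=; lra].
Qed.

(** Cut the chain at the link where its length passes half of the total. Both outer pieces have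
    length at most one half, so by induction their endpoints are at [D]-distance at most the total.
    The middle link is bounded by the total too, and the three-step inequality loses only its factor
    2. *)
Lemma frink D : (forall x y, 0 <= D x y) -> (forall x, D x x = 0) ->
 (forall x y z w, D x w <= 2 * Num.max (D x y) (Num.max (D y z) (D z w))) ->
 forall x s, D x (last x s) <= 2 * chain D x s.
move=> D0 Dxx D3 x s; have [n] := ubnP (size s).
elim: n => // n ih in x s *; rewrite ltnS => sn.
have [s0|s0] := eqVneq (size s) 0%N.
 by rewrite (size0nil s0) Dxx mulr0.
have [s1 [z [s2 [sE h1 h2]]]] := chain_split D x (chain D x s / 2) s0.
have szs : (size s = size s1 + (size s2).+1)%N by rewrite sE size_cat.
have i1 := ih x s1 ltac:(lia); have i2 := ih z s2 ltac:(lia).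
set S := chain D x s in h1 h2 *.
have c1 : 0 <= chain D x s1 by exact: chain_ge0.
have c2 : 0 <= chain D z s2 by exact: chain_ge0.
have SE : S = chain D x s1 + D (last x s1) z + chain D z s2.
 by rewrite /S sE chain_cat addrA.
have Dz := D0 (last x s1) z.
have l1 : chain D x s1 <= S / 2.
 by case: h1 => [->|] /=; lra.
have l2 : chain D z s2 <= S / 2.
 case: h2 => [->|] /=; first lra.
 by rewrite -cats1 chain_cat /=; lra.
rewrite sE last_cat /=.
apply: (leT (D3 x (last x s1) z (last z s2))).
rewrite ler_pM2l//; do ?[rewrite ge_max; apply/andP; split]; lra.
Qed.

Section chdist.
Variable D : X -> X -> R.
Hypotheses (D0 : forall x y, 0 <= D x y) (Dxx : forall x, D x x = 0)
 (Dp : forall x y, x <> y -> 0 < D x y) (Dsym : forall x y, D x y = D y x)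
 (D3 : forall x y z w, D x w <= 2 * Num.max (D x y) (Num.max (D y z) (D z w))).
Let E x y := [set chain D x (rcons s y) | s in setT].

Let E_lb x y : has_lbound (E x y).
by exists 0 => _ [s _ <-]; exact: chain_ge0. Qed.

Let E_inf x y : has_inf (E x y).
by split => //; exists (chain D x (rcons [::] y)); exists [::]. Qed.

Lemma chain_dist_le x y : chdist D x y <= D x y.
by apply: (ge_inf (E_lb x y)); exists [::] => //=; rewrite addr0. Qed.

Lemma le_chain_dist x y : D x y <= 2 * chdist D x y.
rewrite mulrC -lepdM//; apply: lb_le_inf; first exact: (E_inf x y).1.
move=> _ [s _ <-]; rewrite lepdM// mulrC.
by have := @frink D D0 Dxx D3 x (rcons s y); rewrite last_rcons.
Qed.

Lemma chain_dist_metric : is_metric (chdist D).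
split => [x|x y xy|x y|y x z].
- apply/eqP; rewrite eq_le; apply/andP; split.
  by apply: (leT (chain_dist_le x x)); rewrite Dxx.
 by apply: lb_le_inf; [exact: (E_inf x x).1|move=> _ [s _ <-]; exact: chain_ge0].
- by have := le_chain_dist x y; have := Dp xy; lra.
- congr inf; apply/seteqP; split => _ [s _ <-]; exists (rev s) => //.
  by rewrite -chain_rev.
 by rewrite -chain_rev.
- rewrite -lerBlDl; apply: lb_le_inf; first exact: (E_inf y z).1.
 move=> _ [t _ <-]; rewrite lerBlDl -lerBlDr.
 apply: lb_le_inf; first exact: (E_inf x y).1.
 move=> _ [s _ <-]; rewrite lerBlDr; apply: (ge_inf (E_lb x z)).
 exists (rcons s y ++ t) => //.
 by rewrite rcons_cat chain_cat last_rcons.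
Qed.

End chdist.
End frink.

(* Since [(3 c_d^2)^e = 2], the power [dist^e] satisfies the three-step inequality of Frink's lemma. *)
Lemma metrization {R : realType} {X : Type} (dist : X -> X -> R) (cd : R) :
 quasi_metric dist cd -> exists rho : X -> X -> R, exists2 e : R, 0 < e &
  is_metric rho /\ pwcmp rho dist e.
move=> [c1 d0 deq dsym dtri].
pose k := 3 * cd ^+ 2; have cd2 : 1 <= cd ^+ 2 by rewrite exprn_ege1.
have k1 : 1 < k by rewrite /k; lra.
pose e := ln 2 / ln k; have lk : 0 < ln k by rewrite ln_gt0.
have e0 : 0 < e by rewrite dgt0// ln_gt0// ltr1n.
have k0 : 0 < k by lra.
have kd : k `^ e = 2.
 by rewrite /powR divfK ?gtF// lnK// posrE.
pose D x y := dist x y `^ e.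
have Dxx x : D x x = 0.
 by rewrite /D ((deq x x).2 erefl) powR0// gtF.
have D3 x y z w : D x w <= 2 * Num.max (D x y) (Num.max (D y z) (D z w)).
 pose m := Num.max (dist x y) (Num.max (dist y z) (dist z w)).
 have [m1 m2 m3] : [/\ dist x y <= m, dist y z <= m & dist z w <= m].
  by rewrite !le_max !lexx !orbT.
 have m0 : 0 <= m := leT (d0 _ _) m1.
 (* Two uses of the quasi-triangle inequality give [cd + 2 cd^2], which is at most [k = 3 cd^2]
    because [cd >= 1]. *)
 have h : dist x w <= k * m.
  apply: (leT (dtri _ _ y)).
  apply: (leU (cd * (m + cd * (m + m)))).
  rewrite ler_pM2l ?(ltleT ltr01)//; apply: lerD => //.
  apply: (leT (dtri _ _ z)); rewrite ler_pM2l ?(ltleT ltr01)//.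
  exact: lerD.
  rewrite /k; have : 0 <= (cd ^+ 2 - cd) * m.
  by rewrite mge0// expr2 -{3}(mulr1 cd) -mulrBr mge0; lra.
  lra.
 have -> : Num.max (D x y) (Num.max (D y z) (D z w)) = m `^ e.
  have hm a b : 0 <= a -> 0 <= b ->
  Num.max (a `^ e) (b `^ e) = (Num.max a b) `^ e.
  move=> a0 b0; case: (leP a b) => ab; first by rewrite max_r// ge0_ler_powR// ltW.
  by rewrite max_l// ge0_ler_powR// ltW.
  by rewrite !hm// le_max d0.
 rewrite -kd -powRM ?(ltW k0)//; apply: ge0_ler_powR.
 - exact: ltW.
 - exact: d0.
 - by rewrite nnegrE mge0// ltW.
 - exact: h.
have Dp x y : x <> y -> 0 < D x y.
 move=> xy; apply: pgt0; rewrite lt_neqAle d0 andbT eq_sym.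
 by apply/eqP => /deq.
have Dsym x y : D x y = D y x by rewrite /D dsym.
exists (chdist D); exists e => //; split.
 by apply: chain_dist_metric => // x y; exact: pge0.
have D0 x y : 0 <= D x y by exact: pge0.
by move=> x y; rewrite -/(D x y) chain_dist_le ?le_chain_dist.
Qed.

(** * Doubling metric measure spaces and the Vitali covering lemma *)

Lemma meas_bigcupT {R : realType} {dsp} {X : mType dsp}
  (mu : meas X R) (F : nat -> set X) :
 (forall i, measurable (F i)) -> trivIset setT F ->
 mu (\bigcup_i F i) = (\sum_(0 <= i <oo) mu (F i))%E.
by move=> mF tF; rewrite (measure_bigcup mu setT)//; apply: eq_eseriesl => i; rewrite in_setT.
Qed.

(** The setting after metrization. The doubling constant may be enlarged freely; taking it at least
    2 lets powers of [D] absorb numerical constants. *)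
Record dspace {R : realType} {dsp}
  {X : mType dsp} (rho : X -> X -> R)
  (mu : meas X R) (D : R) : Prop := {
 dsmt : is_metric rho;
 ds_open : forall U, qopen rho U -> measurable U;
 ds_ball : forall x s, 0 < s -> (0 < mu (qball rho x s) < +oo)%E;
 dsC : 2 <= D;
 ds_doubling : forall x s, 0 < s ->
  (mu (qball rho x (2 * s)) <= D%:E * mu (qball rho x s))%E }.

Section doubling.
Context {R : realType} {dsp} {X : mType dsp}.
Variables (rho : X -> X -> R) (mu : meas X R) (D : R).
Hypothesis ds : dspace rho mu D.
Local Notation b := (qball rho).

Let rsym := mtsym (dsmt ds).
Let rtri := mttri (dsmt ds).
Let rxx := mtrefl (dsmt ds).
Let r0 := mtge0 (dsmt ds).

Definition vol (x : X) (s : R) : R := fine (mu (b x s)).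

Lemma ball_open x s : qopen rho (b x s).
move=> y; rewrite /qball /= => xy; exists (s - rho x y); first by rewrite subr_gt0.
by move=> z /=; have := rtri y x z; lra.
Qed.

Lemma mball x s : measurable (b x s).
exact/(ds_open ds)/ball_open. Qed.

Lemma ball_ctr x s : 0 < s -> b x s x.
by rewrite /qball /= rxx. Qed.

Lemma bsub x y s t : rho x y + s <= t -> b x s `<=` b y t.
by move=> h z; rewrite /qball /= => xz; have := rtri x y z; rewrite (rsym y x); lra. Qed.

Lemma ball_le0 x s : s <= 0 -> b x s = set0.
move=> s0; apply/seteqP; split => // y; rewrite /qball /= => xy.
by have := r0 x y; lra.
Qed.

Lemma mu_ball x s : 0 < s -> mu (b x s) = (vol x s)%:E.
move=> s0; rewrite fineK// ge0fin//.
by have /andP[] := ds_ball ds x s0.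
Qed.

Lemma vgt0 x s : 0 < s -> 0 < vol x s.
by move=> s0; have /andP[h _] := ds_ball ds x s0; rewrite -lte_fin -mu_ball.
Qed.

Lemma muB_lty x s : (mu (b x s) < +oo)%E.
have [s0|s0] := leP s 0; first by rewrite ball_le0// measure0.
by rewrite mu_ball// ltry.
Qed.

Lemma D_gt0 : 0 < D. Proof. exact: ltleT (dsC ds). Qed.

Lemma dbl_iter k x s : 0 < s -> vol x (2 ^+ k * s) <= D ^+ k * vol x s.
move=> s0; elim: k => [|k ih]; first by rewrite !mul1r.
have p0 : 0 < 2 ^+ k * s by rewrite mgt0//.
have := ds_doubling ds x p0; rewrite !mu_ball//; last by lra.
rewrite leF mulrA -exprS => /leT; apply.
by rewrite [in leRHS]exprS -mulrA ler_pM2l// D_gt0.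
Qed.

Lemma le_mu_ball x y s t : rho x y + s <= t -> (mu (b x s) <= mu (b y t))%E.
by move=> h; apply: lemu; rewrite ?inE; [exact: mball..|exact: bsub].
Qed.

Lemma vol_le k x y s t : 0 < s -> 0 < t -> rho x y + s <= 2 ^+ k * t ->
 vol x s <= D ^+ k * vol y t.
move=> s0 t0 h; apply: leT (dbl_iter k y t0).
by rewrite -leF -!mu_ball// ?mgt0 ?xgt0//; exact: le_mu_ball.
Qed.

Lemma vol_le1 x y s t : 0 < s -> 0 < t -> rho x y + s <= t -> vol x s <= vol y t.
by move=> s0 t0 h; have := @vol_le 0 x y s t s0 t0; rewrite !expr0 !mul1r; apply.
Qed.

Lemma ball_cover (x : X) : \bigcup_n b x n%:R = setT.
apply/seteqP; split => // y _; exists (Num.truncn (rho x y)).+1 => //=.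
by rewrite /qball /= truncnS_gt.
Qed.

(** Balls centred within [n] of a fixed point and of volume above [1/(k+1)] lie in one ball of
    finite measure, so only finitely many of them can be disjoint. The family is the union of these
    classes over [n] and [k]. *)
Lemma disj_countable (G : set (X * R)) r1 :
 (forall z, G z -> 0 < z.2 <= r1) -> trivIset G (fun z => b z.1 z.2) -> countable G.
move=> G0 Gt.
have [->|/set0P[z0 _]] := eqVneq G set0 => //.
pose x0 := z0.1.
pose H (nk : nat * nat) := [set z | [/\ G z, rho x0 z.1 < nk.1%:R &
 nk.2.+1%:R^-1 < vol z.1 z.2]].
have -> : G = \bigcup_(nk in setT) H nk.
 apply/seteqP; split => [z Gz|z [nk _ []//]].
 have /andP[z20 _] := G0 _ Gz; have v0 := vgt0 z.1 z20.
 exists ((Num.truncn (rho x0 z.1)).+1, Num.truncn (vol z.1 z.2)^-1); split => //=.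
  by rewrite truncnS_gt.
 by rewrite invf_plt ?posrE// truncnS_gt.
apply: bigcup_countable => // -[n k] _; apply: finite_set_countable.
apply: contrapT => /infiniteP /pcard_leP [f].
pose F i := b (f i).1 (f i).2.
have Hf i : H (n, k) (f i) by exact: funS.
have mF i : measurable (F i) by exact: mball.
have tF : trivIset setT F.
 apply/trivIsetP => i j _ _ ij; have [Gi _ _] := Hf i; have [Gj _ _] := Hf j.
 move/trivIsetP : Gt => /(_ (f i) (f j) Gi Gj); apply; apply: contra ij => /eqP fij.
 by apply/eqP; have := @inj _ _ _ f i j; rewrite !inE; apply.
have sub : \bigcup_i F i `<=` b x0 (n%:R + r1).
 move=> y [i _]; apply: bsub; have [Gi /= h _] := Hf i.
 by have /andP[_] := G0 _ Gi; rewrite rsym; lra.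
have : (mu (\bigcup_i F i) <= mu (b x0 (n%:R + r1)))%E.
 apply: lemu; rewrite ?inE//; last exact: mball.
 exact: mbigcup.
rewrite meas_bigcupT//.
apply/negP; rewrite -ltNge.
have /fin_numPlt/andP[_ vf] : mu (b x0 (n%:R + r1)) \is a fin_num.
 by rewrite ge0fin// muB_lty.
pose v := fine (mu (b x0 (n%:R + r1))).
pose N := (Num.truncn (v * k.+1%:R)).+1.
have vE : mu (b x0 (n%:R + r1)) = v%:E by rewrite fineK// fin_numElt (ltleT _ (measure_ge0 _ _)).
apply: (@ltleT _ _ (\sum_(0 <= i < N) (k.+1%:R^-1)%:E)%E).
 rewrite sumEFin vE lte_fin sumr_const_nat subn0 -[ltRHS]mulr_natr mulrC.
 by rewrite ltr_pdivlMr ?ltr0n// truncnS_gt.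
apply: (leU (\sum_(0 <= i < N) mu (F i))%E).
 apply: lee_sum => i _; have [Gi _ /= h] := Hf i.
 have /andP[z20 _] := G0 _ Gi.
 by rewrite mu_ball// leF ltW.
exact: nneseries_lim_ge.
Qed.

(* A maximal family [G] such that every ball of [F] meeting [G] meets a member of [G]
 of at least half its radius. *)
Lemma vitali_selection (F : set (X * R)) r1 : (forall z, F z -> 0 < z.2 <= r1) ->
 exists G : set (X * R), [/\ G `<=` F, trivIset G (fun z => b z.1 z.2) &
  forall y, F y -> exists z, [/\ G z, y.2 <= 2 * z.2 &
  b y.1 y.2 `&` b z.1 z.2 !=set0]].
move=> F0.
(* The last clause is the desired conclusion restricted to balls that meet [G]. In this form it
   holds for the empty family and passes to unions of chains, as Zorn's lemma requires. *)
pose P (G : set (X * R)) := [/\ G `<=` F, trivIset G (fun z => b z.1 z.2) &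
 forall y z, F y -> G z -> b y.1 y.2 `&` b z.1 z.2 !=set0 ->
 exists z', [/\ G z', y.2 <= 2 * z'.2 & b y.1 y.2 `&` b z'.1 z'.2 !=set0]].
have [|G [[GF Gt Gp] Gmax]] := @Zorn_bigcup _ P.
 move=> C CP Ct; split.
 - by move=> z [G CG Gz]; have [GF _ _] := CP _ CG; exact: GF.
 - move=> z z' [G CG Gz] [G' CG' Gz'].
  have [GG'|G'G] := Ct _ _ CG CG'.
  by have [_ t _] := CP _ CG'; exact: t z z' (GG' _ Gz) Gz'.
  by have [_ t _] := CP _ CG; exact: t z z' Gz (G'G _ Gz').
 - move=> y z Fy [G CG Gz] yz; have [_ _ h] := CP _ CG.
  by have [z' [Gz' ? ?]] := h _ _ Fy Gz yz; exists z'; split => //; exists G.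
exists G; split => // y Fy; apply: contrapT => Ny.
have Ny' z : G z -> ~ (b y.1 y.2 `&` b z.1 z.2 !=set0).
 by move=> Gz yz; apply: Ny; exact: Gp _ _ Fy Gz yz.
(* If a ball of [F] met no member of [G], then among all such balls one of radius above half the
   supremum could be added to [G], against maximality. *)
pose S := [set z | F z /\ forall z', G z' -> ~ (b z.1 z.2 `&` b z'.1 z'.2 !=set0)].
pose t := sup [set z.2 | z in S].
have hs : has_sup [set z.2 | z in S].
 split; first by exists y.2, y.
 by exists r1 => _ [z [Fz _] <-]; have /andP[] := F0 _ Fz.
have t0 : 0 < t.
 have /andP[y0 _] := F0 _ Fy; apply: (ltleT y0).
 by apply: (supub hs); exists y.
have [|_ [z Sz <-] zt] := @sup_adherent _ _ (t / 2) _ hs.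
 lra.
have [Fz Nz] := Sz; have /andP[z20 _] := F0 _ Fz.
have cz : (b z.1 z.2 `&` b z.1 z.2) z.1 by split; exact: ball_ctr.
apply: (Gmax (G `|` [set z])).
 split; first by move=> ?; left.
 move=> /(_ z (or_intror erefl)) Gz.
 by apply: (Nz z Gz); exists z.1.
split.
- by move=> ? [/GF|->].
- move=> u v [Gu|->] [Gv|->] uv.
 + exact: Gt.
 + by exfalso; apply: (Nz _ Gu); case: uv => w [? ?]; exists w.
 + by exfalso; apply: (Nz _ Gv).
 + by [].
- move=> u v Fu Gv uv.
 have [Nu|/existsNP[v' /not_implyP[Gv' /contrapT uv']]] :=
  pselect (forall z', G z' -> ~ (b u.1 u.2 `&` b z'.1 z'.2 !=set0)).
  case: Gv uv => [Gv /(Nu _ Gv)//|-> uz].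
  exists z; split => //; first by right.
  have : u.2 <= t by apply: (supub hs); exists u.
  by move: zt; rewrite -/t; lra.
 have [w [Gw ? ?]] := Gp _ _ Fu Gv' uv'.
 by exists w; split => //; left.
Qed.

Lemma vitali (x0 : X) (F : set (X * R)) r1 : (forall z, F z -> 0 < z.2 <= r1) ->
 exists z : nat -> X * R, [/\ forall n, (z n).2 = 0 \/ F (z n),
  trivIset setT (fun n => b (z n).1 (z n).2) &
  forall y, F y -> exists n, [/\ F (z n), y.2 <= 2 * (z n).2 &
  b y.1 y.2 `<=` b (z n).1 (5 * (z n).2)]].
move=> F0; have [G [GF Gt Gc]] := vitali_selection F0.
have /countable_injP[f finj] := disj_countable (fun z Gz => F0 _ (GF _ Gz)) Gt.
pose z n := xget (x0, 0 : R) [set y | G y /\ f y = n].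
have zG n : z n = (x0, 0) \/ (G (z n) /\ f (z n) = n).
 by rewrite /z; case: xgetP => [y -> [? ?]|]; [right|left].
exists z; split.
- by move=> n; case: (zG n) => [->|[/GF ? _]]; [left|right].
- apply/trivIsetP => i j _ _ ij; case: (zG i) => [->|[Gi fi]].
  by rewrite ball_le0// set0I.
 case: (zG j) => [->|[Gj fj]]; first by rewrite [X in _ `&` X]ball_le0// setI0.
 move/trivIsetP : Gt; apply => //; apply: contra ij => /eqP zij.
 by rewrite -fi -fj zij.
- move=> y Fy; have [u [Gu yu [w [yw uw]]]] := Gc _ Fy.
 have zu : z (f u) = u.
  rewrite /z; case: xgetP => [v -> [Gv fv]|/(_ u)]; last by case.
  by apply: finj; rewrite ?inE.
 exists (f u); rewrite zu; split => //; first exact: GF.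
 apply: bsub; move: yw uw; rewrite /qball /= => yw uw.
 by have := rtri w y.1 u.1; rewrite (rsym w u.1); lra.
Qed.

End doubling.
Lemma nnes_ge {R : realType} (f : nat -> \bar R) k :
 (forall i, (0 <= f i)%E) -> (f k <= \sum_(0 <= i <oo) f i)%E.
move=> f0; apply: (leU (\sum_(0 <= i < k.+1) f i)%E).
 by rewrite big_nat_recr//= leeDr// sume_ge0.
exact: nneseries_lim_ge.
Qed.

Lemma powRM_pred {R : realType} (x a : R) : 0 <= x -> 0 < a ->
 x `^ a = x * x `^ (a - 1).
rewrite le_eqVlt => /predU1P[<- a0|x0 a0]; first by rewrite powR0 ?gtF// mul0r.
rewrite -[X in _ = X * _]powRr1 ?ltW// -powRD ?(gtF x0) ?implybT//.
by rewrite addrC subrK.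
Qed.

Section integral_facts.
Context {R : realType} {dsp} {X : mType dsp}.
Variable mu : meas X R.
Implicit Types (A B : set X) (g h : X -> R).

Lemma mEFin A g : mfun g ->
 measurable_fun A (fun x => (g x)%:E).
by move=> mg; apply: measurable_funTS; exact/measurable_EFinP. Qed.

Lemma isub A B g : measurable A -> measurable B -> mfun g ->
 (forall x, 0 <= g x) -> A `<=` B ->
 (\int[mu]_(x in A) (g x)%:E <= \int[mu]_(x in B) (g x)%:E)%E.
move=> mA mB mg g0 AB; apply: ge0_subset_integral => //.
 exact: mEFin.
by move=> x _; rewrite leF.
Qed.

Lemma int_le A g h : measurable A -> mfun g -> mfun h ->
 (forall x, 0 <= g x) -> (forall x, A x -> g x <= h x) ->
 (\int[mu]_(x in A) (g x)%:E <= \int[mu]_(x in A) (h x)%:E)%E.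
move=> mA mg mh g0 gh; apply: ge0_le_integral => //.
- by move=> x _; rewrite leF.
- exact: mEFin.
- exact: mEFin.
Qed.

Lemma int_disj_le (F : nat -> set X) B g : (forall i, measurable (F i)) ->
 trivIset setT F -> measurable B -> (forall i, F i `<=` B) ->
 mfun g -> (forall x, 0 <= g x) ->
 (\sum_(0 <= i <oo) \int[mu]_(x in F i) (g x)%:E <= \int[mu]_(x in B) (g x)%:E)%E.
move=> mF tF mB FB mg g0; rewrite -ge0_integral_bigcup//.
- apply: isub => //; first exact: mbigcup.
 by move=> x [i _]; exact: FB.
- exact: mEFin.
- by move=> x _; rewrite leF.
Qed.

Lemma int_cov_le (F : nat -> set X) A g : (forall i, measurable (F i)) ->
 measurable A -> A `<=` \bigcup_i F i ->
 mfun g -> (forall x, 0 <= g x) ->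
 (\int[mu]_(x in A) (g x)%:E <= \sum_(0 <= i <oo) \int[mu]_(x in F i) (g x)%:E)%E.
move=> mF mA AF mg g0.
have mU : measurable (\bigcup_i F i) by exact: mbigcup.
apply: (leT (isub mA mU mg g0 AF)).
rewrite (seqDU_bigcup_eq F) ge0_integral_bigcup//.
- apply: lesers => [i _ _|i _]; first by apply: intge0 => x _; rewrite leF.
 apply: isub => //; last exact: subset_seqDU.
 by apply: measurableD => //; exact: bigsetU_measurable.
- by move=> i; apply: measurableD => //; exact: bigsetU_measurable.
- exact: mEFin.
- by move=> x _; rewrite leF.
Qed.

Lemma intZ A g (k : R) : measurable A -> mfun g ->
 (forall x, 0 <= g x) -> 0 <= k ->
 (\int[mu]_(x in A) (k * g x)%:E = k%:E * \int[mu]_(x in A) (g x)%:E)%E.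
move=> mA mg g0 k0.
under eqint do rewrite EFinM.
rewrite ge0_integralZl_EFin//; first by move=> x _; rewrite leF.
exact: mEFin.
Qed.

Lemma intD A g h : measurable A -> mfun g -> mfun h ->
 (forall x, 0 <= g x) -> (forall x, 0 <= h x) ->
 (\int[mu]_(x in A) (g x + h x)%:E =
 \int[mu]_(x in A) (g x)%:E + \int[mu]_(x in A) (h x)%:E)%E.
move=> mA mg mh g0 h0.
under eqint do rewrite EFinD.
rewrite ge0_integralD//; try exact: mEFin.
 by move=> x _; rewrite leF.
by move=> x _; rewrite leF.
Qed.

Lemma int_cst A (k : R) : measurable A -> 
 (\int[mu]_(x in A) k%:E = k%:E * mu A)%E.
by move=> mA; rewrite integral_cst. Qed.

Lemma int_indic A B g : measurable A -> measurable B ->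
 (\int[mu]_(x in A) (g x * \1_B x)%:E = \int[mu]_(x in A `&` B) (g x)%:E)%E.
move=> mA mB; rewrite [RHS]imkcond [LHS]imkcond; apply: eqint => x _.
rewrite /patch in_setI; case: ifPn => //= xA; rewrite indicE.
by case: (x \in B); rewrite ?mulr1 ?mulr0.
Qed.

Lemma mpowR g a : mfun g ->
 mfun (fun x => g x `^ a).
by move=> mg; apply: (mcomp (measurable_powR a)). Qed.

Lemma mMindic g B : measurable B -> mfun g ->
 mfun (fun x => g x * \1_B x).
move=> mB mg; apply: mfM => //; exact: mindic.
Qed.

Lemma msuplev g (l : R) : mfun g ->
 measurable [set x | l < g x].
move=> mg; rewrite -[X in measurable X]setTI.
have -> : [set x | l < g x] = g @^-1` `]l, +oo[%classic.
 by apply/seteqP; split => x /=; rewrite in_itv andbT.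
exact: mg.
Qed.

End integral_facts.

(** * The uncentred maximal function and its strong bound *)

Section maximal.
Context {R : realType} {dsp} {X : mType dsp}.
Variables (rho : X -> X -> R) (mu : meas X R) (D : R).
Hypothesis ds : dspace rho mu D.
Local Notation b := (qball rho).
Local Notation vol := (vol rho mu).
Implicit Types (g h : X -> R).

(** The superlevel set of the uncentred maximal function over metric balls, which is never formed as
    a function itself. It is open because metric balls are. The variant with radii at most [r1] is
    the one to which the covering lemma applies. *)
Definition omega g (l : R) : set X := [set x | exists c s,
 [/\ 0 < s, b c s x & ((l * vol c s)%:E < \int[mu]_(y in b c s) (g y)%:E)%E]].

Definition om_cap r1 g (l : R) : set X := [set x | exists c s,
 [/\ 0 < s, s <= r1, b c s x & ((l * vol c s)%:E < \int[mu]_(y in b c s) (g y)%:E)%E]].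

Lemma momega g l : measurable (omega g l).
apply: (ds_open ds) => x [c [s [s0 xs h]]].
have [t t0 ts] := ball_open ds xs; exists t => // y /ts ys.
by exists c, s.
Qed.

Lemma momega_cap r1 g l : measurable (om_cap r1 g l).
apply: (ds_open ds) => x [c [s [s0 sr xs h]]].
have [t t0 ts] := ball_open ds xs; exists t => // y /ts ys.
by exists c, s.
Qed.

(** The 5-dilates of disjoint witnessing balls cover the set, and [5 <= 2^3] costs [D^3]. *)
Lemma weak_type_cap (r1 : R) g (l : R) : 0 < l -> mfun g -> (forall x, 0 <= g x) ->
 (l%:E * mu (om_cap r1 g l) <= (D ^+ 3)%:E * \int[mu]_x (g x)%:E)%E.
move=> l0 mg g0.
have [->|/set0P[x0 _]] := eqVneq (om_cap r1 g l) set0.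
 rewrite measure0 mule0 mule_ge0//; last by apply: intge0 => x _; rewrite leF.
 by rewrite leF xge0// ltW// (D_gt0 ds).
pose F : set (X * R) := [set z | [/\ 0 < z.2, z.2 <= r1 &
 ((l * vol z.1 z.2)%:E < \int[mu]_(y in b z.1 z.2) (g y)%:E)%E]].
have [|z [zF zt zc]] := @vitali _ _ _ _ _ _ ds x0 F r1.
 by move=> y [y0 yr _]; rewrite y0.
have mb c s : measurable (b c s) by exact: (mball ds).
have D30 : 0 <= D ^+ 3 by rewrite xge0// ltW// (D_gt0 ds).
apply: (leU (l%:E * \sum_(0 <= i <oo) mu (b (z i).1 (5 * (z i).2)))%E).
 rewrite lee_pmul2l //.
 apply: measure_sigma_subadditive => //; first exact: momega_cap.
 move=> x [c [s [s0 sr xs h]]]; have [//|i [_ _ /(_ x xs) hi]] := zc (c, s).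
 by exists i.
apply: (leU ((D ^+ 3)%:E *
  \sum_(0 <= i <oo) \int[mu]_(y in b (z i).1 (z i).2) (g y)%:E)%E); last first.
 rewrite leMl //; exact: int_disj_le.
rewrite -!nneseriesZl//; last by move=> i _; apply: intge0 => x _; rewrite leF.
apply: lesers => [i _ _|i _]; first by rewrite mule_ge0// ltW.
case: (zF i) => [zi|[z0 _ h]].
 rewrite zi mulr0 (ball_le0 ds)// measure0 mule0 mule_ge0 //.
 by apply: intge0 => x _; rewrite leF.
have z50 : 0 < 5 * (z i).2 by lra.
apply: (leU ((D ^+ 3)%:E * (l * vol (z i).1 (z i).2)%:E)%E); last first.
 by rewrite leMl // ltW.
rewrite (mu_ball ds)// leF mulrCA ler_pM2l//.
apply: vol_le => //; rewrite (mtrefl (dsmt ds)) add0r.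
rewrite ler_pM2r//; lra.
Qed.

Lemma omega_bigcup g l : omega g l = \bigcup_n om_cap n%:R g l.
apply/seteqP; split => x.
 move=> [c [s [s0 xs h]]]; exists (Num.truncn s).+1 => //.
 by exists c, s; split => //; rewrite ltW// truncnS_gt.
by move=> [n _ [c [s [s0 _ xs h]]]]; exists c, s.
Qed.

Lemma weak_type g (l : R) : 0 < l -> mfun g -> (forall x, 0 <= g x) ->
 (l%:E * mu (omega g l) <= (D ^+ 3)%:E * \int[mu]_x (g x)%:E)%E.
move=> l0 mg g0; rewrite -lee_pdivlMl//.
have cv : (mu \o (fun n => om_cap n%:R g l)) x @[x --> \oo] --> mu (omega g l).
 rewrite omega_bigcup; apply: nondecreasing_cvg_mu.
 - by move=> i; exact: momega_cap.
 - by rewrite -omega_bigcup; exact: momega.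
 - move=> n m nm; apply/subsetPset => x [c [s [s0 sn xs h]]].
  by exists c, s; split => //; apply: (leT sn); rewrite ler_nat.
rewrite -(cvg_lim _ cv)//; apply: lime_le; first by apply/cvg_ex; eexists; exact: cv.
by apply: nearW => n /=; rewrite lee_pdivlMl//; exact: weak_type_cap.
Qed.

(* Only the part of [g] above [l / 2] matters at level [l]. *)
Lemma weak_type_trunc g (l : R) : 0 < l -> mfun g -> (forall x, 0 <= g x) ->
 (l%:E * mu (omega g l) <=
  (2 * D ^+ 3)%:E * \int[mu]_x (g x * \1_[set y | l / 2 < g y] x)%:E)%E.
move=> l0 mg g0; set A := [set y | _].
have mA : measurable A by exact: msuplev.
pose g1 x := g x * \1_A x.
have mg1 : mfun g1 by exact: mMindic.
have g10 x : 0 <= g1 x by rewrite mge0.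
have l20 : 0 < l / 2 by lra.
have sub : omega g l `<=` omega g1 (l / 2).
 move=> x [c [s [s0 xs h]]]; exists c, s; split => //.
 have mb : measurable (b c s) by exact: (mball ds).
 have le1 : (\int[mu]_(y in b c s) (g y)%:E <=
  \int[mu]_(y in b c s) (g1 y)%:E + (l / 2 * vol c s)%:E)%E.
  rewrite EFinM -(mu_ball ds)// -int_cst// -intD//; last by move=> _; exact: ltW.
  apply: int_le => //; first exact: mfD.
  move=> y _; rewrite /g1 indicE; case: (boolP (y \in A)) => [yA|/negP yA].
  by rewrite mulr1 lerDl ltW.
  rewrite mulr0 add0r leNgt; apply/negP => yl; apply: yA; rewrite inE//.
 have := ltleT h le1.
 rewrite -lteBlDr//; congr (_ < _)%E; congr EFin; lra.
apply: (leU (l%:E * mu (omega g1 (l / 2)))%E).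
 rewrite lee_pmul2l //; apply: lemu; rewrite ?inE//; exact: momega.
have := weak_type l20 mg1 g10.
rewrite -(@lee_pmul2l _ 2%:E)// !muleA -!EFinM => h.
by rewrite (_ : 2 * (l / 2) = l) in h; last by lra.
Qed.

Lemma exp_level_exists (e y : R) : 0 < e -> e < y ->
 exists k, e * expR k%:R < y <= expR 1 * (e * expR k%:R).
move=> e0 ey; have y0 : 0 < y by exact: lt_trans ey.
pose P k := y <= e * expR k%:R.
have exP : exists k, P k.
 exists (Num.truncn (y / e)); rewrite /P mulrC -lepdM//.
 apply: (leU (1 + (Num.truncn (y / e))%:R)); last exact: expR_ge1Dx.
 by rewrite addrC natr1 ltW// truncnS_gt.
case: (ex_minnP exP) => -[|k]; first by rewrite /P expR0; lra.
move=> Pk kmin; exists k; apply/andP; split.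
 by rewrite ltNge; apply/negP => /kmin; rewrite ltnn.
move: Pk; rewrite /P -natr1 expRD; congr (_ <= _); lra.
Qed.

(** A geometric sum of ratio [exp x], with [1 / (1 - exp (-x)) <= (1 + x) / x]. The behaviour [1/x]
    for small [x] is what later turns into powers of the A_infinity characteristics. *)
Lemma geometric_level_sum (e x y : R) N : 0 < e -> 0 < x -> 0 <= y ->
 \sum_(0 <= k < N) (e * expR k%:R) `^ x * (e * expR k%:R < y)%R%:R <=
 (1 + x) / x * y `^ x.
move=> e0 x0 y0; pose c := (1 - expR (- x))^-1.
have ex1 : expR (- x) < 1 by rewrite expR_lt1; lra.
have c0 : 0 < c by rewrite igt0; lra.
have ce : c * expR (- x) + 1 = c.
 have : c * (1 - expR (- x)) = 1 by rewrite mulVf// gtF//; lra.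
 lra.
have le_c : c <= (1 + x) / x.
 rewrite -[leRHS]invrK lef_pV2 ?posrE ?igt0 ?dgt0//; [|lra|lra].
 rewrite invf_div expRN.
 have : (expR x)^-1 <= (1 + x)^-1.
  by rewrite lef_pV2 ?posrE ?expR_gt0//; [exact: expR_ge1Dx|lra].
 have -> : x / (1 + x) = 1 - (1 + x)^-1 by field; lra.
 lra.
pose E k : R := e * expR k%:R.
have E0 k : 0 < E k by rewrite mgt0//.
have ES k : E k.+1 * expR (-1) = E k.
 by rewrite -mulrA -expRD -natr1; congr (_ * expR _); lra.
(* The sum is dominated by the largest level counted, which is below both the last level available
   and [y]. Keeping the minimum of the two makes the induction on [N] close. *)
suff : \sum_(0 <= k < N) E k `^ x * (E k < y)%R%:R <=
  c * (Num.min (E N * expR (-1)) y) `^ x.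
 move=> /leT; apply; apply: ler_pM => //; [exact: ltW|exact: pge0|].
 apply: ge0_ler_powR; rewrite ?nnegrE ?ge_min ?lexx ?orbT//; first exact: ltW.
 by rewrite le_min y0 mge0 ?expR_ge0// ltW.
move: E E0 ES => {e0 e} E E0 ES; move: c c0 ce le_c => c c0 ce _.
elim: N => [|N ih].
 by rewrite big_geq// mge0 ?pge0// ltW.
rewrite big_nat_recr//= ES; have [yE|Ey] := leP y (E N).
 rewrite mulr0 addr0 (leT ih)// ler_pM2l//.
 apply: ge0_ler_powR; rewrite ?nnegrE ?ge_min ?lexx ?orbT//; first exact: ltW.
 by rewrite le_min y0 mge0 ?expR_ge0// ltW.
rewrite mulr1; apply: (leU (c * (E N * expR (-1)) `^ x + E N `^ x)).
 rewrite lerD2r (leT ih)// ler_pM2l//.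
 apply: ge0_ler_powR; rewrite ?nnegrE ?ge_min ?lexx //; first exact: ltW.
  by rewrite le_min y0 mge0 ?expR_ge0// ltW.
 by rewrite mge0 // ltW.
rewrite powRM ?(ltW (E0 N))// -expRM mulN1r.
suff -> : c * (E N `^ x * expR (- x)) + E N `^ x = c * E N `^ x by [].
by rewrite -[in RHS]ce mulrDl mul1r mulrA mulrAC.
Qed.

(** Marcinkiewicz interpolation by summing [weak_type_trunc] over exponential levels, with the
    explicit factor [a / (a - 1)]. [H] is any measurable function lying below the maximal function
    of [h] in the sense of level sets; it will be a function that is constant on each sparse
    piece. *)
Lemma maximal_power_bound (a : R) (h H : X -> R) : 1 < a ->
 mfun h -> mfun H ->
 (forall x, 0 <= h x) -> (forall x, 0 <= H x) ->
 (forall l, 0 < l -> [set x | l < H x] `<=` omega h l) ->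
 (\int[mu]_x (H x `^ a)%:E <=
  (D ^+ 3 * (2 * expR 1) `^ a * (a / (a - 1)))%:E * \int[mu]_x (h x `^ a)%:E)%E.
move=> a1 mh mH h0 H0 Hh; set C := _ * _ * _.
have D30 : 0 < D ^+ 3 by rewrite xgt0// (D_gt0 ds).
have C0 : 0 <= C.
 apply: mge0; last by apply: dge0; lra.
 by apply: mge0; [exact: ltW|exact: pge0].
have a0 : 0 <= a by lra.
have ppow x : 0 <= h x `^ a by exact: pge0.
(* On this set the levels can start at the positive number [1/(n+1)] and be indexed by naturals;
   monotone convergence in [n] removes the restriction. *)
pose A n := [set x | n.+1%:R^-1 < H x].
have mA n : measurable (A n) by exact: msuplev.
suff key n : (\int[mu]_(x in A n) (H x `^ a)%:E <= C%:E * \int[mu]_x (h x `^ a)%:E)%E.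
 have mHa : mfun (fun x => H x `^ a) by exact: mpowR.
 have -> : (\int[mu]_x (H x `^ a)%:E = \int[mu]_(x in \bigcup_n A n) (H x `^ a)%:E)%E.
  rewrite [RHS]imkcond; apply: eqint => x _.
  rewrite /patch; case: ifPn => // /negP xA.
  have [Hx0|Hx] := leP (H x) 0.
  have -> : H x = 0 by apply/eqP; rewrite eq_le Hx0 H0.
  by rewrite powR0//; lra.
  exfalso; apply: xA; rewrite inE; exists (Num.truncn (H x)^-1) => //=.
  by rewrite /A /= invf_plt ?posrE// truncnS_gt.
 have cv : (\int[mu]_(x in A n) (H x `^ a)%:E)%E @[n --> \oo] -->
  (\int[mu]_(x in \bigcup_n A n) (H x `^ a)%:E)%E.
  apply: ge0_nondecreasing_set_cvg_integral => //.
  - move=> m n' mn; apply/subsetPset => x; apply: leltT.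
  by rewrite lef_pV2 ?posrE// ler_nat.
  - by move=> i; exact: mEFin.
  - by move=> i x _; rewrite leF pge0.
 rewrite -(cvg_lim _ cv)//; apply: lime_le; first by apply/cvg_ex; eexists; exact: cv.
 exact: nearW.
pose e : R := n.+1%:R^-1; have e0 : 0 < e by rewrite igt0.
pose E k : R := e * expR k%:R.
have E0 k : 0 < E k by rewrite mgt0//.
pose B k := [set x | E k < H x].
have mB k : measurable (B k) by exact: msuplev.
apply: (leU (\int[mu]_x
  (\sum_(0 <= k <oo) ((expR 1 * E k) `^ a * \1_(B k) x)%:E))%E).
 rewrite imkcond; apply: ge0_le_integral => //.
 - by move=> x _; rewrite erestrict_ge0// => y; rewrite leF pge0.
 - apply/(measurable_restrictT _ (mA n)).1/mEFin.
  exact: mpowR.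
 - apply: ge0_emeasurable_sum => [k x _|k _].
  by rewrite leF mge0 ?pge0.
  apply: mEFin; apply: mfM => //.
 - move=> x _; rewrite /patch; case: ifPn => [|_]; last first.
  by apply: nneseries_ge0 => k _ _; rewrite leF mge0 ?pge0.
  rewrite inE => /(exp_level_exists e0)[k /andP[k1 k2]].
  apply: (leU ((expR 1 * E k) `^ a * \1_(B k) x)%:E).
  rewrite leF indicE mem_set// mulr1.
  by apply: ge0_ler_powR; rewrite ?nnegrE// mge0 // ltW.
  apply: (nnes_ge (f := fun k => ((expR 1 * E k) `^ a * \1_(B k) x)%:E)).
  by move=> i; rewrite leF mge0 ?pge0.
rewrite integral_nneseries//; last 2 first.
 - move=> k; apply: mEFin; apply: mfM => //.
 - by move=> k x _; rewrite leF mge0 ?pge0.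
pose K := expR 1 `^ a * (2 * D ^+ 3).
have K0 : 0 <= K.
 by apply: mge0; [exact: pge0|apply: mge0; exact: ltW].
pose S k := [set y | E k / 2 < h y].
have mS k : measurable (S k) by exact: msuplev.
have t0 k x : 0 <= K * (E k `^ (a - 1) * (h x * \1_(S k) x)).
 by apply: mge0 => //; rewrite mge0 ?pge0// mge0.
apply: (leU (\sum_(0 <= k <oo)
 \int[mu]_x (K * (E k `^ (a - 1) * (h x * \1_(S k) x)))%:E)%E).
 apply: lesers => [k _ _|k _].
  by apply: intge0 => x _; rewrite leF mge0 ?pge0.
 rewrite intZ//; last exact: pge0.
 rewrite (@intindic _ _ _ mu setT)// setIT.
 have mhS : mfun (fun x => h x * \1_(S k) x).
  exact: mMindic.
 have hS0 x : 0 <= h x * \1_(S k) x by rewrite mge0.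
 rewrite intZ//; last 2 first.
  by apply: mfM.
  by move=> x; rewrite mge0 ?pge0.
 rewrite intZ ?pge0//.
 have := weak_type_trunc (E0 k) mh h0; rewrite -/(S k) => wt.
 have -> : ((expR 1 * E k) `^ a)%:E = ((expR 1 `^ a * E k `^ (a - 1))%:E * (E k)%:E)%E.
  rewrite -EFinM powRM ?(ltW (E0 k))// -mulrA; congr (_ * _)%:E.
  by rewrite (powRM_pred (ltW (E0 k))) 1?mulrC// (lt_trans ltr01 a1).
 rewrite -muleA; apply: (leU ((expR 1 `^ a * E k `^ (a - 1))%:E *
  ((E k)%:E * mu (omega h (E k))))%E).
  rewrite leMl ?leF ?mge0 ?pge0//.
  rewrite lee_pmul2l ?lte_fin//; apply: lemu; rewrite ?inE//.
  exact: momega.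
  exact: Hh.
 apply: (leT (leMl _ wt)); first by rewrite leF mge0 ?pge0.
 rewrite !muleA -!EFinM; apply: leMr.
  by apply: intge0 => x _; rewrite leF.
 by rewrite leF /K; lra.
rewrite -integral_nneseries//; last 2 first.
 - move=> k; apply: mEFin; apply: mfM => //.
  by apply: mfM => //; exact: mMindic.
 - by move=> k x _; rewrite leF.
rewrite -intZ//; last exact: mpowR.
apply: ge0_le_integral => //.
- by move=> x _; apply: nneseries_ge0 => k _ _; rewrite leF.
- apply: ge0_emeasurable_sum => [k x _|k _].
  by rewrite leF.
 apply: mEFin; apply: mfM => //.
 by apply: mfM => //; exact: mMindic.
- apply: mEFin; apply: mfM => //.
 exact: mpowR.
- move=> x _; apply: lime_le.
  by apply: is_cvg_nneseries => k _ _; rewrite leF.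
 apply: nearW => N; rewrite sumEFin leF.
 have x0 : 0 < a - 1 by lra.
 have h20 : 0 <= 2 * h x by rewrite mge0.
 have := geometric_level_sum N e0 x0 h20 => gl.
 apply: (leU (K * h x *
  (\sum_(0 <= k < N) E k `^ (a - 1) * (E k < 2 * h x)%R%:R))).
  rewrite mulr_sumr; apply: ler_sum => k _; rewrite indicE.
  apply: eqW.
  have -> : (x \in S k) = (E k < 2 * h x).
  by apply/idP/idP; rewrite inE /S /=; lra.
  lra.
 apply: (leT (wMl _ gl)); first by rewrite mge0.
 rewrite powRM// (@powRM_pred _ (h x) a) ?(lt_trans ltr01 a1)//.
 have -> : C = D ^+ 3 * (2 * 2 `^ (a - 1) * expR 1 `^ a) * (a / (a - 1)).
  rewrite /C powRM //; congr (_ * (_ * _) * _).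
  by rewrite (@powRM_pred _ 2)// (lt_trans ltr01 a1).
 have -> : 1 + (a - 1) = a by lra.
 by rewrite /K; apply: eqW; ring.
Qed.

End maximal.

(** * Level sets of a weight: the sharp reverse Hoelder inequality and a local maximal bound *)

Section abel.
Context {R : realType}.

(* Multiply the tail bound by [q^(m+1) - q^m] and sum over [m]. *)
Lemma tail_geometric_sum (u : nat -> R) (L : R) : 1 <= L -> (forall k, 0 <= u k) ->
 (forall m N, \sum_(m.+1 <= k < N) u k <= L * u m) ->
 forall N, \sum_(0 <= k < N) (1 + (2 * L)^-1) ^+ k * u k <= 2 * (1 + L) * u 0%N.
move=> L1 u0 uL N; set q := 1 + _.
have L0 : 0 < 2 * L by lra.
have q0 : 0 < q by rewrite addr_gt0// igt0.
have geo k : q ^+ k = 1 + (q - 1) * \sum_(0 <= m < k) q ^+ m.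
 elim: k => [|k ih]; first by rewrite big_geq// mulr0 addr0.
 by rewrite big_nat_recr//= mulrDr addrA -ih exprS; ring.
pose U := \sum_(0 <= k < N) q ^+ k * u k.
pose S := \sum_(0 <= k < N) u k.
have S1 : S <= (1 + L) * u 0%N.
 rewrite /S; case: (N) => [|M]; first by rewrite big_geq// mge0//; lra.
 by rewrite big_nat_recl//= mulrDl mul1r lerD2l -(big_add1 _ _ 0 M.+1 xpredT).
have US : U = S + (q - 1) * \sum_(0 <= k < N) \sum_(0 <= m < k) q ^+ m * u k.
 rewrite mulr_sumr -big_split/=; apply: eq_bigr => k _.
 by rewrite {1}geo mulrDl mul1r -mulr_suml mulrA.
have E : \sum_(0 <= k < N) \sum_(0 <= m < k) q ^+ m * u k =
  \sum_(0 <= m < N) q ^+ m * \sum_(m.+1 <= k < N) u k.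
 elim: N {S U S1 US} => [|N ih]; first by rewrite !big_geq.
 rewrite big_nat_recr//= ih [RHS]big_nat_recr//= (big_geq (leqnn _)) mulr0 addr0.
 rewrite -big_split/= !big_nat; apply: eq_bigr => m /andP[_ mN].
 by rewrite [in RHS]big_nat_recr// mulrDr.
have le1 : \sum_(0 <= m < N) q ^+ m * \sum_(m.+1 <= k < N) u k <= L * U.
 rewrite mulr_sumr; apply: ler_sum => m _.
 by rewrite mulrCA wMl// xge0// ltW.
have : U <= S + (q - 1) * (L * U).
 by rewrite {1}US E lerD2l wMl// addrC addKr ige0 ltW.
have -> : (q - 1) * (L * U) = U / 2.
 by rewrite addrC addKr; field; lra.
by rewrite -/U; lra.
Qed.

End abel.

Section rev_hold.
Context {R : realType} {dsp} {X : mType dsp}.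
Variables (rho : X -> X -> R) (mu : meas X R) (D : R).
Hypothesis ds : dspace rho mu D.
Local Notation b := (qball rho).
Local Notation vol := (vol rho mu).
Local Notation om_cap := (om_cap rho mu).

Let rsym := mtsym (dsmt ds).
Let rtri := mttri (dsmt ds).
Let rxx := mtrefl (dsmt ds).
Let mb c s : measurable (b c s) := mball ds c s.
Let D0 := D_gt0 ds.

(* The Lebesgue differentiation property, up to the factor [Cl] due to the change of
 (quasi-)metric. *)
Definition leb_upto (Cl : R) (w : X -> R) : Prop :=
 {ae mu, forall x l s, 0 < s -> Cl * l < w x -> om_cap s w l x}.

(* The Fujii-Wilson condition, tested on functions [G] below the local maximal function. *)
Definition fwilson (th : nat) (A : R) (w : X -> R) : Prop :=
 forall c s, 0 < s -> forall G : X -> R, mfun G -> (forall x, 0 <= G x) ->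
 (forall x, b c (5 * s) x -> 0 < G x -> exists c' s', [/\ 0 < s', b c' s' x,
  b c' s' `<=` b c (7 * s) & ((G x * vol c' s')%:E <= \int[mu]_(y in b c' s') (w y)%:E)%E]) ->
 (\int[mu]_(x in b c (5 * s)) (G x)%:E <= A%:E * \int[mu]_(x in b c (2 ^+ th * s)) (w x)%:E)%E.

(* A gain of order [1 / A] over integrability, as the sharp reverse Hoelder inequality requires. *)
Definition rh_exp (th : nat) (A : R) : R :=
 ln (1 + (2 * (2 * A * D ^+ th))^-1) / ln (D ^+ 7).

Section tower.
Variables (w : X -> R) (x0 : X) (r1 : R) (th : nat) (W0 : R).
Hypotheses (mw : mfun w) (w0 : forall x, 0 <= w x) (r10 : 0 < r1)
 (th3 : (3 <= th)%N) (W00 : 0 < W0)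
 (wW0 : (\int[mu]_(x in b x0 (4 * r1)) (w x)%:E = W0%:E)%E).

(** The exponent [th + 4] is the one for which [tower_radius] holds: a ball on which the average
    exceeds [level k] is then so small that its dilate by [2^th] still has radius below [r1]. *)
Definition level0 : R := D ^+ (th + 4) * W0 / vol x0 r1.
(** The ratio [D^7] is dictated by the comparison of volumes in [towc_small]. It also makes sums of
    levels geometric and, in [tower_step], lets the next tower fill at most half of a stopping
    ball. *)
Definition level (k : nat) : R := D ^+ (7 * k) * level0.
(** The localizing ball shrinks with [k]: stopping balls of level [m] that reach the ball of index
    [m + 1] have radius small enough to stay inside the ball of index [m]. *)
Definition tower (k : nat) : set X :=
 om_cap r1 w (level k) `&` b x0 ((1 + 2 ^- k) * r1).

Lemma lev_gt0 k : 0 < level k.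
by rewrite mgt0 ?xgt0// dgt0 ?(vgt0 ds)// mgt0// xgt0.
Qed.

Lemma levelS k : level k.+1 = D ^+ 7 * level k.
by rewrite /level mulnS exprD mulrA. Qed.

Lemma level_le k l : (k <= l)%N -> level k <= level l.
move=> kl; rewrite ler_pM2r; last by have := lev_gt0 0; rewrite /level mul1r.
by rewrite ler_weXn2l ?leq_mul2l//; have := dsC ds; lra.
Qed.

Lemma sum_level_le m K : \sum_(m <= k < K.+1) level k <= 2 * level K.
elim: K => [|K ih].
 case: m => [|m]; first by rewrite big_nat1; have := lev_gt0 0; lra.
 by rewrite big_geq//; have := lev_gt0 0; lra.
have [mK|Km] := leqP m K.+1; last first.
 by rewrite big_geq//; have := lev_gt0 K.+1; lra.
rewrite big_nat_recr//= levelS; apply: (leU (2 * level K + D ^+ 7 * level K)).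
 lra.
have D7 : 2 <= D ^+ 7.
 rewrite -[leLHS]expr1; apply: (leU (2 ^+ 7)).
  by lra.
 by rewrite lerXn2r ?nnegrE ?(ltW D0)//; exact: dsC ds.
by have := lev_gt0 K; nra.
Qed.

Lemma mtower k : measurable (tower k).
by apply: measurableI => //; exact: momega_cap ds _ _ _. Qed.

Lemma le1t k : 1 + 2 ^- k <= 2 :> R.
suff : (2 ^- k : R) <= 1 by lra.
by rewrite invf_le1 ?xgt0// exprn_ege1//; lra.
Qed.

(* A ball on which the average of [w] exceeds [level k] has small measure, hence a
 small radius by doubling. *)
Lemma tower_radius k x c s : b x0 (2 * r1) x -> 0 < s -> s <= r1 -> b c s x ->
 ((level k * vol c s)%:E < \int[mu]_(y in b c s) (w y)%:E)%E ->
 2 ^+ (th + 2 + k) * s < r1.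
rewrite /qball /= => xx s0 sr xs hk; rewrite ltNge; apply/negP => rs.
have cx : rho x0 c <= 3 * r1.
 by have := rtri x x0 c; rewrite (rsym x c); lra.
have : (\int[mu]_(y in b c s) (w y)%:E <= W0%:E)%E.
 rewrite -wW0; apply: isub => //; apply: (bsub ds).
 by have := rtri x x0 c; rewrite (rsym c x0); lra.
move/(ltleT hk); rewrite lte_fin; apply/negP; rewrite -leNgt.
have v0 := vgt0 ds x0 r10.
have vle : vol x0 r1 <= D ^+ (th + 4 + k) * vol c s.
 apply: vol_le => //; apply: (leU (4 * r1)); first lra.
 have -> : (th + 4 + k = 2 + (th + 2 + k))%N by clear; lia.
 rewrite exprD -mulrA; apply: ler_pM; lra.
rewrite /level /level0.
have -> : D ^+ (7 * k) * (D ^+ (th + 4) * W0 / vol x0 r1) * vol c s =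
 W0 * ((D ^+ (7 * k) * D ^+ (th + 4) * vol c s) / vol x0 r1) by lra.
rewrite -{1}(mulr1 W0) ler_pM2l// ler_pdivlMr// mul1r (leT vle)//.
rewrite -exprD ler_pM2r ?(vgt0 ds)// ler_weXn2l//; last by clear; lia.
by have := dsC ds; lra.
Qed.

(** A Calderon-Zygmund stopping ball of [w] at height [level m]. The last clause, maximality up to a
    factor 2, controls the mass of [w] on dilates. *)
Definition tower_core m (z : X * R) : Prop :=
 [/\ 0 < z.2, 2 ^+ (th + 2 + m) * z.2 < r1, b z.1 z.2 `<=` tower m,
  ((level m * vol z.1 z.2)%:E < \int[mu]_(y in b z.1 z.2) (w y)%:E)%E &
  forall t, 2 <= t -> t * z.2 <= r1 ->
  (\int[mu]_(y in b z.1 (t * z.2)) (w y)%:E <= (level m * vol z.1 (t * z.2))%:E)%E].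

(** Through each point choose a witnessing ball whose radius exceeds half the supremum of the
    witnessing radii. A ball through this point of at least twice that radius cannot be a witness,
    which is the maximality wanted; the Vitali lemma then makes the chosen balls disjoint. *)
Lemma tower_cover m : exists z : nat -> X * R, [/\
 forall i, (z i).2 = 0 \/ tower_core m (z i),
 trivIset setT (fun i => b (z i).1 (z i).2) &
 om_cap r1 w (level m) `&` b x0 ((1 + 2 ^- m.+1) * r1) `<=`
  \bigcup_i b (z i).1 (5 * (z i).2)].
pose P x (s : R) := exists c, [/\ 0 < s, s <= r1, b c s x &
 ((level m * vol c s)%:E < \int[mu]_(y in b c s) (w y)%:E)%E].
pose F : set (X * R) := [set z | [/\ 0 < z.2, z.2 <= r1,
 ((level m * vol z.1 z.2)%:E < \int[mu]_(y in b z.1 z.2) (w y)%:E)%E &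
 exists x, [/\ b z.1 z.2 x, b x0 ((1 + 2 ^- m.+1) * r1) x &
  forall s, 2 * z.2 <= s -> ~ P x s]]].
have [|z [zF zt zc]] := @vitali _ _ _ _ _ _ ds x0 F r1.
 by move=> y [y0 yr _ _]; rewrite y0.
have t2 : (1 + 2 ^- m.+1) * r1 <= 2 * r1 by rewrite ler_pM2r// le1t.
exists z; split => //.
 move=> i; case: (zF i) => [->|[s0 sr wl [x [xz xx Px]]]]; [by left|right].
 have xx2 : b x0 (2 * r1) x by move: xx; rewrite /qball /=; lra.
 have rad := tower_radius xx2 s0 sr xz wl.
 split => //.
  move=> y yz; split; first by exists (z i).1, (z i).2.
  move: yz xz xx; rewrite /qball /= => yz xz xx.
  have : 2 * (z i).2 <= r1 / 2 ^+ m.+1.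
  rewrite ler_pdivlMr // mulrAC -exprS.
  apply: leT (ltW rad); rewrite ler_pM2r// ler_weXn2l//; [by rewrite ler1n|clear -th3; lia].
  have -> : (1 + 2 ^- m) * r1 = (1 + 2 ^- m.+1) * r1 + r1 / 2 ^+ m.+1.
  rewrite exprS; have : (2 ^+ m : R) != 0 by rewrite gtF.
  lra.
  by have := rtri x x0 y; have := rtri (z i).1 x y; rewrite (rsym x (z i).1); lra.
 move=> t t2' tr; rewrite leNgt; apply/negP => h; apply: (Px (t * (z i).2)).
  by rewrite ler_pM2r.
 exists (z i).1; split => //; first by rewrite mgt0; lra.
 move: xz; rewrite /qball /=; nra.
move=> x [[c [s [s0 sr xs wl]]] xx].
have hs : has_sup [set s | P x s].
 split; first by exists s, c.
 by exists r1 => t [c' []].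
pose sg := sup [set s | P x s].
have sg0 : 0 < sg by apply: (ltleT s0); apply: (supub hs); exists c.
have [|t [c' [t0 tr xt wt]] tsg] := @sup_adherent _ _ (sg / 2) _ hs.
 lra.
have [|i [_ _ /(_ x xt)]] := zc (c', t); last by exists i.
split => //=; exists x; split => // u tu Pu.
by have := supub hs Pu; move: tsg; rewrite -/sg; lra.
Qed.

(** A witness of a higher level near a stopping ball is smaller than that ball. Otherwise the ball
    of radius [7 s] about the centre [z.1] contains it, has average at most [level m], and has
    volume at most [D^7] times larger, whereas the levels differ by at least [D^7]. High levels are
    therefore visible inside the 7-dilate, as [fwilson] requires. *)
Lemma towc_small m z k y c s : tower_core m z -> (m < k)%N ->
 b z.1 (5 * z.2) y -> b x0 (2 * r1) y -> 0 < s -> s <= r1 -> b c s y ->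
 ((level k * vol c s)%:E < \int[mu]_(y in b c s) (w y)%:E)%E ->
 b c s `<=` b z.1 (7 * z.2).
move=> [z0 zr zt zl zm] mk yz yx s0 sr ys h.
have [sz|zs] := ltP s z.2.
 move: yz ys; rewrite /qball /= => yz ys; apply: (bsub ds).
 by have := rtri y c z.1; rewrite (rsym y z.1); lra.
have rad := tower_radius yx s0 sr ys h.
have le8 : 8 * s <= r1.
 apply: ltW; apply: leltT rad; rewrite ler_pM2r//.
 apply: (leU (2 ^+ 3)); first lra.
 by rewrite ler_weXn2l//; [by rewrite ler1n|clear -th3; lia].
pose t := 7 * (s / z.2).
have tz : t * z.2 = 7 * s by rewrite /t; field; lra.
have t2 : 2 <= t.
 have : 1 <= s / z.2 by rewrite ler_pdivlMr// mul1r.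
 by rewrite /t; lra.
have := zm t t2; rewrite tz => /(_ ltac:(lra)) up.
exfalso; move: yz ys; rewrite /qball /= => yz ys.
have sub : b c s `<=` b z.1 (7 * s).
 by apply: (bsub ds); have := rtri y c z.1; rewrite (rsym y z.1); lra.
have i1 := isub mu (mb c s) (mb z.1 (7 * s)) mw w0 sub.
have := ltleT h (leT i1 up); rewrite lte_fin; apply/negP; rewrite -leNgt.
have v7 : vol z.1 (7 * s) <= D ^+ 7 * vol c s.
 apply: vol_le => //; first lra.
 have := rtri y z.1 c; rewrite (rsym y c) => tr.
 by apply: (leU (13 * s)); [lra|lra].
apply: (leU (level m.+1 * vol c s)).
 rewrite levelS -mulrA [leRHS]mulrCA ler_pM2l ?lev_gt0//.
by rewrite ler_pM2r ?(vgt0 ds)// level_le.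
Qed.

Lemma core_sum_le m (z : nat -> X * R) : (forall i, (z i).2 = 0 \/ tower_core m (z i)) ->
 trivIset setT (fun i => b (z i).1 (z i).2) ->
 (\sum_(0 <= i <oo) mu (b (z i).1 (z i).2) <= mu (tower m))%E.
move=> zc zt; rewrite -meas_bigcupT//; apply: lemu; rewrite ?inE.
- exact: mbigcup.
- exact: mtower.
- move=> x [i _]; case: (zc i) => [->|[_ _ h _ _]]; first by rewrite (ball_le0 ds).
 exact: h.
Qed.

Lemma core_dil m j z : tower_core m z -> (1 <= j)%N -> (j <= th)%N ->
 (\int[mu]_(x in b z.1 (2 ^+ j * z.2)) (w x)%:E <=
 (level m * D ^+ j)%:E * mu (b z.1 z.2))%E.
move=> [z0 zr _ _ zm] j1 jth.
have j2 : 2 <= 2 ^+ j :> R by rewrite -[leLHS]expr1 ler_weXn2l//; lra.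
have jr : 2 ^+ j * z.2 <= r1.
 apply: ltW; apply: leltT zr; rewrite ler_pM2r// ler_weXn2l//; [by rewrite ler1n|clear -jth; lia].
apply: (leT (zm _ j2 jr)); rewrite (mu_ball ds)// leF -[leRHS]mulrA.
by rewrite ler_pM2l ?lev_gt0// (dbl_iter ds).
Qed.

Lemma tower_sub m : tower m.+1 `<=`
 om_cap r1 w (level m) `&` b x0 ((1 + 2 ^- m.+1) * r1).
move=> x [[c [s [s0 sr xs h]]] xx]; split => //; exists c, s; split => //.
apply: leltT h; rewrite leF ler_pM2r ?(vgt0 ds)//; exact: level_le.
Qed.

Lemma towr_anti m k : (m <= k)%N ->
 b x0 ((1 + 2 ^- k) * r1) `<=` b x0 ((1 + 2 ^- m) * r1).
move=> mk; apply: (bsub ds); rewrite rxx add0r ler_pM2r// lerD2l.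
by rewrite lef_pV2 ?posrE ?xgt0// ler_weXn2l//; lra.
Qed.

Lemma tower_weight m :
 (\int[mu]_(x in tower m.+1) (w x)%:E <= (level m * D ^+ 3)%:E * mu (tower m))%E.
have [z [zc zt zcov]] := tower_cover m.
apply: (leU (\sum_(0 <= i <oo) \int[mu]_(x in b (z i).1 (5 * (z i).2)) (w x)%:E)%E).
 apply: int_cov_le => //; first exact: mtower.
 by move=> x /tower_sub; exact: zcov.
have l0 : 0 <= level m * D ^+ 3 by rewrite mge0 ?xge0 // ltW// lev_gt0.
apply: (leU ((level m * D ^+ 3)%:E * \sum_(0 <= i <oo) mu (b (z i).1 (z i).2))%E).
 rewrite -nneseriesZl//; apply: lesers => [i _ _|i _].
  by apply: intge0 => x _; rewrite leF.
 case: (zc i) => [->|ci]; first by rewrite !(ball_le0 ds)// integral_set0 measure0 mule0.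
 apply: leT _ (core_dil ci _ th3) => //.
 apply: isub => //; apply: (bsub ds); rewrite rxx add0r ler_pM2r; last by case: ci.
 lra.
by apply: leMl; [rewrite leF|exact: core_sum_le].
Qed.

(** [Phi], the sum of [level k] over the towers containing the point, is at most twice the highest
    of these levels. That tower supplies a ball around the point, inside the 7-dilate of the
    stopping ball, whose average exceeds [Phi / 2]. So [Phi / 2] may be tested in [fwilson] on each
    stopping ball, and the disjoint stopping balls lie in [tower m]. *)
Lemma tower_tail A m N : 0 <= A -> fwilson th A w ->
 (\sum_(m.+1 <= k < N) (level k)%:E * mu (tower k) <=
 (2 * A * D ^+ th)%:E * ((level m)%:E * mu (tower m)))%E.
move=> A0 fw; have [z [zc zt zcov]] := tower_cover m.
pose Phi (x : X) : R := \sum_(m.+1 <= k < N) level k * \1_(tower k) x.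
have mPhi : mfun Phi.
 apply: msum => k; apply: mfM => //.
 exact: mindic (mtower k).
have Phi0 x : 0 <= Phi x.
 by apply: sge0 => k _; rewrite mge0// ltW// lev_gt0.
have -> : (\sum_(m.+1 <= k < N) (level k)%:E * mu (tower k) =
  \int[mu]_x (Phi x)%:E)%E.
 transitivity (\int[mu]_x (\sum_(m.+1 <= k < N) (level k * \1_(tower k) x)%:E))%E;
  last by apply: eqint => x _; rewrite sumEFin.
 rewrite ge0_integral_sum//.
 - apply: eq_bigr => k _; rewrite intZ//; last by rewrite ltW// lev_gt0.
  by rewrite intindic ?setIT//; exact: mtower.
  exact: mindic (mtower k).
 - move=> k; apply: mEFin; apply: mfM => //.
  exact: mindic (mtower k).
 - by move=> k x _; rewrite leF mge0// ltW// lev_gt0.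
pose U := \bigcup_i b (z i).1 (5 * (z i).2).
have mU : measurable U by exact: mbigcup.
have PhiU x : ~ U x -> Phi x = 0.
 move=> Ux; rewrite /Phi big_nat; apply: big1 => k /andP[mk _].
 rewrite indicE memNset ?mulr0// => -[[c [s [s0 sr xs h]]] xx]; apply: Ux; apply: zcov.
 split; last exact: towr_anti xx.
 exists c, s; split => //; apply: leltT h.
 by rewrite leF ler_pM2r ?(vgt0 ds)// level_le// ltnW.
have -> : (\int[mu]_x (Phi x)%:E = \int[mu]_(x in U) (Phi x)%:E)%E.
 rewrite [RHS]imkcond; apply: eqint => x _; rewrite /patch.
 by case: ifPn => // /negP xU; rewrite PhiU// => Ux; apply: xU; rewrite inE.
apply: (leT (int_cov_le mu (fun i => mb (z i).1 (5 * (z i).2)) mU _ mPhi Phi0)) => //.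
have l0 : 0 <= level m := ltW (lev_gt0 m).
have c0 : 0 <= 2 * A * D ^+ th * level m.
 by rewrite mge0// mge0 ?xge0 ?(ltW D0)// mge0.
apply: (leU ((2 * A * D ^+ th * level m)%:E *
  \sum_(0 <= i <oo) mu (b (z i).1 (z i).2))%E); last first.
 rewrite muleA; apply: leMl; [by rewrite leF|exact: core_sum_le].
rewrite -nneseriesZl//; apply: lesers => [i _ _|i _].
 by apply: intge0 => x _; rewrite leF.
case: (zc i) => [->|ci]; first by rewrite !(ball_le0 ds)// integral_set0 measure0 mule0.
have [z0 _ _ _ _] := ci.
have /= := fw (z i).1 (z i).2 z0 (fun x => Phi x / 2).
have mPhi2 : mfun (fun x => Phi x / 2) by apply: mfM.
have Phi20 x : 0 <= Phi x / 2 by rewrite dge0.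
move=> /(_ mPhi2 Phi20) fwi.
have {fwi} : (\int[mu]_(x in b (z i).1 (5 * (z i).2)) (Phi x / 2)%:E <=
  A%:E * \int[mu]_(x in b (z i).1 (2 ^+ th * (z i).2)) (w x)%:E)%E.
 apply: fwi => x xz Phix.
 have [k kP kmax] : exists2 k, (m < k < N)%N && (x \in tower k) &
  forall j, (m < j < N)%N -> x \in tower j -> (j <= k)%N.
  have exk : exists k, (m < k < N)%N && (x \in tower k).
  apply: contrapT => nk; move: Phix; rewrite /Phi big_nat big1 ?mul0r ?ltxx// => k mkN.
  rewrite indicE; case: (boolP (x \in tower k)) => [xk|_]; last by rewrite mulr0.
  by exfalso; apply: nk; exists k; rewrite mkN.
  have bnd j : (m < j < N)%N && (x \in tower j) -> (j <= N)%N.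
  by move=> /andP[/andP[_ /ltnW]].
  case: (ex_maxnP exk bnd) => k Pk mx; exists k => // j mj xj; apply: mx.
  by rewrite mj.
 move: kP => /andP[/andP[mk kN]]; rewrite inE => -[[c [s [s0 sr xs h]]] xx].
 have xx2 : b x0 (2 * r1) x.
  apply: (bsub ds) xx; rewrite rxx add0r ler_pM2r//; exact: le1t.
 exists c, s; split => //.
  exact: towc_small ci mk xz xx2 s0 sr xs h.
 apply: leT (ltW h); rewrite leF ler_pM2r ?(vgt0 ds)//.
 rewrite lepdM// mulrC; apply: leT (sum_level_le m.+1 k).
 have mk' : (m < k.+1)%N by exact: leqW.
 rewrite /Phi (big_cat_nat (n := k.+1))//=.
 rewrite [X in _ + X]big_nat [X in _ + X]big1 ?addr0.
  apply: ler_sum => j _; rewrite indicE; case: (x \in _); rewrite ?mulr1 ?mulr0//.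
  exact/ltW/lev_gt0.
 move=> j /andP[kj jN]; rewrite indicE; case: (boolP (x \in tower j)) => [xj|_]; last by rewrite mulr0.
 have := kmax j; rewrite jN (leq_trans mk (ltnW kj)) => /(_ erefl xj).
 by rewrite leqNgt kj.
have -> : (\int[mu]_(x in b (z i).1 (5 * (z i).2)) (Phi x / 2)%:E =
 (2^-1)%:E * \int[mu]_(x in b (z i).1 (5 * (z i).2)) (Phi x)%:E)%E.
 by rewrite -intZ//; apply: eqint => x _; rewrite mulrC.
rewrite lee_pdivrMl// => /leT; apply.
rewrite muleA -EFinM.
apply: (leU ((2 * A)%:E * ((level m * D ^+ th)%:E * mu (b (z i).1 (z i).2)))%E).
 apply: leMl; first by rewrite leF mge0.
 by apply: core_dil => //; clear -th3; lia.
rewrite !muleA; apply: leMr => //; rewrite leF.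
by apply: eqW; ring.
Qed.

Lemma mutow_fin k : mu (tower k) = (fine (mu (tower k)))%:E.
rewrite fineK// ge0fin//; apply: leltT (muB_lty ds x0 ((1 + 2 ^- k) * r1)).
by apply: lemu; rewrite ?inE//; [exact: mtower|move=> x []].
Qed.

Lemma tower0_le : level 0 * fine (mu (tower 0)) <= D ^+ (th + 5) * W0.
have v0 := vgt0 ds x0 r10.
have : fine (mu (tower 0)) <= D * vol x0 r1.
 apply: (leU (vol x0 (2 ^+ 1 * r1))); last first.
  by apply: leT (dbl_iter ds 1 x0 r10) _.
 rewrite -leF -mutow_fin -(mu_ball ds) ?expr1 ?mgt0//.
 apply: lemu; rewrite ?inE//; first exact: mtower.
 by move=> x [_]; rewrite invr1.
move=> h; rewrite /level mul1r /level0.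
have -> : D ^+ (th + 5) * W0 = D ^+ (th + 4) * W0 / vol x0 r1 * (D * vol x0 r1).
 by rewrite (addnS th 4) exprS; field; lra.
rewrite ler_pM2l// dgt0// mgt0// xgt0//.
Qed.

Lemma tower_lev_ex Cl y : 1 <= Cl -> Cl * level 0 < y ->
 exists k, Cl * level k < y <= Cl * level k.+1.
move=> Cl1 hy; have l0 := lev_gt0 0.
have exP : exists k, y <= Cl * level k.
 exists (Num.truncn (y / level 0)).
 apply: (leU (level (Num.truncn (y / level 0)))); last first.
  by rewrite ler_peMl// ltW// lev_gt0.
 have -> k : level k = D ^+ (7 * k) * level 0 by rewrite /level mul1r.
 rewrite -lepdM//; set n := Num.truncn _.
 apply: (leU n.+1%:R); first by rewrite ltW// truncnS_gt.
 apply: (leU (2 ^+ n)); first by rewrite -natrX ler_nat ltn_expl.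
 apply: (leU (D ^+ n)); first by rewrite lerXn2r ?nnegrE ?(ltW D0)//; exact: dsC ds.
 by rewrite ler_weXn2l ?leq_pmull//; have := dsC ds; lra.
case: (ex_minnP exP) => -[|k]; first lra.
move=> Pk kmin; exists k; rewrite Pk andbT ltNge; apply/negP => /kmin.
by rewrite ltnn.
Qed.

(* If [E] occupying half of a ball carries a fixed fraction of its weight, the weight of
 the tower decreases fast enough for [sum_k level k * mu (tower k)] to telescope. *)
Definition half_mass (c0 : R) : Prop := forall c s, 0 < s -> forall E, measurable E ->
 E `<=` b c s -> ((vol c s / 2)%:E <= mu E)%E ->
 (c0%:E * \int[mu]_(x in b c (2 ^+ 3 * s)) (w x)%:E <= \int[mu]_(x in E) (w x)%:E)%E.

(** In a stopping ball the next tower has measure at most [D^6 / D^7] of the volume by the weak type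
    bound, hence at most half; the remaining part [E] carries the fraction [c0] of the weight. The
    constant [D^10] combines the ratio of levels [D^7] with the volume [D^3] of the 5-dilate. *)
Lemma tower_step c0 k : 0 < c0 -> half_mass c0 ->
 ((level k.+1)%:E * mu (tower k.+1) +
  (D ^+ 10 / c0)%:E * \int[mu]_(x in tower k.+1) (w x)%:E <=
  (D ^+ 10 / c0)%:E * \int[mu]_(x in tower k) (w x)%:E)%E.
move=> c00 hm; have [z [zc zt zcov]] := tower_cover k.
have D10 : 0 <= D ^+ 10 / c0 by rewrite dge0 ?xge0 ?ltW.
have mt := mtower.
have sub : tower k.+1 `<=` tower k.
 by move=> x /tower_sub[? ?]; split => //; apply: towr_anti (leqnSn k) _ _.
have -> : (\int[mu]_(x in tower k) (w x)%:E = \int[mu]_(x in tower k.+1) (w x)%:E +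
  \int[mu]_(x in tower k `\` tower k.+1) (w x)%:E)%E.
 rewrite -ge0_integral_setU//.
 - by rewrite setDUK.
 - exact: measurableD.
 - by apply: mEFin.
 - by move=> x _; rewrite leF.
 - by apply/eqP/seteqP; split => // x [? []].
have wi A : (0 <= \int[mu]_(x in A) (w x)%:E)%E by apply: intge0 => x _; rewrite leF.
rewrite [leRHS](ge0_muleDr _ (wi _) (wi _)) addeC; apply: leeD => //.
pose E i := b (z i).1 (z i).2 `\` tower k.+1.
have mE i : measurable (E i) by exact: measurableD.
have half i : tower_core k (z i) -> ((vol (z i).1 (z i).2 / 2)%:E <= mu (E i))%E.
 move=> ci; have [z0 zr zt' _ _] := ci.
 pose g x := w x * \1_(b (z i).1 (7 * (z i).2)) x.
 have mg : mfun g by exact: mMindic.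
 have g0 x : 0 <= g x by rewrite mge0.
 have subO : b (z i).1 (z i).2 `&` tower k.+1 `<=` om_cap r1 g (level k.+1).
  move=> x [xz [[c [s [s0 sr xs h]]] xx]]; exists c, s; split => //.
  have xx2 : b x0 (2 * r1) x.
  apply: (bsub ds) xx; rewrite rxx add0r ler_pM2r//; exact: le1t.
  have x5 : b (z i).1 (5 * (z i).2) x by move: xz; rewrite /qball /=; lra.
  have := towc_small ci (ltnSn k) x5 xx2 s0 sr xs h => /setIidPl h7.
  by rewrite int_indic// h7.
 have mI : measurable (b (z i).1 (z i).2 `&` tower k.+1) by exact: measurableI.
 have : ((level k.+1)%:E * mu (b (z i).1 (z i).2 `&` tower k.+1) <=
  (D ^+ 6 * level k)%:E * mu (b (z i).1 (z i).2))%E.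
  apply: (leU ((level k.+1)%:E * mu (om_cap r1 g (level k.+1)))%E).
  rewrite lee_pmul2l ?lte_fin ?lev_gt0//; apply: lemu; rewrite ?inE//.
  exact: momega_cap ds _ _ _.
  apply: (leT (weak_type_cap ds r1 (lev_gt0 k.+1) mg g0)).
  rewrite int_indic// setTI.
  apply: (leU ((D ^+ 3)%:E * ((level k * D ^+ 3)%:E * mu (b (z i).1 (z i).2)))%E).
  apply: leMl; first by rewrite leF xge0// ltW.
  apply: leT (core_dil ci (isT : (1 <= 3)%N) th3).
  by apply: isub => //; apply: (bsub ds); rewrite rxx add0r; lra.
  rewrite muleA; apply: leMr => //; rewrite leF.
  lra.
 rewrite levelS (mu_ball ds)//.
 set mI' := fine (mu (b (z i).1 (z i).2 `&` tower k.+1)).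
 have mIE : mu (b (z i).1 (z i).2 `&` tower k.+1) = mI'%:E.
  rewrite fineK// ge0fin//; apply: leltT (muB_lty ds (z i).1 (z i).2).
  by apply: lemu; rewrite ?inE//; move=> x [].
 rewrite mIE => hI.
 have hI2 : mI' <= vol (z i).1 (z i).2 / 2.
  move: hI; rewrite leF.
  have l0 := lev_gt0 k; have D6 : 0 < D ^+ 6 by rewrite xgt0.
  have -> : D ^+ 7 * level k * mI' = (D ^+ 6 * level k) * (D * mI') by lra.
  rewrite ler_pM2l ?(mgt0 D6 l0)// => DI.
  have I0 : 0 <= mI' by exact: fine_ge0.
  by have := dsC ds; nra.
 have : mu (b (z i).1 (z i).2) = (mI'%:E + mu (E i))%E.
  by rewrite -mIE addeC -measureDI.
 rewrite (mu_ball ds)// => vE.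
 rewrite -(@leeD2lE _ mI'%:E)// -vE leF; lra.
apply: (leU ((D ^+ 10 / c0)%:E * \sum_(0 <= i <oo) \int[mu]_(x in E i) (w x)%:E)%E).
 have l0 : 0 < level k.+1 by exact: lev_gt0.
 apply: (leU ((level k.+1)%:E * \sum_(0 <= i <oo) mu (b (z i).1 (5 * (z i).2)))%E).
  rewrite lee_pmul2l //; apply: measure_sigma_subadditive => //.
  by move=> x /tower_sub; exact: zcov.
 rewrite -!nneseriesZl//.
 apply: lesers => [i _ _|i _]; first by rewrite mule_ge0// ltW.
 case: (zc i) => [zi|ci].
  by rewrite zi (ball_le0 ds)// measure0 mule0 mule_ge0 ?leF.
 have [z0 _ _ wl _] := ci.
 have Ei : E i `<=` b (z i).1 (z i).2 by move=> x [].
 have := hm (z i).1 (z i).2 z0 (E i) (mE i) Ei (half i ci).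
 rewrite -lee_pdivlMl// => hmi.
 rewrite (EFinM (D ^+ 10)) -[leRHS]muleA; apply: (leU ((D ^+ 10)%:E *
  \int[mu]_(x in b (z i).1 (2 ^+ 3 * (z i).2)) (w x)%:E)%E); last first.
  by apply: leMl => //; rewrite leF xge0// ltW.
 apply: (leU ((D ^+ 10)%:E * \int[mu]_(x in b (z i).1 (z i).2) (w x)%:E)%E); last first.
  apply: leMl; first by rewrite leF xge0// ltW.
  by apply: isub => //; apply: (bsub ds); rewrite rxx add0r ?ltW//; lra.
 apply: leT (leMl _ (ltW wl)); last by rewrite leF xge0// ltW.
 rewrite (mu_ball ds) ?mgt0// leF levelS.
 have -> : D ^+ 10 * (level k * vol (z i).1 (z i).2) =
  D ^+ 7 * level k * (D ^+ 3 * vol (z i).1 (z i).2) by lra.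
 rewrite ler_pM2l; last by apply: mgt0; [exact: xgt0|exact: lev_gt0].
 by apply: (vol_le ds); rewrite ?mgt0// rxx add0r; lra.
apply: leMl => //.
apply: int_disj_le => //.
- apply/trivIsetP => i j _ _ ij; move/trivIsetP : zt => /(_ i j I I ij).
 rewrite -!subset0 => h x [[x1 _] [x2 _]]; exact: h.
- exact: measurableD.
- move=> i x [xz xt]; split => //.
 case: (zc i) => [zi|[_ _ h _ _]]; last exact: h.
 by move: xz; rewrite zi (ball_le0 ds).
Qed.

Lemma tower_sum c0 N : 0 < c0 -> half_mass c0 ->
 (\sum_(0 <= k < N) (level k.+1)%:E * mu (tower k.+1) <= (D ^+ 10 / c0 * W0)%:E)%E.
move=> c00 hm; have D10 : 0 <= D ^+ 10 / c0 by rewrite dge0 ?xge0 ?ltW.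
suff : (\sum_(0 <= k < N) (level k.+1)%:E * mu (tower k.+1) +
  (D ^+ 10 / c0)%:E * \int[mu]_(x in tower N) (w x)%:E <=
  (D ^+ 10 / c0)%:E * \int[mu]_(x in tower 0) (w x)%:E)%E.
 move=> h; apply: (leU ((D ^+ 10 / c0)%:E * \int[mu]_(x in tower 0) (w x)%:E)%E).
  apply: leT h; rewrite leeDl// mule_ge0//; apply: intge0 => x _; by rewrite leF.
 rewrite (EFinM (D ^+ 10 / c0)) -wW0; apply: leMl => //; apply: isub => //.
  exact: mtower.
 have r4 : (1 + 2 ^- 0) * r1 <= 4 * r1 by rewrite ler_pM2r//; lra.
 by move=> x [_]; apply: (bsub ds); rewrite rxx add0r.
elim: N => [|N ih]; first by rewrite big_geq// add0e.
rewrite big_nat_recr//= -addeA; apply: leT ih; apply: leeD => //.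
exact: tower_step.
Qed.

(** [Psi] adds up the levels passed by the local maximal function of [w]. Its integral is controlled
    by [half_mass] alone, so this gives a finite Fujii-Wilson constant to weights whose A_infinity
    characteristic is not yet known to be finite. *)
Lemma local_maximal_majorant c0 : 0 < c0 -> half_mass c0 ->
 exists2 Psi : X -> \bar R, mfun Psi &
  [/\ forall x, (0 <= Psi x)%E,
  forall x c s, b x0 r1 x -> 0 < s -> s <= r1 -> b c s x ->
  (\int[mu]_(y in b c s) (w y)%:E <= Psi x * (vol c s)%:E)%E &
  (\int[mu]_(x in b x0 r1) Psi x <=
  ((D ^+ (th + 4) + D ^+ (th + 12) + D ^+ 17 / c0) * W0)%:E)%E].
move=> c00 hm.
have mt := mtower; have lg := lev_gt0.
pose T k x : \bar R := (level k.+1 * \1_(tower k) x)%:E.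
have T0 k x : (0 <= T k x)%E by rewrite leF mge0// ltW.
have mT k : mfun (T k).
 by apply: mEFin; apply: mfM => //.
have mS : mfun (fun x => \sum_(0 <= k <oo) T k x)%E.
 by apply: ge0_emeasurable_sum => // k x _.
exists (fun x => (level 0)%:E + \sum_(0 <= k <oo) T k x)%E.
 by apply: emeasurable_funD.
have S0 x : (0 <= \sum_(0 <= k <oo) T k x)%E by exact: nneseries_ge0.
split.
- by move=> x; rewrite adde_ge0// leF ltW.
- move=> x c s xx s0 sr xs.
 have vs := vgt0 ds c s0.
 have ifin : (\int[mu]_(y in b c s) (w y)%:E <= W0%:E)%E.
  rewrite -wW0; apply: isub => //; apply: (bsub ds).
  move: xx xs; rewrite /qball /= => xx xs.
  by have := rtri x x0 c; rewrite (rsym x c) (rsym c x0); lra.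
 have iE : (\int[mu]_(y in b c s) (w y)%:E)%E =
  (fine (\int[mu]_(y in b c s) (w y)%:E))%:E.
  rewrite fineK// ge0fin; first exact: leltT ifin (ltry _).
  by apply: intge0 => y _; rewrite leF.
 set I := fine _ in iE.
 have [le0|gt0] := leP (I / vol c s) (1 * level 0).
  rewrite iE; apply: (leU ((level 0)%:E * (vol c s)%:E)%E).
  by rewrite leF -lepdM// -[level 0]mul1r.
  by apply: leMr; [rewrite ltW|rewrite leeDl].
 have [//|k /andP[k1 k2]] := tower_lev_ex _ gt0.
 rewrite !mul1r in k1 k2.
 have xk : tower k x.
  split; last first.
  apply: (bsub ds) xx; rewrite rxx add0r ler_peMl ?(ltW r10)//.
  by rewrite lerDl ige0.
  by exists c, s; split => //; rewrite iE lte_fin -ltr_pdivlMr.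
 rewrite iE; apply: (leU (T k x * (vol c s)%:E)%E).
  by rewrite /T indicE mem_set// mulr1 leF -lepdM.
 apply: leMr; first by rewrite ltW.
 apply: (leT (nnes_ge k (T0 ^~ x))).
 by rewrite leeDr// leF ltW.
- rewrite ge0_integralD//; last 2 first.
  by move=> x _; rewrite leF ltW.
  exact: measurable_funTS.
 rewrite (_ : (_ + _ + _) * W0 = D ^+ (th + 4) * W0 +
  (D ^+ (th + 12) + D ^+ 17 / c0) * W0); last by ring.
 rewrite (EFinD (D ^+ (th + 4) * W0)); apply: leeD.
  rewrite int_cst// (mu_ball ds)// leF /level mul1r /level0.
  by rewrite divfK// gtF// (vgt0 ds).
 apply: (leU (\int[mu]_x (\sum_(0 <= k <oo) T k x))%E).
  by apply: ge0_subset_integral.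
 rewrite integral_nneseries//.
 apply: lime_le; first by apply: is_cvg_nneseries => k _ _; apply: intge0.
 apply: nearW => N; have TE k : (\int[mu]_x T k x = (level k.+1)%:E * mu (tower k))%E.
  rewrite intZ//; last by rewrite ltW.
  by rewrite intindic ?setIT.
 under eq_bigr do rewrite TE.
 case: N => [|N].
  by rewrite big_geq// leF mge0 ?(ltW W00)// age0 ?dge0 ?xge0 // ltW.
 rewrite big_nat_recl//= mulrDl EFinD; apply: leeD.
  rewrite levelS mutow_fin leF.
  have -> : D ^+ (th + 12) * W0 = D ^+ 7 * (D ^+ (th + 5) * W0).
  by rewrite mulrA -exprD; congr (D ^+ _ * _); clear; lia.
  by rewrite -mulrA ler_pM2l ?xgt0// tower0_le.
 apply: (leU ((D ^+ 7)%:E *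
  \sum_(0 <= k < N) (level k.+1)%:E * mu (tower k.+1))%E).
  rewrite ge0_sume_distrr; last by move=> k _; rewrite mule_ge0// leF ltW.
  by apply: lee_sum => k _; rewrite levelS muleA.
 apply: leT (leMl _ (tower_sum N c00 hm)) _; first by rewrite leF xge0// ltW.
 by rewrite -EFinM leF; apply: eqW; ring.
Qed.

(** Between two consecutive levels [w^e] is comparable to [q^k]. Writing [q^k] through its
    increments brings a factor [q - 1] of order [1/L], which cancels the factor [1 + L] of
    [tail_geometric_sum]. The resulting constant is free of [A], which enters only through the
    exponent. *)
Lemma rev_hold Cl A : 1 <= Cl -> 1 <= A ->
 leb_upto Cl w -> fwilson th A w ->
 (\int[mu]_(x in b x0 r1) (w x `^ (1 + rh_exp th A))%:E <=
  (2 * Cl * (1 + 2 * D ^+ (th + 8)) * (level0 `^ rh_exp th A * W0))%:E)%E.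
move=> Cl1 A1 leb fw; rewrite /rh_exp; set L := 2 * A * D ^+ th; set e := ln _ / _.
have mt := mtower; have lg := lev_gt0.
have D1 : 1 <= D by have := dsC ds; lra.
have Dth : 1 <= D ^+ th by exact: exprn_ege1.
have L1 : 1 <= L by rewrite /L; nra.
(* [rh_exp] is defined so that [(D^7)^e = q]: one level up multiplies [level^e] by exactly the ratio
   that [tail_geometric_sum] tolerates. *)
pose q := 1 + (2 * L)^-1.
have q1 : 1 < q by rewrite ltrDl igt0; lra.
have q2 : q <= 2.
 rewrite -lerBrDl (_ : 2 - 1 = 1 :> R); last by lra.
 by rewrite invf_le1; lra.
have q0 : 0 <= q := ltW (lt_trans ltr01 q1).
have qm0 : 0 <= q - 1 by lra.
have D7 : 1 < D ^+ 7.
 by apply: (@ltleT _ _ D); [have := dsC ds; lra|rewrite ler_eXnr].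
have lD : 0 < ln (D ^+ 7) by rewrite ln_gt0.
have e0 : 0 < e by rewrite dgt0// ln_gt0.
have D70 : 0 < D ^+ 7 by lra.
have De : (D ^+ 7) `^ e = q.
 by rewrite /powR divfK ?gtF// lnK// posrE; exact: lt_trans ltr01 q1.
have e1 : e <= 1.
 rewrite lepdM// mul1r ler_ln; [|exact: lt_trans ltr01 q1|exact: D70].
 apply: (leT q2); apply: (leU D); first exact: dsC ds.
 by rewrite ler_eXnr.
have le_pow k : level k `^ e = q ^+ k * level0 `^ e.
 have l00 : 0 <= level0 by have := lg 0%N; rewrite /level mul1r; exact: ltW.
 rewrite /level exprM (powRM e (xge0 k (ltW D70)) l00); congr (_ * _).
 by rewrite -(powR_mulrn k (ltW D70)) powRAC De powR_mulrn// (lt_trans ltr01).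
have geo k : q ^+ k = 1 + (q - 1) * \sum_(0 <= m < k) q ^+ m.
 elim: k => [|k ih]; first by rewrite big_geq// mulr0 addr0.
 by rewrite big_nat_recr//= mulrDr addrA -ih exprS; ring.
pose K := Cl * level0 `^ e * q.
have K0 : 0 <= K.
 by apply: mge0 q0; apply: mge0; [lra|exact: pge0].
pose T j x : \bar R := (K * (q - 1) * q ^+ j * (w x * \1_(tower j.+1) x))%:E.
have c0 j : 0 <= K * (q - 1) * q ^+ j.
 exact: mge0 (mge0 K0 qm0) (xge0 j q0).
have T0 j x : (0 <= T j x)%E by rewrite leF mge0// mge0.
have mT j : mfun (T j).
 apply: mEFin; apply: mfM => //.
 exact: mMindic.
have mS : mfun (fun x => \sum_(0 <= k <oo) T k x)%E.
 by apply: ge0_emeasurable_sum => // k x _.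
have S0 x : (0 <= \sum_(0 <= k <oo) T k x)%E by exact: nneseries_ge0.
have we0 x : 0 <= K * w x by rewrite mge0.
have mKw : mfun (fun x => K * w x) by apply: mfM.
have mwe : mfun (fun x => w x `^ (1 + e)) by exact: mpowR.
apply: (leU (\int[mu]_(x in b x0 r1)
  ((K * w x)%:E + \sum_(0 <= k <oo) T k x))%E).
 apply: ae_ge0_le_integral => //.
 - by move=> x _; rewrite leF pge0.
 - exact: mEFin.
 - by move=> x _; rewrite adde_ge0 ?leF.
 - by apply: emeasurable_funD; [exact: mEFin|exact: measurable_funTS].
 apply: filterS leb => x lebx xx.
 have wE : w x `^ (1 + e) = w x `^ e * w x.
  rewrite (powRM_pred (w0 x)); last lra.
  by rewrite mulrC; congr (_ `^ _ * _); lra.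
 have Cle : Cl `^ e <= Cl.
  by rewrite -[leRHS]powRr1; [rewrite ler_powR|lra].
 have [le0|gt0] := leP (w x) (Cl * level 0).
  apply: (leU (K * w x)%:E); last by rewrite leeDl.
  rewrite leF wE wMr//.
  apply: (leU ((Cl * level 0) `^ e)).
  apply: ge0_ler_powR; rewrite ?nnegrE//; first exact: ltW.
  by rewrite mge0 ?ltW//; lra.
  rewrite powRM ?(ltW (lg 0%N))//; last lra.
  rewrite le_pow mul1r /K -[leLHS]mulr1.
  apply: ler_pM => //; [|by rewrite wMr ?pge0|exact: ltW].
  by rewrite mge0 ?pge0.
 have [k /andP[k1 k2]] := tower_lev_ex Cl1 gt0.
 have up : w x `^ e <= K * q ^+ k.
  apply: (leU ((Cl * level k.+1) `^ e)).
  apply: ge0_ler_powR; rewrite ?nnegrE//; first exact: ltW.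
  by rewrite mge0 ?ltW//; lra.
  rewrite powRM ?(ltW (lg _))//; last lra.
  rewrite le_pow /K exprS.
  have -> : Cl * level0 `^ e * q * q ^+ k = Cl * (q * q ^+ k * level0 `^ e) by lra.
  apply: wMr => //; apply: mge0 (pge0 _ _); exact: mge0 q0 (xge0 k q0).
 apply: (leU (K * q ^+ k * w x)%:E).
  by rewrite leF wE wMr.
 rewrite geo mulrDr mulr1 mulrDl EFinD; apply: leeD => //.
 apply: (leU (\sum_(0 <= j < k) T j x)%E); last exact: nneseries_lim_ge.
 rewrite sumEFin leF mulrA mulr_sumr mulr_suml !big_nat.
 apply: ler_sum => j /andP[_ jk].
 (* By the differentiation property a point with [w x > Cl * level k] lies in every tower of index
    at most [k], as long as it stays in the inner ball of radius [r1]. *)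
 suff xj : tower j.+1 x by rewrite indicE mem_set// mulr1.
 split; last first.
  apply: (bsub ds) xx; rewrite rxx add0r ler_peMl ?(ltW r10)//.
  by rewrite lerDl ige0.
 apply: lebx => //; apply: leltT k1; rewrite ler_pM2l; last lra.
 exact: level_le.
rewrite ge0_integralD//; last 3 first.
- by move=> x _; rewrite leF.
- exact: mEFin.
- exact: measurable_funTS.
pose u k := level k * fine (mu (tower k)).
have u0 k : 0 <= u k by rewrite mge0 // ltW.
have uL m N : \sum_(m.+1 <= k < N) u k <= L * u m.
 have := @tower_tail A m N ltac:(lra) fw.
 under eq_bigr do rewrite mutow_fin -EFinM.
 by rewrite sumEFin mutow_fin leF.
have U N := tail_geometric_sum L1 u0 uL N; rewrite -/q in U.
have u00 : u 0%N <= D ^+ (th + 5) * W0 by exact: tower0_le.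
apply: (leU ((K * W0)%:E + (K * (2 * D ^+ (th + 8)) * W0)%:E)%E); last first.
 rewrite leF.
 have -> : K * W0 + K * (2 * D ^+ (th + 8)) * W0 =
  q * (Cl * (1 + 2 * D ^+ (th + 8)) * (level0 `^ e * W0)) by rewrite /K; ring.
 have -> : 2 * Cl * (1 + 2 * D ^+ (th + 8)) * (level0 `^ e * W0) =
  2 * (Cl * (1 + 2 * D ^+ (th + 8)) * (level0 `^ e * W0)) by lra.
 apply: wMr => //; apply: mge0; last by rewrite mge0 ?pge0// ltW.
 apply: mge0; first lra.
 by rewrite age0// mge0// xge0// ltW.
apply: leeD.
 rewrite intZ// (EFinM K) -wW0; apply: leMl => //.
 by apply: isub => //; apply: (bsub ds); rewrite rxx add0r ler_peMl ?ler1n ?(ltW r10).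
apply: (leU (\int[mu]_x (\sum_(0 <= k <oo) T k x))%E).
 by apply: ge0_subset_integral.
rewrite integral_nneseries//.
apply: lime_le; first by apply: is_cvg_nneseries => k _ _; apply: intge0.
apply: nearW => N.
apply: (leU (\sum_(0 <= k < N) (K * (q - 1) * D ^+ 3 * (q ^+ k * u k))%:E)%E).
 apply: lee_sum => k _; rewrite intZ//; last 2 first.
  exact: mMindic.
  by move=> x; rewrite mge0.
 rewrite int_indic// setTI.
 apply: leT (leMl _ (tower_weight k)) _; first by rewrite leF.
 rewrite mutow_fin leF /u; apply: eqW; ring.
rewrite sumEFin leF -mulr_sumr.
have Kq0 : 0 <= K * (q - 1) * D ^+ 3 by exact: mge0 (mge0 K0 qm0) (xge0 3 (ltW D0)).
apply: leT (wMl Kq0 (U N)) _.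
have qL : (q - 1) * (2 * (1 + L)) <= 2.
 rewrite addrC addKr ler_pdivrMl; lra.
apply: (leU (K * D ^+ 3 * (2 * (D ^+ (th + 5) * W0)))).
 have -> : K * (q - 1) * D ^+ 3 * (2 * (1 + L) * u 0%N) =
  K * D ^+ 3 * ((q - 1) * (2 * (1 + L)) * u 0%N) by lra.
 apply: wMl; first by rewrite mge0 ?xge0 ?(ltW D0).
 apply: ler_pM => //; apply: mge0; lra.
have -> : (th + 8 = 3 + (th + 5))%N by clear; lia.
by rewrite (exprD D 3); apply: eqW; ring.
Qed.

End tower.
End rev_hold.

(** * Euclidean norms, the spectral theorem and real powers of matrices *)

Section euclidean.
Context {R : realType}.

Lemma cauchy_schwarz n (a c : 'I_n -> R) :
 (\sum_i a i * c i) ^+ 2 <= (\sum_i a i ^+ 2) * (\sum_i c i ^+ 2).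
set A := \sum_i a i ^+ 2; set C := \sum_i c i ^+ 2; set B := \sum_i a i * c i.
have C0 : 0 <= C by apply: sge0 => i _; exact: sqr_ge0.
have quad s t : 0 <= s ^+ 2 * A + 2 * s * t * B + t ^+ 2 * C.
 have -> : s ^+ 2 * A + 2 * s * t * B + t ^+ 2 * C = \sum_i (s * a i + t * c i) ^+ 2.
  rewrite !mulr_sumr -!big_split /=; apply: eq_bigr => i _; ring.
 by apply: sge0 => i _; exact: sqr_ge0.
have [CE|C1] := eqVneq C 0.
 have BE : B = 0.
  apply: big1 => i _; have /eqP := CE; rewrite psumr_eq0; last by move=> j _; exact: sqr_ge0.
  by move/allP => /(_ i (mem_index_enum _)); rewrite sqrf_eq0 => /eqP ->; rewrite mulr0.
 by rewrite BE CE mulr0 expr0n.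
have Cp : 0 < C by lra.
have := quad C (- B).
have -> : C ^+ 2 * A + 2 * C * - B * B + (- B) ^+ 2 * C = C * (A * C - B ^+ 2) by lra.
by rewrite pmulr_rge0// subr_ge0.
Qed.

Variable n : nat.
Implicit Types (u v : 'cV[R]_n) (A B : 'M[R]_n).

Lemma en_ge0 v : 0 <= enorm v. Proof. exact: sqrtr_ge0. Qed.

Lemma en_sqr v : enorm v ^+ 2 = \sum_i v i 0 ^+ 2.
by rewrite /enorm sqr_sqrtr// sge0// => i _; exact: sqr_ge0. Qed.

Lemma en_sqr_mx v : enorm v ^+ 2 = (v^T *m v) 0 0.
by rewrite en_sqr mxE; apply: eq_bigr => i _; rewrite mxE expr2. Qed.

Lemma enorm0 : enorm (0 : 'cV[R]_n) = 0.
by rewrite /enorm big1 ?sqrtr0// => i _; rewrite mxE expr0n. Qed.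

Lemma enorm_eq0 v : enorm v = 0 -> v = 0.
move=> v0; have /eqP := en_sqr v; rewrite v0 expr0n /= eq_sym psumr_eq0; last by move=> i _; exact: sqr_ge0.
move=> /allP h; apply/colP => i; rewrite mxE; apply/eqP.
by have := h i (mem_index_enum _); rewrite sqrf_eq0.
Qed.

Lemma en_gt0 v : v != 0 -> 0 < enorm v.
move=> v0; rewrite lt_neqAle en_ge0 andbT eq_sym; apply: contra v0 => /eqP.
by move=> /enorm_eq0 ->.
Qed.

Lemma enormZ (c : R) v : enorm (c *: v) = `|c| * enorm v.
rewrite -sqrtr_sqr -sqrtrM ?sqr_ge0//; congr Num.sqrt.
by rewrite mulr_sumr; apply: eq_bigr => i _; rewrite mxE exprMn.
Qed.

Lemma enormN v : enorm (- v) = enorm v.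
by rewrite -scaleN1r enormZ normrN1 mul1r. Qed.

Lemma en_tri u v : enorm (u + v) <= enorm u + enorm v.
rewrite -(@ler_pXn2r _ 2) ?nnegrE ?age0 ?en_ge0//.
have := cauchy_schwarz (fun i => u i 0) (fun i => v i 0); rewrite -!en_sqr -exprMn => cs.
have uv : \sum_i u i 0 * v i 0 <= enorm u * enorm v.
 apply: leT (ler_norm _) _.
 by rewrite -(@ler_pXn2r _ 2) ?nnegrE ?mge0 ?en_ge0// real_normK ?num_real.
have -> : enorm (u + v) ^+ 2 = enorm u ^+ 2 + 2 * (\sum_i u i 0 * v i 0) + enorm v ^+ 2.
 by rewrite !en_sqr mulr_sumr -!big_split /=; apply: eq_bigr => i _; rewrite mxE; ring.
by rewrite sqrrD mulr2n; lra.
Qed.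

Lemma coord_le v i : `|v i 0| <= enorm v.
rewrite -(@ler_pXn2r _ 2) ?nnegrE ?en_ge0// real_normK ?num_real// en_sqr.
by rewrite (bigD1 i)//= lerDl sge0// => j _; exact: sqr_ge0.
Qed.

Lemma en_le_sum v : enorm v <= \sum_i `|v i 0|.
have s0 : 0 <= \sum_i `|v i 0| by exact: sge0.
rewrite -(@ler_pXn2r _ 2) ?nnegrE ?en_ge0// en_sqr expr2 mulr_suml.
apply: ler_sum => i _; rewrite -real_normK ?num_real// wMl//.
by rewrite (bigD1 i)//= lerDl sge0.
Qed.

Lemma orth_comm (O : 'M[R]_n) : O^T *m O = 1%:M -> O *m O^T = 1%:M.
exact: mulmx1C. Qed.

Lemma en_orth (O : 'M[R]_n) v : O^T *m O = 1%:M -> enorm (O *m v) = enorm v.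
move=> OO; apply/eqP; rewrite -(@eqrXn2 _ 2) ?en_ge0//; apply/eqP.
by rewrite !en_sqr_mx trmx_mul mulmxA -(mulmxA v^T) OO mulmx1.
Qed.

Lemma mulmx_en_le A v : enorm (A *m v) <= (\sum_i \sum_j `|A i j|) * enorm v.
apply: leT (en_le_sum _) _; rewrite mulr_suml; apply: ler_sum => i _.
rewrite mxE; apply: leT (ler_norm_sum _ _ _) _; rewrite mulr_suml.
by apply: ler_sum => j _; rewrite normrM wMl// coord_le.
Qed.

Let opset A := [set enorm (A *m v) | v in [set v | enorm v <= 1]].

Let opset_sup A : has_sup (opset A).
split; first by exists (enorm (A *m 0)), 0 => //=; rewrite enorm0.
exists (\sum_i \sum_j `|A i j|) => _ [v /= v1 <-].
apply: leT (mulmx_en_le _ _) _; rewrite ler_piMr// sge0// => i _.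
exact: sge0.
Qed.

Lemma on_ge0 A : 0 <= opnorm A.
apply: (leU (enorm (A *m 0))); first exact: en_ge0.
by apply: (supub (opset_sup A)); exists 0 => //=; rewrite enorm0.
Qed.

Lemma on_bound A v : enorm (A *m v) <= opnorm A * enorm v.
have [->|v0] := eqVneq v 0; first by rewrite mulmx0 enorm0 mulr0.
have vp := en_gt0 v0.
rewrite -lepdM// mulrC -[X in X * _](@ger0_norm _ (enorm v)^-1) ?ige0 ?en_ge0//.
rewrite -enormZ scalemxAr; apply: (supub (opset_sup A)).
exists ((enorm v)^-1 *: v) => //=.
by rewrite enormZ ger0_norm ?ige0 ?en_ge0// mulVf// gtF.
Qed.

Lemma opnorm_le A (c : R) : 0 <= c -> (forall v, enorm (A *m v) <= c * enorm v) -> opnorm A <= c.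
move=> c0 h; apply: ge_sup; first exact: (opset_sup A).1.
move=> _ [v /= v1 <-]; apply: leT (h v) _; by rewrite ler_piMr.
Qed.

Lemma on_le_entries A : opnorm A <= \sum_i \sum_j `|A i j|.
apply: opnorm_le; last exact: mulmx_en_le.
by apply: sge0 => i _; exact: sge0.
Qed.

Lemma en_delta i : enorm (dmx i 0 : 'cV[R]_n) = 1.
rewrite /enorm (bigD1 i)//= big1 ?addr0 => [|j ji].
 by rewrite mxE !eqxx expr1n sqrtr1.
by rewrite mxE (negPf ji) expr0n.
Qed.

Lemma col_le_on A j : enorm (A *m dmx j 0) <= opnorm A.
by apply: leT (on_bound _ _) _; rewrite en_delta mulr1. Qed.

Lemma entry_le_col A i j : `|A i j| <= enorm (A *m dmx j 0).
apply: leT (coord_le _ i); rewrite -colE mxE; exact: lexx.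
Qed.

Lemma entry_le_on A i j : `|A i j| <= opnorm A.
exact: leT (entry_le_col A i j) (col_le_on A j). Qed.

Lemma on_le_cols A : opnorm A <= \sum_j enorm (A *m dmx j 0).
apply: opnorm_le; first by apply: sge0 => j _; exact: en_ge0.
move=> v; have -> : A *m v = \sum_j v j 0 *: (A *m dmx j 0).
 rewrite {1}(_ : v = \sum_j v j 0 *: dmx j 0).
  by rewrite mulmx_sumr; apply: eq_bigr => j _; rewrite scalemxAr.
 by rewrite [LHS]matrix_sum_delta; apply: eq_bigr => j _; rewrite big_ord1.
rewrite mulr_suml; apply: (leU (\sum_j enorm (v j 0 *: (A *m dmx j 0)))).
 elim/big_ind2: _ => [|x1 x2 y1 y2 h1 h2|j _]; rewrite ?enorm0//.
 by apply: leT (en_tri _ _) _; exact: lerD.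
apply: ler_sum => j _; rewrite enormZ mulrC wMl ?en_ge0//.
exact: coord_le.
Qed.

Lemma opnorm_trmx A : opnorm A^T <= (n * n)%:R * opnorm A.
apply: leT (on_le_entries _) _.
apply: (leU (\sum_(i < n) \sum_(j < n) opnorm A)).
 by apply: ler_sum => i _; apply: ler_sum => j _; rewrite mxE entry_le_on.
rewrite !sumr_const !card_ord -mulrnA mulr_natl; exact: lexx.
Qed.

End euclidean.

Section spectral.
Context {R : realType}.

(** Take a complex eigenvalue [p + i q] with row eigenvector [a + i c]. Symmetry of the bilinear
    form gives [q (|a|^2 + |c|^2) = 0], so [q = 0], and whichever of [a], [c] is nonzero is a real
    eigenvector. *)
Lemma symmetric_eigenvector n (A : 'M[R]_n.+1) : A^T = A ->
 exists (v : 'cV[R]_n.+1) (a : R), v != 0 /\ A *m v = a *: v.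
move=> As; pose f : {rmorphism R -> R[i]} := [the {rmorphism R -> R[i]} of real_complex R].
pose Ac := map_mx f A.
have [x] : exists x, root (char_poly Ac) x.
 by apply: closed_rootP; rewrite size_char_poly.
rewrite -eigenvalue_root_char => /eigenvalueP[w wA w0].
pose a := map_mx (@complex.Re R) w; pose c := map_mx (@complex.Im R) w.
have wE i j : w i j = Complex (a i j) (c i j) by rewrite !mxE; case: (w i j).
case: x wA => [p q] wA; move: a c wE => a c wE.
have hA j : \sum_k a 0 k * A k j = p * a 0 j - q * c 0 j /\
  \sum_k c 0 k * A k j = q * a 0 j + p * c 0 j.
 have := congr1 (fun M : 'rV_n.+1 => M 0 j) wA; rewrite !mxE.
 have -> : \sum_k w 0 k * Ac k j = Complex (\sum_k a 0 k * A k j) (\sum_k c 0 k * A k j).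
  elim/big_rec3: _ => // k y1 y2 y3 _ ->; rewrite wE !mxE.
  by rewrite /= /real_complex_def; simpc.
 by rewrite wE; simpc => -[-> ->]; split; rewrite addrC.
have aA : a *m A = p *: a - q *: c by apply/rowP => j; rewrite !mxE (hA j).1.
have cA : c *m A = q *: a + p *: c by apply/rowP => j; rewrite !mxE (hA j).2.
have sy (y z : 'rV[R]_n.+1) : (y *m A *m z^T) 0 0 = (z *m A *m y^T) 0 0.
 have -> : z *m A *m y^T = (y *m A *m z^T)^T.
  by rewrite !trmx_mul trmxK As mulmxA.
 by rewrite [RHS]mxE.
have q0 : q = 0.
 have := sy a c; rewrite aA cA !mulmxDl mulNmx -!scalemxAl.
 have sab : (a *m c^T) 0 0 = (c *m a^T) 0 0.
  by rewrite -[in RHS](trmxK c) -trmx_mul [RHS]mxE.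
 rewrite !mxE.
 set S1 := \sum_j a 0 j * c^T j 0; set S2 := \sum_j c 0 j * c^T j 0.
 set S3 := \sum_j a 0 j * a^T j 0; set S4 := \sum_j c 0 j * a^T j 0 => e.
 have S14 : S1 = S4 by move: sab; rewrite !mxE.
 have S20 : S2 = \sum_j c 0 j ^+ 2 by apply: eq_bigr => j _; rewrite mxE.
 have S30 : S3 = \sum_j a 0 j ^+ 2 by apply: eq_bigr => j _; rewrite mxE.
 have : q * (S2 + S3) = 0 by rewrite S14 in e; lra.
 move/eqP; rewrite mulf_eq0 => /orP[/eqP//|].
 rewrite S20 S30 paddr_eq0 ?sge0//; try by move=> *; exact: sqr_ge0.
 rewrite !psumr_eq0; try by move=> *; exact: sqr_ge0.
 move=> /andP[/allP hc /allP ha]; exfalso; move/negP: w0; apply; apply/eqP/rowP => j.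
 rewrite wE [RHS]mxE; have := ha j (mem_index_enum _); have := hc j (mem_index_enum _).
 by rewrite !sqrf_eq0 => /eqP -> /eqP ->.
rewrite q0 !scale0r ?subr0 ?add0r in aA cA.
have fin (y : 'rV[R]_n.+1) : y != 0 -> y *m A = p *: y ->
  exists (v : 'cV[R]_n.+1) (e : R), v != 0 /\ A *m v = e *: v.
 move=> y0 yA; exists y^T, p; split; first by rewrite trmx_eq0.
 by rewrite -{1}As -trmx_mul yA linearZ.
have [a0|a0] := eqVneq a 0; last exact: fin a0 aA.
apply: fin cA; apply: contra w0 => /eqP c0; apply/eqP/rowP => j.
by rewrite wE a0 c0 !mxE.
Qed.

(** The reflection along [v - e_0], which exchanges two vectors of equal length. *)
Lemma householder n (v : 'cV[R]_n.+1) : enorm v = 1 ->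
 exists H : 'M[R]_n.+1, [/\ H^T = H, H *m H = 1%:M & H *m dmx 0 0 = v].
move=> v1; have [->|vd] := eqVneq v (dmx 0 0).
 by exists 1%:M; rewrite trmx1 mul1mx mul1mx.
pose w := v - dmx 0 0.
have w0 : w != 0 by rewrite subr_eq0.
pose c := 2 / enorm w ^+ 2.
have ew : enorm w != 0 by rewrite gtF// en_gt0.
have ww : w^T *m w = (enorm w ^+ 2)%:M.
 by apply/matrixP => i j; rewrite !ord1 en_sqr_mx [RHS]mxE mulr1n.
exists (1%:M - c *: (w *m w^T)); split.
- by rewrite linearB /= trmx1 linearZ /= trmx_mul trmxK.
- rewrite mulmxBl mul1mx mulmxBr mulmx1 -!scalemxAl -!scalemxAr.
 have -> : w *m w^T *m (w *m w^T) = enorm w ^+ 2 *: (w *m w^T).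
  by rewrite mulmxA -(mulmxA w) ww mul_mx_scalar scalemxAl.
 rewrite !scalerA (_ : c * c * enorm w ^+ 2 = c + c); last by rewrite /c; field.
 by rewrite scalerDl opprB addrK subrK.
- have dw : w^T *m dmx 0 0 = (v 0 0 - 1)%:M :> 'M[R]_1.
  by apply/matrixP => i j; rewrite !ord1 -colE !mxE mulr1n.
 have eww : enorm w ^+ 2 = 2 - 2 * v 0 0.
  have -> : enorm w ^+ 2 = \sum_i v i 0 ^+ 2 + \sum_i (1 - 2 * v i 0) * (i == 0)%:R.
  rewrite en_sqr -big_split /=; apply: eq_bigr => i _; rewrite !mxE andbT.
  by case: (i == 0); rewrite /=; ring.
  rewrite -en_sqr v1 expr1n (bigD1 0)//= big1 ?addr0.
  by lra.
  by move=> i /negPf ->; rewrite mulr0.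
 rewrite mulmxBl mul1mx -scalemxAl -mulmxA dw mul_mx_scalar scalerA.
 have -> : c * (v 0 0 - 1) = -1.
  rewrite /c; have : enorm w ^+ 2 != 0 by rewrite expf_neq0.
  by rewrite eww => h; field; apply: contra h => /eqP ?; apply/eqP; lra.
 by rewrite scaleN1r opprK /w addrC subrK.
Qed.

(** Deflation: conjugating with the Householder reflection that takes [e_0] to a unit eigenvector
    splits off the first row and column, and the remaining block is symmetric. *)
Lemma sym_diag n (A : 'M[R]_n) : A^T = A ->
 exists (O : 'M[R]_n) (d : 'rV[R]_n), O^T *m O = 1%:M /\ A = O^T *m diag_mx d *m O.
elim: n => [|n ih] in A * => As.
 by exists 1%:M, 0; rewrite mulmx1; split => //; apply/matrixP => -[].
have [v0 [a [v0n Av0]]] := symmetric_eigenvector As.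
have e0 := en_gt0 v0n.
pose v := (enorm v0)^-1 *: v0.
have v1 : enorm v = 1 by rewrite enormZ ger0_norm ?ige0 ?en_ge0// mulVf// gtF.
have Av : A *m v = a *: v by rewrite -scalemxAr Av0 !scalerA mulrC.
have [H [Hs HH Hd]] := householder v1.
pose B : 'M[R]_n.+1 := H *m A *m H.
have Bs : B^T = B by rewrite !trmx_mul Hs As mulmxA.
have Bd : B *m (dmx 0 0 : 'cV[R]_n.+1) = a *: dmx 0 0.
 by rewrite -mulmxA Hd -mulmxA Av -scalemxAr -Hd mulmxA HH mul1mx.
have Bi0 i : B i 0 = a * (i == 0)%:R.
 have := congr1 (fun M : 'cV_n.+1 => M i 0) Bd.
 by rewrite -colE !mxE andbT.
have B0i i : B 0 i = a * (i == 0)%:R by rewrite -{1}Bs mxE.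
have dB : (@drsubmx _ 1 n 1 n B)^T = @drsubmx _ 1 n 1 n B by rewrite trmx_drsub Bs.
have [Q [d [QQ BE]]] := ih _ dB.
pose P : 'M[R]_(1 + n) := block_mx 1%:M 0 0 Q.
have PP : P^T *m P = 1%:M.
 by rewrite tr_block_mx !trmx0 trmx1 mulmx_block !mulmx0 !mul0mx mulmx1 !addr0 !add0r QQ -scalar_mx_block.
exists (P *m H), (row_mx a%:M d); split.
 by rewrite trmx_mul mulmxA -(mulmxA H^T) PP mulmx1 Hs.
rewrite trmx_mul Hs.
have -> : A = H *m B *m H.
 by rewrite !mulmxA HH mul1mx -mulmxA HH mulmx1.
have -> : B = P^T *m diag_mx (row_mx a%:M d) *m P; last by rewrite !mulmxA.
clearbody B; rewrite -[LHS](@submxK _ 1 n 1 n) diag_mx_row /P tr_block_mx !trmx0 trmx1.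
rewrite !mulmx_block !mulmx0 !mulmx1 !mul1mx !addr0 !add0r ?mul0mx -BE.
have h1 : @ulsubmx _ 1 n 1 n B = diag_mx a%:M.
 apply/matrixP => i j; rewrite !ord1; transitivity (B 0 0).
  by rewrite !mxE; congr (B _ _); exact: val_inj.
 by rewrite Bi0 mulr1 !mxE !eqxx !mulr1n.
have h2 : @ursubmx _ 1 n 1 n B = 0.
 apply/matrixP => i j; rewrite !ord1; transitivity (B 0 (@rshift 1 n j)).
  by rewrite !mxE; congr (B _ _); exact: val_inj.
 by rewrite B0i mulr0 mxE.
have h3 : @dlsubmx _ 1 n 1 n B = 0.
 apply/matrixP => i j; rewrite !ord1; transitivity (B (@rshift 1 n i) 0).
  by rewrite !mxE; congr (B _ _); exact: val_inj.
 by rewrite Bi0 mulr0 mxE.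
by rewrite h1 h2 h3.
Qed.

End spectral.
Section matrix_powers.
Context {R : realType} {n : nat}.
Implicit Types (A B Q : 'M[R]_n) (d : 'rV[R]_n) (s t : R).

Definition fcalc Q d (f : R -> R) : 'M[R]_n := Q^T *m diag_mx (map_mx f d) *m Q.

Lemma fcalcE Q d f i j : fcalc Q d f i j = \sum_k Q k i * Q k j * f (d 0 k).
rewrite /fcalc -mulmxA mxE; apply: eq_bigr => k _; rewrite mul_diag_mx !mxE.
by rewrite -mulrA [f _ * _]mulrC.
Qed.

(** The transition matrix [U] intertwines the two diagonals, so [U i j] can be nonzero only where
    the eigenvalues agree, and then it intertwines every function of them. This makes the arbitrary
    choice in [mxpowR] harmless. *)
Lemma fcalc_unique Q1 d1 Q2 d2 f : Q1^T *m Q1 = 1%:M -> Q2^T *m Q2 = 1%:M ->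
 Q1^T *m diag_mx d1 *m Q1 = Q2^T *m diag_mx d2 *m Q2 -> fcalc Q1 d1 f = fcalc Q2 d2 f.
move=> h1 h2 e; pose U := Q2 *m Q1^T.
have h1' := orth_comm h1; have h2' := orth_comm h2.
have dU : diag_mx d2 *m U = U *m diag_mx d1.
 rewrite /U; have := congr1 (fun M => Q2 *m M *m Q1^T) e.
 rewrite !mulmxA h2' mul1mx -(mulmxA (Q2 *m Q1^T *m diag_mx d1)) h1' mulmx1 => ->.
 by [].
have fU : diag_mx (map_mx f d2) *m U = U *m diag_mx (map_mx f d1).
 apply/matrixP => i j; have := congr1 (fun M : 'M[R]_n => M i j) dU.
 rewrite mul_diag_mx mul_mx_diag mul_diag_mx mul_mx_diag !mxE.
 set u := \sum_k _; have [->|u0] := eqVneq u 0; first by rewrite !mulr0 !mul0r.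
 by rewrite [RHS]mulrC => /(mulIf u0) ->; rewrite mulrC.
have := congr1 (fun M => Q2^T *m M *m Q1) fU.
rewrite /fcalc !mulmxA h2 mul1mx -(mulmxA _ Q1^T Q1) h1 mulmx1 => ->.
by [].
Qed.

Lemma fcalc_mul Q d f g : Q^T *m Q = 1%:M ->
 fcalc Q d f *m fcalc Q d g = fcalc Q d (fun x => f x * g x).
move=> h; have h' := orth_comm h.
rewrite /fcalc !mulmxA -(mulmxA (Q^T *m diag_mx (map_mx f d)) Q Q^T) h' mulmx1.
rewrite -(mulmxA Q^T); congr (_ *m _ *m _).
by rewrite mulmx_diag; congr diag_mx; apply/rowP => i; rewrite !mxE.
Qed.

Lemma fcalc_cst Q d (c : R) : Q^T *m Q = 1%:M -> fcalc Q d (fun=> c) = c%:M.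
move=> h; rewrite /fcalc (_ : map_mx _ d = const_mx c); last by apply/rowP => i; rewrite !mxE.
by rewrite diag_const_mx mul_mx_scalar -scalemxAl h scalemx1.
Qed.

Lemma eq_fcalc Q d f g : (forall i, f (d 0 i) = g (d 0 i)) -> fcalc Q d f = fcalc Q d g.
by move=> fg; apply/matrixP => i j; rewrite !fcalcE; apply: eq_bigr => k _; rewrite fg. Qed.

Lemma fcalc_posdef Q d f : Q^T *m Q = 1%:M -> (forall i, 0 < f (d 0 i)) ->
 pdsym (fcalc Q d f).
move=> h f0; split; first by rewrite !trmx_mul trmxK tr_diag_mx mulmxA.
move=> v v0; rewrite /fcalc.
have -> : v^T *m (Q^T *m diag_mx (map_mx f d) *m Q) *m v =
 (Q *m v)^T *m (diag_mx (map_mx f d) *m (Q *m v)) by rewrite trmx_mul !mulmxA.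
have E (w : 'cV[R]_n) : (w^T *m (diag_mx (map_mx f d) *m w)) 0 0 =
  \sum_j f (d 0 j) * w j 0 ^+ 2.
 by rewrite mxE; apply: eq_bigr => j _; rewrite mul_diag_mx !mxE; ring.
rewrite E.
have s0 j : 0 <= f (d 0 j) * (Q *m v) j 0 ^+ 2 by rewrite mge0 ?sqr_ge0// ltW.
rewrite lt_neqAle sge0 ?andbT//.
apply: contra v0 => /eqP/esym/eqP; rewrite psumr_eq0// => /allP hz.
have Qv : Q *m v = 0.
 apply/colP => j; rewrite [RHS]mxE; apply/eqP.
 have := hz j (mem_index_enum _); rewrite mulf_eq0 gtF//= sqrf_eq0.
 by [].
by rewrite -[v]mul1mx -h -mulmxA Qv mulmx0.
Qed.

(** One decomposition serves all exponents at once, so the laws of powers reduce to scalar laws on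
    the eigenvalues. *)
Lemma pd_spectral A : pdsym A -> exists Q d,
 [/\ Q^T *m Q = 1%:M, forall i, 0 < d 0 i, A = fcalc Q d id &
  forall s, mxpowR A s = fcalc Q d (fun x => x `^ s)].
move=> [As Ap]; have [Q [d [QQ AE]]] := sym_diag As.
have QQ' := orth_comm QQ.
have d0 i : 0 < d 0 i.
 have v0 : Q^T *m (dmx i 0 : 'cV[R]_n) != 0.
  apply: contraTneq (oner_neq0 R) => h; rewrite negbK.
  rewrite -(en_delta (R := R) i) -(mul1mx (dmx i 0)) -QQ' -mulmxA h mulmx0 enorm0.
  by [].
 have := Ap _ v0; rewrite AE trmx_mul trmxK !mulmxA.
 rewrite -(mulmxA _ Q Q^T) QQ' mulmx1 -(mulmxA _ Q Q^T) QQ' mulmx1.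
 by rewrite trmx_delta -rowE -colE !mxE eqxx.
have AE' : A = fcalc Q d id.
 by rewrite AE; congr (_ *m diag_mx _ *m _); apply/rowP => i; rewrite mxE.
exists Q, d; split => // s; rewrite /mxpowR.
case: xgetP => [B -> [Q2 [d2 [h2 d20 A2 ->]]]|/(_ (fcalc Q d (fun x => x `^ s)))].
 by apply: (@fcalc_unique Q2 d2 Q d (fun x => x `^ s)) => //; rewrite -A2.
by case; exists Q, d.
Qed.

Lemma mxpowR_pd A s : pdsym A -> pdsym (mxpowR A s).
move=> /pd_spectral[Q [d [QQ d0 _ ->]]]; apply: fcalc_posdef => // i.
exact: pgt0.
Qed.

Lemma mxpowRD A s t : pdsym A -> mxpowR A s *m mxpowR A t = mxpowR A (s + t).
move=> /pd_spectral[Q [d [QQ d0 _ E]]]; rewrite !E fcalc_mul//.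
by apply: eq_fcalc => i; rewrite -powRD// (gtF (d0 i)) implybT.
Qed.

Lemma mxpowR0 A : pdsym A -> mxpowR A 0 = 1%:M.
move=> /pd_spectral[Q [d [QQ d0 _ ->]]]; rewrite -(fcalc_cst d 1 QQ).
by apply: eq_fcalc => i; rewrite powRr0.
Qed.

Lemma mxpowR1 A : pdsym A -> mxpowR A 1 = A.
move=> /pd_spectral[Q [d [QQ d0 AE ->]]]; rewrite [RHS]AE.
by apply: eq_fcalc => i; rewrite powRr1// ltW.
Qed.

Lemma mxpowRrM A s t : pdsym A -> mxpowR (mxpowR A s) t = mxpowR A (s * t).
move=> pA; have [Q [d [QQ d0 AE E]]] := pd_spectral pA.
have [Q2 [d2 [QQ2 d20 AE2 E2]]] := pd_spectral (mxpowR_pd s pA).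
have e : Q2^T *m diag_mx d2 *m Q2 = Q^T *m diag_mx (map_mx (fun x => x `^ s) d) *m Q.
 have := AE2; rewrite E /fcalc => ->; congr (_ *m diag_mx _ *m _).
 by apply/rowP => i; rewrite [RHS]mxE.
rewrite E2 (fcalc_unique (fun x => x `^ t) QQ2 QQ e) E.
congr (_ *m diag_mx _ *m _); apply/rowP => i; rewrite !mxE.
by rewrite -powRrM.
Qed.

Lemma mxpowRN A s : pdsym A -> mxpowR A (- s) *m mxpowR A s = 1%:M.
by move=> pA; rewrite mxpowRD// addNr mxpowR0. Qed.

Lemma mxpowRV A s : pdsym A -> mxpowR A s *m mxpowR A (- s) = 1%:M.
by move=> pA; rewrite mxpowRD// addrN mxpowR0. Qed.

Lemma mxpowR_sym A s : pdsym A -> (mxpowR A s)^T = mxpowR A s.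
by move=> pA; have [] := mxpowR_pd s pA. Qed.

Lemma mxpowRN1 A : pdsym A -> mxpowR A (-1) = invmx A.
move=> pA; have h := mxpowRN 1 pA; rewrite (mxpowR1 pA) in h.
have uA : A \in unitmx by case/mulmx1_unit: h.
by rewrite -[RHS]mul1mx -h mulmxK.
Qed.

(* In eigenbases the entries of [A^s B^s] are [a_i^s U_ij b_j^s] with [|U_ij| <= 1]. *)
Lemma on_powM A B s : pdsym A -> pdsym B -> 0 < s -> s <= 1 ->
 opnorm (mxpowR A s *m mxpowR B s) <= (n * n)%:R * opnorm (A *m B) `^ s.
move=> pA pB s0 s1.
have [P [a [PP a0 AE EA]]] := pd_spectral pA.
have [Q [c [QQ c0 BE EB]]] := pd_spectral pB.
have PP' := orth_comm PP; have QQ' := orth_comm QQ.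
pose U := P *m Q^T.
have Ule i j : `|U i j| <= 1.
 apply: leT (entry_le_col _ _ _) _.
 rewrite en_orth ?en_delta//.
 by rewrite trmx_mul trmxK mulmxA -(mulmxA Q) PP mulmx1.
pose M f : 'M[R]_n := diag_mx (map_mx f a) *m U *m diag_mx (map_mx f c).
have ME f : fcalc P a f *m fcalc Q c f = P^T *m M f *m Q.
 by rewrite /M /U !mulmxA.
have Mij f i j : M f i j = f (a 0 i) * U i j * f (c 0 j).
 by rewrite /M mul_mx_diag mxE mul_diag_mx !mxE.
rewrite EA EB ME.
have conj (N : 'M[R]_n) : opnorm (P^T *m N *m Q) <= opnorm N.
 apply: opnorm_le; first exact: on_ge0.
 move=> v; rewrite -!mulmxA en_orth ?trmxK//.
 by apply: leT (on_bound _ _) _; rewrite en_orth.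
apply: leT (conj _) _; apply: leT (on_le_entries _) _.
apply: (leU (\sum_(i < n) \sum_(j < n) opnorm (A *m B) `^ s)); last first.
 by rewrite !sumr_const !card_ord -mulrnA mulr_natl.
apply: ler_sum => i _; apply: ler_sum => j _; rewrite Mij.
have N : M id = P *m (A *m B) *m Q^T.
 rewrite [A in RHS]AE [B in RHS]BE ME.
 have -> : P *m (P^T *m M id *m Q) *m Q^T = (P *m P^T) *m M id *m (Q *m Q^T).
  by rewrite !mulmxA.
 by rewrite PP' QQ' mul1mx mulmx1.
have Mid : `|a 0 i * U i j * c 0 j| <= opnorm (A *m B).
 rewrite -(Mij id) N; apply: leT (entry_le_on _ _ _) _.
 apply: opnorm_le; first exact: on_ge0.
 move=> v; rewrite -!mulmxA en_orth// mulmxA.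
 by apply: leT (on_bound _ _) _; rewrite en_orth ?trmxK.
apply: (leU (`|a 0 i * U i j * c 0 j| `^ s)); last first.
 by apply: ge0_ler_powR; rewrite ?nnegrE ?on_ge0//; exact: ltW.
rewrite !normrM !powRM //.
rewrite (gtr0_norm (pgt0 s (a0 i))) (gtr0_norm (pgt0 s (c0 j))).
rewrite (gtr0_norm (a0 i)) (gtr0_norm (c0 j)).
rewrite ler_pM2r ?pgt0// ler_pM2l ?pgt0//.
have [->|u0] := eqVneq (U i j) 0; first by rewrite normr0.
have up : 0 < `|U i j| by rewrite normr_gt0.
rewrite -[leLHS]powRr1// /powR !gtF// ler_expR mul1r.
by rewrite -[leLHS]mul1r; apply: ler_wnM2r => //; rewrite ln_le0// Ule.
Qed.

Lemma mmx_det {dsp} {X : mType dsp} m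
  (M : X -> 'M[R]_m) : mmx M ->
 mfun (fun x => \det (M x)).
move=> mM; apply: msum => s; apply: mfM => //.
by apply: measurable_prod => i _; exact: mM.
Qed.

Lemma mfinv {dsp} {X : mType dsp} (f : X -> R) :
 mfun f -> mfun (fun x => (f x)^-1).
move=> mf; have -> : (fun x => (f x)^-1) = (fun x => f x * (f x ^+ 2) `^ (-1)).
 apply/funext => x; rewrite powR_inv1 ?sqr_ge0//.
 have [->|f0] := eqVneq (f x) 0; first by lra.
 by field.
apply: mfM => //; apply: mpowR; exact: measurable_funX.
Qed.

Lemma minvmx {dsp} {X : mType dsp}
  (M : X -> 'M[R]_n) : (forall x, M x \in unitmx) ->
 mmx M ->
 forall i j, mfun (fun x => invmx (M x) i j).
move=> uM mM i j.
have -> : (fun x => invmx (M x) i j) = (fun x => (\det (M x))^-1 * cofactor (M x) j i).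
 by apply/funext => x; rewrite /invmx uM !mxE.
apply: mfM.
 by apply: mfinv; exact: mmx_det.
apply: mfM => //; apply: mmx_det => k l.
by under eq_fun do rewrite !mxE; exact: mM.
Qed.

End matrix_powers.
Lemma cvg_sum_ord {R : realType} m (F : 'I_m -> nat -> R) (l : 'I_m -> R) :
 (forall k, F k j @[j --> \oo] --> l k) ->
 \sum_k F k j @[j --> \oo] --> \sum_k l k.
elim: m F l => [|m ih] F l Fl.
 by under eq_fun do rewrite big_ord0; rewrite big_ord0; exact: cvg_cst.
under eq_fun do rewrite big_ord_recl; rewrite big_ord_recl.
by apply: cvgD; [exact: Fl|apply: ih => k; exact: Fl].
Qed.

(** * Measurability of the powers of a matrix weight *)

Section measurable_powers.
Context {R : realType} {n : nat} {dsp} {X : mType dsp}.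
Variable W : X -> 'M[R]_n.
Hypotheses (pW : forall x, pdsym (W x))
 (mW : forall i j, mfun (fun x => W x i j)).

Section spectral_choice.
Variables (Q : X -> 'M[R]_n) (d : X -> 'rV[R]_n).
Hypotheses (QQ : forall x, (Q x)^T *m Q x = 1%:M) (d0 : forall x i, 0 < d x 0 i)
 (WE : forall x, W x = fcalc (Q x) (d x) id).

(** The decompositions [Q x], [d x] are chosen point by point and need not be measurable; only the
    entries of [f (W x)] can be. The functions [f] for which they are contain constants and the
    identity, and are closed under algebraic operations, inverses of positive functions and
    pointwise limits on positive numbers. *)
Let mcalc (f : R -> R) : Prop :=
 forall i j, mfun (fun x => fcalc (Q x) (d x) f i j).

Let mcalc_eq f g : (forall t, 0 < t -> f t = g t) -> mcalc f -> mcalc g.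
move=> fg mf i j; have := mf i j; congr measurable_fun; apply/funext => x.
by rewrite (@eq_fcalc _ _ (Q x) (d x) f g)// => k; rewrite fg.
Qed.

Let mcalc_cst c : mcalc (fun=> c).
by move=> i j; under eq_fun do rewrite fcalc_cst//; exact: mcst. Qed.

Let mcalc_id : mcalc id.
by move=> i j; under eq_fun do rewrite -WE; exact: mW. Qed.

Let mcalcD f g : mcalc f -> mcalc g -> mcalc (fun t => f t + g t).
move=> mf mg i j.
have -> : (fun x => fcalc (Q x) (d x) (fun t => f t + g t) i j) =
  (fun x => fcalc (Q x) (d x) f i j + fcalc (Q x) (d x) g i j).
 apply/funext => x; rewrite !fcalcE -big_split/=; apply: eq_bigr => k _.
 lra.
exact: mfD.
Qed.

Let mcalcM f g : mcalc f -> mcalc g -> mcalc (fun t => f t * g t).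
move=> mf mg i j; under eq_fun do rewrite -fcalc_mul// mxE.
by apply: msum => k; exact: mfM.
Qed.

Let mcalc_sum N (f : nat -> R -> R) : (forall k, mcalc (f k)) ->
 mcalc (fun t => \sum_(0 <= k < N) f k t).
move=> mf; elim: N => [|N ih].
 by apply: (mcalc_eq (f := fun=> 0)) (mcalc_cst 0) => t _; rewrite big_geq.
apply: (mcalc_eq (f := fun t => \sum_(0 <= k < N) f k t + f N t)); last exact: mcalcD.
by move=> t _; rewrite big_nat_recr.
Qed.

Let mcalcX f k : mcalc f -> mcalc (fun t => f t ^+ k).
move=> mf; elim: k => [|k ih].
 by apply: (mcalc_eq (f := fun=> 1)) (mcalc_cst 1) => t _.
apply: (mcalc_eq (f := fun t => f t * f t ^+ k)); last exact: mcalcM.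
by move=> t _; rewrite exprS.
Qed.

Let mcalcV f : (forall t, 0 < t -> 0 < f t) -> mcalc f -> mcalc (fun t => (f t)^-1).
move=> f0 mf i j.
have VE x : fcalc (Q x) (d x) (fun t => (f t)^-1) *m fcalc (Q x) (d x) f = 1%:M.
 rewrite fcalc_mul// -(fcalc_cst (d x) 1 (QQ x)); apply: eq_fcalc => k.
 by rewrite mulVf// gtF// f0.
have uf x : fcalc (Q x) (d x) f \in unitmx by have /mulmx1_unit[] := VE x.
have -> : (fun x => fcalc (Q x) (d x) (fun t => (f t)^-1) i j) =
  (fun x => invmx (fcalc (Q x) (d x) f) i j).
 by apply/funext => x; rewrite -[invmx _]mul1mx -(VE x) mulmxK.
exact: minvmx.
Qed.

Let mcalc_lim (f : nat -> R -> R) g : (forall k, mcalc (f k)) ->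
 (forall t, 0 < t -> f k t @[k --> \oo] --> g t) -> mcalc g.
move=> mf fg i j.
apply: (measurable_fun_cvg (h := fun k x => fcalc (Q x) (d x) (f k) i j)).
 by move=> k; exact: mf.
move=> x _; rewrite fcalcE.
under eq_fun do rewrite fcalcE.
apply: cvg_sum_ord => k; apply: cvgM; first exact: cvg_cst.
exact: fg.
Qed.

(** The functions [1 / (1 + (t/a)^k)] converge to the step, except for the value [1/2] at [t = a];
    powers of this limit then send that value to 0. *)
Let mcalc_step a : 0 < a -> mcalc (fun t => (t < a)%R%:R).
move=> a0.
pose g k (t : R) := (1 + (a^-1 * t) ^+ k)^-1.
have mg k : mcalc (g k).
 apply: mcalcV => [t t0|]; first by rewrite addr_gt0// xgt0// mgt0// igt0.
 apply: mcalcD => //.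
 by apply: mcalcX; apply: mcalcM; [exact: mcalc_cst|exact: mcalc_id].
pose h (t : R) : R := if t < a then 1 else if t == a then 2^-1 else 0.
have mh : mcalc h.
 apply: (mcalc_lim mg) => t t0; rewrite /h /g.
 have [ta|at_|->] := ltgtP t a.
 - have z1 : `|a^-1 * t| < 1.
  by rewrite ger0_norm ?mge0 ?ige0 ?(ltW a0) ?(ltW t0)// mulrC ltr_pdivrMr// mul1r.
  rewrite [X in _ --> X](_ : 1 = (1 + 0)^-1); last by rewrite addr0 invr1.
  apply: cvgV; first by rewrite addr0.
  apply: cvgD; first exact: cvg_cst.
  exact: cvg_expr.
 - have y1 : `|a / t| < 1.
  by rewrite ger0_norm ?dge0 ?(ltW a0) ?(ltW t0)// ltr_pdivrMr// mul1r.
  have -> : (fun k => (1 + (a^-1 * t) ^+ k)^-1) = (fun k => (a / t) ^+ k * (1 + (a / t) ^+ k)^-1).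
  apply/funext => k; have -> : a / t = (a^-1 * t)^-1 by rewrite invfM invrK.
  have z0 : 0 < (a^-1 * t) ^+ k by rewrite xgt0// mgt0// igt0.
  by rewrite exprVn; field; rewrite !gtF// addr_gt0.
  rewrite [X in _ --> X](_ : 0 = 0 * (1 + 0)^-1); last by rewrite mul0r.
  apply: cvgM; first exact: cvg_expr.
  apply: cvgV; first by rewrite addr0.
  apply: cvgD; first exact: cvg_cst.
  exact: cvg_expr.
 - under eq_fun do rewrite mulVf ?gtF// expr1n.
  exact: cvg_cst.
apply: (mcalc_lim (f := fun k t => h t ^+ k.+1)).
 by move=> k; exact: mcalcX.
move=> t t0; rewrite /h; have [ta|ta|ta] := ltgtP t a.
- by under eq_fun do rewrite expr1n; exact: cvg_cst.
- by under eq_fun do rewrite expr0n; exact: cvg_cst.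
- suff : (2^-1 : R) * 2^-1 ^+ k @[k --> \oo] --> (2^-1 : R) * 0.
  by rewrite mulr0; under eq_fun do rewrite -exprS.
 apply: cvgM; first exact: cvg_cst.
 by apply: cvg_expr; rewrite ger0_norm ?ige0// invf_lt1// ltr1n.
Qed.

(** With [N' = N + 1], a combination of steps at the points [j / N'] takes the value
    [(floor (N' t) / N')^s] as soon as [t < N']; let [N] tend to infinity. *)
Let mcalc_pow_pos s : 0 < s -> mcalc (fun t => t `^ s).
move=> s0.
pose c N (j : nat) : R := (j%:R / N.+1%:R) `^ s.
pose f N (t : R) : R := \sum_(0 <= j < N.+1 ^ 2)
 (c N j.+1 - c N j) * (1 + -1 * (t < j.+1%:R / N.+1%:R)%R%:R).
apply: (mcalc_lim (f := f)).
 move=> N; apply: mcalc_sum => k; apply: mcalcM => //.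
 apply: mcalcD => //.
 apply: mcalcM => //.
 by apply: mcalc_step.
move=> t t0.
pose m N := Num.truncn (N.+1%:R * t).
have mitv N : (m N)%:R <= N.+1%:R * t < (m N).+1%:R.
 by apply: truncn_itv; rewrite mge0// ltW.
have fE N : t < N.+1%:R -> f N t = c N (m N).
 move=> tN.
 have mN : (m N <= N.+1 ^ 2)%N.
  rewrite -(@ler_nat R) natrX expr2; have /andP[h _] := mitv N.
  by apply: leT h _; rewrite ler_pM2l// ltW.
 rewrite /f (big_cat_nat (n := m N))//=.
 rewrite [X in _ + X]big_nat [X in _ + X]big1 ?addr0; last first.
  move=> j /andP[mj _].
  have -> : t < j.+1%:R / N.+1%:R.
  rewrite ltr_pdivlMr// mulrC; have /andP[_ h] := mitv N.
  by apply: ltleT h _; rewrite ler_nat.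
  by rewrite mulN1r addrN mulr0.
 rewrite big_nat (eq_bigr (fun j => c N j.+1 - c N j)); last first.
  move=> j /andP[_ jm].
  have -> : (t < j.+1%:R / N.+1%:R) = false.
  apply/negbTE; rewrite -leNgt lepdM// mulrC; have /andP[h _] := mitv N.
  by apply: leT h; rewrite ler_nat.
  by rewrite mulr0 addr0 mulr1.
 rewrite -big_nat telescope_sumr// /c mul0r powR0 ?subr0//.
 lra.
have cvg_m : (m N)%:R / N.+1%:R @[N --> \oo] --> t.
 apply: (@squeeze_cvgr _ _ _ _ (fun N => t - N.+1%:R^-1) (fun=> t)).
 - apply: nearW => N; have /andP[h1 h2] := mitv N.
  rewrite lepdM// ler_pdivlMr// (mulrC t) h1 andbT mulrBl mulVf //.
  by move: h2; rewrite (mulrC t); lra.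
 - rewrite -[X in _ --> X]subr0; apply: cvgB; first exact: cvg_cst.
  exact: cvg_harmonic.
 - exact: cvg_cst.
have pc : {for t, continuous (fun x : R => x `^ s)}.
 have : {near t, (fun x : R => expR (s * ln x)) =1 (fun x => x `^ s)}.
  near=> x; rewrite /powR gtF//; near: x; exact: lt_nbhsr.
 move=> /near_eq_cvg h; apply/(cvg_trans h).
 have -> : t `^ s = expR (s * ln t) by rewrite /powR (gtF t0).
 apply: (@cvg_comp _ _ _ (fun x => s * ln x) expR _ (nbhs (s * ln t))).
  by apply: cvgM; [exact: cvg_cst|exact: continuous_ln].
 exact: continuous_expR.
have := cvg_comp _ _ cvg_m pc; apply: cvg_trans.
apply: near_eq_cvg; near=> N.
rewrite fE; near: N; exists (Num.truncn t) => //= N tN.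
by apply: ltleT (truncnS_gt t) _; rewrite ler_nat.
Unshelve. all: by end_near. Qed.

Lemma mfcalc_pow s i j :
 mfun (fun x => fcalc (Q x) (d x) (fun t => t `^ s) i j).
suff : mcalc (fun t => t `^ s) by exact.
have [s0|s0|->] := ltgtP s 0.
- apply: (mcalc_eq (f := fun t => (t `^ (- s))^-1)).
  by move=> t t0; rewrite -powRN opprK.
 apply: mcalcV => [t t0|]; first exact: pgt0.
 by apply: mcalc_pow_pos; rewrite oppr_gt0.
- exact: mcalc_pow_pos.
- by apply: (mcalc_eq (f := fun=> 1)) (mcalc_cst 1) => t _; rewrite powRr0.
Qed.

End spectral_choice.

Lemma mmxpowR s i j : mfun (fun x => mxpowR (W x) s i j).
have /choice[Qd hQd] : forall x, exists Qd : 'M[R]_n * 'rV[R]_n,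
 [/\ Qd.1^T *m Qd.1 = 1%:M, forall i, 0 < Qd.2 0 i, W x = fcalc Qd.1 Qd.2 id &
  forall s, mxpowR (W x) s = fcalc Qd.1 Qd.2 (fun x => x `^ s)].
 by move=> x; have [Q [d h]] := pd_spectral (pW x); exists (Q, d).
have -> : (fun x => mxpowR (W x) s i j) =
  (fun x => fcalc (Qd x).1 (Qd x).2 (fun t => t `^ s) i j).
 by apply/funext => x; have [_ _ _ ->] := hQd x.
apply: mfcalc_pow => x; by have [] := hQd x.
Qed.

End measurable_powers.

Lemma menorm {R : realType} {n : nat} {dsp}
  {X : mType dsp} (v : X -> 'cV[R]_n) :
 (forall i, mfun (fun x => v x i 0)) ->
 mfun (fun x => enorm (v x)).
move=> mv.
have -> : (fun x => enorm (v x)) = (fun x => (\sum_i v x i 0 ^+ 2) `^ 2^-1).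
 by apply/funext => x; rewrite powR12_sqrt// sge0// => i _; exact: sqr_ge0.
apply: mpowR; apply: msum => i; apply: measurable_funX; exact: mv.
Qed.

Lemma mmulmx {R : realType} {m n p : nat} {dsp}
  {X : mType dsp} (A : X -> 'M[R]_(m, n)) (B : X -> 'M[R]_(n, p)) :
 mmx A ->
 mmx B ->
 forall i j, mfun (fun x => (A x *m B x) i j).
move=> mA mB i j; under eq_fun do rewrite mxE.
by apply: msum => k; exact: mfM.
Qed.

(** * Reducing matrices of norm-like functions *)

Section reducing.
Context {R : realType} {n : nat}.

Definition set_col (M : 'M[R]_n) (j : 'I_n) (v : 'cV[R]_n) : 'M[R]_n :=
 \matrix_(i, k) if k == j then v i 0 else M i k.

Lemma det_set_col (M : 'M[R]_n) j v : M \in unitmx ->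
 \det (set_col M j v) = \det M * (invmx M *m v) j 0.
move=> uM; rewrite /invmx uM -scalemxAl mxE mulrA mulfV ?mul1r; last by move: uM; rewrite unitmxE unitfE.
rewrite (expand_det_col _ j) mxE; apply: eq_bigr => i _.
rewrite !mxE eqxx mulrC; congr (_ * _); congr (_ * \det _).
by apply/matrixP => a b; rewrite !mxE eq_sym (negPf (neq_lift j b)).
Qed.

Lemma det_le_of_entries (M : 'M[R]_n) (r : R) : (forall i j, `|M i j| <= r) ->
 `|\det M| <= \sum_(s : 'S_n) r ^+ n.
move=> Mr; apply: leT (ler_norm_sum _ _ _) _.
apply: ler_sum => s _; rewrite normrM normr_sign mul1r normr_prod.
rewrite -[n in leRHS]card_ord -prodr_const; apply: ler_prod => i _.
by rewrite normr_ge0 Mr.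
Qed.

(* Columns of almost maximal determinant in the unit ball of [Phi] form an Auerbach
 basis up to the factor 2, by Cramer's rule. *)
Lemma reducing_matrix (Phi : 'cV[R]_n -> R) (u K c1 c2 : R) :
 0 < u -> 0 < c1 -> 0 <= K ->
 (forall c v, Phi (c *: v) = `|c| `^ u * Phi v) ->
 (forall v : 'I_n -> 'cV[R]_n, Phi (\sum_i v i) <= K * \sum_i Phi (v i)) ->
 (forall v, c1 * enorm v `^ u <= Phi v <= c2 * enorm v `^ u) ->
 exists2 V : 'M[R]_n, pdsym V & forall v,
  enorm (V *m v) `^ u <= (2 * n%:R) `^ u * Phi v /\
  Phi v <= K * n%:R * enorm (V *m v) `^ u.
move=> u0 c10 K0 PhiZ PhiS Phib.
have Phi0 v : 0 <= Phi v.
 by have /andP[h _] := Phib v; apply: leT h; rewrite mge0 ?pge0// ltW.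
pose S := [set M : 'M[R]_n | forall j, Phi (col j M) <= 1].
pose E := [set `|\det M| | M in S].
pose r := c1^-1 `^ u^-1.
have entry M i j : S M -> `|M i j| <= r.
 move=> /(_ j) h; apply: (leU (enorm (col j M))).
  by apply: leT (coord_le _ i); rewrite mxE.
 have /andP[h1 _] := Phib (col j M).
 have h2 : enorm (col j M) `^ u <= c1^-1.
  by rewrite -[leRHS]mul1r ler_pdivlMr// mulrC; exact: leT h1 h.
 rewrite -[leLHS]powRr1 ?en_ge0// -(mulfV (lt0r_neq0 u0)) powRrM.
 apply: ge0_ler_powR; rewrite ?nnegrE ?pge0 ?ige0//; exact: ltW.
have Esup : has_sup E.
 split; first by exists `|\det (0 : 'M[R]_n)|, 0 => // j; rewrite (_ : col j 0 = 0 *: 0) ?PhiZ ?normr0 ?powR0 ?gtF ?mul0r //; apply/colP => i; rewrite !mxE mulr0.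
 exists (\sum_(s : 'S_n) r ^+ n) => _ [M SM <-].
 by apply: det_le_of_entries => i j; exact: entry.
have Spos : 0 < sup E.
 pose de := (1 + `|c2|)^-1 `^ u^-1.
 have de0 : 0 < de by rewrite pgt0//.
 apply: (@ltleT _ _ `|\det (de%:M : 'M[R]_n)|).
  by rewrite det_scalar normr_gt0 expf_neq0// gtF.
 apply: (supub Esup); exists de%:M => // j.
 have -> : col j (de%:M : 'M[R]_n) = de *: dmx j 0.
  by rewrite -scalemx1 linearZ /= col1.
 rewrite PhiZ gtr0_norm// -powRrM mulVf ?gtF// powRr1 //.
 have /andP[_ h] := Phib (dmx j 0); rewrite en_delta powR1 mulr1 in h.
 rewrite mulrC lepdM// mul1r (leT h)//.
 by apply: leT (ler_norm c2) _; rewrite lerDr.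
have [|_ [M SM <-] Mdet] := @sup_adherent _ _ (sup E / 2) _ Esup.
 lra.
have dM : 0 < `|\det M| by lra.
have uM : M \in unitmx by rewrite unitmxE unitfE -normr_gt0.
have coef1 v j : Phi v <= 1 -> `|(invmx M *m v) j 0| <= 2.
 move=> v1.
 have : `|\det (set_col M j v)| <= sup E.
  apply: (supub Esup); exists (set_col M j v) => // k.
  have [->|kj] := eqVneq k j.
  by rewrite (_ : col j _ = v)//; apply/colP => i; rewrite !mxE eqxx.
  by rewrite (_ : col k _ = col k M)//; apply/colP => i; rewrite !mxE (negPf kj).
 rewrite det_set_col// normrM => h.
 rewrite -(ler_pM2l dM) mulrC; lra.
have coef v j : `|(invmx M *m v) j 0| <= 2 * Phi v `^ u^-1.
 have [->|v0] := eqVneq v 0.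
  by rewrite mulmx0 mxE normr0 mge0 ?pge0.
 have Pv : 0 < Phi v.
  have /andP[h _] := Phib v; apply: ltleT h.
  by rewrite mgt0// pgt0// en_gt0.
 pose t := Phi v `^ u^-1; have t0 : 0 < t by exact: pgt0.
 have := coef1 (t^-1 *: v) j; rewrite PhiZ gtr0_norm ?igt0//.
 have -> : t^-1 `^ u * Phi v = 1.
  rewrite -powRN -powRrM mulNr mulVf ?gtF// powRN powRr1 ?mulVf ?gtF//.
 move=> /(_ (lexx _)); rewrite -scalemxAr mxE normrM gtr0_norm ?igt0//.
 by rewrite mulrC lepdM//.
(* [A] gives the coordinates in the nearly optimal basis. The root of [A^T A] is symmetric positive
   definite and changes none of the lengths [|A v|]. *)
pose A := invmx M.
have uA : A \in unitmx by rewrite unitmx_inv.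
have pG : pdsym (A^T *m A).
 split; first by rewrite trmx_mul trmxK.
 move=> v v0; rewrite mulmxA -mulmxA -trmx_mul -en_sqr_mx xgt0// en_gt0//.
 by apply: contra v0 => /eqP h; rewrite -(mulKmx uA v) h mulmx0.
exists (mxpowR (A^T *m A) 2^-1); first exact: mxpowR_pd.
move=> v.
have -> : enorm (mxpowR (A^T *m A) 2^-1 *m v) = enorm (A *m v).
 apply/eqP; rewrite -(@eqrXn2 _ 2) ?en_ge0//; apply/eqP.
 rewrite !en_sqr_mx !trmx_mul mxpowR_sym// !mulmxA -(mulmxA v^T) mxpowRD//.
 by rewrite (_ : 2^-1 + 2^-1 = 1) ?mxpowR1 ?mulmxA//; lra.
have nA : enorm (A *m v) <= 2 * n%:R * Phi v `^ u^-1.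
 apply: leT (en_le_sum _) _.
 apply: (leU (\sum_(i < n) 2 * Phi v `^ u^-1)).
  by apply: ler_sum => i _.
 by rewrite sumr_const card_ord -[leLHS]mulr_natl mulrCA mulrA.
split.
 apply: (leU ((2 * n%:R * Phi v `^ u^-1) `^ u)).
  by apply: ge0_ler_powR; rewrite ?nnegrE ?en_ge0 ?mge0 ?pge0//; exact: ltW.
 by rewrite powRM ?pge0// -powRrM mulVf ?gtF// powRr1.
have vE : v = \sum_i (A *m v) i 0 *: col i M.
 rewrite -{1}(mulKVmx uM v) -/A; apply/colP => i; rewrite mxE summxE.
 by apply: eq_bigr => k _; rewrite !mxE mulrC.
rewrite {1}vE; apply: leT (PhiS _) _; rewrite -mulrA; apply: wMl => //.
apply: (leU (\sum_(i < n) enorm (A *m v) `^ u)).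
 apply: ler_sum => i _; rewrite PhiZ -[leRHS]mulr1; apply: ler_pM => //.
 by apply: ge0_ler_powR; rewrite ?nnegrE ?en_ge0//; [exact: ltW|exact: coord_le].
by rewrite sumr_const card_ord mulr_natl.
Qed.

End reducing.

(** * Approximation in L^2 by Lipschitz functions supported in an open set *)

Section l2_integrals.
Context {R : realType} {dsp} {X : mType dsp}.
Variable mu : meas X R.
Implicit Types (f g : X -> R).

Definition sqint f : \bar R := (\int[mu]_x (f x ^+ 2)%:E)%E.

Lemma msqr f : mfun f -> mfun (fun x => f x ^+ 2).
by move=> mf; exact: measurable_funX. Qed.

Lemma sqint_ge0 f : (0 <= sqint f)%E.
by apply: intge0 => x _; rewrite leF sqr_ge0. Qed.

Lemma sqint_lin (a c : R) f g : mfun f -> mfun g ->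
 (sqint (fun x => a * f x + c * g x)%R <=
  (2 * a ^+ 2)%:E * sqint f + (2 * c ^+ 2)%:E * sqint g)%E.
move=> mf mg; have mf2 := msqr mf; have mg2 := msqr mg.
have a2 : 0 <= 2 * a ^+ 2 by rewrite pmulr_rge0// sqr_ge0.
have c2 : 0 <= 2 * c ^+ 2 by rewrite pmulr_rge0// sqr_ge0.
have f2 x : 0 <= f x ^+ 2 by exact: sqr_ge0.
have g2 x : 0 <= g x ^+ 2 by exact: sqr_ge0.
rewrite /sqint -(intZ mu measurableT mf2 f2 a2) -(intZ mu measurableT mg2 g2 c2).
have ma : mfun (fun x => 2 * a ^+ 2 * f x ^+ 2) by apply: mfM.
have mc : mfun (fun x => 2 * c ^+ 2 * g x ^+ 2) by apply: mfM.
rewrite -intD//; [|by move=> x; exact: mge0..].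
apply: int_le => //.
- apply: msqr; apply: mfD; exact: mfM.
- exact: mfD.
- by move=> x; exact: sqr_ge0.
- move=> x _; have := sqr_ge0 (a * f x - c * g x); nra.
Qed.

Lemma sqintD f g : mfun f -> mfun g ->
 (sqint (fun x => f x + g x)%R <= 2%:E * sqint f + 2%:E * sqint g)%E.
move=> mf mg; have := sqint_lin 1 1 mf mg; rewrite expr1n mulr1.
by under eq_fun do rewrite !mul1r.
Qed.

End l2_integrals.

Section lipschitz_approximation.
Context {R : realType} {dsp} {X : mType dsp}.
Variables (rho : X -> X -> R) (mu : meas X R) (D : R).
Hypothesis ds : dspace rho mu D.
Local Notation b := (qball rho).
Let rsym := mtsym (dsmt ds).
Let rtri := mttri (dsmt ds).
Let rxx := mtrefl (dsmt ds).
Let mb c s : measurable (b c s) := mball ds c s.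

Definition lipf (L : R) (f : X -> R) : Prop :=
 forall x y, `|f x - f y| <= L * rho x y.

Lemma lipschitz_open L f (V : set R) : 0 <= L -> lipf L f -> open V ->
 qopen rho (f @^-1` V).
move=> L0 fL; rewrite openE => oV x /= Vx.
have /nbhs_ballP[e /= e0 eV] := oV _ Vx.
have L1 : 0 < L + 1 by lra.
exists (e / (L + 1)); first by rewrite dgt0.
move=> y; rewrite /qball /= ltr_pdivlMr// => xy; apply: eV.
apply: leltT (fL x y) _; apply: leltT xy.
by rewrite mulrC wMl ?(mtge0 (dsmt ds))//; lra.
Qed.

Lemma lip_meas L f : 0 <= L -> lipf L f -> mfun f.
move=> L0 fL; apply: (measurability _ (RGenOInfty.measurableE R)) => _ [_ [x ->] <-].
rewrite setTI; apply: (ds_open ds); exact: lipschitz_open fL _.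
Qed.

(** The distance to the complement of [U], capped at 1. Expressed through balls it also makes sense
    when the complement is empty. *)
Definition depth (U : set X) (x : X) : R := sup [set t | 0 <= t <= 1 /\ b x t `<=` U].

Let depth_sup U x : has_sup [set t | 0 <= t <= 1 /\ b x t `<=` U].
split; last by exists 1 => t [/andP[]].
by exists 0; split; [rewrite lexx ler01|rewrite (ball_le0 ds)].
Qed.

Lemma depth_ge0 U x : 0 <= depth U x.
by apply: (supub (depth_sup U x)); split; [rewrite lexx ler01|rewrite (ball_le0 ds)].
Qed.

Lemma depth_out U x : ~ U x -> depth U x = 0.
move=> Ux; apply/eqP; rewrite eq_le depth_ge0 andbT.
apply: ge_sup; [exact: (depth_sup U x).1|move=> t [_ tU]].
rewrite leNgt; apply/negP => t0; apply: Ux; apply: tU; exact: (ball_ctr ds).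
Qed.

Lemma depth_gt0 U x : qopen rho U -> U x -> 0 < depth U x.
move=> oU /oU[t t0 tU]; apply: (@ltleT _ _ (Num.min t 1)).
 by rewrite lt_min t0 ltr01.
apply: (supub (depth_sup U x)); split.
 by rewrite le_min ge_min lexx orbT ler01 (ltW t0).
by apply: subT tU; apply: (bsub ds); rewrite rxx add0r ge_min lexx.
Qed.

Lemma depth_lipschitz U : lipf 1 (depth U).
have h x y : depth U x <= depth U y + rho x y.
 apply: ge_sup; [exact: (depth_sup U x).1|move=> t [/andP[t0 t1] tU]].
 have [txy|xyt] := leP t (rho x y).
  by apply: (leT txy); rewrite lerDr depth_ge0.
 rewrite -lerBlDr; apply: (supub (depth_sup U y)); split.
  by have := mtge0 (dsmt ds) x y; lra.
 by apply: subT tU; apply: (bsub ds); rewrite rsym; lra.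
move=> x y; rewrite mul1r ler_norml; apply/andP; split.
 by have := h y x; rewrite rsym; lra.
by have := h x y; lra.
Qed.

Section approx.
Variable O : set X.
Hypotheses (oO : qopen rho O) (mO : (mu O < +oo)%E).

Definition test_fun (phi : X -> R) : Prop := [/\ exists2 L, 0 <= L & lipf L phi,
 forall y, ~ O y -> phi y = 0 & exists M, forall y, `|phi y| <= M].

(** Closure in L^2 of the Lipschitz functions vanishing off [O]. Fixing the support is what keeps
    the approximants away from a given set in [ker_repr]. *)
Definition approx (f : X -> R) : Prop := mfun f /\
 forall e : R, 0 < e -> exists2 phi, test_fun phi & (sqint mu (fun x => phi x - f x)%R <= e%:E)%E.

Lemma test_meas phi : test_fun phi -> mfun phi.
by move=> [[L L0 pL] _ _]; exact: lip_meas L0 pL. Qed.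

Lemma test_lin (a c : R) f g : test_fun f -> test_fun g -> test_fun (fun x => a * f x + c * g x).
move=> [[L L0 fL] f0 [M fM]] [[L' L'0 gL] g0 [M' gM]]; split.
- exists (`|a| * L + `|c| * L'); first by rewrite age0 ?mge0.
 move=> x y; have -> : a * f x + c * g x - (a * f y + c * g y) =
  a * (f x - f y) + c * (g x - g y) by ring.
 apply: leT (ler_normD _ _) _; rewrite !normrM mulrDl -!mulrA.
 by apply: lerD; apply: wMl.
- by move=> y Oy; rewrite f0// g0// !mulr0 addr0.
- exists (`|a| * M + `|c| * M') => y; apply: leT (ler_normD _ _) _.
 by rewrite !normrM; apply: lerD; apply: wMl.
Qed.

Lemma approx_lin (a c : R) f g : approx f -> approx g ->
 approx (fun x => a * f x + c * g x).
move=> [mf af] [mg ag]; split; first by apply: mfD; exact: mfM.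
move=> e e0.
pose k := 2 * a ^+ 2 + 2 * c ^+ 2 + 1.
have k0 : 0 < k by rewrite /k; have := sqr_ge0 a; have := sqr_ge0 c; lra.
have ek : 0 < e / k by rewrite dgt0.
have [f1 tf hf] := af _ ek; have [g1 tg hg] := ag _ ek.
exists (fun x => a * f1 x + c * g1 x); first exact: test_lin.
have mf1 := test_meas tf; have mg1 := test_meas tg.
have -> : (fun x => a * f1 x + c * g1 x - (a * f x + c * g x)) =
 (fun x => a * (f1 x - f x) + c * (g1 x - g x)) by apply/funext => x; ring.
apply: leT (sqint_lin mu a c (mfB mf1 mf) (mfB mg1 mg)) _.
apply: (leU ((2 * a ^+ 2)%:E * (e / k)%:E + (2 * c ^+ 2)%:E * (e / k)%:E)%E).
 by apply: leeD; apply: leMl => //; rewrite leF pmulr_rge0// sqr_ge0.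
rewrite leF -mulrDl mulrA lepdM// mulrC ler_pM2l//.
by rewrite /k; lra.
Qed.

Lemma approx_lim (f : X -> R) (F : nat -> X -> R) : mfun f ->
 (forall k, approx (F k)) ->
 (forall e : R, 0 < e -> exists k, (sqint mu (fun x => F k x - f x)%R <= e%:E)%E) ->
 approx f.
move=> mf aF Ff; split => // e e0; have e4 : 0 < e / 4 by rewrite dgt0.
have [k hk] := Ff _ e4; have [mk ak] := aF k; have [phi tp hp] := ak _ e4.
exists phi => //; have mp := test_meas tp.
have -> : (fun x => phi x - f x) = (fun x => (phi x - F k x) + (F k x - f x)).
 by apply/funext => x; ring.
apply: leT (sqintD mu (mfB mp mk) (mfB mk mf)) _.
apply: (leU (2%:E * (e / 4)%:E + 2%:E * (e / 4)%:E)%E).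
 by apply: leeD; apply: leMl.
by rewrite -!EFinM -EFinD leF; lra.
Qed.

Lemma small_sets (A : nat -> set X) : (forall k, measurable (A k)) ->
 (forall k, A k `<=` O) -> nonincreasing_seq A -> \bigcap_k A k = set0 ->
 forall e : R, 0 < e -> exists k, (mu (A k) <= e%:E)%E.
move=> mA AO Adec A0 e e0.
have mOm : measurable O by exact: (ds_open ds).
have cv : (mu \o A) x @[x --> \oo] --> (0 : \bar R)%E.
 rewrite -(measure0 mu) -A0; apply: nonincreasing_cvg_mu => //.
  by apply: leltT mO; apply: lemu; rewrite ?inE.
 exact: bigcap_measurable.
apply: contrapT => /forallNP h; have : (e%:E <= 0)%E.
 rewrite -(cvg_lim _ cv)//; apply: lime_ge; first by apply/cvg_ex; eexists; exact: cv.
 by apply: nearW => k; rewrite leNgt; apply/negP => /ltW; exact: h.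
by rewrite leF; lra.
Qed.

Lemma sq_le_indic A (c : R) (f : X -> R) : measurable A -> mfun f ->
 0 <= c -> (forall x, `|f x| <= c * \1_A x) -> (sqint mu f <= (c ^+ 2)%:E * mu A)%E.
move=> mA mf c0 fA; have -> : mu A = (\int[mu]_x (\1_A x)%:E)%E.
 by rewrite intindic ?setIT.
rewrite -intZ ?sqr_ge0//; apply: int_le => //.
- exact: msqr.
- by apply: mfM => //.
- by move=> x; exact: sqr_ge0.
- move=> x _; rewrite -[leLHS]real_normK ?num_real//.
 apply: (leU ((c * \1_A x) ^+ 2)).
  by rewrite lerXn2r ?nnegrE ?mge0.
 by rewrite exprMn wMl ?sqr_ge0// indicE; case: (_ \in _); rewrite ?expr1n ?expr0n.
Qed.

(** The minimum of 1 and [(k + 1)] times the depth differs from the indicator only where the depth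
    is positive and below [1/(k+1)]; these sets decrease to the empty set inside a set of finite
    measure. *)
Lemma approx_open U : qopen rho U -> approx (\1_(U `&` O)).
move=> oU; have oUO : qopen rho (U `&` O).
 move=> x [Ux Ox]; have [s s0 sU] := oU _ Ux; have [t t0 tO] := oO Ox.
 exists (Num.min s t); first by rewrite lt_min s0.
 move=> y xy; split.
  by apply: sU; apply: (bsub ds) xy; rewrite rxx add0r ge_min lexx.
 by apply: tO; apply: (bsub ds) xy; rewrite rxx add0r ge_min lexx orbT.
set A := U `&` O in oUO *.
have mA : measurable A by exact: (ds_open ds).
split => //.
move=> e e0.
pose S k := [set x | A x /\ k.+1%:R * depth A x < 1].
have md : mfun (depth A) := lip_meas ler01 (@depth_lipschitz A).
have mS k : measurable (S k).
 have -> : S k = A `&` [set x | -1 < - (k.+1%:R * depth A x)].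
  by apply/seteqP; split => x [? /= ?]; split => //=; lra.
 apply: measurableI => //; apply: msuplev.
 by apply: measurable_funN; exact: mfM.
have [k hk] : exists k, (mu (S k) <= e%:E)%E.
 apply: small_sets => //.
 - by move=> k x [[]].
 - move=> i j ij; apply/subsetPset => x [Ax h]; split => //; apply: leltT h.
  by rewrite wMr ?depth_ge0// ler_nat.
 - apply/seteqP; split => // x Sx; have [Ax _] := Sx 0%N I.
  have d0 := depth_gt0 oUO Ax.
  have [_ ] := Sx (Num.truncn (depth A x)^-1) I; apply/negP; rewrite -leNgt.
  by rewrite -lepdM// div1r ltW// truncnS_gt.
exists (fun x => Num.min 1 (k.+1%:R * depth A x)).
 split.
 - exists k.+1%:R => // x y; have := @depth_lipschitz A x y; rewrite mul1r => dl.
  have kd : `|k.+1%:R * depth A x - k.+1%:R * depth A y| <= k.+1%:R * rho x y.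
  by rewrite -mulrBr normrM gtr0_norm// wMl.
  move: kd; rewrite !ler_norml => /andP[h1 h2].
  by apply/andP; split; case: (leP 1 (_ * depth A x)) => ?; case: (leP 1 (_ * depth A y)) => ?; lra.
 - by move=> y Oy; rewrite depth_out ?mulr0 ?min_r// => -[].
 - exists 1 => y; rewrite ger0_norm ?ge_min ?lexx// le_min ler01.
  by rewrite mge0// depth_ge0.
apply: leT hk; rewrite -[leRHS]mul1e -[X in (X%:E * _)%E](expr1n _ 2).
apply: sq_le_indic => //.
 apply: mfB => //.
 by apply: measurable_minr => //; exact: mfM.
move=> x; rewrite mul1r !indicE.
have kd0 : 0 <= k.+1%:R * depth A x by rewrite mge0// depth_ge0.
case: (boolP (x \in A)) => [|/negP Ax]; [rewrite inE => Ax|].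
 have [h|h] := leP 1 (k.+1%:R * depth A x); first by rewrite subrr normr0.
 have Sx : S k x by [].
 by rewrite (mem_set Sx) /= ler_norml; apply/andP; split; lra.
rewrite depth_out ?mulr0 ?min_r ?subrr ?normr0//.
by move=> Ax'; apply: Ax; rewrite inE.
Qed.

(** By the pi-lambda theorem: open sets are stable under intersection and generate the Borel sets,
    and the sets with approximable indicator form a lambda-system. *)
Lemma approx_indic (A : set X) : @measurable dsp X = <<s [set U | qopen rho U] >> ->
 measurable A -> approx (\1_(A `&` O)).
move=> borel; pose H := [set A | measurable A /\ approx (\1_(A `&` O))].
have mOm : measurable O by exact: (ds_open ds).
have iE (A' : set X) x : \1_(A' `&` O) x = \1_A' x * \1_O x :> R by rewrite indicI.
suff HH : lambda_system setT H.
 move=> mA; suff : H A by case.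
 move: mA; rewrite borel; apply: lambda_system_subset => //.
 - move=> U V oU oV x [Ux Vx]; have [s s0 sU] := oU _ Ux; have [t t0 tV] := oV _ Vx.
  exists (Num.min s t); first by rewrite lt_min s0.
  move=> y xy; split.
  by apply: sU; apply: (bsub ds) xy; rewrite rxx add0r ge_min lexx.
  by apply: tV; apply: (bsub ds) xy; rewrite rxx add0r ge_min lexx orbT.
 - by move=> U oU; split; [exact: (ds_open ds)|exact: approx_open].
split => //.
- split => //; apply: approx_open; move=> x _; exists 1 => //.
- move=> A1 A2 A21 [m1 a1] [m2 a2]; split; first exact: measurableD.
 have -> : \1_((A1 `\` A2) `&` O) = (fun x => 1 * \1_(A1 `&` O) x + -1 * \1_(A2 `&` O) x) :> (X -> R).
  apply/funext => x; rewrite !iE !indicE in_setD.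
  have [x2|x2] := boolP (x \in A2); last by rewrite andbT /=; lra.
  have -> : x \in A1 by move: x2; rewrite !inE; exact: A21.
  by rewrite /=; lra.
 exact: approx_lin.
- move=> F Fnd HF; have mF k : measurable (F k) by have [] := HF k.
 have mU : measurable (\bigcup_k F k) by exact: mbigcup.
 split => //; apply: (approx_lim (F := fun k => \1_(F k `&` O))).
 + by apply: mindic; exact: measurableI.
 + by move=> k; have [] := HF k.
 + move=> e e0; pose S k := ((\bigcup_k F k) `\` F k) `&` O.
  have mS k : measurable (S k) by apply: measurableI => //; exact: measurableD.
  have [k hk] : exists k, (mu (S k) <= e%:E)%E.
  apply: small_sets => //.
  - by move=> k x [].
  - move=> i j ij; apply/subsetPset => x [[Ux Fj] Ox]; split => //; split => // Fi.
  by apply: Fj; have /subsetPset := Fnd _ _ ij; apply.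
  - apply/seteqP; split => // x Sx; have [[[i _ Fi] _] _] := Sx 0%N I.
  by have [[_ ]] := Sx i I.
  exists k; apply: leT hk.
  rewrite -[leRHS]mul1e -[X in (X%:E * _)%E](expr1n _ 2).
  apply: sq_le_indic => //.
  by apply: mfB; apply: mindic; exact: measurableI.
  move=> x; rewrite mul1r !iE !indicE in_setD.
  have [xF|xF] := boolP (x \in F k).
  have -> : x \in \bigcup_k F k by move: xF; rewrite !inE => ?; exists k.
  by rewrite subrr normr0.
  rewrite mul0r sub0r normrN andbT.
  by case: (x \in \bigcup_k F k); case: (x \in O); rewrite /= ?mul0r ?mul1r ?normr0 ?normr1.
Qed.

(* Slicing [0, 1]: [f] is within [1/N] of [sum_j 1/N 1_(f > j/N)]. *)
Lemma approx_bd (f : X -> R) (M : R) : @measurable dsp X = <<s [set U | qopen rho U] >> ->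
 mfun f -> (forall x, `|f x| <= M) -> (forall x, ~ O x -> f x = 0) ->
 approx f.
move=> borel mf fM fO.
have mOm : measurable O by exact: (ds_open ds).
have [M0|M0] := leP M 0.
 have -> : f = (fun x => 0 * \1_(set0 `&` O) x + 0 * \1_(set0 `&` O) x).
  apply/funext => x; rewrite !mul0r addr0; apply/eqP; rewrite -normr_le0.
  exact: leT (fM x) M0.
 by apply: approx_lin; exact: approx_indic.
(* Rescaling to values in [[0, 1]]; on [O] the function [f] is recovered as [2 M g - M]. *)
pose g x := (f x / M + 1) / 2.
have g01 x : 0 <= g x <= 1.
 have := fM x; rewrite ler_norml => /andP[h1 h2].
 have : -1 <= f x / M <= 1 by rewrite ler_pdivlMr// lepdM// mulN1r mul1r h1.
 by rewrite /g; lra.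
have mg : mfun g.
 by apply: mfM => //; apply: mfD => //; exact: mfM.
have -> : f = (fun x => (2 * M) * (g x * \1_O x) + - M * \1_(setT `&` O) x).
 apply/funext => x; rewrite setTI indicE; case: (boolP (x \in O)) => [_|/negP xO] /=.
  by rewrite /g; field; rewrite gtF.
 by rewrite !mulr0 addr0 fO// => Ox; apply: xO; rewrite inE.
apply: approx_lin; last exact: approx_indic.
pose G N x : R := \sum_(0 <= j < N.+1) N.+1%:R^-1 * \1_([set y | j.+1%:R / N.+1%:R < g y] `&` O) x.
apply: (approx_lim (F := G)).
- exact: mMindic.
- move=> N; rewrite /G; elim: {1}N.+1 => [|k ih].
  have -> : (fun x => \sum_(0 <= j < 0) N.+1%:R^-1 *
  \1_([set y | j.+1%:R / N.+1%:R < g y] `&` O) x) =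
  (fun x => 0 * \1_(set0 `&` O) x + 0 * \1_(set0 `&` O) x) :> (X -> R).
  by apply/funext => x; rewrite big_geq// !mul0r addr0.
  by apply: approx_lin; exact: approx_indic.
 have -> : (fun x => \sum_(0 <= j < k.+1) N.+1%:R^-1 *
  \1_([set y | j.+1%:R / N.+1%:R < g y] `&` O) x) =
  (fun x => 1 * (\sum_(0 <= j < k) N.+1%:R^-1 *
  \1_([set y | j.+1%:R / N.+1%:R < g y] `&` O) x) +
  N.+1%:R^-1 * \1_([set y | k.+1%:R / N.+1%:R < g y] `&` O) x) :> (X -> R).
  by apply/funext => x; rewrite big_nat_recr//= mul1r.
 apply: approx_lin => //; apply: approx_indic => //.
 exact: msuplev.
- move=> e e0.
 have /fin_numPlt/andP[_ mOf] : mu O \is a fin_num by rewrite ge0fin.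
 pose m := fine (mu O); have mE : mu O = m%:E by rewrite fineK// ge0fin.
 exists (Num.truncn (m / e)); set N := Num.truncn _.
 apply: (leU ((N.+1%:R^-1 ^+ 2)%:E * mu O)%E); last first.
  rewrite mE leF -mulrA mulrC -ler_pdivlMr // invrK.
  rewrite mulrC lepdM// -mulrA.
  have h : m / e < N.+1%:R by exact: truncnS_gt.
  move: h; rewrite ltr_pdivrMr// => h; rewrite (leT (ltW h))// mulrCA.
  by rewrite ler_pM2l// ler_peMr ?ler1n// ltW.
 apply: sq_le_indic => //.
  apply: mfB; last exact: mMindic.
  apply: msum => j; apply: mfM => //; apply: mindic.
  by apply: measurableI => //; exact: msuplev.
 move=> x; rewrite /G.
 have [xO|xO] := boolP (x \in O); last first.
  rewrite big1; last by move=> j _; rewrite indicE in_setI (negPf xO) andbF mulr0.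
  by rewrite indicE (negPf xO) !mulr0 subrr normr0.
 rewrite indicE xO !mulr1.
 have /andP[gx0 gx1] := g01 x.
 have NE j : (\1_([set y | j.+1%:R / N.+1%:R < g y] `&` O) x : R) =
  (j.+1%:R < N.+1%:R * g x)%R%:R.
  rewrite indicE in_setI xO andbT.
  suff -> : (x \in [set y | j.+1%:R / N.+1%:R < g y]) = (j.+1%:R < N.+1%:R * g x) by [].
  by apply/idP/idP; rewrite inE /= ltr_pdivrMr// mulrC.
 under eq_bigr do rewrite NE.
 rewrite -mulr_sumr; set y := N.+1%:R * g x.
 have y0 : 0 <= y by rewrite mge0.
 have yN : y <= N.+1%:R by rewrite ler_piMr.
 have [h1 h2 _] : [/\ \sum_(0 <= j < N.+1) (j.+1%:R < y)%R%:R <= y,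
  (y <= N.+1%:R -> y - 1 <= \sum_(0 <= j < N.+1) (j.+1%:R < y)%R%:R) &
  (N.+1%:R < y -> \sum_(0 <= j < N.+1) (j.+1%:R < y)%R%:R = N.+1%:R :> R)].
  elim: {yN} N.+1 => [|k [i1 i2 i3]].
  rewrite big_geq; split => // y0'; lra.
  rewrite big_nat_recr//=; have [yk|yk] := leP y k.+1%:R.
  rewrite addr0; split => // _.
  have [yk'|/i3 ->] := leP y k%:R; first exact: i2.
  by move: yk; lra.
  have ky : k%:R < y by lra.
  rewrite (i3 ky) natr1; split => //; exact: ltW.
 have -> : g x = N.+1%:R^-1 * y by rewrite mulrA mulVf ?mul1r// gtF.
 rewrite -mulrBr normrM gtr0_norm // -[leRHS]mulr1 wMl //.
 by rewrite ler_norml; have := h2 yN; lra.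
Qed.

End approx.
End lipschitz_approximation.

(** * Tools on integrals *)

Section integral_tools.
Context {R : realType} {dsp} {X : mType dsp}.
Variable mu : meas X R.

(** Integrals of nonnegative functions are suprema over simple functions below them, so they are
    monotone without measurability. This spares measurability proofs for maximal functions and for
    averages depending on a parameter. *)
Lemma int_le_nm A (f g : X -> \bar R) : (forall x, (0 <= f x)%E) ->
 (forall x, A x -> (f x <= g x)%E) ->
 (\int[mu]_(x in A) f x <= \int[mu]_(x in A) g x)%E.
move=> f0 fg; rewrite imkcond [leRHS]imkcond.
have fg' x : ((f \_ A) x <= (g \_ A) x)%E.
 by rewrite !patchE; case: ifPn => // /set_mem; exact: fg.
have f0' x : (0 <= (f \_ A) x)%E by rewrite patchE; case: ifP.
rewrite !ge0_integralE//; last by move=> x _; exact: leT (f0' x) (fg' x).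
rewrite !patch_setT; apply: le_ereal_sup => _ [h hf <-]; exists h => // x.
exact: leT (hf x) (fg' x).
Qed.

Lemma mnneseries (A : set X) (h : nat -> X -> \bar R) :
 (forall k, measurable_fun A (h k)) -> (forall k x, (0 <= h k x)%E) ->
 measurable_fun A (fun x => \sum_(0 <= k <oo) h k x)%E.
move=> mh h0; apply: ge0_emeasurable_sum => [k x _ _|k _]; [exact: h0|exact: mh].
Qed.

Lemma poweR_mono (x y : \bar R) (t : R) : 0 <= t -> (0 <= x)%E -> (x <= y)%E ->
 (x `^ t <= y `^ t)%E.
by move=> t0 x0 xy; apply: gt0_ler_poweR => //; rewrite in_itv /= leey andbT// (leT x0 xy).
Qed.

Lemma powR_inv_le (x a t : R) : 0 < t -> 0 <= x -> 0 <= a -> x `^ t <= a `^ t -> x <= a.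
move=> t0 x0 a0 h; rewrite leNgt; apply/negP => ax.
by move: h; apply/negP; rewrite -ltNge gt0_ltr_powR ?in_itv/= ?andbT.
Qed.

Lemma powRK (x t : R) : 0 <= x -> t != 0 -> (x `^ t) `^ t^-1 = x.
by move=> x0 t0; rewrite -powRrM mulfV// powRr1. Qed.

Lemma powRVK (x t : R) : 0 <= x -> t != 0 -> (x `^ t^-1) `^ t = x.
by move=> x0 t0; rewrite -powRrM mulVf// powRr1. Qed.

Lemma int_hoelder A (f g : X -> R) (p q : R) : measurable A ->
 mfun f -> mfun g ->
 (forall x, 0 <= f x) -> (forall x, 0 <= g x) -> 0 < p -> 0 < q -> p^-1 + q^-1 = 1 ->
 (\int[mu]_(x in A) (f x * g x)%:E <=
 (\int[mu]_(x in A) (f x `^ p)%:E) `^ p^-1 * (\int[mu]_(x in A) (g x `^ q)%:E) `^ q^-1)%E.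
move=> mA mf mg f0 g0 p0 q0 pq.
have mf1 := mMindic mA mf; have mg1 := mMindic mA mg.
have key (h : X -> R) t : 0 < t -> (forall x, 0 <= h x) ->
  Lnorm mu t%:E (EFin \o (fun x => h x * \1_A x)) =
  ((\int[mu]_(x in A) (h x `^ t)%:E) `^ t^-1)%E.
 move=> t0 h0; rewrite Lnorm.unlock [in RHS]imkcond; congr (poweR _ _).
 apply: eqint => x _; rewrite patchE /= indicE; case: (x \in A); rewrite ?mulr1 ?mulr0.
  by rewrite ger0_norm.
 by rewrite normr0 powR0// gtF.
have := hoelder mu mf1 mg1 p0 q0 pq; rewrite (key f p)// (key g q)// Lnorm1.
apply: leT; rewrite imkcond; apply: eqW.
apply: eqint => x _; rewrite patchE /= indicE; case: (x \in A); rewrite ?mulr1 ?mulr0 ?normr0//.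
by rewrite ger0_norm ?mge0.
Qed.

Lemma int_hold_le A (f g : X -> R) (p q a c : R) : measurable A ->
 mfun f -> mfun g ->
 (forall x, 0 <= f x) -> (forall x, 0 <= g x) -> 0 < p -> 0 < q -> p^-1 + q^-1 = 1 ->
 0 <= a -> 0 <= c ->
 (\int[mu]_(x in A) (f x `^ p)%:E <= (a `^ p)%:E)%E ->
 (\int[mu]_(x in A) (g x `^ q)%:E <= (c `^ q)%:E)%E ->
 (\int[mu]_(x in A) (f x * g x)%:E <= (a * c)%:E)%E.
move=> mA mf mg f0 g0 p0 q0 pq a0 c0 fa gc.
apply: leT (int_hoelder mA mf mg f0 g0 p0 q0 pq) _; rewrite EFinM.
have key (h : X -> R) t d : 0 < t -> 0 <= d -> (\int[mu]_(x in A) (h x `^ t)%:E <= (d `^ t)%:E)%E ->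
  ((\int[mu]_(x in A) (h x `^ t)%:E) `^ t^-1 <= d%:E)%E.
 move=> t0 d0 hd; have -> : d%:E = (((d `^ t)%:E) `^ t^-1)%E.
  by rewrite poweR_EFin powRK// gtF.
 apply: poweR_mono => //; first by rewrite ige0 ltW.
 by apply: intge0 => x _; rewrite leF pge0.
by apply: lee_pmul; rewrite ?poweR_ge0//; exact: key.
Qed.

Lemma ae_of_null (P : X -> Prop) (N : set X) : measurable N -> mu N = 0 ->
 (forall x, ~ N x -> P x) -> {ae mu, forall x, P x}.
move=> mN N0 NP; exists N; split => // x /= Px; apply: contrapT => /NP; exact.
Qed.

(** The sum of the functions is integrable, hence finite almost everywhere, so its terms tend to 0.
    The pointwise conclusion avoids passing to subsequences later: the approximants are chosen with
    geometric error from the start. *)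
Lemma ae_vanish (a : nat -> X -> R) : (forall k, mfun (a k)) ->
 (forall k x, 0 <= a k x) ->
 (forall k, (\int[mu]_x (a k x)%:E <= (2 ^- k)%:E)%E) ->
 {ae mu, forall x, forall e : R, 0 < e -> exists k0, forall k, (k0 <= k)%N -> a k x <= e}.
move=> ma a0 aS; pose S x := (\sum_(0 <= k <oo) (a k x)%:E)%E.
have mS : mfun S.
 apply: mnneseries => [k|k x]; last by rewrite leF.
 exact/mEFin.
have S0 x : (0 <= S x)%E by apply: nneseries_ge0 => k _ _; rewrite leF.
have Sf : (\int[mu]_x S x < +oo)%E.
 rewrite integral_nneseries//; last by move=> k x _; rewrite leF.
 - apply: (@leltT _ _ (\sum_(0 <= k <oo) (2 ^- k)%:E)%E); first by apply: lesers => [k _ _|k _] //; apply: intge0 => x _; rewrite leF.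
  apply: (@leltT _ _ (2%:E : \bar R)); last by rewrite ltry.
  apply: lime_le; first by apply: is_cvg_nneseries => k _ _; rewrite leF ige0.
  apply: nearW => N; rewrite sumEFin leF.
  suff -> : \sum_(0 <= k < N) 2 ^- k = 2 - 2 * 2 ^- N :> R.
  by rewrite gerBl mge0// xge0.
  elim: N => [|N ih]; first by rewrite big_geq// invr1 mulr1 subrr.
  by rewrite big_nat_recr//= exprS invfM; lra.
 - by move=> k; exact/mEFin.
have iS : mu.-integrable setT S.
 apply/integrableP; split => //; under eqint do rewrite gee0_abs//; exact: Sf.
have := integrable_ae measurableT iS; apply: filterS => x /(_ I) Sx e e0.
apply: contrapT => /forallNP h.
suff : S x = +oo%E by move=> S1; rewrite S1 in Sx.
apply: contrapT => /eqP Soo.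
have cv : (\sum_(0 <= k < n) (a k x)%:E)%E @[n --> \oo] --> S x.
 by apply: is_cvg_nneseries => k _ _; rewrite leF.
have Sr : S x = (fine (S x))%:E by rewrite fineK.
have [k0 hk0] : exists k0, (S x - e%:E < \sum_(0 <= k < k0) (a k x)%:E)%E.
 apply: contrapT => /forallNP h2.
 have : (S x <= S x - e%:E)%E.
  apply: lime_le; first by apply/cvg_ex; exists (S x); exact: cv.
  by apply: nearW => n; rewrite leNgt; apply/negP.
 by rewrite Sr leF; lra.
have [k /not_implyP[kk0 /negP]] := (existsNP _).2 (h k0).
rewrite -ltNge => ek.
have : (\sum_(0 <= k < k0) (a k x)%:E + (a k x)%:E <= S x)%E.
 apply: (leU (\sum_(0 <= j < k.+1) (a j x)%:E)%E).
  rewrite big_nat_recr//=; apply: leeD => //.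
  rewrite [leRHS](big_cat_nat _ (n := k0))//=; apply: leeDl.
  by apply: sume_ge0 => j _; rewrite leF.
 by apply: (nneseries_lim_ge k.+1) => j _; rewrite leF.
apply/negP; rewrite -ltNge Sr; move: hk0; rewrite Sr sumEFin -EFinB -EFinD !lte_fin; lra.
Qed.

Lemma Lfun2P (f : X -> R) : f \in Lfun mu 2%:E <->
 mfun f /\ (sqint mu f < +oo)%E.
have E : (Lnorm mu 2%:E (EFin \o f) = sqint mu f `^ (2^-1))%E.
 rewrite unlock; congr (poweR _ _); apply: eqint => x _ /=.
 by rewrite powR_mulrn// real_normK ?num_real.
split => [/andP[]|[mf sf]].
 rewrite !inE /= /finite_norm E => mf sf; split => //.
 exact: lty_poweRy sf.
apply/andP; split; rewrite inE //= /finite_norm E.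
by apply: poweR_lty.
Qed.

Lemma Ln2_sqint (f : X -> R) : (Lnorm mu 2%:E (EFin \o f) `^ 2 = sqint mu f)%E.
rewrite poweR_Lnorm //; apply: eqint => x _ /=.
by rewrite powR_mulrn// real_normK ?num_real.
Qed.

End integral_tools.

(** * Transfer from the quasi-metric to the metric *)

Section metrized.
Context {R : realType} {dsp} {X : mType dsp}.
Variables (dist : X -> X -> R) (cd : R) (mu : meas X R).
Variables (rho : X -> X -> R) (e : R).
Hypotheses (hX : htype dist cd mu) (e0 : 0 < e) (rm : is_metric rho)
 (re : pwcmp rho dist e).
Local Notation b := (qball rho).
Local Notation dball := (qball dist).

Let dist0 x y : 0 <= dist x y := qm_ge0 (htqm hX) x y.

Lemma dbl_sub c t : 0 < t -> dball c t `<=` b c (t `^ e).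
move=> t0 y; rewrite /qball /= => cy; have /andP[h _] := re c y.
by apply: leltT h _; rewrite gt0_ltr_powR ?nnegrE ?dist0 ?(ltW t0).
Qed.

Lemma sub_dball c t : 0 < t -> b c (t / 2) `<=` dball c (t `^ e^-1).
move=> t0 y; rewrite /qball /= => cy; have /andP[_ h] := re c y.
rewrite -[ltLHS](powRK (t := e)) ?gtF//.
rewrite gt0_ltr_powR ?igt0 ?nnegrE ?pge0 ?(ltW t0)//.
by apply: leltT h _; rewrite mulrC -ltr_pdivlMr.
Qed.

Lemma qopen_metr U : qopen rho U <-> qopen dist U.
split=> oU x Ux; have [t t0 tU] := oU x Ux.
 exists (t `^ e^-1); first exact: pgt0.
 apply: subT tU; have h := @dbl_sub x _ (pgt0 e^-1 t0).
 by rewrite powRVK ?gtF ?ltW in h.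
exists (t `^ e / 2); first by rewrite dgt0 ?pgt0.
apply: subT tU; have h := @sub_dball x _ (pgt0 e t0).
by rewrite powRK ?gtF ?ltW in h.
Qed.

Lemma borel_metrized : @measurable dsp X = <<s [set U | qopen rho U] >>.
rewrite (ht_borel hX); congr (<<s _ >>); apply/seteqP.
by split=> U /qopen_metr.
Qed.

(** A metric ball of radius [s] lies between quasi-metric balls of radii [s^(1/e)] and
    [(2 s)^(1/e)]. Doubling a metric ball thus multiplies the quasi-metric radius by at most
    [4^(1/e) <= 2^m], that is by [m] doublings. *)
Lemma metrized_doubling : exists D, dspace rho mu D.
have [C hC] := ht_doubling hX; pose C' := Num.max 1 C.
have C1 : 1 <= C' by rewrite le_max lexx.
have C'0 : 0 < C' by lra.
have hC' x t : 0 < t -> (mu (dball x (2 * t)) <= C'%:E * mu (dball x t))%E.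
 move=> t0; apply: leT (hC _ _ t0) _; apply: leMr => //.
 by rewrite leF le_max lexx orbT.
have opn U : qopen rho U -> measurable U.
 by move=> oU; rewrite borel_metrized; exact: sub_sigma_algebra.
have mb x s : measurable (b x s).
 apply: opn => y; rewrite /qball /= => xy; exists (s - rho x y); first by rewrite subr_gt0.
 by move=> z /=; have := mttri rm y x z; lra.
have md x t : 0 < t -> measurable (dball x t) by exact: (htbm hX).
have mubd x s t : 0 < s -> 2 * s <= t -> (mu (b x s) <= mu (dball x (t `^ e^-1)))%E.
 move=> s0 st; have t0 : 0 < t by apply: ltleT st; rewrite mgt0.
 apply: lemu; rewrite ?inE//; first exact/md/pgt0.
 apply: subT (@sub_dball x t t0).
 by move=> y; rewrite /= => h; apply: ltleT h _; rewrite ler_pdivlMr// mulrC.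
have mudb x s : 0 < s -> (mu (dball x (s `^ e^-1)) <= mu (b x s))%E.
 move=> s0; apply: lemu; rewrite ?inE//; first exact/md/pgt0.
 by have h := @dbl_sub x _ (pgt0 e^-1 s0); rewrite powRVK ?gtF ?ltW in h.
have iter k x t : 0 < t -> (mu (dball x (2 ^+ k * t)) <= (C' ^+ k)%:E * mu (dball x t))%E.
 move=> t0; elim: k => [|k ih]; first by rewrite mul1r mul1e.
 rewrite !exprS -mulrA; apply: leT (hC' _ _ _) _; first by rewrite mgt0//.
 by rewrite EFinM -muleA; apply: leMl => //; rewrite ltW.
pose m := (Num.truncn (4 `^ e^-1 : R)).+1.
have m4 : 4 `^ e^-1 <= 2 ^+ m :> R.
 apply: (leU m%:R); first by rewrite ltW// truncnS_gt.
 by rewrite -natrX ler_nat ltnW// ltn_expl.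
exists (Num.max 2 (C' ^+ m)); split => //.
- move=> x s s0; apply/andP; split.
  apply: ltleT (mudb x s s0).
  by have /andP[] := htbmu hX x (pgt0 e^-1 s0).
 apply: (@leltT _ _ (mu (dball x ((2 * s) `^ e^-1)))).
  exact: mubd.
 have s2 : 0 < 2 * s by rewrite mgt0.
 by have /andP[] := htbmu hX x (pgt0 e^-1 s2).
- by rewrite le_max lexx.
- move=> x s s0; apply: (leU (mu (dball x ((4 * s) `^ e^-1)))).
  by apply: mubd; rewrite ?mgt0// mulrA -natrM.
 have s4 : 0 < s `^ e^-1 by exact: pgt0.
 apply: (leU (mu (dball x (2 ^+ m * s `^ e^-1)))).
  apply: lemu; rewrite ?inE; [|by apply: md; rewrite mgt0// xgt0|].
  by apply/md/pgt0; rewrite mgt0.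
  move=> y; rewrite /= => h; apply: ltleT h _.
  by rewrite powRM ?(ltW s0)// wMr// ltW.
 apply: leT (iter m x _ s4) _; apply: lee_pmul => //.
 + by rewrite leF xge0// ltW.
 + by rewrite leF le_max lexx orbT.
 + exact: mudb.
Qed.

Variable D : R.
Hypothesis ds : dspace rho mu D.

Lemma mu_dball_ge c t : 0 < t -> (mu (b c (t `^ e)) <= D%:E * mu (dball c t))%E.
move=> t0; have te : 0 < t `^ e by exact: pgt0.
rewrite (_ : t `^ e = 2 * (t `^ e / 2)); last by rewrite mulrC divfK.
apply: leT (ds_doubling ds _ _) _; first by rewrite dgt0.
apply: leMl; first by rewrite leF ltW// (D_gt0 ds).
apply: lemu; rewrite ?inE; first exact: (mball ds).
 exact: (htbm hX).
by have := @sub_dball c _ te; rewrite powRK// ?gtF// ltW.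
Qed.

(** Differentiation is available along quasi-metric balls. Such a ball of radius [t] sits in the
    metric ball of radius [t^e], whose measure is at most [D] times as large; this is the loss [D]
    in the threshold. *)
Lemma leb_metr (w : X -> R) : mfun w -> (forall x, 0 <= w x) ->
 (forall c s, 0 < s -> (\int[mu]_(x in b c s) (w x)%:E < +oo)%E) ->
 leb_upto rho mu D w.
move=> mw w0 wf.
have lint x t : 0 < t -> mu.-integrable (dball x t) (EFin \o w).
 move=> t0; apply/integrableP; split; first exact: mEFin.
 under eqint do rewrite /= ger0_norm//.
 apply: leltT (wf x _ (pgt0 e t0)); apply: isub => //.
 - exact: (htbm hX).
 - exact: (mball ds).
 - exact: dbl_sub.
have := ht_lebesgue hX mw lint; apply: filterS => x hx l s s0 lw.
have [l0|l0] := ltP l 0.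
 exists x, s; split => //; first exact: (ball_ctr ds).
 apply: (@ltleT _ _ 0%E); last by apply: intge0 => y _; rewrite leF.
 by rewrite lte_fin nmulr_rlt0// (vgt0 ds).
have [t [t0 ts ht]] : exists t, [/\ 0 < t, t `^ e <= s &
  ((D * l)%:E < avg mu (dball x t) (EFin \o w))%E].
 have n1 : \forall t \near (0:R)^'+, ((D * l)%:E < avg mu (dball x t) (EFin \o w))%E.
  apply: (hx [set y | ((D * l)%:E < y)%E]).
  by apply: open_nbhs_nbhs; split; [exact: open_ereal_gt_ereal|rewrite /=].
 have n2 : \forall t \near (0:R)^'+, t < s `^ e^-1 by apply: nbhs_right_lt; exact: pgt0.
 have n3 : \forall t \near (0:R)^'+, 0 < t by exact: nbhs_right_gt.
 have nn : \forall t \near (0:R)^'+, [/\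
  ((D * l)%:E < avg mu (dball x t) (EFin \o w))%E, t < s `^ e^-1 & 0 < t].
  by apply: filterS3 n1 n2 n3 => t.
 have [t [ht1 ht2 ht3]] := @filter_ex _ _ (at_right_proper_filter (0:R)) _ nn.
 exists t; split => //; rewrite -[s](powRVK (t := e)) ?gtF ?(ltW s0)//.
 by apply: ge0_ler_powR; rewrite ?nnegrE ?pge0// ltW.
have te : 0 < t `^ e by exact: pgt0.
exists x, (t `^ e); split => //; first exact: (ball_ctr ds).
have mB := htbm hX x t0; have /andP[B0 Bf] := htbmu hX x t0.
apply: (@ltleT _ _ (\int[mu]_(y in dball x t) (w y)%:E)%E); last first.
 by apply: isub => //; [exact: (mball ds)|exact: dbl_sub].
have Bfin : mu (dball x t) \is a fin_num by rewrite ge0fin.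
move: ht; rewrite /avg; set I := (\int[mu]_(y in _) _)%E.
have mE : mu (dball x t) = (fine (mu (dball x t)))%:E by rewrite fineK.
set m := fine _ in mE; have m0 : 0 < m by rewrite -lte_fin -mE.
rewrite mE inver gtF// muleC lte_pdivlMr// -EFinM => h.
apply: leltT h; have := mu_dball_ge x t0.
rewrite (mu_ball ds)// mE !leF => h.
by apply: leT (wMl l0 h) _; rewrite mulrCA mulrA.
Qed.

End metrized.

Section product_measurability.
Context {R : realType} {dsp} {X : mType dsp}.
Variables (rho : X -> X -> R) (mu : meas X R) (D : R).
Hypothesis ds : dspace rho mu D.
Local Notation b := (qball rho).

(** Balls of integer radius make [mu] sigma-finite; the measure is repackaged with this structure,
    to which the Tonelli theorem applies. *)
Lemma tonelli (f : X * X -> \bar R) : mfun f -> (forall z, (0 <= f z)%E) ->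
 (\int[mu]_x \int[mu]_y f (x, y) = \int[mu]_y \int[mu]_x f (x, y))%E.
move=> mf f0.
have sf : sigma_finite setT mu.
 exists (fun n => b point n%:R); first by rewrite (ball_cover rho).
 by move=> n; split; [exact: (mball ds)|exact: (muB_lty ds)].
pose H1 := isSFinite.Build _ _ _ _ (sfinite_measure_sigma_finite sf).
pose H2 := isSigmaFinite.Build _ _ _ _ sf.
pose mu' : {sigma_finite_measure set X -> \bar R} :=
 HB.pack_for (SigmaFiniteMeasure.type X R) (Measure.sort mu) H1 H2.
have E : mu = mu' :> measure X R by exact: eq_measure.
by rewrite E; exact: fubini_tonelli.
Qed.

Lemma net_seq t : 0 < t -> exists z : nat -> X, forall x, exists n, rho (z n) x < t.
move=> t0; have [|z [_ _ zc]] := @vitali _ _ _ _ _ _ ds point [set y : X * R | y.2 = t / 5] (t / 5).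
 by move=> z /= ->; rewrite lexx; lra.
exists (fun n => (z n).1) => x; have [n [zn _ h]] := zc (x, t / 5) erefl.
exists n; have := h x; rewrite zn /qball /= (_ : 5 * (t / 5) = t); last by lra.
by apply; rewrite (mtrefl (dsmt ds)); lra.
Qed.

(** The space is separable by the Vitali lemma, so two distinct points are separated by a countable
    family of rectangles, each the product of a small ball with its complement. *)
Lemma moffdiag : measurable [set xy : X * X | xy.1 <> xy.2].
have ex m : exists z : nat -> X, forall x, exists n, rho (z n) x < m.+1%:R^-1.
 by apply: net_seq.
have [z hz] := choice ex.
have -> : [set xy : X * X | xy.1 <> xy.2] =
  \bigcup_m \bigcup_n (b (z m n) m.+1%:R^-1 `*` ~` b (z m n) m.+1%:R^-1).
 apply/seteqP; split => [[x y] /= xy|[x y] [m _ [n _]] [h1 h2] xy].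
  have d0 : 0 < rho x y.
  by apply: (mtpos (dsmt ds)).
  pose m := Num.truncn (2 / rho x y); have hm : m.+1%:R^-1 < rho x y / 2.
  rewrite -[ltRHS]invf_div ltf_pV2 ?posrE ?dgt0//; exact: truncnS_gt.
  have [n hn] := hz m x; exists m => //; exists n; split => //=.
  apply/negP; rewrite -leNgt.
  have := mttri (dsmt ds) (z m n) x y.
  rewrite (mtsym (dsmt ds) x (z m n)); move: hm hn.
  by move: (m.+1%:R^-1 : R) => q; lra.
 by apply: h2; rewrite -xy.
apply: mbigcup => m _; apply: mbigcup => n _.
apply: measurableX; first exact: (mball ds).
by apply: measurableC; exact: (mball ds).
Qed.

Variable K : X -> X -> R.
Hypothesis mK : measurable_fun [set xy : X * X | xy.1 <> xy.2] (fun xy => K xy.1 xy.2).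

(** The kernel set to 0 on the diagonal, in order to be measurable on the whole product. *)
Definition offdiag (x y : X) : R := K x y * \1_[set xy : X * X | xy.1 <> xy.2] (x, y).

Lemma offdiagE x y : x <> y -> offdiag x y = K x y.
by move=> xy; rewrite /offdiag indicE mem_set// mulr1. Qed.

Lemma moffdiagK : mfun (fun xy : X * X => offdiag xy.1 xy.2).
have mo := moffdiag.
suff -> : (fun xy : X * X => offdiag xy.1 xy.2) =
  (fun xy => K xy.1 xy.2) \_ [set xy : X * X | xy.1 <> xy.2].
 by apply/(measurable_restrictT _ mo).
apply/funext => -[x y]; rewrite /offdiag patchE indicE /=.
by case: (_ \in _); rewrite ?mulr1 ?mulr0.
Qed.

Lemma mker1 x : mfun (offdiag x).
by apply: (mcomp moffdiagK (measurable_pair1 x)).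
Qed.

Lemma mker2 y : mfun (offdiag^~ y).
by apply: (mcomp moffdiagK (measurable_pair2 y)).
Qed.

End product_measurability.

Lemma powR_ge1 {R : realType} (x a : R) : 1 <= x -> 0 <= a -> 1 <= x `^ a.
by move=> x1 a0; rewrite -[leLHS](powRr0 x); apply: ler_powR. Qed.

Lemma hconj_gt1 {R : realType} (r : R) : 1 < r ->
 hconj r%:E = (r / (r - 1))%:E.
move=> r1; rewrite /hconj /= eqe gtF ?(lt_trans ltr01)//.
by rewrite -EFinD inver subr_eq0 gtF// -EFinM.
Qed.

(** * The Hormander condition, the kernel representation and local oscillation of [T f] *)

Section oscillation.
Context {R : realType} {dsp} {X : mType dsp}.
Variables (mu : meas X R).

Lemma tavg_ge0 (t : \bar R) B g : (0 < mu B)%E -> measurable B -> (0 <= tavg mu t B g)%E.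
move=> B0 mB; case: t => [t| |]; rewrite ?poweR_ge0//; apply: ess_sup_gee.
 by apply: ltleT B0 _; apply: lemu; rewrite ?inE.
by apply: nearW => x; rewrite patchE; case: ifP.
Qed.

(** Hoelder's inequality with exponents [r'] and [r], uniformly in [r >= 1]: for [r = 1] the average
    is an essential supremum. Finiteness of the right factor excludes an infinite supremum. *)
Lemma tavg_hoelder (r : R) (B : set X) (a h : X -> R) (N m : R) : 1 <= r ->
 measurable B -> mu B = m%:E -> 0 < m -> mfun a -> mfun h ->
 0 <= N -> (\int[mu]_(x in B) (`|h x| `^ r)%:E <= (N `^ r * m)%:E)%E ->
 (mu B * tavg mu (hconj r%:E) B a < +oo)%E ->
 (\int[mu]_(x in B) (`|a x| * `|h x|)%:E <=
  N%:E * (mu B * tavg mu (hconj r%:E) B a))%E.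
move=> r1 mB Bm m0 ma mh N0 hN fin.
have mna : mfun (fun x => `|a x|) by exact: mcomp.
have mnh : mfun (fun x => `|h x|) by exact: mcomp.
move: r1; rewrite le_eqVlt => /predU1P[r1|r1]; last first.
 rewrite (hconj_gt1 r1) /=; set r' := r / (r - 1).
 have r0 : 0 < r by lra.
 have r'0 : 0 < r' by rewrite dgt0// subr_gt0.
 have rr' : r'^-1 + r^-1 = 1.
  by rewrite invf_div; field; rewrite gtF.
 apply: leT (int_hoelder mu mB mna mnh (fun=> normr_ge0 _) (fun=> normr_ge0 _) r'0 r0 rr') _.
 set I := (\int[mu]_(x in B) (`|a x| `^ r')%:E)%E.
 have I0 : (0 <= I)%E by apply: intge0 => x _.
 rewrite /avg -/I Bm inver (gtF m0) poweRM//; last by rewrite leF ige0 ltW.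
 apply: (leU (I `^ r'^-1 * (N * m `^ r^-1)%:E)%E).
  apply: leMl; first exact: poweR_ge0.
  have -> : (N * m `^ r^-1)%:E = (((N `^ r * m)%:E) `^ r^-1)%E.
  by rewrite poweR_EFin powRM ?pge0 ?(ltW m0)// powRK ?gtF.
  apply: poweR_mono; [by rewrite ige0 ltW| |exact: hN].
  by apply: intge0 => x _; rewrite leF.
 rewrite [leLHS]muleC !muleA -!EFinM; apply: eqW.
 congr (_%:E * _)%E.
 have -> : m^-1 `^ r'^-1 = m `^ (r^-1 - 1).
  have -> : r^-1 - 1 = - r'^-1 by lra.
  by rewrite -powR_inv1 ?(ltW m0)// -powRrM mulN1r.
 rewrite -mulrA; congr (_ * _); rewrite -{2}[m]powRr1 ?(ltW m0)// -powRD.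
  by congr (_ `^ _); ring.
 by apply/implyP => _; rewrite gtF.
move: hN fin; rewrite -r1 hoelder_conjugate1 /= powRr1// => hN.
have := @tavg_ge0 +oo%E B a; rewrite /= Bm => /(_ m0 mB).
rewrite /ess_sup_on; set es := ess_sup _ _ => es0 fin.
have esf : es \is a fin_num.
 rewrite ge0fin// ltey; apply/eqP => esy; move: fin.
 by rewrite esy gt0_muley.
have esP : {ae mu, forall x, B x -> (`|a x|%:E <= es)%E}.
 have := ess_sup_ge mu ((fun y : X => `|a y|%:E) \_ B); apply: filterS => x.
 by rewrite patchE => /[swap] Bx; rewrite mem_set.
move: es0 esP; rewrite -(fineK esf); set E := fine es; rewrite leF => E0 esP.
apply: (leU (\int[mu]_(x in B) (E * `|h x|)%:E)%E).
 apply: ae_ge0_le_integral => //.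
 - by apply: mEFin; exact: mfM.
 - by move=> x _; rewrite leF mge0.
 - by apply: mEFin; exact: mfM.
 - by apply: filterS esP => x h1 /h1; rewrite !leF => h2; exact: wMr.
rewrite intZ//; apply: (leU (E%:E * (N * m)%:E)%E).
 apply: leMl => //.
 by apply: leT hN; apply: int_le => // [|x _]; rewrite ?powRr1//; under eq_fun do rewrite powRr1//.
by rewrite -!EFinM leF mulrC mulrA.
Qed.
End oscillation.

Section hormander_condition.
Context {R : realType} {dsp} {X : mType dsp}.
Variables (dist : X -> X -> R) (cd : R) (mu : meas X R).
Variables (rho : X -> X -> R) (e D : R).
Hypotheses (hX : htype dist cd mu) (e0 : 0 < e) (rm : is_metric rho)
 (re : pwcmp rho dist e)
 (ds : dspace rho mu D).
Local Notation b := (qball rho).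
Local Notation dball := (qball dist).

(* [dball c (2 cd (2 s)^(1/e))] lies between [b c s], even dilated by [2 cd], and
 [b c (osc_dil * s)]. *)
Definition osc_dil : R := 2 * (2 * cd) `^ e.

Variables (r : R) (K : X -> X -> R) (H : R).
Hypotheses (r1 : 1 <= r)
 (mK : measurable_fun [set xy : X * X | xy.1 <> xy.2] (fun xy => K xy.1 xy.2))
 (KH : (hormander_const dist cd mu (hconj r%:E) K <= H%:E)%E).

(** The Hormander sum over dyadic quasi-metric annuli, with Hoelder's inequality on each of them.
    The bound on the means of [h] passes from metric balls to quasi-metric ones at the cost of
    [D]. *)
Lemma ker_osc c s x z (h : X -> R) (N : R) : 0 < s -> b c s x -> b c s z ->
 mfun h -> 0 <= N ->
 (forall t, s <= t -> (\int[mu]_(y in b c t) (`|h y| `^ r)%:E <= (N `^ r * vol rho mu c t)%:E)%E) ->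
 (\int[mu]_(y in ~` b c (osc_dil * s)) (`|offdiag K x y - offdiag K z y| * `|h y|)%:E <=
  (H * D * N)%:E)%E.
move=> s0 xs zs mh N0 hN.
have cd1 : 1 <= cd := qm_const (htqm hX).
have cd0 : 0 < 2 * cd by lra.
have cd2 : 1 <= 2 * cd by lra.
have s2 : 0 < 2 * s by lra.
pose tau := 2 * cd * (2 * s) `^ e^-1.
have tau0 : 0 < tau by rewrite mgt0// pgt0.
have taue : tau `^ e = osc_dil * s.
 rewrite powRM ?pge0 ?(ltW cd0)// powRVK ?gtF ?(ltW s2)//.
 by rewrite mulrCA mulrA.
have inner y : b c s y -> dball c (tau / (2 * cd)) y.
 move=> cy; rewrite mulrAC mulfV ?gtF// mul1r.
 apply: (sub_dball hX e0 re s2); move: cy; by rewrite /= [2 * s]mulrC mulfK.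
have D1 : 1 <= D by apply: leT (dsC ds); rewrite ler1n.
have D0 := D_gt0 ds.
pose B k := dball c (2 ^+ k * tau).
have t0 k : 0 < 2 ^+ k * tau by rewrite mgt0//.
have mB k : measurable (B k) by exact: (htbm hX).
pose A k := B k `\` B k.-1.
have mA k : measurable (A k) by exact: measurableD.
pose a y := offdiag K x y - offdiag K z y.
have ma : mfun a.
 by apply: mfB; exact: (mker1 ds mK).
pose m k := fine (mu (B k)).
have Bm k : mu (B k) = (m k)%:E.
 by rewrite fineK// ge0fin; have /andP[] := htbmu hX c (t0 k).
have m0 k : 0 < m k by rewrite -lte_fin -Bm; have /andP[] := htbmu hX c (t0 k).
pose S k := (mu (B k) * tavg mu (hconj r%:E) (B k) (fun y => a y * \1_(A k) y)%R)%E.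
have S0 k : (0 <= S k)%E.
 by rewrite mule_ge0// tavg_ge0// Bm lte_fin.
have SH : (\sum_(0 <= k <oo) S k.+1 <= H%:E)%E.
 apply: leT KH; apply: esupub; exists c, tau, x, z; split; [exact: tau0|exact: inner|exact: inner|].
  under eq_eseriesr do rewrite -addn1.
  rewrite (nneseries_addn 1 S0); congr (limn _); apply/funext => n.
  apply: eq_big_nat => k /andP[k1 _]; congr (_ * tavg _ _ _ _)%E.
  apply/funext => y; rewrite indicE; have [|_] := boolP (y \in A k); last by rewrite !mulr0.
  rewrite inE => -[_ yB]; rewrite !mulr1 /a.
  (* On an annulus [y] differs from both points of the small ball, so the kernel values are taken
     off the diagonal. *)
  have neq w : b c s w -> w <> y.
  move=> /inner ws wy; apply: yB; rewrite -wy; move: ws; rewrite /B /qball /= => ws.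
  apply: (ltleT ws); apply: (leU tau).
  rewrite lepdM// ler_peMr ?(ltW tau0)//.
  by rewrite ler_peMl ?(ltW tau0)// exprn_ege1// ler1n.
  by rewrite !offdiagE//; exact: neq.
have Sf k : (S k.+1 < +oo)%E.
 apply: (@leltT _ _ H%:E); last exact: ltry.
 by apply: leT SH; exact: (nnes_ge (f := fun k => S k.+1)).
have mna : mfun (fun y => `|a y| * `|h y|).
 by apply: mfM; exact: mcomp.
apply: leT (int_cov_le mu (F := fun k => A k.+1) _ _ _ mna _) _ => //.
- by apply: measurableC; exact: (mball ds).
- move=> y yb.
 have [k hk] : exists k, B k y.
  exists (Num.truncn (dist c y / tau)).+1; rewrite /B /qball /= -ltr_pdivrMr//.
  apply: ltleT (truncnS_gt _) _; rewrite -natrX ler_nat ltnW// ltn_expl//.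
 have [|k0 kB kmin] := @ex_minnP (fun k => `[< B k y >]); first by exists k; apply/asboolP.
 case: k0 kB kmin => [/asboolP B0|k0 /asboolP kB kmin].
  exfalso; apply: yb; rewrite -taue; apply: (dbl_sub hX e0 re tau0).
  by move: B0; rewrite /B mul1r.
 exists k0; split => //= Bk; have /kmin : `[< B k0 y >] by apply/asboolP.
 by rewrite ltnn.
apply: (leU (\sum_(0 <= k <oo) (D * N)%:E * S k.+1)%E).
 apply: lesers => [k _ _|k _]; first by apply: intge0 => y _; rewrite leF.
 have mak : mfun (fun y => a y * \1_(A k.+1) y) by exact: mMindic.
 apply: leT (tavg_hoelder r1 (mB k.+1) (Bm _) (m0 _) mak mh _ _ (Sf k)); last 2 first.
 - by rewrite mge0// ltW.
 - have te : 0 < (2 ^+ k.+1 * tau) `^ e by exact: pgt0.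
  apply: (leU (\int[mu]_(y in b c ((2 ^+ k.+1 * tau) `^ e)) (`|h y| `^ r)%:E)%E).
  apply: isub => //.
  - exact: (mball ds).
  - by apply: mpowR; exact: mcomp.
  - exact: (dbl_sub hX e0 re).
  apply: leT (hN _ _) _.
  rewrite powRM ?(ltW tau0)// taue mulrA ler_peMl ?(ltW s0)//.
  have o1 : 1 <= osc_dil.
  rewrite -[leLHS]mulr1; apply: ler_pM; rewrite ?ler1n//.
  by apply: powR_ge1 => //; exact: ltW.
  rewrite -[leLHS]mulr1; apply: ler_pM => //; apply: powR_ge1; last exact: ltW.
  by rewrite exprn_ege1// ler1n.
  rewrite leF [(D * N) `^ r]powRM ?(ltW D0)// [D `^ r * _]mulrC -[leRHS]mulrA wMl ?pge0//.
  have := mu_dball_ge hX e0 re ds c (t0 k.+1).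
  rewrite (mu_ball ds)// Bm leF => h1; apply: leT h1 _.
  rewrite wMr ?(ltW (m0 _))// -{1}[D]powRr1 ?(ltW D0)// ler_powR//.
 apply: (leU (\int[mu]_(y in A k.+1) (`|a y * \1_(A k.+1) y| * `|h y|)%:E)%E).
  apply: eqW; apply: eqint => y Ay.
  by rewrite indicE Ay mulr1.
 apply: isub => //; last by move=> y [].
 - by apply: mfM; exact: mcomp.
rewrite nneseriesZl//; apply: leT (leMl _ SH) _; first by rewrite leF mge0// ltW.
by rewrite -EFinM leF mulrC mulrA.
Qed.

End hormander_condition.
Section bdsupp.
Context {R : realType} {dsp} {X : mType dsp}.
Variables (rho : X -> X -> R) (mu : meas X R) (D : R).
Hypothesis ds : dspace rho mu D.
Local Notation b := (qball rho).

Definition bdsupp (f : X -> R) : Prop := [/\ mfun f,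
 exists M, forall x, `|f x| <= M & exists c s, forall x, ~ b c s x -> f x = 0].

Lemma bdsupp_lin (a : R) f g : bdsupp f -> bdsupp g ->
 bdsupp (fun x => a * f x + g x).
move=> [mf [M fM] [c [s fs]]] [mg [M' gM] [c' [s' gs]]]; split.
- by apply: mfD => //; exact: mfM.
- exists (`|a| * M + M') => x; apply: leT (ler_normD _ _) _; rewrite normrM.
 by apply: lerD => //; exact: wMl.
- exists c, (Num.max s (rho c' c + s')) => x xn; rewrite fs ?gs ?mulr0 ?addr0//.
  by move=> xs; apply: xn; apply: (bsub ds) xs; rewrite le_max lexx orbT.
 move=> xs; apply: xn; apply: (bsub ds) xs.
 by rewrite (mtrefl (dsmt ds)) add0r le_max lexx.
Qed.

Lemma bdsupp_indic f A : bdsupp f -> measurable A ->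
 bdsupp (fun x => f x * \1_A x).
move=> [mf [M fM] [c [s fs]]] mA; split.
- exact: mMindic.
- exists M => x; rewrite normrM; apply: leT (fM x); rewrite ler_piMr// indicE.
 by case: (_ \in _); rewrite ?normr0 ?normr1.
- by exists c, s => x /fs ->; rewrite mul0r.
Qed.

Lemma bdsupp_ball c s : bdsupp (\1_(b c s)).
split; first exact: mindic (mball ds c s).
- by exists 1 => x; rewrite indicE; case: (_ \in _); rewrite ?normr0 ?normr1.
- by exists c, s => x xs; rewrite indicE memNset.
Qed.

Lemma sqint_bounded f : bdsupp f -> (sqint mu f < +oo)%E.
move=> [mf [M fM] [c [s fs]]].
have M0 : 0 <= M by apply: leT (fM point).
have mb := mball ds c s.
apply: (@leltT _ _ ((M ^+ 2)%:E * mu (b c s))%E).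
 apply: sq_le_indic => // x; rewrite indicE; case: (boolP (x \in _)) => [_|]; first by rewrite mulr1.
 by rewrite notin_setE => /fs ->; rewrite normr0 mulr0.
by apply: lte_mul_pinfty; rewrite ?leF ?sqr_ge0// (muB_lty ds).
Qed.

Lemma int_fin (g : X -> R) (O : set X) (M : R) : measurable O -> (mu O < +oo)%E ->
 mfun g -> 0 <= M -> (forall x, `|g x| <= M * \1_O x) ->
 mu.-integrable setT (EFin \o g).
move=> mO Ofin mg M0 gM; apply/integrableP; split; first exact: mEFin.
apply: (@leltT _ _ (\int[mu]_x (M * \1_O x)%:E)%E).
 apply: int_le => //; first exact: mcomp.
 by apply: mfM => //.
by rewrite intZ// intindic// setIT; apply: lte_mul_pinfty; rewrite ?leF.
Qed.

Lemma intB_EFin (f g : X -> R) : mu.-integrable setT (EFin \o f) ->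
 mu.-integrable setT (EFin \o g) -> mu.-integrable setT (EFin \o (fun x => f x - g x)).
move=> fi gi; have -> : EFin \o (fun x => f x - g x) = ((EFin \o f) \- (EFin \o g))%E.
 by apply/funext => x /=.
exact: integrableB.
Qed.

Lemma normr_Rint_le (g : X -> R) (B : R) : mu.-integrable setT (EFin \o g) ->
 (\int[mu]_x `|g x|%:E <= B%:E)%E -> `|Rintegral mu setT g| <= B.
move=> ig gB; rewrite -leF EFin_normr_Rintegral//.
by apply: leT gB; apply: le_abse_integral => //; case/integrableP: ig.
Qed.

(** Young's inequality [|a| <= eps + a^2 / eps] on the set [O] that carries [a]. *)
Lemma int_abs_small (a : X -> R) (O : set X) (m eps : R) : measurable O -> (mu O <= m%:E)%E ->
 mfun a -> (forall x, ~ O x -> a x = 0) -> 0 < eps ->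
 (sqint mu a <= (eps ^+ 2)%:E)%E -> (\int[mu]_x `|a x|%:E <= (eps * (m + 1))%:E)%E.
move=> mO Om ma aO e0 sa.
apply: (leU (\int[mu]_x (eps * \1_O x + eps^-1 * a x ^+ 2)%:E)%E).
 apply: int_le => //; first exact: mcomp.
  apply: mfD; first by apply: mfM.
  by apply: mfM => //; exact: measurable_funX.
 move=> x _; rewrite indicE; case: (boolP (x \in O)) => [_|]; last first.
  rewrite notin_setE => /aO ->; rewrite normr0 mulr0 expr2 mul0r mulr0 addr0//.
 rewrite mulr1 -(ler_pM2l e0) mulrDr mulrA mulfV ?gtF// mul1r.
 rewrite -[a x ^+ 2]real_normK ?num_real//.
 by have := sqr_ge0 (`|a x| - eps); have := sqr_ge0 eps; have := sqr_ge0 `|a x|; nra.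
have i0 : 0 <= eps^-1 by rewrite ige0 ltW.
rewrite intD//; last 4 first.
- by apply: mfM => //.
- by apply: mfM => //; exact: measurable_funX.
- by move=> x; rewrite mge0 ?(ltW e0).
- by move=> x; rewrite mge0 ?sqr_ge0.
rewrite intZ ?(ltW e0)// intindic// setIT intZ//; last 2 first.
- exact: measurable_funX.
- by move=> x; exact: sqr_ge0.
rewrite mulrDr mulr1 EFinD; apply: leeD.
 by rewrite EFinM; apply: leMl => //; rewrite ltW.
apply: leT (leMl _ sa) _ => //.
by rewrite -EFinM leF expr2 mulKf// gtF.
Qed.

End bdsupp.

Section kernel_operator.
Context {R : realType} {dsp} {X : mType dsp}.
Variables (dist : X -> X -> R) (cd : R) (mu : meas X R).
Variables (rho : X -> X -> R) (e D : R).
Hypotheses (hX : htype dist cd mu) (e0 : 0 < e) (rm : is_metric rho)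
 (re : pwcmp rho dist e)
 (ds : dspace rho mu D).
Local Notation b := (qball rho).
Variables (r : R) (T : (X -> R) -> X -> R) (K : X -> X -> R) (C2 Ck : R).
Hypotheses (r1 : 1 <= r)
 (Tlin : forall (a : R) f g, f \in Lfun mu 2%:E -> g \in Lfun mu 2%:E ->
  {ae mu, forall x, T (fun y => a * f y + g y)%R x = (a * T f x + T g x)%R})
 (C20 : 0 <= C2)
 (Tbd : forall f, f \in Lfun mu 2%:E -> mfun (T f) /\
  (sqint mu (T f) <= C2%:E * sqint mu f)%E)
 (mK : measurable_fun [set xy : X * X | xy.1 <> xy.2] (fun xy => K xy.1 xy.2))
 (Ksize : forall x y, x <> y -> (`|K x y|%:E <= Ck%:E / mu (qball dist x (dist x y)))%E)
 (Krep : forall f, qcontinuous dist f -> qbounded dist (qsupp dist f) ->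
  f \in Lfun mu 2%:E ->
  {ae mu, forall x, ~ qsupp dist f x ->
  T f x = Rintegral mu setT (fun y => K x y * f y)%R}).
Local Notation K0 := (offdiag K).

Lemma Lfun_bd f : bdsupp rho f -> f \in Lfun mu 2%:E.
by move=> fb; apply/Lfun2P; split; [case: fb|exact: (sqint_bounded ds)]. Qed.

Lemma ker_bd (x : X) (d : R) : 0 < d ->
 exists2 M, 0 <= M & forall y, d <= rho x y -> `|K0 x y| <= M.
move=> d0; pose t := d `^ e^-1; have t0 : 0 < t by exact: pgt0.
pose m := fine (mu (qball dist x t)).
have mE : mu (qball dist x t) = m%:E.
 by rewrite fineK// ge0fin//; have /andP[] := htbmu hX x t0.
have m0 : 0 < m by rewrite -lte_fin -mE; have /andP[] := htbmu hX x t0.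
exists (`|Ck| / m); first by rewrite dge0// ltW.
move=> y xy; have nxy : x <> y.
 by move=> nxy; move: xy; rewrite nxy (mtrefl rm) leNgt d0.
rewrite offdiagE// -leF; apply: leT (Ksize nxy) _.
have tle : t <= dist x y.
 apply: (powR_inv_le e0) => //; first exact: ltW.
  exact: (qm_ge0 (htqm hX)).
 by rewrite powRVK ?gtF ?(ltW d0)//; apply: leT xy _; have /andP[] := re x y.
have dxy : 0 < dist x y by exact: ltleT tle.
have /andP[b0 bf] := htbmu hX x dxy.
have mle : (m%:E <= mu (qball dist x (dist x y)))%E.
 rewrite -mE; apply: lemu; rewrite ?inE; try exact: (htbm hX).
 by move=> z; rewrite /qball /= => h; exact: ltleT h tle.
have bfin : mu (qball dist x (dist x y)) \is a fin_num by rewrite ge0fin.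
move: b0 mle; rewrite -(fineK bfin); set q := fine _; rewrite lte_fin leF => q0 mq.
rewrite inver gtF// -EFinM leF; apply: (leU (`|Ck| / q)).
 by rewrite wMr ?ler_norm// ige0 ltW.
by rewrite wMl// lef_pV2 ?posrE.
Qed.

Lemma ker_int h x (d : R) : bdsupp rho h -> 0 < d ->
 (forall y, h y != 0 -> d <= rho x y) ->
 mu.-integrable setT (EFin \o (fun y => K0 x y * h y)).
move=> [mh [M hM] [c [s hs]]] d0 hd; have [Mx Mx0 KM] := ker_bd x d0.
have M0 : 0 <= M by apply: leT (hM point).
apply: (@int_fin _ _ _ mu _ (b c s) (Mx * M)).
- exact: (mball ds).
- exact: (muB_lty ds).
- by apply: mfM => //; exact: (mker1 ds mK).
- exact: mge0.
- move=> y; have [->|hy] := eqVneq (h y) 0; first by rewrite mulr0 normr0 !mge0.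
 have bys : b c s y by apply: contrapT => /hs h0; move: hy; rewrite h0 eqxx.
 by rewrite indicE mem_set// mulr1 normrM ler_pM// KM// hd.
Qed.

(** The formula is given only for continuous functions. Approximate [h] in L^2 by Lipschitz
    functions supported within [d/2] of its support: by L^2 boundedness [T] of the approximants
    converges almost everywhere, and their kernel integrals converge since the kernel from a point
    of [A] is bounded at distance at least [d/2]. *)
Lemma ker_repr h (A : set X) (d : R) : bdsupp rho h -> 0 < d ->
 (forall x y, A x -> h y != 0 -> d <= rho x y) ->
 {ae mu, forall x, A x -> T h x = Rintegral mu setT (fun y => K0 x y * h y)}.
move=> bh d0 hd; have [mh [M hM] [c [s hs]]] := bh.
have r0 := mtge0 rm; have rsym := mtsym rm; have rtri := mttri rm.
pose O := [set y | exists2 y', h y' != 0 & rho y' y < d / 2].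
have oO : qopen rho O.
 move=> y [y' hy' yy]; exists (d / 2 - rho y' y); first by rewrite subr_gt0.
 move=> z; rewrite /qball /= => yz; exists y' => //.
 by apply: leltT (rtri y y' z) _; rewrite -ltrBrDl.
have Ob : O `<=` b c (s + d).
 move=> y [y' hy' yy]; have cy' : rho c y' < s.
  by apply: contrapT => h0; move: hy'; rewrite hs ?eqxx.
 rewrite /qball /=; apply: leltT (rtri y' c y) _; apply: ltrD => //.
 by apply: ltleT yy _; rewrite lepdM// ler_peMr ?(ltW d0)// ler1n.
have mO : measurable O by exact: (ds_open ds).
have Of : (mu O < +oo)%E.
 apply: (@leltT _ _ (mu (b c (s + d)))); last exact: (muB_lty ds).
 by apply: lemu; rewrite ?inE//; exact: (mball ds).
have hO x : ~ O x -> h x = 0.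
 move=> Ox; apply/eqP; apply: contrapT => /negP hx; apply: Ox; exists x => //.
 by rewrite (mtrefl rm) dgt0.
have AO x y : A x -> O y -> d / 2 <= rho x y.
 move=> Ax [y' hy' yy]; have := hd _ _ Ax hy'; have := rtri y x y'; rewrite (rsym y) => t1 t2.
 have := leT t2 t1; rewrite -lerBlDr; apply: leT.
 by rewrite lerBrDr -lerBrDl (_ : d - d / 2 = d / 2) ?(ltW yy)//; field.
have [_ ap] := approx_bd ds oO Of (borel_metrized hX e0 re) mh hM hO.
have C21 : 0 < C2 + 1 by rewrite ltr_wpDl.
(* The squared error [4^-k / (C2 + 1)] makes both the error and its image under [T] summable, so
   convergence holds almost everywhere without subsequences. *)
have ek k : 0 < 2 ^- k ^+ 2 / (C2 + 1) :> R by rewrite dgt0// xgt0// igt0 xgt0.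
have phi_ex k : exists p, test_fun rho O p /\
  (sqint mu (fun x => p x - h x)%R <= (2 ^- k ^+ 2 / (C2 + 1))%:E)%E.
 by have [p ? ?] := ap _ (ek k); exists p.
have [phi hphi] := choice phi_ex.
pose g k y := -1 * h y + phi k y.
have bphi k : bdsupp rho (phi k).
 have [tp _] := hphi k; have [_ p0 pM] := tp; split => //.
  exact: (test_meas ds tp).
 by exists c, (s + d) => x xb; apply: p0 => /Ob.
have bg k : bdsupp rho (g k) by exact: (bdsupp_lin ds).
have gE k : g k = (fun x => phi k x - h x) by apply/funext => x; rewrite /g mulN1r addrC.
have sg k : (sqint mu (g k) <= (2 ^- k ^+ 2 / (C2 + 1))%:E)%E by rewrite gE; case: (hphi k).
have p2 k : 0 < 2 ^- k :> R by rewrite igt0 xgt0.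
have sg' k : (sqint mu (g k) <= (2 ^- k ^+ 2)%:E)%E.
 apply: leT (sg k) _; rewrite leF lepdM// ler_peMr ?sqr_ge0//.
 by rewrite lerDr.
have gO k y : ~ O y -> g k y = 0.
 move=> Oy; rewrite /g hO// mulr0 add0r; have [[_ p0 _] _] := hphi k; exact: p0.
have mTg k : mfun (T (g k)) by case: (Tbd (Lfun_bd (bg k))).
have v1 : {ae mu, forall x, forall eps : R, 0 < eps ->
  exists k0, forall k, (k0 <= k)%N -> T (g k) x ^+ 2 <= eps}.
 apply: ae_vanish; first by move=> k; exact: msqr.
  by move=> k x; exact: sqr_ge0.
 move=> k; have [_ h1] := Tbd (Lfun_bd (bg k)); apply: leT h1 _.
 apply: leT (leMl _ (sg k)) _; first by rewrite leF.
 rewrite -EFinM leF mulrCA -[leRHS]mulr1; apply: ler_pM.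
 - exact: sqr_ge0.
 - by rewrite dge0// ltW.
 - by rewrite expr2 ler_piMl ?(ltW (p2 k))// invf_le1 ?xgt0// exprn_ege1// ler1n.
 - by rewrite lepdM// mul1r lerDl.
have v2 : {ae mu, forall x, forall k, T (g k) x = -1 * T h x + T (phi k) x}.
 apply: ae_foralln => k; apply: Tlin; exact: Lfun_bd.
have v3 : {ae mu, forall x, forall k, ~ qsupp dist (phi k) x ->
  T (phi k) x = Rintegral mu setT (fun y => K x y * phi k y)}.
 apply: ae_foralln => k; apply: Krep; last exact: Lfun_bd.
  have [[[L L0 pL] _ _] _] := hphi k => V oV; apply/(qopen_metr hX e0 re).
  exact: (lipschitz_open ds L0 pL).
 exists c, ((2 * (s + d + d)) `^ e^-1) => x xs.
 have sd : 0 < s + d + d.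
  have [y [_ py]] : (b x d `&` [set x | phi k x != 0] !=set0).
  apply: xs; last exact: (ball_ctr ds).
  by apply/(qopen_metr hX e0 re); exact: (ball_open ds).
  have : b c (s + d) y.
  by apply: Ob; apply: contrapT => Oy; move: py; have [[_ p0 _] _] := hphi k; rewrite /= p0 ?eqxx.
  by rewrite /qball /= => h1; rewrite ltr_wpDr ?(ltW d0)// (leltT (r0 c y) h1).
 apply: (sub_dball hX e0 re); first by rewrite mgt0.
 rewrite [2 * _]mulrC mulfK//.
 have [y [xy py]] : (b x d `&` [set x | phi k x != 0] !=set0).
  apply: xs; last exact: (ball_ctr ds).
  by apply/(qopen_metr hX e0 re); exact: (ball_open ds).
 have : b c (s + d) y.
  by apply: Ob; apply: contrapT => Oy; move: py; have [[_ p0 _] _] := hphi k; rewrite /= p0 ?eqxx.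
 move: xy; rewrite /qball /= => xy cy; apply: leltT (rtri y c x) _.
 by rewrite (rsym y); apply: ltrD.
apply: filterS3 v1 v2 v3 => x w1 w2 w3 Ax.
have nsupp k : ~ qsupp dist (phi k) x.
 move=> /(_ (b x (d / 2))) []; first by apply/(qopen_metr hX e0 re); exact: (ball_open ds).
  by apply: (ball_ctr ds); rewrite dgt0.
 move=> y [xy py]; suff Oy : O y.
  by have := AO _ _ Ax Oy; rewrite leNgt; move: xy; rewrite /qball /= => ->.
 by apply: contrapT => Oy; move: py; have [[_ p0 _] _] := hphi k; rewrite /= p0 ?eqxx.
have d2 : 0 < d / 2 by rewrite dgt0.
have Ox : ~ O x by move=> /(AO _ _ Ax); rewrite (mtrefl rm) leNgt d2.
have w4 k : T (phi k) x = Rintegral mu setT (fun y => K0 x y * phi k y).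
 rewrite (w3 _ (@nsupp k)); congr Rintegral; apply/funext => y.
 have [xy|xy] := pselect (x = y); last by rewrite offdiagE.
 by rewrite -xy; have [[_ p0 _] _] := hphi k; rewrite p0// !mulr0.
have [Mx Mx0 KM] := ker_bd x d2.
have ih : mu.-integrable setT (EFin \o (fun y => K0 x y * h y)).
 by apply: (ker_int bh d0) => y; exact: hd.
have iphi k : mu.-integrable setT (EFin \o (fun y => K0 x y * phi k y)).
 apply: (ker_int (bphi k) d2) => y py; apply: AO => //.
 by apply: contrapT => Oy; move: py; have [[_ p0 _] _] := hphi k; rewrite p0 ?eqxx.
pose m := fine (mu O); have mE : mu O = m%:E by rewrite fineK// ge0fin.
have m0 : 0 <= m by exact: fine_ge0.
have w5 k : `|Rintegral mu setT (fun y => K0 x y * phi k y) -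
  Rintegral mu setT (fun y => K0 x y * h y)| <= Mx * (2 ^- k * (m + 1)).
 rewrite -RintegralB//; apply: normr_Rint_le.
  exact: intB_EFin.
 have mg : mfun (g k) by case: (bg k).
 have mng : mfun (fun y => `|g k y|) by exact: mcomp.
 apply: (leU (\int[mu]_y (Mx * `|g k y|)%:E)%E).
  apply: int_le => //.
  - apply: mcomp => //; apply: mfB; apply: mfM;
  by [exact: (mker1 ds mK)|case: (bphi k)|case: bh].
  - exact: mfM.
  - move=> y _; rewrite -mulrBr normrM gE; have [Oy|Oy] := pselect (O y).
  by rewrite wMr// KM// AO.
  by have := gO k y Oy; rewrite gE => ->; rewrite normr0 !mulr0.
 rewrite intZ//; apply: leT (leMl _ (int_abs_small _ _ mg (gO k) (p2 k) (sg' k))) _.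
 - by rewrite leF.
 - exact: mO.
 - by rewrite mE.
 - by rewrite -EFinM leF.
apply/eqP; rewrite -subr_eq0 -normr_le0; apply/ler_addgt0Pr => eps eps0; rewrite add0r.
have eps2 : 0 < eps / 2 by rewrite dgt0.
have [k0 hk0] := w1 ((eps / 2) ^+ 2) (xgt0 _ eps2).
pose k1 := Num.truncn (Mx * (m + 1) / (eps / 2)).
pose k := maxn k0 k1.+1.
have t1 : `|T (g k) x| <= eps / 2.
 rewrite -(ler_pXn2r (n := 2))// ?nnegrE ?(ltW eps2)// real_normK ?num_real//.
 by apply: hk0; exact: leq_maxl.
have t2 : Mx * (2 ^- k * (m + 1)) <= eps / 2.
 rewrite mulrCA mulrC lepdM ?xgt0//.
 rewrite -(ler_pdivrMl _ _ eps2) [_^-1 * _]mulrC; apply: leT (ltW (truncnS_gt _)) _; rewrite -/k1 -natrX ler_nat.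
 by apply: leq_trans (leq_maxr k0 k1.+1) _; rewrite ltnW// ltn_expl.
have := w5 k; rewrite -w4 => t3.
have -> : T h x - Rintegral mu setT (fun y => K0 x y * h y) =
  - T (g k) x + (T (phi k) x - Rintegral mu setT (fun y => K0 x y * h y)).
 by rewrite w2; ring.
apply: leT (ler_normD _ _) _; rewrite normrN [eps]splitr; apply: lerD => //.
exact: leT t3 t2.
Qed.

Variable H : R.
Hypothesis KH : (hormander_const dist cd mu (hconj r%:E) K <= H%:E)%E.

(** [T h] is determined up to a null set, so a single exceptional set serves all pairs of points.
    The function vanishes on a dilate large enough for the kernel formula and for [ker_osc]. *)
Lemma operator_oscillation h c s N : bdsupp rho h -> 0 < s -> 0 <= N ->
 (forall y, b c (osc_dil cd e * s) y -> h y = 0) ->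
 (forall t, s <= t -> (\int[mu]_(y in b c t) (`|h y| `^ r)%:E <= (N `^ r * vol rho mu c t)%:E)%E) ->
 exists Z, [/\ measurable Z, mu Z = 0%E & forall x z, b c s x -> b c s z -> ~ Z x -> ~ Z z ->
  `|T h x - T h z| <= H * D * N].
move=> bh s0 N0 h0 hN.
have cd1 : 1 <= cd := qm_const (htqm hX).
have o2 : 2 <= osc_dil cd e.
 rewrite /osc_dil -[leLHS]mulr1 ler_pM2l//; apply: powR_ge1; last exact: ltW.
 by rewrite -[leLHS]mulr1; apply: ler_pM; rewrite // ler1n.
have gap x y : b c s x -> h y != 0 -> s <= rho x y.
 move=> xs hy; have : osc_dil cd e * s <= rho c y.
  rewrite leNgt; apply/negP => yb; move: hy; rewrite h0 ?eqxx//.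
 move=> h1; have h2 : 2 * s <= rho c y by apply: leT h1; rewrite wMr// ltW.
 have := mttri rm x c y; move: xs; rewrite /qball /= => xs h3.
 have := leT h2 h3; rewrite mulr_natl mulr2n => h4.
 have := lerB h4 (ltW xs); rewrite addrK; apply: contraTT; rewrite -!ltNge => h5.
 by rewrite addrC addKr.
have [Z [mZ Z0 hZ]] := ker_repr bh s0 gap.
exists Z; split => // x z xs zs nx nz.
have ex w : b c s w -> ~ Z w -> T h w = Rintegral mu setT (fun y => K0 w y * h y).
 by move=> ws nw; apply: contrapT => neq; apply: nw; apply: hZ => /= /(_ ws).
have iw w : b c s w -> mu.-integrable setT (EFin \o (fun y => K0 w y * h y)).
 by move=> ws; apply: (ker_int bh s0) => y; exact: gap.
rewrite ex// ex// -RintegralB//; [|exact: iw|exact: iw].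
apply: normr_Rint_le.
 by apply: intB_EFin; exact: iw.
have mh : mfun h by case: bh.
apply: leT (ker_osc hX e0 re ds r1 mK KH s0 xs zs mh N0 hN).
rewrite [leRHS]imkcond; apply: eqW.
apply: eqint => y _; rewrite patchE -mulrBl normrM; case: ifPn => // /negP yb.
rewrite h0 ?normr0 ?mulr0//; apply: contrapT => yb'; apply: yb; exact/mem_set.
Qed.

End kernel_operator.

(** * The weak (1,1) bound by Calderon-Zygmund decomposition *)

Fact stopping_arith1 {R : rfType} (a n r s u v w x : R) : a < n -> n <= r -> s <= r ->
 u < s -> v < s -> w <= u + v -> x <= a + w -> x < 3 * r.
lra. Qed.

Fact stopping_arith2 {R : rfType} (d r t : R) : 0 < t -> r / 6 < 2 * t -> d < 3 * r ->
 d + r <= 2 ^+ 6 * t.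
lra. Qed.

Fact stopping_arith3 {R : rfType} (x y z w : R) : x + (y + (z + w)) <= 1 + y + x + z + w.
lra. Qed.

Lemma nindic {R : realType} {X : Type} (A : set X) x : `|\1_A x| = \1_A x :> R.
by rewrite ger0_norm. Qed.

Lemma sum_disj_indic {R : realType} {X : Type} (F : nat -> set X) M x : trivIset setT F ->
 \sum_(0 <= j < M) \1_(F j) x = \1_(\bigcup_(j in `I_M) F j) x :> R.
move=> tF; elim: M => [|M ih]; first by rewrite big_geq// II0 bigcup_set0 indic0.
rewrite big_nat_recr//= ih IIS bigcup_setU bigcup_set1 !indicE in_setU.
have [xM|xM] := boolP (x \in F M); last by rewrite orbF addr0.
rewrite orbT (_ : (x \in \bigcup_(j in `I_M) F j) = false) ?add0r//.
apply/negbTE/negP; rewrite inE => -[j /= jM Fj]; move: xM; rewrite inE => xM.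
have jM' : j = M by apply: tF => //; exists x.
by rewrite jM' ltnn in jM.
Qed.

Section tools.
Context {R : realType} {dsp} {X : mType dsp}.
Variable mu : meas X R.

Lemma int_le_ae_nm A (f g : X -> \bar R) : measurable A ->
 measurable_fun A f -> (forall x, (0 <= f x)%E) -> (forall x, (0 <= g x)%E) ->
 {ae mu, forall x, A x -> (f x <= g x)%E} ->
 (\int[mu]_(x in A) f x <= \int[mu]_(x in A) g x)%E.
move=> mA mf f0 g0 [Z [mZ Z0 hZ]].
rewrite (ge0_negligible_integral mZ mA mf _ Z0)//.
rewrite imkcond [leRHS]imkcond; apply: int_le_nm.
 by move=> x; rewrite patchE; case: ifP.
move=> x _; rewrite !patchE; case: ifPn => [|_]; last by case: ifP.
rewrite inE => -[Ax Zx]; rewrite mem_set//; apply: contrapT => neq; apply: Zx.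
by apply: hZ => /= /(_ Ax).
Qed.

Lemma markov_le A (f : X -> R) (l : R) : measurable A -> mfun f ->
 (forall x, 0 <= f x) -> 0 < l ->
 (l%:E * mu (A `&` [set x | (l < f x)%R]) <= \int[mu]_(x in A) (f x)%:E)%E.
move=> mA mf f0 l0; have mS : measurable (A `&` [set x | l < f x]).
 by apply: measurableI => //; exact: msuplev.
rewrite -int_cst//; apply: leT (isub mu mS mA mf f0 _); last by move=> x [].
by apply: int_le => // x; [rewrite ltW|move=> [_ /ltW]].
Qed.

Lemma chebyshev_le (f : X -> R) (l : R) : mfun f -> 0 < l ->
 ((l ^+ 2)%:E * mu [set x | (l < `|f x|)%R] <= sqint mu f)%E.
move=> mf l0; rewrite /sqint -[mu _](_ : mu (setT `&` [set x | l ^+ 2 < f x ^+ 2]) = _).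
 apply: markov_le => //; [exact: msqr|by move=> x; exact: sqr_ge0|exact: xgt0].
rewrite setTI; congr (mu _); apply/seteqP; split => x /=;
 by rewrite -[f x ^+ 2]real_normK ?num_real// ltr_pXn2r ?nnegrE// ltW.
Qed.

Lemma sqint0_integral0 (f : X -> R) : mfun f -> (sqint mu f <= 0)%E ->
 (\int[mu]_x `|f x|%:E = 0)%E.
move=> mf sf; have mf2 : mfun (fun x => (f x ^+ 2)%:E).
 by apply: mEFin; exact: msqr.
have mf1 : mfun (fun x => (f x)%:E) by exact: mEFin.
have /(ae_eq_integral_abs mu measurableT mf2) h :
  (\int[mu]_x `|(f x ^+ 2)%:E| = 0)%E.
 apply/eqP; rewrite eq_le intge0// andbT; apply: leT sf.
 rewrite /sqint; apply: eqW; apply: eqint => x _ /=.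
 by rewrite ger0_norm// sqr_ge0.
apply/(ae_eq_integral_abs mu measurableT mf1); apply: filterS h => x hx xT.
by have := hx xT => /= -[] /eqP; rewrite sqrf_eq0 => /eqP ->.
Qed.

End tools.

Section weak_type_operator.
Context {R : realType} {dsp} {X : mType dsp}.
Variables (dist : X -> X -> R) (cd : R) (mu : meas X R).
Variables (rho : X -> X -> R) (e D : R).
Hypotheses (hX : htype dist cd mu) (e0 : 0 < e) (rm : is_metric rho)
 (re : pwcmp rho dist e)
 (ds : dspace rho mu D).
Local Notation b := (qball rho).
Variables (r : R) (T : (X -> R) -> X -> R) (K : X -> X -> R) (C2 Ck H : R).
Hypotheses (r1 : 1 <= r)
 (Tlin : forall (a : R) f g, f \in Lfun mu 2%:E -> g \in Lfun mu 2%:E ->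
  {ae mu, forall x, T (fun y => a * f y + g y)%R x = (a * T f x + T g x)%R})
 (C20 : 0 <= C2)
 (Tbd : forall f, f \in Lfun mu 2%:E -> mfun (T f) /\
  (sqint mu (T f) <= C2%:E * sqint mu f)%E)
 (mK : measurable_fun [set xy : X * X | xy.1 <> xy.2] (fun xy => K xy.1 xy.2))
 (Ksize : forall x y, x <> y -> (`|K x y|%:E <= Ck%:E / mu (qball dist x (dist x y)))%E)
 (Krep : forall f, qcontinuous dist f -> qbounded dist (qsupp dist f) ->
  f \in Lfun mu 2%:E ->
  {ae mu, forall x, ~ qsupp dist f x ->
  T f x = Rintegral mu setT (fun y => K x y * f y)%R})
 (H0 : 0 <= H)
 (KH : (hormander_const dist cd mu (hconj r%:E) (fun x y => K y x) <= H%:E)%E).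
Local Notation K0 := (offdiag K).
Local Notation Lam := (osc_dil cd e).

Let Lam2 : 2 <= Lam.
have cd1 : 1 <= cd := qm_const (htqm hX).
rewrite /osc_dil -[leLHS]mulr1 ler_pM2l//; apply: powR_ge1; last exact: ltW.
by rewrite -[leLHS]mulr1; apply: ler_pM; rewrite // ler1n.
Qed.

Lemma offdiag_tr x y : offdiag (fun x y => K y x) x y = K0 y x.
have [->//|xy] := pselect (x = y).
by rewrite !offdiagE//; exact: nesym.
Qed.

(** Since [f] has mean zero, [K x c] may be subtracted from the kernel. By Tonelli the inner
    integral over [x] is then the Hormander condition for the transposed kernel. *)
Lemma atom_decay f c s : bdsupp rho f -> 0 < s ->
 (forall y, ~ b c s y -> f y = 0) -> Rintegral mu setT f = 0 ->
 (\int[mu]_(x in ~` b c (Lam * s)) `|T f x|%:E <= (H * D)%:E * \int[mu]_x `|f x|%:E)%E.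
move=> bf s0 fs f0; have [mf [M fM] _] := bf.
have mKt : measurable_fun [set xy : X * X | xy.1 <> xy.2] (fun xy => K xy.2 xy.1).
 apply: (eq_measurable_fun (fun xy : X * X => K0 xy.2 xy.1)).
  by move=> [x y]; rewrite inE /= => xy; rewrite offdiagE//; exact: nesym.
 apply: measurable_funTS.
 exact: (mcomp (moffdiagK ds mK) (@measurable_swap _ _ X X)).
set A := ~` b c (Lam * s); have mA : measurable A by apply: measurableC; exact: (mball ds).
have gap x y : A x -> f y != 0 -> s <= rho x y.
 move=> /negP; rewrite -leNgt => xA fy; have cy : rho c y < s.
  by apply: contrapT => h; move: fy; rewrite fs ?eqxx.
 have h2 : s + s <= rho c x by apply: leT xA; rewrite -mulr2n -mulr_natl wMr// ltW.
 have := mttri rm y c x; rewrite (mtsym rm y x) => h3.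
 by rewrite -(lerD2l s); apply: leT h2 (leT h3 _); rewrite lerD2r ltW.
have rep := ker_repr hX e0 rm re ds Tlin C20 Tbd mK Ksize Krep bf s0 gap.
pose F (z : X * X) : R := `|K0 z.1 z.2 - K0 z.1 c| * `|f z.2| * \1_A z.1.
have mF : mfun F.
 apply: mfM; last by apply: mcomp => //; exact: mindic.
 apply: mfM; apply: mcomp => //.
  apply: mfB; first exact: (moffdiagK ds mK).
  exact: (mcomp (mker2 ds mK c) (@measurable_fst _ _ X X)).
 exact: mcomp.
have F0 z : 0 <= F z by rewrite !mge0.
have intf : mu.-integrable setT (EFin \o f).
 apply: (@int_fin _ _ _ mu _ (b c s) M) => //.
 - exact: (mball ds).
 - exact: (muB_lty ds).
 - exact: leT (fM point).
 - move=> x; rewrite indicE; case: (boolP (x \in _)) => [_|]; first by rewrite mulr1.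
  by rewrite notin_setE => /fs ->; rewrite normr0 mulr0.
have mTf : mfun (T f) by case: (Tbd (Lfun_bd ds bf)).
apply: (leU (\int[mu]_(x in A) \int[mu]_y (F (x, y))%:E)%E).
 apply: int_le_ae_nm => //.
 - by apply: mEFin; exact: mcomp.
 - by move=> x; apply: intge0 => y _; rewrite leF.
 apply: filterS rep => x rx Ax.
 have ix : mu.-integrable setT (EFin \o (fun y => K0 x y * f y)).
  by apply: (ker_int hX e0 rm re ds mK Ksize bf s0) => y; exact: gap.
 have icf : mu.-integrable setT (EFin \o (fun y => K0 x c * f y)).
  have -> : EFin \o (fun y => K0 x c * f y) = (fun y => (K0 x c)%:E * (EFin \o f) y)%E.
  by apply/funext => y /=; rewrite EFinM.
  exact: integrableZl.
 have -> : T f x = Rintegral mu setT (fun y => K0 x y * f y - K0 x c * f y).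
  rewrite RintegralB// rx// [X in _ - X](_ : _ = 0) ?subr0//.
  by rewrite RintegralZl// f0 mulr0.
 rewrite EFin_normr_Rintegral//; last exact: intB_EFin.
 apply: leT (le_abse_integral mu measurableT _) _.
  by have /integrableP[] := intB_EFin ix icf.
 apply: eqW; apply: eqint => y _.
 by rewrite /F /= indicE mem_set// mulr1 -mulrBl normrM.
apply: (leU (\int[mu]_x \int[mu]_y (F (x, y))%:E)%E).
 rewrite imkcond; apply: int_le_nm => x; rewrite patchE; case: ifP => // _.
  by apply: intge0 => y _; rewrite leF.
 by move=> _; apply: intge0 => y _; rewrite leF.
have HD0 : 0 <= H * D by rewrite mge0// ltW// (D_gt0 ds).
rewrite (tonelli ds (f := fun z => (F z)%:E))//; last exact: mEFin.
rewrite -intZ//; last exact: mcomp.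
apply: int_le_nm => [y|y _]; first by apply: intge0 => x _; rewrite leF.
have [yb|/fs fy] := pselect (b c s y); last first.
 rewrite (_ : (fun x => (F (x, y))%:E) = cst 0%E).
  by rewrite integral0 leF mge0.
 by apply/funext => x; rewrite /F /= fy normr0 mulr0 mul0r.
have mg : mfun (fun x => `|K0 x y - K0 x c|).
 apply: mcomp => //; apply: mfB; exact: (mker2 ds mK).
have -> : (fun x => (F (x, y))%:E) = (fun x => (`|f y| * (`|K0 x y - K0 x c| * \1_A x))%:E).
 by apply/funext => x; rewrite /F /=; congr (_%:E); ring.
rewrite intZ//; last exact: mMindic.
rewrite int_indic// setTI mulrC EFinM; apply: leMl; first by rewrite leF.
(* [ker_osc] is applied to the transposed kernel against the constant function 1, whose means are
   1. *)
have hN t : s <= t -> (\int[mu]_(y in b c t) (`|(cst 1 : X -> R) y| `^ r)%:E <=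
  (1 `^ r * vol rho mu c t)%:E)%E.
 move=> st; rewrite /= normr1 powR1 int_cst; last exact: (mball ds).
 by rewrite mul1e (mu_ball ds) ?mul1r// (ltleT s0).
rewrite -[H * D]mulr1.
apply: leT (ker_osc hX e0 re ds r1 mKt KH s0 yb (ball_ctr ds c s0)
 (mcst (1 : R)) ler01 hN).
apply: eqW; apply: eqint => x _.
by rewrite !offdiag_tr normr1 mulr1.
Qed.

Lemma operator_sum (u : X -> R) (F : nat -> X -> R) M : bdsupp rho u ->
 (forall j, bdsupp rho (F j)) ->
 bdsupp rho (fun x => u x + \sum_(0 <= j < M) F j x) /\
 {ae mu, forall x, T (fun x => u x + \sum_(0 <= j < M) F j x) x =
  T u x + \sum_(0 <= j < M) T (F j) x}.
move=> bu bF; elim: M => [|M [ih1 ih2]].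
 have -> : (fun x => u x + \sum_(0 <= j < 0) F j x) = u.
  by apply/funext => x; rewrite big_geq// addr0.
 by split => //; apply: nearW => x; rewrite big_geq// addr0.
have -> : (fun x => u x + \sum_(0 <= j < M.+1) F j x) =
  (fun x => 1 * F M x + (u x + \sum_(0 <= j < M) F j x)).
 by apply/funext => x; rewrite big_nat_recr//= mul1r addrA [RHS]addrC.
split; first exact: (bdsupp_lin ds).
have lin := Tlin 1 (Lfun_bd ds (bF M)) (Lfun_bd ds ih1).
apply: filterS2 ih2 lin => x h1 ->; rewrite h1 mul1r big_nat_recr//= [LHS]addrC addrA.
by [].
Qed.

(* The Whitney-type balls of the Calderon-Zygmund decomposition at height [l]; the balls of
 radius comparable with [t0] need not come close to the complement of [O]. *)
Definition stopping_ball (O : set X) (t0 : R) (z : X * R) : Prop :=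
 [/\ 0 < z.2, z.2 <= t0, b z.1 z.2 `<=` O & ~ b z.1 (2 * z.2) `<=` O \/ t0 < 2 * z.2].

Lemma stopping_ball_exists O t0 x : qopen rho O -> 0 < t0 -> O x ->
 exists t, stopping_ball O t0 (x, t).
move=> oO t00 Ox; have [d d0 dO] := oO x Ox.
pose P k := `[< b x (t0 / 2 ^+ k) `<=` O >].
have [k0 Pk0] : exists k, P k.
 exists (Num.truncn (t0 / d)).+1; apply/asboolP; apply: subT dO.
 apply: (bsub ds); rewrite (mtrefl rm) add0r lepdM ?xgt0//.
 rewrite mulrC -lepdM//; apply: leT (ltW (truncnS_gt _)) _.
 by rewrite -natrX ler_nat ltnW// ltn_expl.
have [k /asboolP Pk kmin] := ex_minnP (ex_intro P k0 Pk0).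
exists (t0 / 2 ^+ k); split => /=.
- by rewrite dgt0// xgt0.
- by rewrite lepdM ?xgt0// ler_peMr ?(ltW t00)// exprn_ege1// ler1n.
- by [].
- case: k Pk kmin => [|k] Pk kmin.
  by right; rewrite expr0 divr1 ltr_pMl// ltr1n.
 left => h; have /kmin : P k.
  apply/asboolP; move: h; rewrite exprS invfM mulrCA mulVKf//.
 by rewrite ltnn.
Qed.

(** The hypothesis [I < l * vol c R0] says that [f] has mean below [l] at the scale [R0]. Radii may
    therefore be capped by [R0], which keeps [O] bounded: a small stopping ball dilates to a ball
    meeting the complement of [O], and on one comparable with [R0] the total mass [I] is already
    small enough. *)
Lemma cz_decomposition f l c N R0 I : bdsupp rho f -> 0 < l -> 0 <= I ->
 (\int[mu]_x `|f x|%:E = I%:E)%E -> (forall x, ~ b c N x -> f x = 0) ->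
 0 < R0 -> N <= R0 -> I < l * vol rho mu c R0 ->
 exists O (z : nat -> X * R), [/\ measurable O /\ qopen rho O,
  (mu O < +oo)%E /\ (l%:E * mu O <= (D ^+ 3 * I)%:E)%E,
  {ae mu, forall x, ~ O x -> `|f x| <= D * l},
  trivIset setT (fun j => b (z j).1 (z j).2) /\
  O `<=` \bigcup_j b (z j).1 (5 * (z j).2) &
  forall j, (z j).2 = 0 \/ [/\ 0 < (z j).2, b (z j).1 (z j).2 `<=` O &
  (\int[mu]_(x in b (z j).1 (5 * (z j).2)) `|f x|%:E <=
  (l * D ^+ 6 * vol rho mu (z j).1 (z j).2)%:E)%E]].
move=> bf l0 I0 IE fN R00 NR0 hR0; have [mf [M0 fM0] _] := bf.
have D0 := D_gt0 ds.
have D1 : 1 <= D by apply: leT (dsC ds); rewrite ler1n.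
have mnf : mfun (fun x => `|f x|) by exact: mcomp.
have mbc s : measurable (b c s) by exact: (mball ds).
pose O := om_cap rho mu R0 (fun x => `|f x|) l.
have mO : measurable O by exact: (momega_cap ds).
have oO : qopen rho O.
 move=> x [c' [s' [s'0 s'R xs' h]]]; have [d d0 dO] := ball_open ds xs'.
 by exists d => // y /dO ys; exists c', s'.
have Ob : O `<=` b c (3 * R0).
 move=> x [c' [s' [s'0 s'R xs' h]]].
 have [y ys fy] : exists2 y, b c' s' y & f y != 0.
  apply: contrapT => nex; move: h; rewrite integral0_eq.
  by rewrite lte_fin ltNge mge0 ?(ltW l0)// ltW// (vgt0 ds).
  move=> y ys; apply/eqP; rewrite eqe normr_eq0; apply: contrapT => /negP fy.
  by apply: nex; exists y.
 have cy : rho c y < N by apply: contrapT => h'; move: fy; rewrite fN ?eqxx.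
 have := mttri rm y c x; have := mttri rm c' y x.
 move: ys xs'; rewrite /qball /= (mtsym rm c' y) => t1 t2 t3 t4.
 exact: (stopping_arith1 cy NR0 s'R t1 t2 t3 t4).
have Ofin : (mu O < +oo)%E.
 apply: (@leltT _ _ (mu (b c (3 * R0)))); last exact: (muB_lty ds).
 by apply: lemu; rewrite ?inE.
have muO : (l%:E * mu O <= (D ^+ 3 * I)%:E)%E.
 by rewrite EFinM -IE; apply: (weak_type_cap ds).
have R60 : 0 < R0 / 6 by rewrite dgt0.
have [|z [zF ztriv zcov]] := @vitali _ _ _ _ _ _ ds c (stopping_ball O (R0 / 6)) (R0 / 6).
 by move=> z [-> ->].
have zbig j : stopping_ball O (R0 / 6) (z j) ->
  (\int[mu]_(x in b (z j).1 (5 * (z j).2)) `|f x|%:E <=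
  (l * D ^+ 6 * vol rho mu (z j).1 (z j).2)%:E)%E.
 move: (z j) => [x t] [/= t0 tR tO alt].
 have DD k v : 0 <= v -> (k <= 6)%N -> l * (D ^+ k * v) <= l * D ^+ 6 * v.
  move=> v0 k6; rewrite mulrA wMr// wMl ?(ltW l0)//; exact: ler_weXn2l.
 case: alt => [/existsNP[y /not_implyP[yx yO]]|Rt].
  have t6 : 0 < 6 * t by rewrite mgt0.
  have h1 : (\int[mu]_(w in b x (6 * t)) `|f w|%:E <= (l * vol rho mu x (6 * t))%:E)%E.
  rewrite leNgt; apply/negP => h; apply: yO; exists x, (6 * t); split => //.
  - by rewrite mulrC -ler_pdivlMr.
  - by apply: ltleT yx _; rewrite wMr ?(ltW t0)// ler_nat.
  apply: leT (leT h1 _).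
  apply: isub => //; try exact: (mball ds).
  apply: (bsub ds); rewrite (mtrefl rm) add0r wMr ?(ltW t0)//.
  by rewrite ler_nat.
  rewrite leF; apply: leT (DD 3 _ _ _) => //; last by rewrite ltW// (vgt0 ds).
  rewrite wMl ?(ltW l0)//; apply: (vol_le ds) => //.
  by rewrite (mtrefl rm) add0r wMr ?(ltW t0)// -natrX ler_nat.
 have xO : O x by apply: tO; exact: (ball_ctr ds).
 apply: (leU I%:E).
  by rewrite -IE; apply: isub => //; exact: (mball ds).
 rewrite leF; apply: leT (ltW hR0) (leT _ (DD 6 _ _ _)) => //.
  rewrite wMl ?(ltW l0)//; apply: (vol_le ds) => //.
  exact: (stopping_arith2 t0 Rt (Ob _ xO)).
 by rewrite ltW// (vgt0 ds).
exists O, z; split => //; last first.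
- by move=> j; case: (zF j) => [->|zj]; [left|right; split; [case: zj|case: zj|exact: zbig]].
- split => // x Ox; have [t tx] := stopping_ball_exists oO R60 Ox.
 have [j [_ _ h]] := zcov _ tx; exists j => //; apply: h => /=.
 by apply: (ball_ctr ds); case: tx.
have lf c' s' : 0 < s' -> (\int[mu]_(x in b c' s') `|f x|%:E < +oo)%E.
 move=> _; apply: (@leltT _ _ I%:E); last exact: ltry.
 by rewrite -IE; apply: isub => //; exact: (mball ds).
have := leb_metr hX e0 re ds mnf (fun=> normr_ge0 _) lf.
apply: filterS => x hx xO; rewrite leNgt; apply/negP => h; apply: xO; exact: hx R00 h.
Qed.

(** The classical splitting into good and bad parts, with a third part: linearity of [T] is
    available for finite sums only, so the tail of the bad parts is treated as a function that is
    small in L^2. *)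
Lemma weak_type_11 : exists2 C, 0 <= C & forall f (l : R), bdsupp rho f -> 0 < l ->
 (l%:E * mu [set x | (l < `|T f x|)%R] <= C%:E * \int[mu]_x `|f x|%:E)%E.
have D0 := D_gt0 ds; have D2 := dsC ds.
have D1 : 1 <= D by apply: leT D2; rewrite ler1n.
pose k5 := (Num.truncn (5 * Lam)).+1.
have k5L : 5 * Lam <= 2 ^+ k5.
 by apply: leT (ltW (truncnS_gt _)) _; rewrite -natrX ler_nat ltnW// ltn_expl.
(* The summands belong, in order, to the case of no admissible radius, the good part, the tail, the
   dilated balls and the bad parts. *)
pose CW := 1 + 18 * C2 * D ^+ 6 + 9 * C2 + D ^+ k5 * D ^+ 3 + 6 * (H * D).
exists CW.
 by rewrite /CW !age0// ?mge0 ?xge0// ltW.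
move=> f l bf l0; have [mf [M0 fM0] [c [N fN]]] := bf.
have mT g : bdsupp rho g -> mfun (T g).
 by move=> bg; case: (Tbd (Lfun_bd ds bg)).
have mnf : mfun (fun x => `|f x|) by exact: mcomp.
have M00 : 0 <= M0 by exact: leT (fM0 point).
have mbc s : measurable (b c s) by exact: (mball ds).
pose I := fine (\int[mu]_x `|f x|%:E).
have IE : (\int[mu]_x `|f x|%:E = I%:E)%E.
 rewrite fineK// ge0fin; last by apply: intge0 => x _; rewrite leF.
 have : mu.-integrable setT (EFin \o f).
  apply: (@int_fin _ _ _ mu _ (b c N) M0) => //; first exact: (muB_lty ds).
  move=> x; rewrite indicE; case: (boolP (x \in _)) => [_|]; first by rewrite mulr1.
  by rewrite notin_setE => /fN ->; rewrite normr0 mulr0.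
 by case/integrableP.
have I0 : 0 <= I by rewrite /I fine_ge0// intge0// => x _; rewrite leF.
set E := [set x | (l < `|T f x|)%R].
have mE : measurable E by apply: msuplev; apply: mcomp => //; exact: mT.
rewrite IE; suff hE : (l%:E * mu E <= (CW * I)%:E)%E by rewrite EFinM in hE.
have [I00|I1] := leP I 0.
 have I00' : I = 0 by apply/eqP; rewrite eq_le I00.
 have sf0 : sqint mu f = 0%E.
  apply/eqP; rewrite eq_le sqint_ge0 andbT.
  apply: (leU (\int[mu]_x (M0 * `|f x|)%:E)%E).
  apply: int_le => //; [exact: msqr|exact: mfM|by move=> x; exact: sqr_ge0|].
  by move=> x _; rewrite -real_normK ?num_real// expr2 wMr.
  by rewrite intZ// IE I00' mule0.
 have [_ ] := Tbd (Lfun_bd ds bf); rewrite sf0 mule0 => sT.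
 have := chebyshev_le mu (mT _ bf) l0 => /leT /(_ sT).
 rewrite -/E pmule_rle0 ?lte_fin ?xgt0// => hE.
 have -> : mu E = 0%E by apply/eqP; rewrite eq_le hE measure_ge0.
 by rewrite mule0 leF I00' mulr0.
(* If no ball is large enough to make the mean smaller than [l], the whole space has measure at most
   [I / l] and the bound is trivial. *)
have [[R0 [R00 NR0 hR0]]|noR] := pselect (exists s, [/\ 0 < s, N <= s & I < l * vol rho mu c s]); last first.
 have : (l%:E * mu setT <= I%:E)%E.
  rewrite -(ball_cover rho c).
  have cv : (mu \o (fun n => b c n%:R)) n @[n --> \oo] --> mu (\bigcup_n b c n%:R).
  apply: nondecreasing_cvg_mu => //; first exact: mbigcup.
  move=> i j ij; apply/subsetPset; apply: (bsub ds).
  by rewrite (mtrefl rm) add0r ler_nat.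
  rewrite muleC -lee_pdivlMr//; rewrite -(cvg_lim _ cv)//.
  apply: lime_le; first by apply/cvg_ex; eexists; exact: cv.
  exists (Num.truncn N).+1 => // n /= Nn.
  have n0 : 0 < n%:R :> R by rewrite ltr0n (leq_trans _ Nn).
  rewrite (mu_ball ds)// -EFinM leF ler_pdivlMr// mulrC leNgt; apply/negP => h.
  apply: noR; exists n%:R; split => //.
  by apply: leT (ltW (truncnS_gt _)) _; rewrite ler_nat.
 move=> h; apply: (leU (l%:E * mu setT)%E).
  by apply: leMl; [rewrite leF ltW|apply: lemu; rewrite ?inE].
 apply: leT h _; rewrite leF ler_peMl// /CW -!addrA lerDl.
 by rewrite !age0// ?mge0 ?xge0// ltW.
have [Q [z [[mO oO] [Ofin muO] Of [ztriv Ocov] zP]]] := cz_decomposition bf l0 I0 IE fN R00 NR0 hR0.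
pose B j := b (z j).1 (z j).2; pose B5 j := b (z j).1 (5 * (z j).2).
have mB j : measurable (B j) by exact: (mball ds).
have mB5 j : measurable (B5 j) by exact: (mball ds).
pose v j := vol rho mu (z j).1 (z j).2.
(* The 5-dilates cover [Q] but overlap; [P] makes them disjoint. *)
pose P := seqDU (fun j => B5 j `&` Q).
have mP j : measurable (P j).
 by apply: measurableD; [exact: measurableI|apply: bigsetU_measurable => i _; exact: measurableI].
have tP : trivIset setT P by exact: trivIset_seqDU.
have PB j : P j `<=` B5 j by move=> x [[]].
have PO j : P j `<=` Q by move=> x [[]].
have OP : Q = \bigcup_j P j.
 rewrite -seqDU_bigcup_eq; apply/seteqP; split => [x Ox|x [j _ []]//].
 by have [j _ ?] := Ocov _ Ox; exists j.
have z0 j : 0 <= (z j).2 by case: (zP j) => [->|[/ltW]].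
have vE j : mu (B j) = (v j)%:E.
 rewrite fineK// ge0fin//; exact: (muB_lty ds).
have v0 j : 0 <= v j by exact: fine_ge0.
have empty j : (z j).2 = 0 -> B5 j = set0 /\ B j = set0.
 by move=> zj; rewrite /B5 /B zj mulr0 !(ball_le0 ds).
pose J j := fine (\int[mu]_(x in P j) `|f x|%:E)%E.
have JE j : (\int[mu]_(x in P j) `|f x|%:E = (J j)%:E)%E.
 rewrite fineK// ge0fin; last by apply: intge0 => x _; rewrite leF.
 apply: (@leltT _ _ I%:E); last exact: ltry.
 by rewrite -IE; apply: isub.
have J0 j : 0 <= J j by rewrite -leF -JE intge0// => x _; rewrite leF.
have SJ M : \sum_(0 <= j < M) J j <= I.
 rewrite -leF -sumEFin -IE; under eq_bigr do rewrite -JE.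
 apply: leT (int_disj_le mu mP tP measurableT _ mnf _) => //.
 by apply: nneseries_lim_ge => j _; rewrite intge0// => x _; rewrite leF.
have intf : mu.-integrable setT (EFin \o f).
 apply/integrableP; split; first exact: mEFin.
 by rewrite IE ltry.
have intP j : mu.-integrable (P j) (EFin \o f) by apply: integrableS intf.
(* The mass of [f] on [P j] is spread evenly over [B j] rather than over [P j]. The [B j] are
   disjoint and of controlled volume, so the good part is bounded by a multiple of [l]. *)
pose a j := Rintegral mu (P j) f / v j.
have aJ j : `|Rintegral mu (P j) f| <= J j.
 by rewrite -leF -JE EFin_normr_Rintegral//; apply: le_abse_integral => //; case/integrableP: (intP j).
have av j : `|a j| * v j <= J j.
 rewrite /a normrM normfV [`|v j|]ger0_norm//; have [->|vj] := eqVneq (v j) 0; first by rewrite mulr0.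
 by rewrite divfK.
have al j : `|a j| <= l * D ^+ 6.
 case: (zP j) => [zj|[zj _ hj]].
  rewrite /a normrM; have [_ Bj] := empty _ zj.
  have -> : v j = 0 by rewrite /v /vol -/(B j) Bj measure0.
  by rewrite invr0 normr0 mulr0 mge0 ?(ltW l0)// xge0// ltW.
 have vj : 0 < v j by exact: (vgt0 ds).
 rewrite -(ler_pM2r vj); apply: leT (av j) _; rewrite -leF -JE.
 apply: leT hj; exact: (isub mu (mP j) (mB5 j) mnf _ (PB j)).
pose bad j x := f x * \1_(P j) x + - a j * \1_(B j) x.
have bB j : bdsupp rho (\1_(B j) : X -> R) by exact: (bdsupp_ball ds).
have bbad j : bdsupp rho (bad j).
 have -> : bad j = (fun x => - a j * \1_(B j) x + f x * \1_(P j) x).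
  by apply/funext => x; rewrite /bad addrC.
 by apply: (bdsupp_lin ds) => //; exact: bdsupp_indic.
have mbad j : mfun (bad j) by case: (bbad j).
have B55 j : B j `<=` B5 j.
 by apply: (bsub ds); rewrite (mtrefl rm) add0r ler_peMl// ler1n.
have bads j y : ~ B5 j y -> bad j y = 0.
 move=> nB; rewrite /bad !indicE !memNset ?mulr0 ?addr0// => [/B55//|/PB//].
have intB j : mu.-integrable setT (EFin \o (\1_(B j) : X -> R)).
 apply: (@int_fin _ _ _ mu _ (B j) 1) => //.
 - exact: (muB_lty ds).
 - by move=> x; rewrite mul1r indicE; case: (_ \in _); rewrite ?normr0 ?normr1.
have bad0 j : Rintegral mu setT (bad j) = 0.
 case: (zP j) => [zj|[zj _ hj]].
  have [B5j _] := empty _ zj; rewrite (_ : bad j = cst 0); first by rewrite /Rintegral integral0.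
  by apply/funext => x; rewrite bads// B5j.
 have vj : 0 < v j by exact: (vgt0 ds).
 have ifP : mu.-integrable setT (EFin \o (fun x => f x * \1_(P j) x)).
  have /integrable_mkcond := intP j; rewrite (_ : _ \_ _ = EFin \o (fun x => f x * \1_(P j) x)).
  by apply.
  apply/funext => x; rewrite patchE /= indicE; case: (_ \in _); by rewrite ?mulr1 ?mulr0.
 have iaB : mu.-integrable setT (EFin \o (fun x => a j * \1_(B j) x)).
  have -> : EFin \o (fun x => a j * \1_(B j) x) = (fun x => (a j)%:E * (EFin \o \1_(B j)) x)%E.
  by apply/funext => x /=; rewrite EFinM.
  exact: integrableZl.
 have -> : bad j = (fun x => f x * \1_(P j) x - a j * \1_(B j) x).
  by apply/funext => x; rewrite /bad mulNr.
 rewrite RintegralB// RintegralZl//.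
 have -> : Rintegral mu setT (\1_(B j) : X -> R) = v j.
  by rewrite /Rintegral intindic// setIT vE.
 have -> : Rintegral mu setT (fun x => f x * \1_(P j) x) = Rintegral mu (P j) f.
  rewrite /Rintegral [in RHS]imkcond; congr fine; apply: eqint => x _.
  by rewrite patchE indicE; case: (_ \in _); rewrite ?mulr1 ?mulr0.
 by rewrite /a divfK ?subrr// gtF.
have mindB j (k : R) : mfun (fun x => k * \1_(B j) x).
 by apply: mfM => //; exact: mindic.
have mfP j : mfun (fun x => `|f x| * \1_(P j) x) by exact: mMindic.
have pfP j x : 0 <= `|f x| * \1_(P j) x by rewrite mge0.
have paB j x : 0 <= `|a j| * \1_(B j) x by rewrite mge0.
have i1 (A : set X) x : \1_A x <= 1 :> R by rewrite indicE lern1 leq_b1.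
have intbad j : (\int[mu]_x `|bad j x|%:E <= (2 * J j)%:E)%E.
 apply: (leU (\int[mu]_x (`|f x| * \1_(P j) x + `|a j| * \1_(B j) x)%:E)%E).
  apply: int_le => //; first exact: mcomp.
  exact: mfD.
  move=> x _; apply: leT (ler_normD _ _) _.
  by rewrite [`|f x * _|]normrM [`|- a j * _|]normrM normrN !nindic.
 rewrite (intD mu measurableT (mfP j) (mindB j _) (pfP j) (paB j)).
 rewrite int_indic// setTI JE intZ//.
 by rewrite intindic// setIT vE -EFinM -EFinD leF mulr_natl mulr2n lerD2l.
pose S M := Q `\` \bigcup_(j in `I_M) P j.
have mUP M : measurable (\bigcup_(j in `I_M) P j) by apply: mbigcup => j _.
have mS M : measurable (S M) by exact: measurableD.
have M02 : 0 < M0 ^+ 2 + 1 by rewrite ltr_wpDl// sqr_ge0.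
have eps0 : 0 < l * I / (M0 ^+ 2 + 1) by rewrite dgt0// mgt0.
(* [M] is chosen so that [f], bounded by [M0], has squared L^2 norm at most [l I] on the uncovered
   rest [S M]. *)
have [M hM] : exists M, (mu (S M) <= (l * I / (M0 ^+ 2 + 1))%:E)%E.
 apply: (small_sets ds oO Ofin) => //.
 - by move=> k x [].
 - move=> i j ij; apply/subsetPset => x [Qx nx]; split => // -[k /= ki Pk]; apply: nx.
  by exists k => //=; exact: leq_trans ki ij.
 - apply/seteqP; split => // x Sx; have [Qx _] := Sx 0%N Logic.I.
  move: Qx; rewrite OP => -[j _ Pj]; have [_] := Sx j.+1 Logic.I; apply; exists j => //=.
pose rest x := f x * \1_(S M) x.
have brest : bdsupp rho rest by exact: bdsupp_indic.
pose g x := \sum_(0 <= j < M) a j * \1_(B j) x + f x * \1_(~` Q) x.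
have mg0 : mfun (fun x => \sum_(0 <= j < M) a j * \1_(B j) x).
 by apply: msum => j; apply: mfM => //; exact: mindic.
have mQc : measurable (~` Q) by exact: measurableC.
have bg : bdsupp rho g.
 rewrite /g; elim: {hM rest brest g mg0} M => [|k ih].
  have -> : (fun x => \sum_(0 <= j < 0) a j * \1_(B j) x + f x * \1_(~` Q) x) =
  (fun x => f x * \1_(~` Q) x) by apply/funext => x; rewrite big_geq// add0r.
  exact: bdsupp_indic.
 have -> : (fun x => \sum_(0 <= j < k.+1) a j * \1_(B j) x + f x * \1_(~` Q) x) =
  (fun x => a k * \1_(B k) x + (\sum_(0 <= j < k) a j * \1_(B j) x + f x * \1_(~` Q) x)).
  by apply/funext => x; rewrite big_nat_recr//= addrAC addrC.
 exact: (bdsupp_lin ds).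
have mg : mfun g by case: bg.
have BQ j : B j `<=` Q.
 by case: (zP j) => [/empty[_ ->]//|[_ h _]]; exact: h.
have a60 : 0 <= l * D ^+ 6 by rewrite mge0 ?(ltW l0)// xge0// ltW.
have gbd : {ae mu, forall x, `|g x| <= l * D ^+ 6}.
 apply: filterS Of => x fx; rewrite /g indicE in_setC; case: (boolP (x \in Q)) => xQ /=.
  rewrite mulr0 addr0; apply: leT (ler_norm_sum _ _ _) _.
  apply: (leU (\sum_(0 <= j < M) (l * D ^+ 6) * \1_(B j) x)).
  by apply: ler_sum => j _; rewrite normrM nindic wMr.
  rewrite -mulr_sumr (sum_disj_indic _ _ ztriv); exact: (ler_piMr a60 (i1 _ _)).
 move: xQ; rewrite notin_setE => xQ; rewrite big1 ?add0r ?mulr1.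
  apply: leT (fx xQ) _; rewrite mulrC wMl ?(ltW l0)//.
  by rewrite -{1}[D]expr1; apply: ler_weXn2l.
 by move=> j _; rewrite indicE memNset ?mulr0// => /BQ.
pose ga x := \sum_(0 <= j < M) `|a j| * \1_(B j) x + `|f x|.
have mga0 : mfun (fun x => \sum_(0 <= j < M) `|a j| * \1_(B j) x).
 by apply: msum => j; apply: mfM => //; exact: mindic.
have ga00 x : 0 <= \sum_(0 <= j < M) `|a j| * \1_(B j) x.
 by apply: sge0 => j _; rewrite mge0.
have gga x : `|g x| <= ga x.
 apply: leT (ler_normD _ _) _; apply: lerD.
  apply: leT (ler_norm_sum _ _ _) _; apply: ler_sum => j _.
  by rewrite normrM nindic.
 by rewrite normrM ler_piMr// indicE; case: (_ \in _); rewrite ?normr0 ?normr1.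
have intga : (\int[mu]_x (ga x)%:E <= (2 * I)%:E)%E.
 rewrite /ga (intD mu measurableT mga0 mnf ga00 (fun=> normr_ge0 _)) IE mulr_natl mulr2n EFinD; apply: leeD => //.
 have -> : (\int[mu]_x (\sum_(0 <= j < M) `|a j| * \1_(B j) x)%:E =
  \sum_(0 <= j < M) (`|a j| * v j)%:E)%E.
  elim: {hM rest brest g mg0 bg mg gbd ga mga0 ga00 gga} M => [|k ih].
  rewrite big_geq//; under eqint do rewrite big_geq//; exact: integral0.
  rewrite big_nat_recr//= -ih; under eqint do rewrite big_nat_recr//=.
  rewrite (intD mu measurableT _ (mindB k _) _ (paB k)).
  - by rewrite intZ// intindic// setIT vE -EFinM.
  - by apply: msum => j; exact: mindB.
  - by move=> x; apply: sge0 => j _; exact: paB.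
 by rewrite sumEFin leF; apply: leT (SJ M); exact: ler_sum.
have sg : (sqint mu g <= (l * D ^+ 6 * (2 * I))%:E)%E.
 rewrite EFinM; apply: leT (leMl _ intga); last by rewrite leF.
 have mga : mfun ga by exact: mfD.
 have ga0 x : 0 <= ga x by rewrite age0.
 rewrite -intZ//; apply: ae_ge0_le_integral => //.
 - by move=> x _; rewrite leF sqr_ge0.
 - by apply: mEFin; exact: msqr.
 - by move=> x _; rewrite leF mge0.
 - by apply: mEFin; exact: mfM.
 - apply: filterS gbd => x gx _; rewrite leF -real_normK ?num_real// expr2.
  by apply: ler_pM.
have srest : (sqint mu rest <= (l * I)%:E)%E.
 apply: (leU ((M0 ^+ 2)%:E * mu (S M))%E).
  apply: sq_le_indic => //; first by case: brest.
  by move=> x; rewrite normrM nindic; exact: wMr.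
 apply: leT (leMl _ hM) _; first by rewrite leF sqr_ge0.
 rewrite -EFinM leF mulrCA ler_piMr ?mge0 ?(ltW l0)// lepdM// mul1r.
 by rewrite lerDl.
have fE : f = (fun x => (1 * rest x + g x) + \sum_(0 <= j < M) bad j x).
 apply/funext => x; rewrite /rest /g /bad big_split /= mul1r.
 have -> : \sum_(0 <= j < M) - a j * \1_(B j) x = - \sum_(0 <= j < M) a j * \1_(B j) x.
  by rewrite -sumrN; apply: eq_bigr => j _; rewrite mulNr.
 rewrite -mulr_sumr (sum_disj_indic _ _ tP).
 have -> : \1_(S M) x = \1_Q x - \1_(\bigcup_(j in `I_M) P j) x :> R.
  rewrite /S !indicE in_setD; case: (boolP (x \in \bigcup_(j in `I_M) P j)) => xP /=.
  have -> : x \in Q by move: xP; rewrite !inE => -[j _ /PO].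
  by rewrite subrr.
  by rewrite andbT subr0.
 have -> : \1_(~` Q) x = 1 - \1_Q x :> R.
  by rewrite !indicE in_setC; case: (_ \in _); rewrite /= ?subrr ?subr0.
 by ring.
have bu : bdsupp rho (fun x => 1 * rest x + g x) by exact: (bdsupp_lin ds).
have [_ Tsum] := operator_sum M bu bbad; rewrite -fE in Tsum.
have Tu := Tlin 1 (Lfun_bd ds brest) (Lfun_bd ds bg).
have l3 : 0 < l / 3 by rewrite dgt0.
have [Z [mZ Z0 hZ]] : {ae mu, forall x, T f x = T rest x + T g x + \sum_(0 <= j < M) T (bad j) x}.
 by apply: filterS2 Tsum Tu => x -> ->; rewrite mul1r.
pose E1 := [set x | (l / 3 < `|T rest x|)%R].
pose E2 := [set x | (l / 3 < `|T g x|)%R].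
pose BL j := b (z j).1 (Lam * (5 * (z j).2)).
have mBL j : measurable (BL j) by exact: (mball ds).
pose E3 := \bigcup_j BL j.
have mE3 : measurable E3 by exact: mbigcup.
pose tb x := \sum_(0 <= j < M) `|T (bad j) x|.
have mTb j : mfun (fun x => `|T (bad j) x|).
 by apply: mcomp => //; exact: mT.
have mtb : mfun tb by apply: msum => j; exact: mTb.
pose E4 := ~` E3 `&` [set x | (l / 3 < tb x)%R].
have mE1 : measurable E1 by apply: msuplev; apply: mcomp => //; exact: mT.
have mE2 : measurable E2 by apply: msuplev; apply: mcomp => //; exact: mT.
have mE3c : measurable (~` E3) by exact: measurableC.
have mE4 : measurable E4 by apply: measurableI => //; exact: msuplev.
have Esub : E `<=` E1 `|` (E2 `|` (E3 `|` (E4 `|` Z))).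
 move=> x Ex; have [Zx|Zx] := pselect (Z x); first by right; right; right; right.
 have xE : T f x = T rest x + T g x + \sum_(0 <= j < M) T (bad j) x.
  by apply: contrapT => h; apply: Zx; exact: hZ.
 have [|n1] := pselect (E1 x); first by left.
 have [|n2] := pselect (E2 x); first by right; left.
 have [|n3] := pselect (E3 x); first by right; right; left.
 right; right; right; left; split => //.
 move: n1 n2 => /negP; rewrite -leNgt => n1 /negP; rewrite -leNgt => n2.
 move: Ex; rewrite /E /= xE => Ex.
 have h1 := leT (ler_normD _ _) (lerD (ler_normD (T rest x) (T g x)) (ler_norm_sum _ _ _)).
 have h2 := ltleT Ex (h1 _ _ _ _).
 rewrite /= ltNge; apply/negP => h3.
 have := ltleT h2 (lerD (lerD n1 n2) h3).
 by rewrite -!mulrDl -mulr2n -mulrSr -(mulr_natr l 3) mulfK// ltxx.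
have b1 : (l%:E * mu E1 <= (9 * C2 * I)%:E)%E.
 have := chebyshev_le mu (mT _ brest) l3 => /leT.
 have [_ h1] := Tbd (Lfun_bd ds brest) => /(_ _ h1) h2.
 have := leT h2 (leMl _ srest) => /(_ _); rewrite leF => /(_ C20).
 rewrite -/E1 -EFinM; have E1f := measure_ge0 mu E1.
 have -> : (l%:E * mu E1 = (9 / l)%:E * (((l / 3) ^+ 2)%:E * mu E1))%E.
  by rewrite muleA -EFinM; congr (_%:E * _)%E; field; rewrite gtF.
 move=> h3; apply: leT (leMl _ h3) _; first by rewrite leF dge0// ltW.
 by rewrite -EFinM leF; apply: eqW; field; rewrite gtF.
have b2 : (l%:E * mu E2 <= (18 * C2 * D ^+ 6 * I)%:E)%E.
 have := chebyshev_le mu (mT _ bg) l3 => /leT.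
 have [_ h1] := Tbd (Lfun_bd ds bg) => /(_ _ h1) h2.
 have := leT h2 (leMl _ sg) => /(_ _); rewrite leF => /(_ C20).
 rewrite -/E2 -EFinM.
 have -> : (l%:E * mu E2 = (9 / l)%:E * (((l / 3) ^+ 2)%:E * mu E2))%E.
  by rewrite muleA -EFinM; congr (_%:E * _)%E; field; rewrite gtF.
 move=> h3; apply: leT (leMl _ h3) _; first by rewrite leF dge0// ltW.
 by rewrite -EFinM leF; apply: eqW; field; rewrite gtF.
have b3 : (l%:E * mu E3 <= (D ^+ k5 * D ^+ 3 * I)%:E)%E.
 have sB : (\sum_(0 <= j <oo) mu (B j) <= mu Q)%E.
  have := int_disj_le mu mB ztriv mO BQ (mcst (1 : R)) (fun=> ler01).
  rewrite int_cst// mul1e; apply: leT; apply: lesers => // j _.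
  by rewrite int_cst// mul1e.
 have h1 : (mu E3 <= (D ^+ k5)%:E * mu Q)%E.
  apply: (leU (\sum_(0 <= j <oo) mu (BL j))%E).
  have := int_cov_le mu mBL mE3 (fun x h => h) (mcst (1 : R)) (fun=> ler01).
  rewrite int_cst// mul1e => /leT; apply; apply: lesers => [j _ _|j _].
  by apply: intge0.
  by rewrite int_cst// mul1e.
  apply: leT (leMl _ sB); last by rewrite leF xge0// ltW.
  rewrite -nneseriesZl//; apply: lesers => // j _.
  case: (zP j) => [zj|[zj _ _]].
  by rewrite /BL zj !mulr0 (ball_le0 ds)// measure0 mule_ge0// leF xge0// ltW.
  have Lam0 : 0 < Lam by apply: ltleT Lam2.
  have Lz : 0 < Lam * (5 * (z j).2) by rewrite mgt0// mgt0.
  rewrite vE -EFinM (mu_ball ds)// leF; apply: (vol_le ds) => //.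
  by rewrite (mtrefl rm) add0r mulrA wMr ?(ltW zj)// mulrC.
 apply: leT (leMl _ h1) _; first by rewrite leF ltW.
 rewrite muleCA -[_ * _ * I]mulrA EFinM; apply: leMl => //.
 by rewrite leF xge0// ltW.
have b4 : (l%:E * mu E4 <= (6 * (H * D) * I)%:E)%E.
 have h1 := markov_le mu mE3c mtb (fun x => sge0 _ (fun j _ => normr_ge0 _)) l3.
 have h2 : (\int[mu]_(x in ~` E3) (tb x)%:E <= (2 * (H * D) * I)%:E)%E.
  have -> : (\int[mu]_(x in ~` E3) (tb x)%:E =
  \sum_(0 <= j < M) \int[mu]_(x in ~` E3) `|T (bad j) x|%:E)%E.
  rewrite /tb; elim: {1 2}M => [|k ih].
  rewrite big_geq//; under eqint do rewrite big_geq//; exact: integral0.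
  rewrite big_nat_recr//= -ih; under eqint do rewrite big_nat_recr//=.
  rewrite (intD mu mE3c _ (mTb k) _ (fun=> normr_ge0 _))//.
  by apply: msum => j; exact: mTb.
  by move=> x; apply: sge0.
  apply: (leU (\sum_(0 <= j < M) ((2 * (H * D)) * J j)%:E)%E); last first.
  rewrite sumEFin leF -mulr_sumr wMl// mge0// mge0// ltW//.
  apply: lee_sum => j _; case: (zP j) => [zj|[zj _ _]].
  have [B5j _] := empty _ zj.
  have bE : bad j = cst 0 by apply/funext => x; rewrite bads// B5j.
  have s0 : sqint mu (bad j) = 0%E.
  by rewrite bE /sqint; under eqint do rewrite expr0n /=; exact: integral0.
  have [_ ] := Tbd (Lfun_bd ds (bbad j)); rewrite s0 mule0 => sT.
  apply: (leU 0%E); last by rewrite leF mge0// mge0// mge0// ltW.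
  apply: leT (isub mu mE3c measurableT (mTb j) _ _) _ => //.
  by rewrite sqint0_integral0//; exact: mT.
  apply: (leU ((H * D)%:E * (2 * J j)%:E)%E); last first.
  by rewrite -EFinM leF mulrCA mulrA.
  apply: leT (leMl _ (intbad j)); last by rewrite leF mge0// ltW.
  have z5 : 0 < 5 * (z j).2 by rewrite mgt0.
  apply: leT (atom_decay (bbad j) z5 (bads j) (bad0 j)).
  apply: isub => //; first by apply: measurableC; exact: (mball ds).
  by move=> x /= h3 h4; apply: h3; exists j.
 have := leT h1 h2.
 have -> : (l%:E * mu E4 = 3%:E * ((l / 3)%:E * mu E4))%E.
  by rewrite muleA -EFinM; congr (_%:E * _)%E; field.
 move=> h3; apply: leT (leMl _ h3) _; first by rewrite leF.
 by rewrite -EFinM leF; apply: eqW; ring.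
apply: (leU (l%:E * (mu E1 + (mu E2 + (mu E3 + (mu E4 + mu Z)))))%E).
 apply: leMl; first by rewrite leF ltW.
 apply: leT (lemu mu _ _ Esub) _; rewrite ?inE//.
  by apply: measurableU => //; apply: measurableU => //; apply: measurableU => //; exact: measurableU.
 have m4 : measurable (E4 `|` Z) by exact: measurableU.
 have m3 : measurable (E3 `|` (E4 `|` Z)) by exact: measurableU.
 have m2 : measurable (E2 `|` (E3 `|` (E4 `|` Z))) by exact: measurableU.
 apply: leT (measureU2 mu mE1 m2) _; apply: leeD => //.
 apply: leT (measureU2 mu mE2 m3) _; apply: leeD => //.
 apply: leT (measureU2 mu mE3 m4) _; apply: leeD => //.
 exact: measureU2.
rewrite Z0 adde0 !ge0_muleDr ?adde_ge0//.
apply: leT (leeD b1 (leeD b2 (leeD b3 b4))) _.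
rewrite -!EFinD leF -!mulrDl wMr//.
exact: stopping_arith3.
Qed.

End weak_type_operator.

(** What the sparse domination uses of the operator, stated for bounded functions of bounded support
    and metric balls. [Lam] is the dilation beyond which oscillation is controlled. *)
Record cz_op {R : realType} {dsp} {X : mType dsp}
  (rho : X -> X -> R) (mu : meas X R) (r Lam C : R)
  (T : (X -> R) -> X -> R) : Prop := {
 cz_const : 0 <= C;
 cz_measurable : forall f, bdsupp rho f -> mfun (T f);
 cz_linear : forall (a : R) f g, bdsupp rho f -> bdsupp rho g ->
  {ae mu, forall x, T (fun y => a * f y + g y) x = a * T f x + T g x};
 cz_weak : forall f (l : R), bdsupp rho f -> 0 < l ->
  (l%:E * mu [set x | (l < `|T f x|)%R] <= C%:E * \int[mu]_x `|f x|%:E)%E;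
 cz_osc : forall h c s N, bdsupp rho h -> 0 < s -> 0 <= N ->
  (forall y, qball rho c (Lam * s) y -> h y = 0) ->
  (forall t, s <= t -> (\int[mu]_(y in qball rho c t) (`|h y| `^ r)%:E <=
  (N `^ r * vol rho mu c t)%:E)%E) ->
  exists Z, [/\ measurable Z, mu Z = 0%E & forall x z, qball rho c s x -> qball rho c s z ->
  ~ Z x -> ~ Z z -> `|T h x - T h z| <= C * N] }.

Lemma le_add_powR {R : realType} (x r : R) : 0 <= x -> 1 <= r -> x <= 1 + x `^ r.
move=> x0 r1; have [x1|x1] := leP x 1; first by apply: (leT x1); rewrite lerDl pge0.
apply: (leU (x `^ r)); last by rewrite lerDr.
by rewrite -{1}[x]powRr1//; apply: ler_powR => //; exact: ltW.
Qed.

Section cz_lemmas.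
Context {R : realType} {dsp} {X : mType dsp}.
Variables (rho : X -> X -> R) (mu : meas X R) (D : R).
Hypothesis ds : dspace rho mu D.
Local Notation b := (qball rho).
Variables (r Lam C : R) (T : (X -> R) -> X -> R).
Hypotheses (r1 : 1 <= r) (czT : cz_op rho mu r Lam C T).

(** The inequality [x <= 1 + x^r], applied to [w / N], turns the L^r bound into an L^1 bound. As [N]
    may vanish, the argument runs with [N + 1/(k+1)], and the sets increase to the desired one. *)
Lemma cz_weak_avg (h w : X -> R) (S : set X) (m m' N a : R) : bdsupp rho h ->
 mfun w -> (forall x, 0 <= w x) -> measurable S ->
 (forall x, `|h x| <= w x * \1_S x) -> 0 <= N -> 0 < a -> 0 <= m' -> (mu S <= m%:E)%E ->
 (\int[mu]_(x in S) (w x `^ r)%:E <= (N `^ r * m')%:E)%E ->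
 (mu [set x | (a * N < `|T h x|)%R] <= (C * (m + m') / a)%:E)%E.
move=> bh mw w0 mS hw N0 a0 m'0 Sm wN.
have r0 : 0 <= r by exact: leT r1.
have [mh _ _] := bh; have mTh := cz_measurable czT bh.
pose A k := [set x | (a * (N + k.+1%:R^-1) < `|T h x|)%R].
have mA k : measurable (A k) by apply: msuplev; exact: mcomp.
have bA k : (mu (A k) <= (C * (m + m') / a)%:E)%E.
 pose Nk := N + k.+1%:R^-1; have Nk0 : 0 < Nk by rewrite ltr_wpDl//.
 have mwr : mfun (fun x => w x `^ r) by exact: mpowR.
 have hI : (\int[mu]_x `|h x|%:E <= (Nk * (m + m'))%:E)%E.
  apply: (leU (\int[mu]_(x in S) (Nk * (1 + Nk `^ (- r) * w x `^ r))%:E)%E).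
  have -> : (\int[mu]_(x in S) (Nk * (1 + Nk `^ (- r) * w x `^ r))%:E =
  \int[mu]_x (Nk * (1 + Nk `^ (- r) * w x `^ r) * \1_S x)%:E)%E.
  by rewrite int_indic// setTI.
  apply: int_le => //; first exact: mcomp.
  apply: mfM => //.
  by apply: mfM; apply: mfD => //; exact: mfM.
  move=> x _; apply: leT (hw x) _; rewrite wMr//.
  have := le_add_powR (dge0 (w0 x) (ltW Nk0)) r1; rewrite lepdM// mulrC.
  by rewrite powRM ?ige0 ?(ltW Nk0)// -powR_inv1 ?(ltW Nk0)// -powRrM mulN1r [_ * Nk `^ _]mulrC.
  have p0 x : 0 <= Nk `^ (- r) * w x `^ r by rewrite mge0// pge0.
  have mp : mfun (fun x => Nk `^ (- r) * w x `^ r) by exact: mfM.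
  rewrite intZ ?(ltW Nk0)//; last 2 first.
  - by apply: mfD.
  - by move=> x; rewrite age0.
  rewrite EFinM; apply: leMl; first by rewrite ltW.
  have m1 : mfun (fun _ : X => 1 : R) by [].
  rewrite (intD mu mS m1 mp (fun=> ler01) p0) int_cst// mul1e EFinD.
  apply: leeD => //; rewrite intZ ?pge0//; last by move=> x; exact: pge0.
  apply: leT (leMl _ wN) _; first by rewrite leF pge0.
  rewrite leF mulrA ler_piMl// -(@ler_pM2l _ (Nk `^ r)) ?pgt0//.
  have -> : Nk `^ r * (Nk `^ (- r) * N `^ r) = N `^ r.
  by rewrite mulrA powRN mulfV ?mul1r// gtF// pgt0.
  rewrite mulr1.
  by apply: ge0_ler_powR => //; rewrite ?nnegrE ?(ltW Nk0)// lerDl.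
 have aN : 0 < a * Nk by rewrite mgt0.
 have := leT (cz_weak czT bh aN) (leMl _ hI).
 rewrite leF => /(_ (cz_const czT)); rewrite muleC -lee_pdivlMr// => /leT; apply.
 by rewrite leF; apply: eqW; field; rewrite !gtF.
have -> : [set x | (a * N < `|T h x|)%R] = \bigcup_k A k.
 apply/seteqP; split => [x hx|x [k _]]; last first.
  by apply: lt_trans; rewrite ltr_pM2l// ltrDl.
 pose e := (`|T h x| - a * N) / a; have e0 : 0 < e by rewrite dgt0// subr_gt0.
 exists (Num.truncn e^-1) => //; rewrite /A /= mulrDr addrC -ltrBrDr mulrC -ltr_pdivlMr//.
 by rewrite -[ltRHS]invrK ltf_pV2 ?posrE ?igt0// truncnS_gt.
have cv : (mu \o A) n @[n --> \oo] --> mu (\bigcup_k A k).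
 apply: nondecreasing_cvg_mu => //; first exact: mbigcup.
 move=> i j ij; apply/subsetPset => x; apply: leltT.
 by rewrite wMl ?(ltW a0)// lerD2l lef_pV2 ?posrE// ler_nat.
rewrite -(cvg_lim _ cv)//; apply: lime_le; first by apply/cvg_ex; eexists; exact: cv.
by apply: nearW => k; exact: bA.
Qed.

Lemma cz_sum (I : eqType) (s : seq I) (a : I -> R) (g : I -> X -> R) :
 (forall i, bdsupp rho (g i)) ->
 bdsupp rho (fun x => \sum_(i <- s) a i * g i x) /\
 {ae mu, forall x, T (fun x => \sum_(i <- s) a i * g i x) x = \sum_(i <- s) a i * T (g i) x}.
move=> bg; elim: s => [|i s [ih1 ih2]].
 have b0 : bdsupp rho (fun _ : X => 0 : R).
  split; [exact: mcst|by exists 0 => x; rewrite normr0|by exists point, 0].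
 have -> : (fun x => \sum_(i <- [::]) a i * g i x) = (fun=> 0).
  by apply/funext => x; rewrite big_nil.
 split => //; have := cz_linear czT 1 b0 b0; rewrite (_ : (fun y => 1 * 0 + 0) = (fun=> 0)).
  by apply: filterS => x; rewrite mul1r big_nil => /eqP; rewrite -subr_eq subrr => /eqP.
 by apply/funext => x; rewrite mul1r addr0.
have -> : (fun x => \sum_(j <- i :: s) a j * g j x) = (fun x => a i * g i x + \sum_(j <- s) a j * g j x).
 by apply/funext => x; rewrite big_cons.
split; first exact: (bdsupp_lin ds).
by apply: filterS2 ih2 (cz_linear czT (a i) (bg i) ih1) => x h ->; rewrite h big_cons.
Qed.

End cz_lemmas.

(** * Sparse domination by a stopping time with variable radii *)

Section sparse_arithmetic.
Context {R : rfType}.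

Fact radius_arith1 (K s s' t d : R) : 100 <= K -> 0 < s -> s <= t -> 0 <= s' ->
 K * s' <= K * s + d -> d <= 17 * s + 2 * t + 7 * s' -> s' <= 2 * t.
nra. Qed.

Fact radius_arith2 (K s s' d : R) : 100 <= K -> 0 < s -> 0 <= s' -> K * s' <= K * s + d ->
 d <= 5 * s + 5 * s' -> s' <= 2 * s.
nra. Qed.

Fact radius_arith3 (k K s s' : R) : K = 2 * k + 100 -> 1 <= k -> 0 <= s' -> K * s' < 2 * s ->
 k * s' <= s /\ 50 * s' <= s.
move=> -> ? ? ?; split; nra. Qed.

Fact radius_arith4 (K s s' q d : R) : 100 <= K -> 0 < s -> 50 * s' <= s -> K * s <= K * q + d ->
 d <= 5 * s + 5 * s' -> 2 * s' <= q.
nra. Qed.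

Fact bad_arith1 (d v q l : R) : q != 0 -> l != 0 -> d * (q * v) / (l * q) = d * v / l.
by move=> ? ?; field; apply/andP. Qed.

Fact bad_arith2 (c d v l : R) : c * (d * v + v) / l = c * (d + 1) * v / l.
ring. Qed.

Fact bad_arith3 (m c d v l : R) : m * (c * v / l) + d * v / l = (m * c + d) / l * v.
ring. Qed.

Fact omega_arith (e d v : R) : 0 < e -> 0 < d -> 1 <= d -> 0 <= v ->
 e^-1 * (d ^+ 3 * (e / d ^+ 19 * d ^+ 5 * (d ^+ 5 * v))) <= d ^- 6 * v.
move=> e0 d0 d1 v0; apply: eqW.
by field; rewrite !gtF.
Qed.

Fact radius_arith5 (k t i : R) : 7 * k + (t + (t + 17 * i)) = 17 * i + 2 * t + 7 * k.
ring. Qed.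

Fact lip_arith (k a c d : R) : 0 < k -> k * a <= k * c + d -> k * c <= k * a + d ->
 `|a - c| <= k^-1 * d.
move=> k0 h1 h2; rewrite ler_pdivlMl// -{1}[k](gtr0_norm k0) -normrM mulrBr ler_norml.
by apply/andP; split; lra.
Qed.

Fact radius_arith6 (s s' : R) : s' <= 2 * s -> 5 * s + 5 * s' + s <= 16 * s.
lra. Qed.

Fact radius_arith7 (s s' : R) : 5 * s' <= s -> 5 * s + 5 * s' + s <= 7 * s.
lra. Qed.

Fact weak_arith1 (k l q v : R) : l * q * (k * v) = q * (k * l * v).
ring. Qed.

Fact weak_arith2 (c k l v : R) : 0 <= c * (k + k * l) -> 0 <= v ->
 c * (k * v + k * l * v) / (4 * (c * (k + k * l)) + 1) <= 4^-1 * v.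
set q := c * (k + k * l) => q0 v0; rewrite (_ : c * (k * v + k * l * v) = q * v); last by rewrite /q; ring.
rewrite lepdM; last by lra.
nra.
Qed.

Fact quarter_arith : 4^-1 + 4^-1 < 1 :> R.
lra. Qed.
End sparse_arithmetic.

Lemma measure_bigsetU_le {R : realType} {dsp} {X : mType dsp}
  (mu : meas X R) (I : choiceType) (s : seq I) (F : I -> set X) (m : R) :
 (forall i, measurable (F i)) -> (forall i, (mu (F i) <= m%:E)%E) ->
 (mu (\bigcup_(i in [set` s]) F i) <= ((size s)%:R * m)%:E)%E.
move=> mF Fm; rewrite bigcup_seq; elim: s => [|i s ih].
 by rewrite big_nil measure0 mul0r.
rewrite big_cons; apply: leT (measureU2 mu (mF i) _) _.
 by apply: bigsetU_measurable => j _.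
by rewrite /= -natr1 mulrDl mul1r addrC EFinD; exact: leeD.
Qed.

Lemma meas_disj_le {R : realType} {dsp} {X : mType dsp}
  (mu : meas X R) (F : nat -> set X) (B : set X) :
 (forall k, measurable (F k)) -> trivIset setT F -> measurable B -> (forall k, F k `<=` B) ->
 (\sum_(0 <= k <oo) mu (F k) <= mu B)%E.
move=> mF tF mB FB; rewrite -meas_bigcupT//; apply: lemu; rewrite ?inE//.
 exact: mbigcup.
by move=> x [k _ /FB].
Qed.

Section sparse_step.
Context {R : realType} {dsp} {X : mType dsp}.
Variables (rho : X -> X -> R) (mu : meas X R) (D : R).
Hypothesis ds : dspace rho mu D.
Local Notation b := (qball rho).
Variables (r Lam C : R) (T : (X -> R) -> X -> R).
Hypotheses (r1 : 1 <= r) (Lam1 : 1 <= Lam) (czT : cz_op rho mu r Lam C T).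
Hypothesis leb : forall E, measurable E -> leb_upto rho mu D (\1_E).
Variables (n : nat) (f : X -> 'cV[R]_n) (V : X * R -> 'M[R]_n).
Hypothesis bf : forall i, bdsupp rho (fun x => f x i 0).

Let rsym := mtsym (dsmt ds).
Let rtri := mttri (dsmt ds).
Let rxx := mtrefl (dsmt ds).
Let mb c s : measurable (b c s) := mball ds c s.
Let D0 := D_gt0 ds.
Let D1 : 1 <= D. Proof. by apply: leT (dsC ds); rewrite ler1n. Qed.
Let r0 : 0 < r. Proof. exact: ltleT r1. Qed.
Let C0 := cz_const czT.

(** The summand [5 Lam] makes the far part of [f] vanish on the ball of radius [5 Lam s], as the
    oscillation estimate asks; [9] brings [sdil] up to 14, enough to hold the 7-dilates and the
    initial support. [slip] is the inverse Lipschitz constant of radius functions: it makes radii of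
    meeting balls comparable and forces the next radius below [s / sdil]. *)
Definition sdil : R := 5 * Lam + 9.
Definition slip : R := 2 * sdil + 100.
Definition sdlog : nat := (Num.truncn sdil).+1.
Definition slip_log : nat := (Num.truncn (2 * slip)).+1.
(** [sdens] leaves density at most [1/4] near a point outside the enlarged bad set. [sbad] carries
    [D^-19] to beat the factors [D^3 D^5 D^5] of the weak type bound and keep [D^-6]. [slev] makes
    the bad sets that small, and [slev2] makes a second exceptional set fill at most a quarter of a
    ball. *)
Definition sdens : R := (4 * D ^+ slip_log)^-1.
Definition sbad : R := sdens / D ^+ 19.
Definition slev : R := (n%:R * (C * (D ^+ sdlog + 1)) + D ^+ 3) / sbad + 1.
Definition slev2 : R := 4 * (C * (D ^+ sdlog + D ^+ sdlog * slev)) + 1.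
Definition sout : R := n%:R * (slev + slev2 + C * slev).

Let sdil14 : 14 <= sdil.
by rewrite /sdil -[leLHS](_ : 5 * 1 + 9 = 14 :> R) ?lerD2r ?ler_pM2l//; ring. Qed.
Let sdil0 : 0 < sdil. Proof. exact: ltleT sdil14. Qed.
Let slip100 : 100 <= slip. Proof. by rewrite /slip lerDr mge0// ltW. Qed.
Let slip0 : 0 < slip. Proof. exact: ltleT slip100. Qed.
Let two_pow (x : R) : x <= 2 ^+ (Num.truncn x).+1.
by apply: leT (ltW (truncnS_gt _)) _; rewrite -natrX ler_nat ltnW// ltn_expl. Qed.
Let Dn k : 0 < D ^+ k. Proof. exact: xgt0. Qed.
Let sdens0 : 0 < sdens. Proof. by rewrite igt0 mgt0. Qed.
Let sbad0 : 0 < sbad. Proof. by rewrite dgt0. Qed.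
Let slev1 : 1 <= slev.
by rewrite /slev lerDr dge0 ?(ltW sbad0)// age0 ?(ltW (Dn 3))// !mge0// age0// ltW.
Qed.
Let slev0 : 0 < slev. Proof. exact: ltleT slev1. Qed.
Let slev20 : 0 < slev2.
by rewrite ltr_wpDl// !mge0// age0 ?mge0// ltW. Qed.

Definition scomp (A : 'M[R]_n) (l : 'I_n) (y : X) : R := (A *m f y) l 0.
Definition snorm (A : 'M[R]_n) (y : X) : R := enorm (A *m f y).

Lemma scompE A l : scomp A l = (fun y => \sum_j A l j * f y j 0).
by apply/funext => y; rewrite /scomp mxE. Qed.

Lemma bs_scomp A l : bdsupp rho (scomp A l).
by rewrite scompE; have [] := cz_sum ds czT (index_enum _) (A l) bf. Qed.

Lemma msnorm A : mfun (snorm A).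
by apply: menorm => i; have [] := bs_scomp A i. Qed.

Lemma scomp_le A l y : `|scomp A l y| <= snorm A y.
exact: coord_le. Qed.

Lemma snorm_bounded A : exists2 M, 0 <= M & forall y, snorm A y <= M.
have Mex l : exists M, forall y, `|scomp A l y| <= M by have [] := bs_scomp A l.
have [M hM] := choice Mex; exists (\sum_l `|M l|); first by apply: sge0.
move=> y; apply: leT (en_le_sum _) _; apply: ler_sum => l _.
exact: leT (hM l y) (ler_norm _).
Qed.

Definition savg (z : X * R) : R :=
 (fine (\int[mu]_(y in b z.1 (sdil * z.2)) (snorm (V z) y `^ r)%:E) / vol rho mu z.1 z.2) `^ r^-1.

Let mpow A : mfun (fun y => snorm A y `^ r).
by apply: mpowR; exact: msnorm. Qed.

Lemma savg_ge0 z : 0 <= savg z. Proof. exact: pge0. Qed.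

Lemma savgE z : 0 < z.2 -> (\int[mu]_(y in b z.1 (sdil * z.2)) (snorm (V z) y `^ r)%:E =
 (savg z `^ r * vol rho mu z.1 z.2)%:E)%E.
move=> z0; have v0 := vgt0 ds z.1 z0; rewrite powRVK ?gtF//; last first.
 by rewrite dge0 ?(ltW v0)// fine_ge0// intge0// => y; rewrite leF pge0.
rewrite divfK ?gtF// fineK// ge0fin; last first.
 by rewrite intge0// => y; rewrite leF pge0.
have [M M0 hM] := snorm_bounded (V z).
apply: (@leltT _ _ (\int[mu]_(y in b z.1 (sdil * z.2)) (M `^ r)%:E)%E).
 apply: int_le => //; first by move=> y; exact: pge0.
 by move=> y _; apply: ge0_ler_powR; rewrite ?nnegrE ?(ltW r0)// en_ge0.
by rewrite int_cst//; apply: lte_mul_pinfty; rewrite ?leF ?pge0// (muB_lty ds).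
Qed.

Definition sfun (A : 'M[R]_n) (l : 'I_n) (S : set X) (y : X) : R := scomp A l y * \1_S y.
Definition sden (z : X * R) (y : X) : R := snorm (V z) y `^ r * \1_(b z.1 (sdil * z.2)) y.

Lemma bs_sfun A l S : measurable S -> bdsupp rho (sfun A l S).
by move=> mS; apply: bdsupp_indic => //; exact: bs_scomp. Qed.

Lemma sfun_le A l S y : `|sfun A l S y| <= snorm A y * \1_S y.
by rewrite normrM nindic wMr// scomp_le. Qed.

Let msden z : mfun (sden z). Proof. exact: mMindic. Qed.
Let sden0 z y : 0 <= sden z y. Proof. by rewrite mge0// pge0. Qed.

Definition big_set (z : X * R) (l : 'I_n) : set X :=
 [set x | (slev * savg z < `|T (sfun (V z) l (b z.1 (sdil * z.2))) x|)%R].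

(** Off this set both [T] of the localized function and the means of the localized data over all
    balls through the point are bounded by [savg z]. The 7-dilate is where the balls of the next
    generation live. *)
Definition bad_set (z : X * R) : set X := b z.1 (7 * z.2) `&`
 ((\bigcup_(l in [set` index_enum 'I_n]) big_set z l) `|` omega rho mu (sden z) (slev * savg z `^ r)).

Let mbig z l : measurable (big_set z l).
apply: msuplev; apply: mcomp => //.
by apply: (cz_measurable czT); exact: bs_sfun.
Qed.

Let mbigU z : measurable (\bigcup_(l in [set` index_enum 'I_n]) big_set z l).
by rewrite bigcup_seq; apply: bigsetU_measurable => l _; exact: mbig. Qed.

Lemma mbadset z : measurable (bad_set z).
by apply: measurableI => //; apply: measurableU => //; exact: (momega ds).
Qed.

Lemma bad_set_small z : 0 < z.2 -> (mu (bad_set z) <= (sbad * vol rho mu z.1 z.2)%:E)%E.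
move=> z0; have v0 := vgt0 ds z.1 z0; set v := vol _ _ _ _ in v0 *.
have kz0 : 0 < sdil * z.2 by rewrite mgt0.
have bl l : (mu (big_set z l) <= (C * (D ^+ sdlog + 1) * v / slev)%:E)%E.
 have := @cz_weak_avg _ _ _ _ _ _ _ _ _ r1 czT _ (snorm (V z)) (b z.1 (sdil * z.2))
  (D ^+ sdlog * v) v (savg z) slev (bs_sfun (V z) l (mb _ _)) (msnorm _)
  (fun=> en_ge0 _) (mb _ _) (sfun_le _ _ _) (savg_ge0 z) slev0 (ltW v0).
 rewrite -/(big_set z l) => h; apply: leT (h _ _) _.
 - rewrite (mu_ball ds)//; apply: vol_le => //.
  by rewrite rxx add0r wMr ?(ltW z0).
 - by rewrite savgE.
 - by rewrite bad_arith2.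
have bo : (mu (omega rho mu (sden z) (slev * savg z `^ r)) <= (D ^+ 3 * v / slev)%:E)%E.
 have iE : (\int[mu]_y (sden z y)%:E = (savg z `^ r * v)%:E)%E.
  by rewrite int_indic// setTI savgE.
 have [N0|N0] := eqVneq (savg z `^ r) 0.
  rewrite N0 mulr0 (_ : omega _ _ _ _ = set0) ?measure0.
  by rewrite leF dge0 ?(ltW slev0)// mge0// ltW.
  apply/seteqP; split => // x [c [s [_ _]]]; rewrite mul0r ltNge => /negP; apply.
  by have := iE; rewrite N0 mul0r => <-; apply: isub.
 have N1 : 0 < savg z `^ r by rewrite lt0r N0 pge0.
 have l0 : 0 < slev * savg z `^ r by rewrite mgt0.
 have := weak_type ds l0 (msden z) (sden0 z); rewrite iE muleC -lee_pdivlMr// => /leT; apply.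
 rewrite leF; apply: eqW.
 by apply: bad_arith1; rewrite ?gtF.
apply: leT (lemu mu _ _ (@subIsetr _ _ _)) _; rewrite ?inE.
- exact: mbadset.
- by apply: measurableU => //; exact: (momega ds).
apply: leT (measureU2 mu (mbigU z) (momega ds _ _)) _.
apply: leT (leeD (measure_bigsetU_le (index_enum 'I_n) (mbig z) bl) bo) _.
rewrite leF.
have -> : size (index_enum 'I_n) = n by rewrite -[RHS]card_ord cardE enumT.
rewrite bad_arith3.
rewrite ler_pM2r// lepdM// -(ler_pdivrMl _ _ sbad0) [_^-1 * _]mulrC.
by rewrite /slev lerDl.
Qed.

Definition svec (z : X * R) (x : X) : 'cV[R]_n :=
 \col_m T (fun y => f y m 0 * \1_(b z.1 (sdil * z.2)) y) x.

(** Linearity moves a constant matrix inside [T], so vectors can be estimated through scalar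
    functions [sfun], outside a null set common to all coordinates. *)
Lemma svecE (A : 'M[R]_n) S : measurable S -> {ae mu, forall x, forall l,
 \sum_m A l m * T (fun y => f y m 0 * \1_S y) x = T (sfun A l S) x}.
move=> mS; have h l : {ae mu, forall x, \sum_m A l m * T (fun y => f y m 0 * \1_S y) x =
  T (sfun A l S) x}.
 have bfS m : bdsupp rho (fun y => f y m 0 * \1_S y) by exact: bdsupp_indic.
 have [_] := cz_sum ds czT (index_enum _) (A l) bfS.
 have -> : (fun x => \sum_(i <- index_enum 'I_n) A l i * (f x i 0 * \1_S x)) = sfun A l S.
  by apply/funext => x; rewrite /sfun scompE mulr_suml; apply: eq_bigr => m _; rewrite mulrA.
 by apply: filterS => x ->.
have h' k : {ae mu, forall x, forall l : 'I_n, val l = k ->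
  \sum_m A l m * T (fun y => f y m 0 * \1_S y) x = T (sfun A l S) x}.
 have [kn|kn] := ltnP k n; last by apply: nearW => x l lk; have := ltn_ord l; rewrite lk ltnNge kn.
 by apply: filterS (h (Ordinal kn)) => x hx l lk; rewrite (_ : l = Ordinal kn)//; apply: val_inj.
by apply: filterS (ae_foralln h') => x hx l; exact: (hx (val l)).
Qed.

Lemma enorm_le_comp (v : 'cV[R]_n) (a : R) : (forall l, `|v l 0| <= a) -> enorm v <= n%:R * a.
move=> va; apply: leT (en_le_sum _) _.
apply: (leU (\sum_(i < n) a)); first exact: ler_sum.
by rewrite sumr_const card_ord mulr_natl.
Qed.

(** Slowly varying radii take the place of dyadic cubes: a generation of sparse balls is a Vitali
    selection among the balls [b x (rad x)]. *)
Definition rad_fun (rad : X -> R) : Prop := [/\ forall x, 0 <= rad x,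
 forall x y, slip * rad x <= slip * rad y + rho x y & exists R0, forall x, rad x <= R0].

Section step.
Variable rad : X -> R.
Hypothesis rfun : rad_fun rad.
Variable z : nat -> X * R.
Hypotheses (zP : forall i, (z i).2 = 0 \/ (0 < (z i).2 /\ (z i).2 = rad (z i).1))
 (ztriv : trivIset setT (fun i => b (z i).1 (z i).2)).

Let z0 i : 0 <= (z i).2. Proof. by case: (zP i) => [->|[/ltW]]. Qed.
Let E := \bigcup_i bad_set (z i).
Let mE : measurable E. Proof. by apply: mbigcup => i _; exact: mbadset. Qed.
Let Om := omega rho mu (\1_E : X -> R) sdens.
Let mOm : measurable Om. Proof. exact: (momega ds). Qed.

Let badE0 i : (z i).2 = 0 -> bad_set (z i) = set0.
by move=> h; rewrite /bad_set h mulr0 (ball_le0 ds)// set0I. Qed.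

Let oOm : qopen rho Om.
move=> x [c [s [s0 xs h]]]; have [d d0 dO] := ball_open ds xs.
by exists d => // y /dO ys; exists c, s.
Qed.

Let int1E A : measurable A -> (\int[mu]_(x in A) ((\1_E : X -> R) x)%:E = mu (E `&` A))%E.
by move=> mA; rewrite intindic. Qed.

(** By the Lipschitz property the selected balls whose bad sets meet [b c t] have radius at most
    [2 t]; being disjoint and contained in the dilate by [2^5], they carry bad sets of total measure
    at most [sbad D^5] times the volume. *)
Let local_density i y c t : 0 < (z i).2 -> b (z i).1 (17 * (z i).2) y -> b c t y ->
 (z i).2 <= t -> (mu (E `&` b c t) <= (sbad * D ^+ 5 * vol rho mu c t)%:E)%E.
move=> zi0 yi yt it; have t0 : 0 < t by exact: ltleT it.
have [_ rl _] := rfun.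
pose J k := (0 < (z k).2) && `[< bad_set (z k) `&` b c t !=set0 >].
pose Ek k := if J k then bad_set (z k) else set0.
pose Bk k := if J k then b (z k).1 (z k).2 else set0.
have mEk k : measurable (Ek k) by rewrite /Ek; case: ifP => // _; exact: mbadset.
have mBk k : measurable (Bk k) by rewrite /Bk; case: ifP.
have EEk : E `&` b c t `<=` \bigcup_k Ek k.
 move=> x [[k _ kx] xt]; exists k => //; rewrite /Ek /J.
 have -> : 0 < (z k).2 by case: (zP k) => [/badE0 h|[]//]; rewrite h in kx.
 by rewrite (asboolT (ex_intro _ x (conj kx xt))).
have Bkt : trivIset setT Bk.
 apply/trivIsetP => i1 i2 _ _ i12; rewrite /Bk; case: ifP => _; last by rewrite set0I.
 case: ifP => _; last by rewrite setI0.
 by move/trivIsetP : ztriv; apply.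
have Bks k : Bk k `<=` b c (2 ^+ 5 * t).
 rewrite /Bk; case: ifPn => [/andP[zk0 /asboolP[p [[pk _] pt]]]|_] => //.
 have zk : (z k).2 = rad (z k).1 by case: (zP k) zk0 => [->|[]//]; rewrite ltxx.
 have zi : (z i).2 = rad (z i).1 by case: (zP i) zi0 => [->|[]//]; rewrite ltxx.
 have := rl (z k).1 (z i).1; rewrite -zk -zi => h1.
 have h2 : rho (z k).1 (z i).1 <= 17 * (z i).2 + 2 * t + 7 * (z k).2.
  have u1 := rtri p (z k).1 (z i).1; have u2 := rtri c p (z i).1; have u3 := rtri y c (z i).1.
  move: pk pt yi yt; rewrite /qball /= (rsym p c) (rsym y (z i).1) in u2 u3 *.
  move=> pk pt yi yt; apply: leT u1 _; apply: leT (lerD (ltW pk) u2) _.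
  apply: leT (lerD (lexx _) (lerD (ltW pt) u3)) _.
  apply: leT (lerD (lexx _) (lerD (lexx _) (lerD (ltW yt) (ltW yi)))) _.
  lra.
 have h3 := radius_arith1 slip100 zi0 it (z0 k) h1 h2.
 apply: (bsub ds); have u1 := rtri p (z k).1 c.
 have : rho (z k).1 c <= 7 * (z k).2 + t.
  by apply: leT u1 _; apply: lerD; [exact: ltW|rewrite rsym ltW].
 move=> h4; apply: leT (lerD h4 (lexx _)) _.
 have h5 : 7 * (z k).2 + t + (z k).2 = 8 * (z k).2 + t by lra.
 rewrite h5; apply: (leU (8 * (2 * t) + t)); first by rewrite lerD2r ler_pM2l.
 lra.
have h1 : (mu (E `&` b c t) <= \sum_(0 <= k <oo) mu (Ek k))%E.
 by apply: measure_sigma_subadditive => //; exact: measurableI _ _ mE (mb c t).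
have h2 : (\sum_(0 <= k <oo) mu (Bk k) <= mu (b c (2 ^+ 5 * t)))%E.
 exact: meas_disj_le.
apply: leT h1 _; apply: (leU (sbad%:E * \sum_(0 <= k <oo) mu (Bk k))%E).
 rewrite -nneseriesZl//; apply: lesers => // k _; rewrite /Ek /Bk.
 case: ifP => [/andP[zk0 _]|_]; last by rewrite measure0 mule0.
 by rewrite (mu_ball ds)//; exact: bad_set_small.
apply: leT (leMl _ h2) _; first by rewrite ltW.
have t5 : 0 < 2 ^+ 5 * t by lra.
rewrite (mu_ball ds)// leF -mulrA ler_pM2l//.
exact: (dbl_iter ds).
Qed.

(** Near a selected ball large balls have small density of [E] by [local_density]. So only balls of
    smaller radius can witness membership in [Om]; they see only the part of [E] in the 19-dilate,
    to which the weak type bound applies. *)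
Let omega_small i : 0 < (z i).2 ->
 (mu (Om `&` b (z i).1 (17 * (z i).2)) <= (D ^- 6 * vol rho mu (z i).1 (z i).2)%:E)%E.
move=> zi0; set c := (z i).1; set s := (z i).2; pose B := b c (19 * s).
have s19 : 0 < 19 * s by rewrite mgt0.
have mEB : measurable (E `&` B) := measurableI _ _ mE (mb c _).
have sub : Om `&` b c (17 * s) `<=` omega rho mu (\1_(E `&` B) : X -> R) sdens.
 move=> x [[c' [t [t0 xt h]]] xi]; exists c', t; split => //.
 have [st|ts] := leP s t.
  exfalso; have := local_density zi0 xi xt st; rewrite -(int1E (mb c' t)).
  move=> /(ltleT h); rewrite lte_fin ltNge => /negP; apply.
  rewrite wMr ?(ltW (vgt0 ds c' t0))// -mulrA ler_piMr ?(ltW sdens0)//.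
  by rewrite mulrC lepdM// mul1r ler_weXn2l.
 apply: ltleT h _; rewrite !intindic//.
 apply: lemu; rewrite ?inE; [exact: measurableI|exact: measurableI|].
 move=> y [Ey yt]; split => //; split => //; rewrite /B /qball /=.
 have u1 := rtri x c y; have u2 := rtri c' x y; move: xi xt yt; rewrite /qball /= rsym => xi xt yt.
 apply: leltT u1 _; have -> : 19 * s = 17 * s + (s + s) by ring.
 apply: ltr_leD; first by rewrite rsym.
 by apply: leT u2 _; rewrite (rsym x c'); apply: lerD; apply: ltW; exact: lt_trans ts.
apply: leT (lemu mu _ _ sub) _; rewrite ?inE; [exact: measurableI|exact: (momega ds)|].
have m1E : mfun (\1_(E `&` B) : X -> R) by [].
have := weak_type ds sdens0 m1E (fun x => ler0n _ _); rewrite intindic// setIT.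
have cB : B c by exact: (ball_ctr ds).
have c17 : b c (17 * s) c by apply: (ball_ctr ds); rewrite mgt0.
have s19' : s <= 19 * s by lra.
have ld := local_density zi0 c17 cB s19'.
rewrite muleC -lee_pdivlMr// => /leT; apply; rewrite muleC.
have i0 : (0 <= (sdens^-1)%:E)%E by rewrite leF ige0 ltW.
have d3 : (0 <= (D ^+ 3)%:E)%E by rewrite leF ltW.
apply: leT (leMl i0 (leMl d3 ld)) _.
rewrite leF.
have v19 : vol rho mu c (19 * s) <= D ^+ 5 * vol rho mu c s.
 apply: vol_le => //; rewrite rxx add0r wMr ?(ltW zi0)// -natrX ler_nat//.
apply: (leU (sdens^-1 * (D ^+ 3 * (sbad * D ^+ 5 * (D ^+ 5 * vol rho mu c s))))).
 apply: wMl => //.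
 apply: wMl => //.
 by apply: wMl => //; rewrite mge0 // ltW.
by rewrite /sbad; apply: omega_arith => //; exact: ltW (vgt0 ds _ _).
Qed.

(** The next radius is of Whitney type: the largest [t <= rad x] whose ball of radius [slip t] stays
    inside [Om]. It inherits the Lipschitz constant and is positive exactly on the points of [Om]
    where [rad] is. *)
Let nset x := [set t | 0 <= t <= rad x /\ b x (slip * t) `<=` Om].
Let nrad x := sup (nset x).
Let rad0 x : 0 <= rad x. Proof. by have [] := rfun. Qed.

Let nset_sup x : has_sup (nset x).
split; last by exists (rad x) => t [/andP[]].
by exists 0; split; [rewrite lexx rad0|rewrite mulr0 (ball_le0 ds)].
Qed.

Let nset0 x : nset x 0.
by split; [rewrite lexx rad0|rewrite mulr0 (ball_le0 ds)]. Qed.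

Let nrad_ge0 x : 0 <= nrad x.
exact: (supub (nset_sup x)). Qed.

Let nrad_le x : nrad x <= rad x.
by apply: ge_sup; [exact: (nset_sup x).1|move=> t [/andP[]]]. Qed.

Let nrad_lip x y : slip * nrad x <= slip * nrad y + rho x y.
rewrite -ler_pdivlMl//; apply: ge_sup; first exact: (nset_sup x).1.
move=> t [/andP[t0 tr] tO]; rewrite ler_pdivlMl// -lerBlDr.
have [h|h] := leP (slip * t - rho x y) 0.
 by apply: (leT h); rewrite mge0// ltW.
rewrite -ler_pdivrMl//; apply: (supub (nset_sup y)); split.
 rewrite mge0 ?ige0 ?(ltW slip0) ?(ltW h)//= ler_pdivrMl// lerBlDr.
 have [_ rl _] := rfun; apply: leT (rl x y).
 by rewrite ler_pM2l.
rewrite mulrA mulfV ?gtF// mul1r; apply: subT tO; apply: (bsub ds).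
by rewrite rsym addrC subrK.
Qed.

Let nrad_in x t : t < nrad x -> b x (slip * t) `<=` Om.
move=> tn; have h : 0 < nrad x - t by rewrite subr_gt0.
have [t' [_ t'O]] := sup_adherent h (nset_sup x); rewrite subKr => tt'.
apply: subT t'O.
by apply: (bsub ds); rewrite rxx add0r ler_pM2l// ltW.
Qed.

Let nrad_Om x : 0 < nrad x -> Om x.
move=> h; apply: (@nrad_in x (nrad x / 2)); first by rewrite ltr_pdivrMr// ltr_pMr// ltr1n.
by apply: (ball_ctr ds); rewrite mgt0// dgt0.
Qed.

Let nrad_pos x : Om x -> 0 < rad x -> 0 < nrad x.
move=> /oOm[d d0 dO] rx; apply: (@ltleT _ _ (Num.min (rad x) (d / slip))).
 by rewrite lt_min rx dgt0.
apply: (supub (nset_sup x)); split.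
 by rewrite le_min rad0 (dge0 (ltW d0) (ltW slip0)) ge_min lexx.
apply: subT dO; apply: (bsub ds); rewrite rxx add0r mulrC -ler_pdivlMr//.
by rewrite ge_min lexx orbT.
Qed.

Let nrad_stop x t : nrad x < t -> t <= rad x -> exists2 y, b x (slip * t) y & ~ Om y.
move=> nt tr; apply: contrapT => h; have : nset x t.
 split; first by rewrite tr ltW// (leltT (nrad_ge0 x)).
 by move=> y yt; apply: contrapT => yO; apply: h; exists y.
by move=> /(supub (nset_sup x)); rewrite leNgt nt.
Qed.

Let nrad_fun : rad_fun nrad.
split => //; have [_ _ [R0 h]] := rfun; exists R0 => x; exact: leT (nrad_le x) (h x).
Qed.

Let D6 : D ^- 6 <= 2^-1 :> R.
rewrite lef_pV2 ?posrE// -[leLHS]expr1; apply: (leU (2 ^+ 6)).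
 lra.
by apply: lerXn2r; rewrite ?nnegrE ?(ltW D0)//; exact: (dsC ds).
Qed.

Let next_half i : 0 < (z i).2 ->
 (mu (b (z i).1 (17 * (z i).2) `&` [set x | (0 < nrad x)%R]) <=
  (2^-1 * vol rho mu (z i).1 (z i).2)%:E)%E.
move=> zi; have mnr : measurable [set x | 0 < nrad x].
 apply: msuplev; apply: (@lip_meas _ _ _ _ _ _ ds slip^-1).
  by rewrite ige0 ltW.
 move=> x y; have h1 := nrad_lip x y; have h2 := nrad_lip y x.
 by rewrite rsym in h2; exact: lip_arith.
apply: leT (lemu mu _ _ _) (leT (omega_small zi) _); rewrite ?inE.
- exact: measurableI.
- exact: measurableI.
- by move=> x [xi /nrad_Om].
- by rewrite leF wMr// ltW// (vgt0 ds).
Qed.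

(** A point where the process stops lies outside [Om], hence almost surely outside [E] by
    differentiation, and there [T] of the localized function is bounded. The loss [D] in the
    differentiation property is covered by [D * sdens < 1]. *)
Let terminal : {ae mu, forall x, 0 < rad x -> nrad x = 0 -> forall i, 0 < (z i).2 ->
 b (z i).1 (5 * (z i).2) x -> enorm (V (z i) *m svec (z i) x) <= n%:R * slev * savg (z i)}.
have Dl : D * sdens < 1.
 rewrite ltr_pdivrMr ?mgt0// mul1r; apply: (@leltT _ _ (D ^+ slip_log)).
  by rewrite -[leLHS]expr1 ler_weXn2l.
 by rewrite ltr_pMl// ltr1n.
have h1 := leb mE.
have h2 : {ae mu, forall x, forall i l, \sum_m V (z i) l m *
  T (fun y => f y m 0 * \1_(b (z i).1 (sdil * (z i).2)) y) x =
  T (sfun (V (z i)) l (b (z i).1 (sdil * (z i).2))) x}.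
 by apply: ae_foralln => i; exact: svecE.
apply: filterS2 h1 h2 => x h1 h2 rx nx i zi xi.
have nE : ~ E x.
 move=> Ex; have : Om x.
  have := h1 sdens 1 ltr01; rewrite indicE mem_set// => /(_ Dl) [c [s [s0 _ xs h]]].
  by exists c, s.
 by move=> /nrad_pos /(_ rx); rewrite nx ltxx.
rewrite -mulrA; apply: enorm_le_comp => l; rewrite mxE; under eq_bigr do rewrite mxE.
rewrite h2 leNgt; apply/negP => hl; apply: nE; exists i; split.
 by move: xi; apply: (bsub ds); rewrite rxx add0r wMr // ler_nat.
by left; exists l => //=; rewrite mem_index_enum.
Qed.

(** The two localizations differ by a function [h] supported away from the new ball. On that ball
    [T h] oscillates little, and at one good point it is bounded, so it is bounded almost
    everywhere. *)
Let next_step i c : 0 < (z i).2 -> 0 < nrad c ->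
 b (z i).1 (5 * (z i).2) `&` b c (5 * nrad c) !=set0 ->
 {ae mu, forall x, b c (5 * nrad c) x ->
  enorm (V (z i) *m (svec (z i) x - svec (c, nrad c) x)) <= sout * savg (z i)}.
move=> zi0 nc0 [p [pi pc]]; set s' := nrad c in nc0 pc *.
have zi : (z i).2 = rad (z i).1 by case: (zP i) zi0 => [->|[]//]; rewrite ltxx.
set ci := (z i).1 in pi zi *; set s := (z i).2 in zi0 pi zi *; set A := V (z i); set N := savg (z i).
have dci : rho c ci <= 5 * s + 5 * s'.
 apply: leT (rtri p c ci) _; rewrite addrC (rsym p ci); apply: lerD; exact: ltW.
have [_ rl _] := rfun.
have s's : s' <= 2 * s.
 apply: (radius_arith2 slip100 zi0 (ltW nc0) _ dci); rewrite zi; apply: leT (rl c ci).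
 by rewrite ler_pM2l//; exact: nrad_le.
have v0 t w : 0 < t -> 0 < vol rho mu w t by exact: (vgt0 ds).
(* Were the next radius not much smaller than [s], the ball [b c s] would lie in [Om], which fills
   too little of the neighbourhood of the old ball. *)
have Ks : slip * s' < 2 * s.
 rewrite ltNge; apply/negP => h.
 have bO : b c s `<=` Om.
  have -> : s = slip * (s / slip) by rewrite mulrC divfK// gtF.
  apply: nrad_in; rewrite ltr_pdivrMr// mulrC; apply: ltleT h.
  by lra.
 have h16 : rho c ci + s <= 16 * s by lra.
 have h1 : (mu (b c s) <= (D ^- 6 * vol rho mu ci s)%:E)%E.
  apply: leT (omega_small zi0); apply: lemu; rewrite ?inE//; first exact: measurableI.
  move=> y yc; split; first exact: bO.
  apply: (bsub ds) yc; apply: leT h16 _.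
  by rewrite wMr ?(ltW zi0)// ler_nat.
 have h2 : vol rho mu ci s <= D ^+ 5 * vol rho mu c s.
  apply: vol_le => //; rewrite rsym; apply: leT h16 _.
  by lra.
 move: h1; rewrite (mu_ball ds)// leF leNgt => /negP; apply.
 apply: (@leltT _ _ (D ^- 6 * (D ^+ 5 * vol rho mu c s))).
  by rewrite wMl// ige0 ltW.
 rewrite mulrA gtr_pMl ?v0// exprS invfM -mulrA mulVf ?gtF// mulr1 invf_lt1//.
 by apply: ltleT (dsC ds); rewrite ltr1n.
have [ks s50] := radius_arith3 erefl (leT (ler1n _ 14) sdil14) (ltW nc0) Ks.
have k5s : 5 * s' <= s by lra.
have B7 : b c (sdil * s') `<=` b ci (7 * s).
 apply: (bsub ds); apply: leT (lerD dci ks) _; exact: radius_arith7.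
have B57 : b c (5 * s') `<=` b ci (7 * s).
 apply: (bsub ds); apply: leT (lerD dci k5s) _; exact: radius_arith7.
have Bk : b c (sdil * s') `<=` b ci (sdil * s).
 apply: subT B7 _; apply: (bsub ds).
 by rewrite rxx add0r wMr ?(ltW zi0)//; apply: leT sdil14; rewrite ler_nat.
(* Twice the next radius no longer fits into [Om]. The point found outside [Om] shows that [E] has
   small density around [c]. *)
have [xs xsb xsO] : exists2 y, b c (slip * (2 * s')) y & ~ Om y.
 apply: nrad_stop; first by rewrite ltr_pMl// ltr1n.
 apply: radius_arith4 slip100 zi0 s50 _ dci; rewrite zi; have := rl ci c; by rewrite rsym.
have EB : (mu (E `&` b c (5 * s')) <= (4^-1 * vol rho mu c s')%:E)%E.
 have K2 : 0 < slip * (2 * s') by rewrite mgt0// mgt0.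
 have h1 : (mu (E `&` b c (slip * (2 * s'))) <= (sdens * vol rho mu c (slip * (2 * s')))%:E)%E.
  rewrite -int1E// leNgt; apply/negP => h; apply: xsO; exists c, (slip * (2 * s')); split => //.
 apply: leT (lemu mu _ _ _) (leT h1 _); rewrite ?inE.
 - exact: measurableI _ _ mE (mb _ _).
 - exact: measurableI _ _ mE (mb _ _).
 - apply: setIS; apply: (bsub ds); rewrite rxx add0r mulrA wMr ?(ltW nc0)//.
  by apply: (leU slip); [apply: leT slip100; rewrite ler_nat|rewrite ler_peMr ?(ltW slip0)// ler1n].
 rewrite leF; have : vol rho mu c (slip * (2 * s')) <= D ^+ slip_log * vol rho mu c s'.
  apply: vol_le => //; rewrite rxx add0r mulrA wMr ?(ltW nc0)// mulrC; exact: two_pow.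
 move=> h; apply: leT (wMl (ltW sdens0) h) _; rewrite /sdens invfM -mulrA mulKf// gtF//.
have s5 : 0 < 5 * s' by lra.
have v5 : vol rho mu c s' <= vol rho mu c (5 * s').
 by apply: (vol_le1 ds) => //; rewrite rxx add0r ler_peMl ?(ltW nc0)// ler1n.
have [q [qb qE]] : exists q, b c (5 * s') q /\ ~ E q.
 apply: contrapT => /forallNP h; have : (mu (b c (5 * s')) <= mu (E `&` b c (5 * s')))%E.
  apply: lemu; rewrite ?inE//; first exact: measurableI.
  by move=> y yb; split; apply: contrapT => yE; apply: (h y).
 move=> /leT /(_ EB); rewrite (mu_ball ds)// leF leNgt => /negP; apply.
 by apply: ltleT v5; rewrite gtr_pMl ?v0// invf_lt1// ltr1n.
have qO : ~ omega rho mu (sden (z i)) (slev * N `^ r) q.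
 by move=> qO; apply: qE; exists i; split; [exact: B57|right].
have den t : 5 * s' <= t -> (\int[mu]_(y in b c t) (sden (z i) y)%:E <=
  (slev * N `^ r * vol rho mu c t)%:E)%E.
 move=> t5; have t0 : 0 < t by exact: ltleT t5.
 rewrite leNgt; apply/negP => h; apply: qO; exists c, t; split => //.
 by apply: (bsub ds) qb; rewrite rxx add0r.
pose Bi := b ci (sdil * s); pose Bc := b c (sdil * s').
have mBi : measurable Bi := mb _ _.
have mBc : measurable Bc := mb _ _.
pose N' := slev `^ r^-1 * N.
have N0 : 0 <= N by exact: savg_ge0.
have N'E : N' `^ r = slev * N `^ r.
 by rewrite powRM ?pge0// powRVK ?gtF// ltW.
have N'0 : 0 <= N' by rewrite mge0// pge0.
have main l : {ae mu, forall x, b c (5 * s') x ->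
  `|T (sfun A l Bi) x - T (sfun A l Bc) x| <= (slev + slev2 + C * slev) * N}.
 pose h y := sfun A l Bi y * \1_(~` Bc) y.
 have mcB : measurable (~` Bc) by exact: measurableC.
 have bh : bdsupp rho h by apply: bdsupp_indic => //; exact: bs_sfun.
 have bB : bdsupp rho (sfun A l Bc) by exact: bs_sfun.
 have hE : sfun A l Bi = (fun y => 1 * h y + sfun A l Bc y).
  apply/funext => y; rewrite /h /sfun mul1r indicC; case: (boolP (y \in Bc)) => yB.
  have -> : \1_Bi y = 1 :> R by rewrite indicE mem_set//; apply: Bk; exact: set_mem.
  by rewrite indicE yB !(mulr1, mulr0) add0r.
  by rewrite [\1_Bc y]indicE (negPf yB) mulr1 mulr0 addr0.
 have lin := cz_linear czT 1 bh bB; rewrite -hE in lin.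
 have [Z1 [mZ1 Z10 hZ1]] := lin.
 have [||Z2 [mZ2 Z20 hZ2]] := cz_osc czT (c := c) (N := N') bh s5 N'0.
 - move=> y yL; rewrite /h indicC (_ : y \in Bc) ?mulr0//; apply: mem_set.
  apply: (bsub ds) yL; rewrite rxx add0r mulrA wMr ?(ltW nc0)// mulrC /sdil.
  by lra.
 - move=> t t5; rewrite N'E; apply: leT (den t t5); apply: int_le => //.
  + apply: mpowR; apply: mcomp; by have [] := bh.
  + move=> y _; rewrite /sden /h normrM nindic.
  apply: (leU (`|sfun A l Bi y| `^ r)).
  apply: ge0_ler_powR; rewrite ?nnegrE ?(ltW r0)//.
  by rewrite ler_piMr// lern1 leq_b1.
  rewrite normrM nindic indicE; case: (_ \in Bi).
  rewrite !mulr1; apply: ge0_ler_powR; rewrite ?nnegrE ?(ltW r0) ?en_ge0//.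
  exact: scomp_le.
  by rewrite !mulr0 powR0// gtF.
 have Bcv : (mu Bc <= (D ^+ sdlog * vol rho mu c s')%:E)%E.
  rewrite (mu_ball ds) ?mgt0//; apply: vol_le => //; first by rewrite mgt0.
  by rewrite rxx add0r wMr ?(ltW nc0)//.
 pose G := [set x | (slev2 * N < `|T (sfun A l Bc) x|)%R].
 have mG : measurable G.
  by apply: msuplev; apply: mcomp => //; exact: (cz_measurable czT).
 have Gs : (mu G <= (4^-1 * vol rho mu c s')%:E)%E.
  have kc : 5 * s' <= sdil * s'.
  by rewrite wMr ?(ltW nc0)//; apply: leT sdil14; rewrite ler_nat.
  have := @cz_weak_avg _ _ _ _ _ _ _ _ _ r1 czT _ (snorm A) Bc (D ^+ sdlog * vol rho mu c s')
  (D ^+ sdlog * slev * vol rho mu c s') N slev2 bB (msnorm _) (fun=> en_ge0 _)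
  mBc (sfun_le _ _ _) N0 slev20.
  rewrite -/G => h1; apply: leT (h1 _ Bcv _) _.
  + by rewrite !mge0 ?(ltW (Dn _))// ltW// v0.
  + apply: (leU (\int[mu]_(y in Bc) (sden (z i) y)%:E)%E).
  apply: eqW; apply: eqint => y /set_mem yB.
  by rewrite /sden indicE mem_set ?mulr1//; exact: Bk.
  apply: leT (den _ kc) _; rewrite leF; have kc0 := mgt0 sdil0 nc0.
  move: Bcv; rewrite (mu_ball ds)// leF => h2.
  apply: leT (wMl _ h2) _; first by rewrite mge0 ?pge0// ltW.
  by lra.
  + rewrite leF; apply: weak_arith2; last by rewrite ltW// v0.
  by rewrite mge0// age0 ?mge0// ltW.
 have Z12 : (mu (Z1 `|` Z2) <= 0)%E.
  by apply: (leU (mu Z1 + mu Z2)%E); [exact: measureU2|rewrite Z10 Z20 adde0].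
 (* [E] and [G] each fill at most a quarter of the volume, so some point of the ball avoids both, as
    well as the null sets. *)
 have [w [wb wE wG [wZ1 wZ2]]] : exists w, [/\ b c (5 * s') w, ~ E w, ~ G w & ~ Z1 w /\ ~ Z2 w].
  apply: contrapT => /forallNP hn.
  have sub : b c (5 * s') `<=` (E `&` b c (5 * s')) `|` (G `|` (Z1 `|` Z2)).
  move=> y yb; have [yE|yE] := pselect (E y); first by left.
  have [yG|yG] := pselect (G y); first by right; left.
  right; right; apply: contrapT => /not_orP[y1 y2]; exact: (hn y).
  have mEb : measurable (E `&` b c (5 * s')) by exact: measurableI.
  have mZ : measurable (Z1 `|` Z2) by exact: measurableU.
  have mGZ : measurable (G `|` (Z1 `|` Z2)) by exact: measurableU.
  have : (mu (b c (5 * s')) <= mu (E `&` b c (5 * s')) + (mu G + 0))%E.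
  apply: leT (lemu mu _ _ sub) _; rewrite ?inE//; first exact: measurableU.
  apply: leT (measureU2 mu mEb mGZ) _; apply: leeD => //.
  by apply: leT (measureU2 mu mG mZ) _; apply: leeD.
  rewrite adde0 => /leT /(_ (leeD EB Gs)).
  rewrite (mu_ball ds)// leNgt => /negP; apply; apply: ltleT v5.
  by rewrite -mulrDl gtr_pMl ?v0//; exact: quarter_arith.
 have TE x : ~ Z1 x -> T (sfun A l Bi) x = 1 * T h x + T (sfun A l Bc) x.
  by move=> xZ; apply: contrapT => neq; apply: xZ; exact: hZ1.
 have wl : `|T h w| <= (slev + slev2) * N.
  have -> : T h w = T (sfun A l Bi) w - T (sfun A l Bc) w by rewrite (TE w wZ1) mul1r addrK.
  apply: leT (ler_normB _ _) _; rewrite mulrDl; apply: lerD.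
  rewrite leNgt; apply/negP => hb; apply: wE; exists i; split; first exact: B57.
  by left; exists l => //=; rewrite mem_index_enum.
  by move: wG => /negP; rewrite -leNgt.
 exists (Z1 `|` Z2); split; first exact: measurableU.
  by apply/eqP; rewrite eq_le measure_ge0 andbT.
 move=> x hx; apply: contrapT => /not_orP[x1 x2]; apply: hx => xb.
 have -> : T (sfun A l Bi) x - T (sfun A l Bc) x = (T h x - T h w) + T h w.
  by rewrite (TE x x1) mul1r addrK subrK.
 apply: leT (ler_normD _ _) _; rewrite addrC mulrDl; apply: lerD => //.
 apply: leT (hZ2 x w xb wb x2 wZ2) _; rewrite -mulrA wMl// wMr//.
 rewrite -[leRHS]powRr1 ?(ltW slev0)//; apply: ler_powR => //.
 by rewrite invf_le1.
have main' k : {ae mu, forall x, b c (5 * s') x -> forall l : 'I_n, val l = k ->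
  `|T (sfun A l Bi) x - T (sfun A l Bc) x| <= (slev + slev2 + C * slev) * N}.
 have [kn|kn] := ltnP k n; last by apply: nearW => x _ l lk; have := ltn_ord l; rewrite lk ltnNge kn.
 by apply: filterS (main (Ordinal kn)) => x hx xb l lk; rewrite (_ : l = Ordinal kn) ?hx//; apply: val_inj.
apply: filterS3 (ae_foralln main') (svecE A mBi) (svecE A mBc) => x h1 h2 h3 xb.
rewrite -mulrA; apply: enorm_le_comp => l; apply: leT (h1 (val l) xb l erefl).
rewrite -h2 -h3 mxE -sumrB; apply: eqW; congr (`| _ |).
by apply: eq_bigr => m _; rewrite !mxE mulrBr.
Qed.

Lemma step_result : exists nr, [/\ rad_fun nr, forall x, nr x <= rad x,
 forall i, 0 < (z i).2 -> (mu (b (z i).1 (17 * (z i).2) `&` [set x | (0 < nr x)%R]) <=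
  (2^-1 * vol rho mu (z i).1 (z i).2)%:E)%E,
 {ae mu, forall x, 0 < rad x -> nr x = 0 -> forall i, 0 < (z i).2 ->
  b (z i).1 (5 * (z i).2) x -> enorm (V (z i) *m svec (z i) x) <= n%:R * slev * savg (z i)} &
 forall i c, 0 < (z i).2 -> 0 < nr c ->
  b (z i).1 (5 * (z i).2) `&` b c (5 * nr c) !=set0 ->
  {ae mu, forall x, b c (5 * nr c) x ->
  enorm (V (z i) *m (svec (z i) x - svec (c, nr c) x)) <= sout * savg (z i)}].
by exists nrad; split. Qed.

End step.

Definition step_spec (rad : X -> R) (p : (nat -> X * R) * (X -> R)) : Prop :=
 let z := p.1 in let nr := p.2 in
 [/\ (forall i, (z i).2 = 0 \/ (0 < (z i).2 /\ (z i).2 = rad (z i).1)) /\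
  trivIset setT (fun i => b (z i).1 (z i).2),
  forall x, 0 < rad x -> exists2 i, 0 < (z i).2 & b (z i).1 (5 * (z i).2) x,
  rad_fun nr /\ (forall x, nr x <= rad x),
  (forall i, 0 < (z i).2 -> (mu (b (z i).1 (17 * (z i).2) `&` [set x | (0 < nr x)%R]) <=
  (2^-1 * vol rho mu (z i).1 (z i).2)%:E)%E) /\
  {ae mu, forall x, 0 < rad x -> nr x = 0 -> forall i, 0 < (z i).2 ->
  b (z i).1 (5 * (z i).2) x -> enorm (V (z i) *m svec (z i) x) <= n%:R * slev * savg (z i)} &
  forall i c, 0 < (z i).2 -> 0 < nr c ->
  b (z i).1 (5 * (z i).2) `&` b c (5 * nr c) !=set0 ->
  {ae mu, forall x, b c (5 * nr c) x ->
  enorm (V (z i) *m (svec (z i) x - svec (c, nr c) x)) <= sout * savg (z i)}].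

Lemma step_exists rad : rad_fun rad -> exists p, step_spec rad p.
move=> rf; have [rad0 _ [R0 hR]] := rf.
have [|z [zP zt zc]] := @vitali _ _ _ _ _ _ ds point [set y : X * R | 0 < y.2 /\ y.2 = rad y.1] R0.
 by move=> y [-> ->]; rewrite hR.
have [nr [h1 h2 h3 h4 h5]] := step_result rf zP zt.
exists (z, nr); split => //= x rx.
have [i [[zi _] _ h]] := zc (x, rad x) (conj rx erefl); exists i => //; apply: h.
exact: (ball_ctr ds).
Qed.

Lemma step_mono rad p : step_spec rad p -> rad_fun rad -> forall i,
 b (p.1 i).1 (p.1 i).2 `<=` [set x | (0 < rad x)%R].
move=> [[zP _] _ _ _ _] [_ rl _] i x; case: (zP i) => [->|[zi zE]]; first by rewrite (ball_le0 ds).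
rewrite /qball /= => xi; have := rl (p.1 i).1 x; rewrite -zE => h.
have h1 : slip * (p.1 i).2 < slip * rad x + (p.1 i).2 by lra.
rewrite -(pmulr_rgt0 _ slip0); move: h1; rewrite -ltrBlDr; apply: leltT.
by rewrite subr_ge0 ler_peMl ?(ltW zi)//; apply: leT slip100; rewrite ler1n.
Qed.

Lemma mradius rad : rad_fun rad -> mfun rad.
move=> [_ rl _]; apply: (@lip_meas _ _ _ _ _ _ ds slip^-1).
 by rewrite ige0 ltW.
move=> x y; have h1 := rl x y; have h2 := rl y x.
by rewrite rsym in h2; exact: lip_arith.
Qed.

(** The 17-dilates of the selected balls cover, and in each of them the next set fills at most half
    the volume of the selected ball; these balls are disjoint inside the current set. *)
Lemma step_decay rad p : step_spec rad p -> rad_fun rad ->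
 (mu [set x | (0 < p.2 x)%R] <= (2^-1)%:E * mu [set x | (0 < rad x)%R])%E.
move=> sp rf; have sub := step_mono sp rf; case: sp => -[zP zt] cov [nf nle] [half _] _.
set z := p.1 in zP zt cov half sub *; set nr := p.2 in nf nle half *.
have mU : measurable [set x | (0 < rad x)%R] by apply: msuplev; exact: mradius.
have mU' : measurable [set x | (0 < nr x)%R] by apply: msuplev; exact: mradius.
pose F i := b (z i).1 (17 * (z i).2) `&` [set x | (0 < nr x)%R].
have mF i : measurable (F i) by exact: measurableI.
apply: (leU (\sum_(0 <= i <oo) mu (F i))%E).
 apply: measure_sigma_subadditive => // x nx.
 have [i zi xi] := cov x (ltleT nx (nle x)); exists i; split => //.
 by apply: (bsub ds) xi; rewrite rxx add0r wMr ?(ltW zi)// ler_nat.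
have i2 : (0 <= (2^-1 : R)%:E)%E by [].
apply: leT (leMl i2 (meas_disj_le mu (fun i => mb (z i).1 (z i).2) zt mU sub)).
rewrite -nneseriesZl//; apply: lesers => // i _; case: (zP i) => [zi|[zi _]].
 by rewrite /F zi (ball_le0 ds)// set0I measure0 mule_ge0.
by rewrite (mu_ball ds)// -EFinM; exact: half.
Qed.

Lemma slev_gt0 : 0 < slev. Proof. exact: slev0. Qed.

Lemma slev_le_sout : n%:R * slev <= sout.
rewrite wMl// -addrA lerDl age0 ?(ltW slev20)//.
by rewrite mge0 ?(ltW slev0).
Qed.

End sparse_step.
Fact start_radius_lip {R : rfType} (k N a c d u v : R) : 0 < k -> 0 < N -> 0 <= d ->
 k * u = N - a -> k * v = N - c -> c <= a + d ->
 k * Num.max 0 (Num.min N (N + u)) <= k * Num.max 0 (Num.min N (N + v)) + d.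
move=> k0 N0 d0 hu hv cd.
have key (x y : R) : k * x <= k * y + d -> k * Num.max 0 (Num.min N x) <= k * Num.max 0 (Num.min N y) + d.
 move=> h; have kN : 0 < k * N by rewrite mgt0.
 rewrite !maxr_pMr ?(ltW k0)// !minr_pMr ?(ltW k0)// mulr0.
 move: (k * x) (k * y) (k * N) h kN => p q m h kN.
 rewrite ge_max age0 ?le_max ?lexx//=; apply: (leU (Num.min m q + d)).
  rewrite -lerBlDr le_min !lerBlDr !ge_min h orbT andbT.
  by lra.
 by rewrite lerD2r le_max lexx orbT.
by apply: key; rewrite !mulrDr hu hv; lra.
Qed.

Fact start_radius_bound {R : rfType} (k N a u : R) : 0 < k -> k * u = N - a ->
 0 < N + u -> a < (k + 1) * N.
by move=> k0 ku h; have := mgt0 k0 h; rewrite mulrDr ku; lra. Qed.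

Fact start_radius_cover {R : rfType} (K k N s p q u v w : R) : 100 <= K -> 14 <= k -> 0 < s ->
 K * N <= K * s + p -> p < 5 * s -> q < N -> u < N -> v <= u + q -> w <= p + v -> w < k * s.
move=> K1 k1 s0 h1 h2 h3 h4 h5 h6.
have Ks : 100 * s <= K * s by rewrite ler_pM2r.
have ks : 14 * s <= k * s by rewrite ler_pM2r.
have K0 : 0 < K by lra.
have N2 : N <= 2 * s.
 rewrite leNgt; apply/negP => h; have : K * (2 * s) < K * N by rewrite ltr_pM2l.
 by lra.
by lra.
Qed.

Lemma sum_uniq_le_series {R : realType} {I : countType} (s : seq I) (t : I -> \bar R) : uniq s ->
 (forall p, (0 <= t p)%E) ->
 (\sum_(p <- s) t p <= \sum_(0 <= m <oo) (if pickle_inv m is Some p then t p else 0))%E.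
move=> us t0; pose g m : \bar R := if pickle_inv m is Some p then t p else 0%E.
have g0 m : (0 <= g m)%E by rewrite /g; case: pickle_inv.
have -> : (\sum_(p <- s) t p = \sum_(m <- map pickle s) g m)%E.
 by rewrite big_map; apply: eq_bigr => p _; rewrite /g pickleK_inv.
have us' : uniq (map pickle s) by rewrite map_inj_uniq//.
move: (map pickle s) us' => l ul.
pose M := (\max_(i <- l) i).+1.
have lM i : i \in l -> (i < M)%N by move=> il; exact: leq_bigmax_seq.
apply: (leU (\sum_(0 <= m < M) g m)%E); last by apply: nneseries_lim_ge => m _.
have -> : (\sum_(m <- l) g m = \sum_(0 <= m < M | m \in l) g m)%E.
 rewrite -[RHS]big_filter; apply: perm_big; apply: uniq_perm => //.
  by rewrite filter_uniq// iota_uniq.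
 by move=> i; rewrite mem_filter mem_index_iota; case: (boolP (i \in l)) => //= /lM ->.
rewrite big_mkcond; apply: lee_sum => m _; by case: ifP.
Qed.

Section sparse.
Context {R : realType} {dsp} {X : mType dsp}.
Variables (rho : X -> X -> R) (mu : meas X R) (D : R).
Hypothesis ds : dspace rho mu D.
Local Notation b := (qball rho).
Variables (r Lam C : R) (T : (X -> R) -> X -> R).
Hypotheses (r1 : 1 <= r) (Lam1 : 1 <= Lam) (czT : cz_op rho mu r Lam C T).
Hypothesis leb : forall E, measurable E -> leb_upto rho mu D (\1_E).
Variables (n : nat) (f : X -> 'cV[R]_n) (V : X * R -> 'M[R]_n).
Hypothesis bf : forall i, bdsupp rho (fun x => f x i 0).
Hypothesis Vu : forall z, V z \in unitmx.
Local Notation rfun := (rad_fun rho Lam).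
Local Notation sspec := (step_spec rho mu D r Lam C T f V).
Local Notation avg := (savg rho mu r Lam f V).
Local Notation Cs := (sout D Lam C n).
Local Notation dil := (sdil Lam).
Local Notation lip := (slip Lam).

Let rsym := mtsym (dsmt ds).
Let rtri := mttri (dsmt ds).
Let rxx := mtrefl (dsmt ds).
Let rge0 := mtge0 (dsmt ds).
Let mb c s : measurable (b c s) := mball ds c s.

(** Iteration of the step halves the set of positive radius each time, so almost every point stops.
    The matrix [A] is quantified after the point, so that it may be the weight at that point; [V]
    remains an arbitrary family of invertible matrices. *)
Lemma sparse_domination x0 N0 : 0 < N0 -> (forall x, ~ b x0 N0 x -> f x = 0) ->
 exists (z : nat -> X * R) (F : nat -> set X), [/\
  forall m, (z m).2 = 0 \/ 0 < (z m).2,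
  (forall m, measurable (F m)) /\ trivIset setT F,
  forall m, F m `<=` b (z m).1 (z m).2,
  forall m, 0 < (z m).2 -> ((vol rho mu (z m).1 (z m).2 / 2)%:E <= mu (F m))%E &
  {ae mu, forall x, b x0 N0 x -> forall A : 'M[R]_n,
  ((enorm (A *m vec_op T f x))%:E <= Cs%:E * \sum_(0 <= m <oo)
  (\1_(b (z m).1 (5 * (z m).2)) x * opnorm (A *m invmx (V (z m))) * avg (z m))%:E)%E}].
move=> N00 fN.
have dil14 : 14 <= dil.
 by rewrite /sdil -[leLHS](_ : 5 * 1 + 9 = 14 :> R) ?lerD2r ?ler_pM2l//; ring.
have lip100 : 100 <= lip.
 by rewrite /slip lerDr mge0// (leT _ dil14).
have lip0 : 0 < lip by exact: ltleT lip100.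
(* The initial radius is [N0] on the ball carrying [f] and then decreases to 0 with slope
   [1/slip]. *)
pose rad0 x := Num.max 0 (Num.min N0 (N0 + (N0 - rho x0 x) / lip)).
have rf0 : rfun rad0.
 split; first by move=> x; rewrite le_max lexx.
  move=> x y; apply: (start_radius_lip (a := rho x0 x) (c := rho x0 y)) => //.
  - by rewrite mulrC divfK// gtF.
  - by rewrite mulrC divfK// gtF.
 by exists N0 => x; rewrite ge_max (ltW N00) ge_min lexx.
have ex rad : exists p, rfun rad -> sspec rad p.
 have [rf|nrf] := pselect (rfun rad); last by exists (fun=> (x0, 0), rad).
 by have [p hp] := step_exists ds r1 Lam1 czT leb V bf rf; exists p.
have [nx hnx] := choice ex.
pose rk k := iter k (fun rd => (nx rd).2) rad0.
pose zk k := (nx (rk k)).1.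
have rfk k : rfun (rk k).
 by elim: k => [//|k ih]; have [_ _ []] := hnx _ ih.
have spk k : sspec (rk k) (zk k, rk k.+1).
 have := hnx _ (rfk k); rewrite /zk /rk iterS; by case: (nx _).
pose U k := [set x | (0 < rk k x)%R].
have mU k : measurable (U k) by apply: msuplev; exact: (mradius ds Lam1 (rfk k)).
have Ule k l : (k <= l)%N -> U l `<=` U k.
 move=> /subnKC <-; elim: (l - k)%N => [|j ih]; first by rewrite addn0.
 apply: subT ih; rewrite addnS => x; rewrite /U /= => h.
 by have [_ _ [_ le] _ _] := spk (k + j)%N; exact: ltleT h (le x).
have zB k i : b (zk k i).1 (zk k i).2 `<=` U k by exact: (step_mono ds Lam1 (spk k) (rfk k)).
have U0 : (mu (U 0%N) < +oo)%E.
 apply: (@leltT _ _ (mu (b x0 ((lip + 1) * N0)))); last exact: (muB_lty ds).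
 apply: lemu; rewrite ?inE// => x; rewrite /U /= /rad0 lt_max ltxx /= lt_min N00 /= => h.
 apply: (@start_radius_bound _ lip N0 (rho x0 x) ((N0 - rho x0 x) / lip)) => //.
 by rewrite mulrC divfK// gtF.
pose m0 := fine (mu (U 0%N)).
have m0E : mu (U 0%N) = m0%:E by rewrite fineK// ge0fin.
have Uk k : (mu (U k) <= (2 ^- k * m0)%:E)%E.
 elim: k => [|k ih]; first by rewrite expr0 invr1 mul1r m0E.
 apply: leT (step_decay ds Lam1 (spk k) (rfk k)) _ => /=.
 apply: leT (leMl _ ih) _; first by rewrite leF.
 by rewrite -EFinM leF exprS invfM mulrA.
have nullU : mu (\bigcap_k U k) = 0%E.
 apply/eqP; rewrite eq_le measure_ge0 andbT; apply/lee_addgt0Pr => e e0; rewrite add0e.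
 have m00 : 0 <= m0 by exact: fine_ge0.
 pose k := (Num.truncn (m0 / e)).+1.
 apply: (leU (mu (U k))).
  by apply: lemu; rewrite ?inE//; [exact: bigcap_measurable|move=> x; apply].
 apply: leT (Uk k) _; rewrite leF mulrC lepdM ?xgt0// -ler_pdivrMl// mulrC.
 by apply: leT (ltW (truncnS_gt _)) _; rewrite -natrX ler_nat ltnW// ltn_expl.
pose z m := if pickle_inv m is Some p then zk p.1 p.2 else (x0, 0 : R).
(* The sparse part of a ball is what the next generation leaves; codes that decode to no pair of
   indices get an empty ball. *)
pose F m := if pickle_inv m is Some p then
 b (zk p.1 p.2).1 (zk p.1 p.2).2 `\` U p.1.+1 else set0.
exists z, F; split.
- move=> m; rewrite /z; case: (pickle_inv m) => [p|]; last by left.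
 by have [[zP _] _ _ _ _] := spk p.1; case: (zP p.2) => [|[]]; [left|right].
- split; first by move=> m; rewrite /F; case: (pickle_inv m) => [p|//]; exact: measurableD.
 apply/trivIsetP => m m' _ _; rewrite /F; case E1 : (pickle_inv m) => [[k i]|]; last by rewrite set0I.
 case E2 : (pickle_inv m') => [[k' i']|]; last by rewrite setI0.
 move=> mm' /=; apply/seteqP; split => // x [[xB xU] [xB' xU']].
 have kk : k = k'.
  apply/eqP; rewrite eqn_leq; apply/andP; split; rewrite leqNgt; apply/negP => h.
  by apply: xU'; apply: (Ule _ _ h); exact: zB xB.
  by apply: xU; apply: (Ule _ _ h); exact: zB xB'.
 subst k'; have [[_ zt] _ _ _ _] := spk k; have ii : i = i' by apply: zt => //; exists x.
 subst i'; move: mm'; have := pickle_invK (T := (nat * nat)%type) m.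
 have := pickle_invK (T := (nat * nat)%type) m'.
 by rewrite E1 E2 /= => <- <-; rewrite eqxx.
- move=> m x; rewrite /F /z; case: (pickle_inv m) => [p []//|//].
- move=> m; rewrite /F /z; case: (pickle_inv m) => [[k i] /= zi|]; last by rewrite ltxx.
 have [_ _ _ [half _] _] := spk k.
 have h : (mu (b (zk k i).1 (zk k i).2 `&` U k.+1) <= (2^-1 * vol rho mu (zk k i).1 (zk k i).2)%:E)%E.
  apply: leT (half i zi); apply: lemu; rewrite ?inE; try exact: measurableI _ _ (mb _ _) (mU _).
  by apply: setSI; apply: (bsub ds); rewrite rxx add0r ler_peMl ?(ltW zi)// ler1n.
 set B := b (zk k i).1 (zk k i).2 in h *; set v := vol _ _ _ _ in h *.
 have mBU : measurable (B `\` U k.+1) by apply: measurableD; [exact: mb|exact: mU].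
 have mBU' : measurable (B `&` U k.+1) by apply: measurableI; [exact: mb|exact: mU].
 have : (v%:E <= mu (B `\` U k.+1) + (2^-1 * v)%:E)%E.
  rewrite /v -(mu_ball ds)//; apply: (leU (mu (B `\` U k.+1) + mu (B `&` U k.+1))%E).
  apply: leT (measureU2 mu mBU mBU'); apply: lemu; rewrite ?inE; [exact: mb|exact: measurableU|].
  by move=> y yB; have [yU|yU] := pselect (U k.+1 y); [right|left].
  exact: leeD.
 by rewrite -leeBlDr// -EFinB; congr (_%:E <= _)%E; field.
have ae1 : {ae mu, forall x, exists k, rk k x = 0}.
 exists (\bigcap_k U k); split => //; first exact: bigcap_measurable.
 move=> x /= /forallNP nx0 k _; rewrite /U /= lt0r; apply/andP; split; first exact/eqP.
 by have [h0 _ _] := rfk k.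
have ae2 : {ae mu, forall x, forall k, 0 < rk k x -> rk k.+1 x = 0 -> forall i, 0 < (zk k i).2 ->
  b (zk k i).1 (5 * (zk k i).2) x ->
  enorm (V (zk k i) *m svec rho Lam T f (zk k i) x) <= n%:R * slev D Lam C n * avg (zk k i)}.
 by apply: ae_foralln => k; have [_ _ _ [_ h] _] := spk k.
have ae3 : {ae mu, forall x, forall k i j, 0 < (zk k i).2 -> 0 < (zk k.+1 j).2 ->
  b (zk k i).1 (5 * (zk k i).2) x -> b (zk k.+1 j).1 (5 * (zk k.+1 j).2) x ->
  enorm (V (zk k i) *m (svec rho Lam T f (zk k i) x - svec rho Lam T f (zk k.+1 j) x)) <=
  Cs * avg (zk k i)}.
 apply: ae_foralln => k; apply: ae_foralln => i; apply: ae_foralln => j.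
 have [zi|zi] := ltP 0 (zk k i).2; last by apply: nearW.
 have [zj|zj] := ltP 0 (zk k.+1 j).2; last by apply: nearW.
 have [[zP _] _ _ _ _] := spk k.+1.
 have zE : (zk k.+1 j).2 = rk k.+1 (zk k.+1 j).1 by case: (zP j) zj => [->|[]//]; rewrite ltxx.
 have [ov|nov] := pselect (b (zk k i).1 (5 * (zk k i).2) `&` b (zk k.+1 j).1 (5 * (zk k.+1 j).2) !=set0); last first.
  by apply: nearW => x _ _ xi xj; exfalso; apply: nov; exists x.
 have [_ _ _ _ h] := spk k; have := h i (zk k.+1 j).1 zi.
 rewrite -[(zk k, rk k.+1).2]/(rk k.+1) -[(zk k, rk k.+1).1]/(zk k) -zE => /(_ zj ov).
 apply: filterS => x hx _ _ _ xj; have := hx xj; by case: (zk k.+1 j).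
have slevCs : n%:R * slev D Lam C n <= Cs.
 exact: (slev_le_sout ds czT n).
apply: filterS3 ae1 ae2 ae3 => x [kx rx] h2 h3 xN A.
pose t (p : nat * nat) : \bar R := (\1_(b (zk p.1 p.2).1 (5 * (zk p.1 p.2).2)) x *
 opnorm (A *m invmx (V (zk p.1 p.2))) * avg (zk p.1 p.2))%:E.
have t0 p : (0 <= t p)%E by rewrite leF !mge0 ?on_ge0// savg_ge0.
have Cs0 : 0 <= Cs by apply: leT slevCs; rewrite mge0// ltW// (slev_gt0 ds czT).
have bnd k i (v : 'cV[R]_n) : b (zk k i).1 (5 * (zk k i).2) x ->
  enorm (V (zk k i) *m v) <= Cs * avg (zk k i) -> ((enorm (A *m v))%:E <= Cs%:E * t (k, i))%E.
 move=> xi hv; rewrite /t /= indicE mem_set// mul1r -EFinM leF.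
 have -> : A *m v = (A *m invmx (V (zk k i))) *m (V (zk k i) *m v).
  by rewrite -mulmxA mulKmx.
 apply: leT (on_bound _ _) _; rewrite mulrCA.
 by rewrite wMl ?on_ge0.
(* Telescoping at a fixed point: pass from a ball of each generation to one of the next that
   contains the point, each passage costing one term, until the radius vanishes and the terminal
   estimate applies. *)
have claim j : forall k i, rk (k + j)%N x = 0 -> 0 < rk k x -> 0 < (zk k i).2 ->
  b (zk k i).1 (5 * (zk k i).2) x -> exists s : seq (nat * nat), [/\ uniq s,
  forall p, p \in s -> (k <= p.1)%N &
  ((enorm (A *m svec rho Lam T f (zk k i) x))%:E <= Cs%:E * \sum_(p <- s) t p)%E].
 elim: j => [|j ih] k i; first by rewrite addn0 => ->; rewrite ltxx.
 rewrite addnS -addSn => r0 rkx zi xi.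
 have [rk0|rk1] := eqVneq (rk k.+1 x) 0.
  exists [:: (k, i)]; split => //; first by move=> p; rewrite inE => /eqP ->.
  rewrite big_seq1; apply: bnd => //; apply: leT (h2 _ rkx rk0 _ zi xi) _.
  by rewrite wMr// savg_ge0.
 have rk1' : 0 < rk k.+1 x by rewrite lt0r rk1; have [/(_ x)] := rfk k.+1.
 have [_ cov _ _ _] := spk k.+1; have [i' zi' xi'] := cov x rk1'.
 have [s [us sk hs]] := ih _ i' r0 rk1' zi' xi'.
 exists ((k, i) :: s); split.
 - by rewrite /= us andbT; apply/negP => /sk /=; rewrite ltnn.
 - by move=> p; rewrite inE => /predU1P[->//|/sk /ltnW].
 - rewrite big_cons ge0_muleDr//; last by apply: sume_ge0.
  have -> : A *m svec rho Lam T f (zk k i) x =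
  A *m (svec rho Lam T f (zk k i) x - svec rho Lam T f (zk k.+1 i') x) +
  A *m svec rho Lam T f (zk k.+1 i') x by rewrite -mulmxDr subrK.
  apply: (leU (_%:E + _%:E)%E); first by rewrite -EFinD leF; exact: en_tri.
  by apply: leeD => //; apply: bnd => //; exact: h3.
have r00 : 0 < rk 0%N x.
 rewrite /rk /= /rad0 lt_max; apply/orP; right; rewrite lt_min N00 /= ltr_pwDl// dge0 ?(ltW lip0)//.
 by rewrite subr_ge0 ltW.
have [[zP _] cov _ _ _] := spk 0%N; have [i zi xi] := cov x r00.
have [s [us _ hs]] := claim kx 0%N i (etrans (congr1 (fun k => rk k x) (add0n kx)) rx) r00 zi xi.
(* At a point of [b x0 N0] the initial radius equals [N0], so a selected ball near it has comparable
   radius and its dilate by [sdil] contains the support of [f]; localization changes nothing. *)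
have -> : vec_op T f x = svec rho Lam T f (zk 0%N i) x.
 apply/matrixP => l j; rewrite !mxE; congr (T _ x); apply/funext => y.
 have [->|fy] := eqVneq (f y) 0; first by rewrite mxE mul0r.
 rewrite indicE mem_set ?mulr1//.
 have yN : b x0 N0 y by apply: contrapT => /fN h; move: fy; rewrite h eqxx.
 have zE : (zk 0%N i).2 = rad0 (zk 0%N i).1 by case: (zP i) zi => [->|[]//]; rewrite ltxx.
 have rx0 : rad0 x = N0.
  rewrite /rad0 min_l; first by rewrite max_r// ltW.
  by rewrite lerDl dge0 ?(ltW lip0)// subr_ge0 ltW.
 have [_ rl _] := rf0; have := rl x (zk 0%N i).1; rewrite rx0 -zE => h.
 rewrite /qball /=; have := rtri x (zk 0%N i).1 y; have := rtri x0 x y.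
 move: xi yN xN; rewrite /qball /= (rsym x x0) => xi yN xN u1 u2.
 rewrite (rsym x) in h; exact: start_radius_cover lip100 dil14 zi h xi yN xN u1 u2.
apply: leT hs _; apply: leMl; first by rewrite leF.
apply: leT (sum_uniq_le_series us t0) _; apply: lesers => // m _.
 by case: pickle_inv.
rewrite /z; case: (pickle_inv m) => [p//|] /=.
by rewrite mulr0 (ball_le0 ds)// indic0 !mul0r.
Qed.

End sparse.

Fact sparse_arith1 {R : rfType} (c n d v : R) : n * (c * d * v) = 2 * c * (n * d) * (v / 2).
by field. Qed.

Fact sparse_arith2 {R : rfType} (cs c m f l j : R) :
 cs * (2 * c) * (m * f * (l * j)) = 2 * cs * c * m * l * f * j.
ring. Qed.

(** * Carleson embedding for sparse families *)

Section carleson.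
Context {R : realType} {dsp} {X : mType dsp}.
Variables (rho : X -> X -> R) (mu : meas X R) (D : R).
Hypothesis ds : dspace rho mu D.
Local Notation b := (qball rho).
Variables (z : nat -> X * R) (F : nat -> set X).
Hypotheses (zP : forall m, (z m).2 = 0 \/ 0 < (z m).2) (mF : forall m, measurable (F m))
 (tF : trivIset setT F) (FB : forall m, F m `<=` b (z m).1 (z m).2).

(** The sets [F m] are disjoint, so at most one term is nonzero: this encodes the function equal to
    [c m] on [F m] and to 0 elsewhere. *)
Definition hsum (c : nat -> R) (x : X) : R := fine (\sum_(0 <= m <oo) (c m * \1_(F m) x)%:E)%E.

Lemma hsum_in c m x : F m x -> hsum c x = c m.
move=> Fx; rewrite /hsum; suff -> : (\sum_(0 <= i <oo) (c i * \1_(F i) x)%:E = (c m)%:E)%E by [].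
have E i : (c i * \1_(F i) x)%:E = (if i == m then (c m)%:E else 0)%E.
 case: eqP => [->|im]; first by rewrite indicE mem_set// mulr1.
 rewrite indicE memNset ?mulr0// => Fi; apply: im; apply: tF => //; by exists x.
apply: lim_near_cst => //; exists m.+1 => // k /= mk.
by rewrite (bigD1_seq m) ?mem_index_iota ?iota_uniq//= E eqxx big1 ?adde0// => i /negPf im; rewrite E im.
Qed.

Lemma hsum_out c x : (forall m, ~ F m x) -> hsum c x = 0.
by move=> h; rewrite /hsum eseries0// => m _ _; rewrite indicE memNset ?mulr0.
Qed.

Lemma hsum_ge0 c x : (forall m, 0 <= c m) -> 0 <= hsum c x.
by move=> c0; rewrite fine_ge0// nneseries_ge0// => m _ _; rewrite leF mge0. Qed.

Lemma mhsum c : (forall m, 0 <= c m) -> mfun (hsum c).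
move=> c0; apply: mcomp => //; apply: mnneseries.
 move=> m; apply: mEFin; apply: mfM => //.
by move=> m x; rewrite leF mge0.
Qed.

(** The constant of the maximal theorem at the exponent [q / a], times the loss [D^k] for replacing
    a ball by a dilate. *)
Definition maxC (q a : R) (k : nat) : R :=
 D ^+ 3 * (2 * expR 1) `^ (q / a) * (q / a / (q / a - 1)) * (D ^+ k) `^ (q / a).

Lemma maxC_ge0 q a k : 0 < a -> a < q -> 0 <= maxC q a k.
move=> a0 aq; have qa : 1 < q / a by rewrite ltr_pdivlMr// mul1r.
rewrite mge0 ?pge0// mge0//.
 by rewrite mge0 // xge0// ltW// (D_gt0 ds).
by rewrite dge0 ?subr_ge0 ?(ltW qa)// (leT ler01)// ltW.
Qed.

(** On [F m] the number [c m ^ a] is at most [D^k] times a mean of [psi^a] over a ball containing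
    [F m]. So [hsum c ^ a] lies below a maximal function, and [maximal_power_bound] applies at the
    exponent [q / a]. *)
Lemma carleson_max (c : nat -> R) (psi : X -> R) (a q kap : R) (k : nat) :
 0 < a -> a < q -> 1 <= kap -> kap <= 2 ^+ k -> (forall m, 0 <= c m) ->
 mfun psi -> (forall x, 0 <= psi x) ->
 (forall m, 0 < (z m).2 -> ((c m `^ a * vol rho mu (z m).1 (z m).2)%:E <=
  \int[mu]_(x in b (z m).1 (kap * (z m).2)) (psi x `^ a)%:E)%E) ->
 (\int[mu]_x (hsum c x `^ q)%:E <= (maxC q a k)%:E * \int[mu]_x (psi x `^ q)%:E)%E.
move=> a0 aq kap1 kapk c0 mpsi psi0 hc.
have D0 := D_gt0 ds; have Dk : 0 < D ^+ k by exact: xgt0.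
have qa : 1 < q / a by rewrite ltr_pdivlMr// mul1r.
have mh := mhsum c0.
pose h x := D ^+ k * psi x `^ a.
have mpa : mfun (fun x => psi x `^ a) by exact: mpowR.
have h0 x : 0 <= h x by rewrite mge0 ?(ltW Dk)// pge0.
have := @maximal_power_bound _ _ _ _ _ _ ds (q / a) h (fun x => hsum c x `^ a) qa
 (mfM (mcst _) mpa) (mpowR _ mh) h0 (fun=> pge0 _ _).
have E x : (hsum c x `^ a) `^ (q / a) = hsum c x `^ q.
 by rewrite -powRrM mulrC divfK// gtF.
have E2 x : h x `^ (q / a) = (D ^+ k) `^ (q / a) * psi x `^ q.
 by rewrite powRM ?(ltW Dk) ?pge0// -powRrM [a * _]mulrC divfK// gtF.
have E3 : (\int[mu]_x (h x `^ (q / a))%:E = ((D ^+ k) `^ (q / a))%:E * \int[mu]_x (psi x `^ q)%:E)%E.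
 under eqint do rewrite E2; rewrite intZ ?pge0//.
  exact: mpowR.
 by move=> x; exact: pge0.
under eqint do rewrite E.
rewrite E3 muleA; apply => l l0 x /= lx.
have [m Fm] : exists m, F m x.
 apply: contrapT => /forallNP nF; move: lx; rewrite hsum_out// powR0 ?gtF//.
 lra.
move: lx; rewrite (hsum_in c Fm) => lc.
have zm : 0 < (z m).2.
 by case: (zP m) => // zm; have := FB Fm; rewrite zm (ball_le0 ds).
have kz : 0 < kap * (z m).2 by rewrite mgt0// (ltleT ltr01).
exists (z m).1, (kap * (z m).2); split => //.
 by apply: (bsub ds) (FB Fm); rewrite (mtrefl (dsmt ds)) add0r ler_peMl// ltW.
have mB : measurable (b (z m).1 (kap * (z m).2)) := mball ds _ _.
rewrite intZ ?(ltW Dk)//; last by move=> y; exact: pge0.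
have Dk' : (0 <= (D ^+ k)%:E)%E by exact: ltW.
apply: ltleT (leMl Dk' (hc m zm)); rewrite lte_fin.
have vk : vol rho mu (z m).1 (kap * (z m).2) <= D ^+ k * vol rho mu (z m).1 (z m).2.
 apply: vol_le => //; rewrite (mtrefl (dsmt ds)) add0r wMr// ltW//.
apply: leltT (wMl (ltW l0) vk) _; rewrite mulrCA ltr_pM2l// ltr_pM2r//.
exact: (vgt0 ds).
Qed.

Variables (p a b' kap C1 Cs : R) (k : nat) (psi : X -> R) (N : nat -> R) (K : nat -> X -> R).
Hypotheses (p1 : 1 < p) (a0 : 1 < a) (ap : a < p / (p - 1)) (b0 : 0 < b') (bp : b' < p)
 (kap5 : 5 <= kap) (kapk : kap <= 2 ^+ k) (N0 : forall m, 0 <= N m) (Cs0 : 0 <= Cs)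
 (C10 : 0 <= C1) (mpsi : mfun psi) (psi0 : forall x, 0 <= psi x)
 (half : forall m, 0 < (z m).2 -> ((vol rho mu (z m).1 (z m).2 / 2)%:E <= mu (F m))%E)
 (mK : forall m, mfun (K m)) (K0 : forall m x, 0 <= K m x)
 (hK : forall m, 0 < (z m).2 -> (\int[mu]_(x in b (z m).1 (5 * (z m).2))
  (K m x `^ (a / (a - 1)))%:E <= (C1 `^ (a / (a - 1)) * vol rho mu (z m).1 (z m).2)%:E)%E)
 (hN : forall m, 0 < (z m).2 -> ((N m `^ b' * vol rho mu (z m).1 (z m).2)%:E <=
  \int[mu]_(x in b (z m).1 (kap * (z m).2)) (psi x `^ b')%:E)%E).

Definition sparseC : R := 2 * Cs * C1 * maxC p b' k `^ p^-1 *
 maxC (p / (p - 1)) a 3 `^ (1 - p^-1).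

(** Duality with [g = U^(p-1)]. On each ball Hoelder's inequality with exponents [a'] and [a]
    separates [K] from [g]; the ball is then traded for [F m], which has at least half its measure,
    and the two functions [hsum] are bounded in [L^p] and [L^p']. Truncation by [L] on [S] makes [J]
    finite, so that [J^(1 - 1/p)] can be divided out. *)
Lemma sparse_form_bound (u : X -> R) (S : set X) (Phi L : R) : measurable S -> (mu S < +oo)%E ->
 mfun u -> (forall x, 0 <= u x) -> 0 <= L -> 0 <= Phi ->
 (\int[mu]_x (psi x `^ p)%:E <= (Phi `^ p)%:E)%E ->
 {ae mu, forall x, S x -> ((u x)%:E <= Cs%:E * \sum_(0 <= m <oo)
  (\1_(b (z m).1 (5 * (z m).2)) x * K m x * N m)%:E)%E} ->
 (\int[mu]_x ((Num.min (u x) L * \1_S x) `^ p)%:E <= ((sparseC * Phi) `^ p)%:E)%E.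
move=> mS Sf mu_ u0 L0 Phi0 hPhi hu.
have p0 : 0 < p by exact: lt_trans.
have p10 : 0 < p - 1 by rewrite subr_gt0.
have a00 : 0 < a by exact: lt_trans.
have a10 : 0 < a - 1 by rewrite subr_gt0.
have pp0 : 0 < p / (p - 1) by rewrite dgt0.
have aa0 : 0 < a / (a - 1) by rewrite dgt0.
have ppE : p^-1 + (p / (p - 1))^-1 = 1 by rewrite invf_div; field; rewrite gtF.
have aaE : (a / (a - 1))^-1 + a^-1 = 1 by rewrite invf_div; field; rewrite gtF.
have v0 m : 0 < (z m).2 -> 0 < vol rho mu (z m).1 (z m).2 by exact: (vgt0 ds).
pose U x := Num.min (u x) L * \1_S x.
have U0 x : 0 <= U x by rewrite mge0// le_min u0.
have mU : mfun U.
 by apply: mMindic => //; exact: measurable_minr.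
pose g x := U x `^ (p - 1).
have g0 x : 0 <= g x by exact: pge0.
have mg : mfun g by exact: mpowR.
have UL x : U x <= L * \1_S x by rewrite wMr// ge_min lexx orbT.
have fin (t : R) (A : set X) : 0 < t -> measurable A ->
  (\int[mu]_(x in A) (U x `^ t)%:E < +oo)%E.
 move=> t0 mA; apply: (@leltT _ _ (\int[mu]_x (L `^ t * \1_S x)%:E)%E).
  apply: (leU (\int[mu]_x (U x `^ t)%:E)%E).
  apply: isub => //; first exact: mpowR.
  by move=> x; exact: pge0.
  apply: int_le => //; first exact: mpowR.
  - by apply: mfM => //.
  - by move=> x; exact: pge0.
  move=> x _; apply: (leU ((L * \1_S x) `^ t)).
  by apply: ge0_ler_powR; [exact: ltW|rewrite nnegrE|rewrite nnegrE mge0|exact: UL].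
  rewrite powRM// indicE; case: (_ \in _); first by rewrite powR1.
  by rewrite powR0 ?gtF.
 by rewrite intZ ?pge0// intindic// setIT; apply: lte_mul_pinfty; rewrite ?leF ?pge0.
have gE t x : g x `^ t = U x `^ ((p - 1) * t) by rewrite -powRrM.
pose J := fine (\int[mu]_x (U x `^ p)%:E).
have JE : (\int[mu]_x (U x `^ p)%:E = J%:E)%E.
 by rewrite fineK// ge0fin ?fin// intge0// => x; rewrite leF pge0.
have J0 : 0 <= J by rewrite fine_ge0// intge0// => x; rewrite leF pge0.
pose B5 m := b (z m).1 (5 * (z m).2).
have mB5 m : measurable (B5 m) := mball ds _ _.
pose v m := vol rho mu (z m).1 (z m).2.
pose c m := (fine (\int[mu]_(x in B5 m) (g x `^ a)%:E) / v m) `^ a^-1.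
have c0 m : 0 <= c m by exact: pge0.
have cE m : 0 < (z m).2 -> (\int[mu]_(x in B5 m) (g x `^ a)%:E = (c m `^ a * v m)%:E)%E.
 move=> zm; have vm := v0 m zm; rewrite powRVK ?gtF//; last first.
  apply: dge0; last exact: ltW.
  by apply: fine_ge0; apply: intge0 => x _; rewrite leF pge0.
 rewrite divfK; last by rewrite gtF.
 rewrite fineK// ge0fin; last by apply: intge0 => x _; rewrite leF pge0.
 by under eqint do rewrite gE; apply: fin => //; exact: mgt0.
pose H1 := hsum N; pose H2 := hsum c.
have H10 x : 0 <= H1 x by exact: hsum_ge0.
have H20 x : 0 <= H2 x by exact: hsum_ge0.
have mH1 : mfun H1 by exact: mhsum.
have mH2 : mfun H2 by exact: mhsum.
have mH12 : mfun (fun x => H1 x * H2 x) by exact: mfM.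
have term m : (\int[mu]_x (\1_(B5 m) x * K m x * N m * g x)%:E <=
  (2 * C1)%:E * \int[mu]_(x in F m) (H1 x * H2 x)%:E)%E.
 have mKg : mfun (fun x => K m x * g x) by exact: mfM.
 have -> : (\int[mu]_x (\1_(B5 m) x * K m x * N m * g x)%:E =
  (N m)%:E * \int[mu]_(x in B5 m) (K m x * g x)%:E)%E.
  rewrite -intZ//; last by move=> x; rewrite mge0.
  rewrite [RHS]imkcond; apply: eqint => x _; rewrite patchE indicE.
  case: (_ \in _); rewrite ?mul1r ?mul0r//.
  by rewrite mulrA [N m * _]mulrC.
 case: (zP m) => [zm|zm].
  rewrite /B5 zm (ball_le0 ds)// integral_set0 mule0 mule_ge0 ?leF ?mge0//.
  by apply: intge0 => x _; rewrite leF mge0.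
 have vm := v0 m zm.
 have -> : (\int[mu]_(x in F m) (H1 x * H2 x)%:E = (N m * c m)%:E * mu (F m))%E.
  rewrite -int_cst//; apply: eqint => x; rewrite inE => Fx.
  by rewrite /H1 /H2 !(hsum_in _ Fx).
 have Kg : (\int[mu]_(x in B5 m) (K m x * g x)%:E <= (C1 * c m * v m)%:E)%E.
  have -> : C1 * c m * v m = C1 * v m `^ (a / (a - 1))^-1 * (c m * v m `^ a^-1).
  by rewrite mulrACA -powRD ?aaE ?powRr1 ?(ltW vm)//; apply/implyP => _; rewrite gtF.
  apply: (int_hold_le (p := a / (a - 1)) (q := a)) => //.
  - by rewrite mge0// pge0.
  - by rewrite mge0// pge0.
  - by rewrite powRM ?pge0// powRVK ?gtF ?(ltW vm)//; exact: hK.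
  - by rewrite powRM ?pge0// powRVK ?gtF ?(ltW vm)// cE.
 apply: leT (leMl _ Kg) _; first by rewrite leF.
 have c2 : (0 <= (2 * C1 * (N m * c m))%:E)%E by rewrite leF !mge0.
 apply: (leU ((2 * C1 * (N m * c m))%:E * (v m / 2)%:E)%E).
  by rewrite leF sparse_arith1.
 have hv : ((v m / 2)%:E <= mu (F m))%E by exact: half.
 have h3 := @leMl _ _ c2 _ _ hv.
 apply: leT h3 _.
 by rewrite muleA.
have s1 : (J%:E <= (Cs * (2 * C1))%:E * \int[mu]_x (H1 x * H2 x)%:E)%E.
 pose G m x := (\1_(B5 m) x * K m x * N m * g x)%:E.
 have G0 m x : (0 <= G m x)%E by rewrite leF !mge0.
 have mG m : mfun (G m).
  apply: mEFin; apply: mfM => //; apply: mfM => //.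
  by apply: mfM => //.
 apply: (leU (\int[mu]_x (Cs%:E * \sum_(0 <= m <oo) G m x))%E).
  rewrite -JE; apply: ae_ge0_le_integral => //.
  - by move=> x _; rewrite leF pge0.
  - by apply: mEFin; exact: mpowR.
  - by move=> x _; rewrite mule_ge0 // nneseries_ge0.
  - by apply: measurable_funeM; exact: mnneseries.
  - apply: filterS hu => x hx _; have [Sx|Sx] := pselect (S x); last first.
  rewrite /U indicE memNset// mulr0 powR0 ?gtF//.
  by rewrite mule_ge0 // nneseries_ge0.
  rewrite (powRM_pred (U0 x) p0) -/(g x).
  apply: (leU ((g x)%:E * (u x)%:E)%E).
  rewrite leF mulrC wMl// /U indicE mem_set// mulr1 ge_min lexx//.
  apply: leT (leMl _ (hx Sx)) _; first by rewrite leF.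
  rewrite muleCA -nneseriesZl; last by move=> m _; rewrite leF !mge0.
  apply: eqW; congr (_ * _)%E.
  by apply: eq_eseriesr => m _; rewrite -EFinM mulrC.
 rewrite ge0_integralZl//; last 2 first.
 - exact: mnneseries.
 - by move=> x _; exact: nneseries_ge0.
 rewrite EFinM -muleA; apply: leMl => //.
 rewrite integral_nneseries//.
 have c2 : (0 <= (2 * C1)%:E)%E by rewrite leF mge0.
 apply: leT (leMl c2 (int_disj_le mu mF tF measurableT (fun _ _ _ => Logic.I) mH12 _)); last first.
  by move=> x; rewrite mge0.
 rewrite -nneseriesZl; last by move=> m _; rewrite intge0// => x; rewrite leF mge0.
 apply: lesers => [m _ _|m _]; last exact: term.
 by rewrite intge0.
have M10 : 0 <= maxC p b' k by exact: maxC_ge0.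
have M20 : 0 <= maxC (p / (p - 1)) a 3 by exact: maxC_ge0.
pose q1 := maxC p b' k `^ p^-1 * Phi.
pose q2 := (maxC (p / (p - 1)) a 3 * J) `^ (p / (p - 1))^-1.
have kap1 : 1 <= kap by apply: leT kap5; rewrite ler1n.
have s2 : (\int[mu]_x (H1 x * H2 x)%:E <= (q1 * q2)%:E)%E.
 apply: (int_hold_le (p := p) (q := p / (p - 1))) => //.
 - by rewrite mge0// pge0.
 - exact: pge0.
 - apply: leT (carleson_max b0 bp kap1 kapk N0 mpsi psi0 hN) _.
  apply: leT (leMl _ hPhi) _ => //.
  by rewrite leF powRM ?pge0// powRVK ?gtF.
 - have k3 : 5 <= 2 ^+ 3 :> R by rewrite -natrX ler_nat.
  apply: leT (carleson_max a00 ap (ler1n _ 5) k3 c0 mg g0 _) _.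
  by move=> m zm; rewrite -cE.
  have -> : q2 `^ (p / (p - 1)) = maxC (p / (p - 1)) a 3 * J.
  rewrite powRVK.
  - by [].
  - exact: mge0.
  by rewrite gtF.
  rewrite [in leRHS]EFinM; apply: leMl => //.
  rewrite -JE; apply: eqW; apply: eqint => x _.
  by rewrite gE mulrC divfK// gtF.
rewrite JE; have C2 : (0 <= (Cs * (2 * C1))%:E)%E by rewrite leF !mge0.
have := leT s1 (leMl C2 s2); rewrite leF => s3.
have pE : (p / (p - 1))^-1 = 1 - p^-1 by lra.
have J1 : J <= sparseC * Phi * J `^ (1 - p^-1).
 apply: leT s3 _; rewrite /q1 /q2 pE powRM//; apply: eqW.
 exact: sparse_arith2.
rewrite leF; have [->|Jn] := eqVneq J 0; first exact: pge0.
have Jp : 0 < J by lra.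
rewrite -[J](powRVK (t := p)) ?gtF//; apply: ge0_ler_powR; rewrite ?nnegrE ?pge0 ?(ltW p0)//.
 by rewrite /sparseC !mge0 ?pge0.
rewrite -(ler_pM2r (pgt0 (1 - p^-1) Jp)) -powRD; last by apply/implyP => _.
by rewrite addrC subrK powRr1.
Qed.

End carleson.
Section hormander_cz.
Context {R : realType} {dsp} {X : mType dsp}.
Variables (dist : X -> X -> R) (cd : R) (mu : meas X R).
Variables (t : \bar R) (T : (X -> R) -> X -> R).
Hypothesis hT : hormander_operator dist cd mu t T.

Lemma horm_sqint : exists2 C, 0 <= C & forall f, f \in Lfun mu 2%:E ->
 mfun (T f) /\ (sqint mu (T f) <= C%:E * sqint mu f)%E.
have [C hC] := ho_bounded hT; exists (`|C| ^+ 2) => [|f f2] => //.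
have [Tf2 Tf] := hC f f2; have /Lfun2P[mTf _] := Tf2; split => //.
have Tf' : (Lnorm mu 2%:E (EFin \o T f) <= `|C|%:E * Lnorm mu 2%:E (EFin \o f))%E.
 by apply: leT Tf _; apply: leMr; rewrite ?Lnorm_ge0// leF ler_norm.
have := @poweR_mono _ _ _ 2 (ler0n _ 2) (Lnorm_ge0 _ _ _) Tf'.
rewrite Ln2_sqint poweRM ?Lnorm_ge0// Ln2_sqint.
by rewrite poweR_EFin powR_mulrn.
Qed.

Lemma hormander_cz (r : R) (rho : X -> X -> R) (e D : R) : t = hconj r%:E -> 1 <= r ->
 htype dist cd mu -> 0 < e -> is_metric rho ->
 pwcmp rho dist e -> dspace rho mu D ->
 exists C, cz_op rho mu r (osc_dil cd e) C T.
move=> tE r1 hX e0 rm re ds; have [C2 C20 Tbd] := horm_sqint.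
subst t; have Tlin := ho_linear hT; have [K hK Krep] := ho_kernel hT.
have mK := hk_measurable hK; have [Ck Ksize] := hk_size hK.
have fin K' : (hormander_const dist cd mu (hconj r%:E) K' < +oo)%E ->
  exists2 H, 0 <= H & (hormander_const dist cd mu (hconj r%:E) K' <= H%:E)%E.
 case: (hormander_const _ _ _ _ _) => [h _|//|_]; last by exists 0; rewrite ?leNye.
 by exists `|h| => //; rewrite leF ler_norm.
have [H1 H10 KH1] := fin _ (hk_regular1 hK); have [H2 H20 KH2] := fin _ (hk_regular2 hK).
have [C C0 weak] := weak_type_11 hX e0 rm re ds r1 Tlin C20 Tbd mK Ksize Krep H20 KH2.
have HD : 0 <= H1 * D by rewrite mge0// ltW// (D_gt0 ds).
exists (C + H1 * D); split.
- exact: age0.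
- by move=> f /(Lfun_bd ds)/Tbd[].
- by move=> a f g /(Lfun_bd ds) bf /(Lfun_bd ds); exact: Tlin.
- move=> f l bf l0; apply: leT (weak f l bf l0) _; apply: leMr.
  by apply: intge0 => x _.
 by rewrite leF lerDl.
- move=> h c s N bh s0 N0 h0 hN.
 have [Z [mZ Z0 hZ]] := operator_oscillation hX e0 rm re ds r1 Tlin C20 Tbd mK Ksize Krep KH1 bh s0 N0 h0 hN.
 exists Z; split => // x z xc zc Zx Zz; apply: leT (hZ x z xc zc Zx Zz) _.
 by rewrite wMr// lerDr.
Qed.
End hormander_cz.
Import HBNNSimple.

(** * From sparse domination to a weighted bound *)

Section fatou.
Context {R : realType} {dsp} {X : mType dsp}.
Variable mu : meas X R.

Lemma int_le_null (A Z : set X) (f g : X -> \bar R) : measurable A -> measurable Z ->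
 mu Z = 0%E -> (forall x, (0 <= f x)%E) -> (forall x, (0 <= g x)%E) ->
 (forall x, A x -> ~ Z x -> (f x <= g x)%E) ->
 (\int[mu]_(x in A) f x <= \int[mu]_(x in A) g x)%E.
move=> mA mZ Z0 f0 g0 fg; rewrite imkcond.
have fA0 x : [set: X] x -> (0 <= (f \_ A) x)%E by move=> _; exact: erestrict_ge0.
rewrite ge0_integralTE; last by move=> x; exact: fA0.
apply: ge_ereal_sup => _ [h /= hf <-].
have mh : mfun (EFin \o (h : X -> R)) by exact: mEFin.
have h0 x : (0 <= (h x)%:E)%E by rewrite leF.
rewrite -integralT_nnsfun (@imkcond _ _ _ mu A).
apply: (@int_le_ae_nm _ _ _ mu setT (EFin \o (h : X -> R))) => //.
 by move=> x; exact: erestrict_ge0.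
apply: (ae_of_null mZ Z0) => x Zx _; apply: leT (hf x) _; rewrite !patchE.
by case: ifPn => // /set_mem Ax; exact: fg.
Qed.

Lemma eq_int_null (A Z : set X) (f g : X -> \bar R) : measurable A -> measurable Z ->
 mu Z = 0%E -> (forall x, (0 <= f x)%E) -> (forall x, (0 <= g x)%E) ->
 (forall x, A x -> ~ Z x -> f x = g x) ->
 (\int[mu]_(x in A) f x = \int[mu]_(x in A) g x)%E.
move=> mA mZ Z0 f0 g0 fg; apply/eqP; rewrite eq_le; apply/andP.
by split; apply: (int_le_null mA mZ Z0) => // x Ax Zx; rewrite fg.
Qed.

Lemma fatou_bound (F : nat -> X -> R) (G : X -> R) (B : nat -> R) (L : R) :
 (forall k, mfun (F k)) -> (forall k x, 0 <= F k x) -> (forall x, 0 <= G x) ->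
 {ae mu, forall x e, 0 < e -> exists k0, forall k, (k0 <= k)%N -> G x <= F k x + e} ->
 (forall k, (\int[mu]_x (F k x)%:E <= (B k)%:E)%E) -> B k @[k --> \oo] --> L ->
 (\int[mu]_x (G x)%:E <= L%:E)%E.
move=> mF F0 G0 [Z [mZ Z0 hZ]] FB cvB.
pose f k x := (F k x)%:E; have mf k : mfun (f k) by exact: mEFin.
have e0 x : (0 <= limn_einf (f^~ x))%E.
 rewrite limn_einf_lim; apply: lime_ge; first exact: is_cvg_einfs.
 by apply: nearW => k; apply: le_ereal_inf_tmp => _ [m _ <-]; rewrite leF.
apply: (leU (\int[mu]_x limn_einf (f^~ x))%E).
 apply: (int_le_null measurableT mZ Z0) => // x _ Zx.
 apply/lee_subgt0Pr => e ep; have [k0 hk] : exists k0, forall k, (k0 <= k)%N -> G x <= F k x + e.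
  by apply: contrapT => h; apply/Zx/hZ => h'; exact/h/h'.
 rewrite limn_einf_lim -EFinB; apply: lime_ge; first exact: is_cvg_einfs.
 by exists k0 => // k kk; apply: le_ereal_inf_tmp => _ [m /= km <-]; rewrite leF lerBlDr hk// (leq_trans kk).
apply: leT (fatou mu measurableT mf (fun k x _ => F0 k x)) _.
rewrite limn_einf_lim; have cB : ((B k)%:E @[k --> \oo] --> L%:E)%E by exact: cvg_comp cvB _.
rewrite -(cvg_lim _ cB)//; apply: lee_lim; [exact: is_cvg_einfs|by apply/cvg_ex; exists L%:E|].
apply: nearW => k; apply: leT (FB k); apply: ereal_inf_lbound; exists k => //=.
Qed.

End fatou.

Section weighted_sparse.
Context {R : realType} {dsp} {X : mType dsp}.
Variables (rho : X -> X -> R) (mu : meas X R) (D : R).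
Hypothesis ds : dspace rho mu D.
Local Notation b := (qball rho).
Variables (n : nat) (r Lam C p a b' C1 : R) (T : (X -> R) -> X -> R).
Hypotheses (r1 : 1 <= r) (Lam1 : 1 <= Lam) (czT : cz_op rho mu r Lam C T)
 (leb : forall E, measurable E -> leb_upto rho mu D (\1_E))
 (p1 : 1 < p) (a1 : 1 < a) (ap : a < p / (p - 1)) (b0 : 0 < b') (bp : b' < p) (C10 : 0 <= C1).
Variables (A : X -> 'M[R]_n) (V : X * R -> 'M[R]_n) (K : X * R -> X -> R) (f : X -> 'cV[R]_n)
 (psi : X -> R).
Hypotheses (mA : forall i j, mfun (fun x => A x i j))
 (Vu : forall z, V z \in unitmx) (mK : forall z, mfun (K z))
 (AK : forall z x, opnorm (A x *m invmx (V z)) <= K z x)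
 (hK : forall z, 0 < z.2 -> (\int[mu]_(x in b z.1 (5 * z.2)) (K z x `^ (a / (a - 1)))%:E <=
  (C1 `^ (a / (a - 1)) * vol rho mu z.1 z.2)%:E)%E)
 (bf : forall i, bdsupp rho (fun x => f x i 0))
 (mpsi : mfun psi) (psi0 : forall x, 0 <= psi x)
 (hN : forall z, 0 < z.2 -> ((savg rho mu r Lam f V z `^ b' * vol rho mu z.1 z.2)%:E <=
  \int[mu]_(x in b z.1 (sdil Lam * z.2)) (psi x `^ b')%:E)%E).

(** The domination holds on a ball containing the support and is used for values truncated at height
    [k]. The bounds do not depend on the ball or on [k]; both are sent to infinity by Fatou's
    lemma. *)
Lemma wsparse_bound (Phi : R) : 0 <= Phi ->
 (\int[mu]_x (psi x `^ p)%:E <= (Phi `^ p)%:E)%E ->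
 (\int[mu]_x (enorm (A x *m vec_op T f x) `^ p)%:E <=
  ((sparseC D p a b' C1 (sout D Lam C n) (sdlog Lam) * Phi) `^ p)%:E)%E.
move=> Phi0 hPhi; have p0 : 0 < p by exact: lt_trans.
have /choice[s hs] i : exists s : R, forall x, ~ b point s x -> f x i 0 = 0.
 have [_ _ [c [s h]]] := bf i; exists (rho point c + s) => x bx; apply: h => cx; apply: bx.
 by apply: (bsub ds) cx; rewrite (mtsym (dsmt ds)).
pose N0 (k : nat) : R := \sum_i `|s i| + k.+1%:R.
have sN k i : s i <= N0 k.
 rewrite /N0 (bigD1 i)//= -addrA; apply: leT (ler_norm _) _; rewrite lerDl age0//.
 by apply: sge0.
have N00 k : 0 < N0 k by rewrite ltr_wpDl// sge0.
have f0 k x : ~ b point (N0 k) x -> f x = 0.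
 move=> bx; apply/colP => i; rewrite mxE; apply: hs => h; apply: bx.
 by apply: (bsub ds) h; rewrite (mtrefl (dsmt ds)) add0r.
pose u x := enorm (A x *m vec_op T f x).
have u0 x : 0 <= u x by exact: en_ge0.
have mu_ : mfun u.
 apply: menorm => i; apply: mmulmx => // k l; rewrite /vec_op.
 have -> : (fun x => (\col_j T (fun y => f y j 0) x) k l) = T (fun y => f y k 0).
  by apply/funext => x; rewrite mxE.
 by apply: (cz_measurable czT).
pose F k x := (Num.min (u x) k%:R * \1_(b point (N0 k)) x) `^ p.
have mB k := mball ds point (N0 k).
have Cs0 : 0 <= sout D Lam C n.
 by apply: leT (slev_le_sout ds czT n); rewrite mge0// ltW// (slev_gt0 ds czT).
have sd : 14 <= sdil Lam by rewrite /sdil; move: Lam1; lra.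
have FB k : (\int[mu]_x (F k x)%:E <=
  ((sparseC D p a b' C1 (sout D Lam C n) (sdlog Lam) * Phi) `^ p)%:E)%E.
 have [z [G [zP [mG tG] GB half hu]]] :=
  sparse_domination ds r1 Lam1 czT leb bf Vu (N00 k) (f0 k).
 apply: (@sparse_form_bound _ _ _ _ _ _ ds z G zP mG tG GB p a b' (sdil Lam) C1 _ (sdlog Lam)
  psi (fun m => savg rho mu r Lam f V (z m)) (fun m => K (z m))) => //.
 - lra.
 - rewrite /sdlog; apply: ltW; apply: ltleT (truncnS_gt _) _; rewrite -natrX ler_nat.
  exact: ltnW (ltn_expl _ _).
 - by move=> m; exact: savg_ge0.
 - by move=> m x; apply: leT (AK _ x); exact: on_ge0.
 - by move=> m; exact: hK.
 - by move=> m; exact: hN.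
 - exact: muB_lty ds _ _.
 - apply: filterS hu => x hx Bx; apply: leT (hx Bx (A x)) _.
  apply: leMl => //.
  apply: lesers => [m _ _|m _]; rewrite leF ?mge0 ?on_ge0 ?savg_ge0//.
  by rewrite wMr ?savg_ge0// wMl.
apply: (fatou_bound _ _ _ _ FB (cvg_cst _)).
- move=> k; apply: mpowR; apply: mMindic => //.
 exact: measurable_minr.
- by move=> k x; exact: pge0.
- by move=> x; exact: pge0.
- apply: aeW => x e ep.
 have [m um] : exists m, forall k, (m <= k)%N -> u x <= k%:R /\ rho point x < k%:R.
  exists (maxn (Num.truncn (u x)).+1 (Num.truncn (rho point x)).+1) => k.
  rewrite geq_max => /andP[h1 h2]; split; [apply: ltW|]; apply: ltleT (truncnS_gt _) _;
  by rewrite ler_nat.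
 exists m => k mk; have [h1 h2] := um k mk.
 rewrite /F indicE mem_set; last first.
  apply: ltleT h2 _; rewrite /N0; apply: (leU (k.+1%:R)); first by rewrite ler_nat.
  by rewrite lerDr sge0.
 by rewrite mulr1 min_l// lerDl ltW.
Qed.

End weighted_sparse.

(** * Reducing matrices of a matrix weight *)

Lemma powR_sum_le {R : realType} m (a : 'I_m -> R) (t : R) : 0 < t -> (forall i, 0 <= a i) ->
 (\sum_i a i) `^ t <= m%:R `^ t * \sum_i a i `^ t.
move=> t0 a0; have s0 : 0 <= \sum_i a i `^ t by apply: sge0 => i _; exact: pge0.
case: (posnP m) => [m0|mp].
 rewrite (_ : \sum_i a i = 0) ?powR0 ?gtF ?mge0 //.
 by rewrite big1// => j; have := ltn_ord j; rewrite {2}m0.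
pose j := [arg max_(i > Ordinal mp) a i]%O.
have hj i : a i <= a j by rewrite /j; case: arg_maxP => // k _; exact.
apply: (leU ((m%:R * a j) `^ t)).
 apply: ge0_ler_powR; rewrite ?nnegrE ?mge0 ?sge0//; first exact: ltW.
 by apply: leT (ler_sum _ (fun i _ => hj i)) _; rewrite sumr_const card_ord mulr_natl.
rewrite powRM// wMl // (bigD1 j)//= lerDl.
by apply: sge0 => i _; exact: pge0.
Qed.

Lemma le_powR {R : realType} (x y t : R) : 0 <= t -> 0 <= x -> x <= y -> x `^ t <= y `^ t.
by move=> t0 x0 xy; apply: ge0_ler_powR; rewrite ?nnegrE// (leT x0). Qed.

Section cnorm.
Context {R : realType} {n : nat}.
Implicit Types M : 'M[R]_n.

(** Comparable to the operator norm up to the factor [n], but a finite sum of vector norms: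
    measurability is immediate, and estimates reduce to the scalar weights given by the columns. *)
Definition cnorm M : R := \sum_j enorm (M *m dmx j 0).

Lemma cn_ge0 M : 0 <= cnorm M.
by apply: sge0 => j _; exact: en_ge0. Qed.

Lemma en_le_cn M v : enorm (M *m v) <= cnorm M * enorm v.
by apply: leT (on_bound _ _) _; rewrite wMr ?en_ge0//; exact: on_le_cols.
Qed.

Lemma cn_le_on M : cnorm M <= n%:R * opnorm M.
rewrite mulr_natl -{2}[n]card_ord -sumr_const; apply: ler_sum => j _; exact: col_le_on.
Qed.

Lemma cn_trmx M : cnorm M^T <= (n * (n * n))%:R * cnorm M.
apply: leT (cn_le_on _) _; rewrite natrM -mulrA wMl//.
apply: leT (opnorm_trmx _) _; rewrite wMl//; exact: on_le_cols.
Qed.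

Lemma mcnorm {dsp} {X : mType dsp} (M : X -> 'M[R]_n) :
 mmx M ->
 mfun (fun x => cnorm (M x)).
move=> mM; apply: msum => j; apply: menorm => i.
by apply: mmulmx => // k l; exact: mcst.
Qed.

End cnorm.

Section averaging.
Context {R : realType} {dsp} {X : mType dsp}.
Variables (mu : meas X R) (n : nat) (B : set X) (m : R).
Hypotheses (mB : measurable B) (muB : mu B = m%:E) (m0 : 0 < m).

Lemma int_colnorm (M : X -> 'M[R]_n) (t c : R) : 0 < t ->
 mmx M ->
 (forall j, (\int[mu]_(x in B) (enorm (M x *m dmx j 0) `^ t)%:E <= c%:E)%E) ->
 (\int[mu]_(x in B) (cnorm (M x) `^ t)%:E <= (n%:R `^ t * (n%:R * c))%:E)%E.
move=> t0 mM hc; pose g j x := enorm (M x *m dmx j 0) `^ t.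
have g0 j x : 0 <= g j x by exact: pge0.
have mg j : mfun (g j).
 apply: mpowR; apply: menorm => i.
 by apply: mmulmx => // k l.
have ms : mfun (fun x => \sum_j g j x) by exact: msum.
apply: (leU (\int[mu]_(x in B) (n%:R `^ t * \sum_j g j x)%:E)%E).
 apply: int_le => //.
 - by apply: mpowR; exact: mcnorm.
 - exact: mfM.
 - by move=> x; exact: pge0.
 - by move=> x _; apply: powR_sum_le => // j; exact: en_ge0.
rewrite intZ //; last by move=> x; apply: sge0.
rewrite (EFinM (_ `^ _)); apply: leMl; first by rewrite leF.
under eqint do rewrite -sumEFin; rewrite ge0_integral_sum//; last 2 first.
- by move=> j; apply/measurable_EFinP; exact: measurable_funTS.
- by move=> j x _; rewrite leF.
apply: (leU (\sum_(j < n) c%:E)%E); first by apply: lee_sum => j _; exact: hc.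
by rewrite sumEFin sumr_const card_ord mulr_natl.
Qed.

Lemma avg_le_int (f : X -> \bar R) (y : \bar R) :
 (avg mu B f <= y)%E -> (\int[mu]_(x in B) f x <= y * m%:E)%E.
by rewrite /avg muB inver gtF// muleC lee_pdivrMr. Qed.

Lemma pos_int_gt0 (g : X -> R) : mfun g -> (forall x, 0 < g x) ->
 (0 < \int[mu]_(x in B) (g x)%:E)%E.
move=> mg g0; rewrite lt_def intge0 ?andbT; last by move=> x _; rewrite leF ltW.
apply/eqP => I0; have mgB : measurable_fun B (EFin \o g).
 by apply/measurable_EFinP; exact: measurable_funTS.
have : (\int[mu]_(x in B) `|(EFin \o g) x| = 0)%E.
 by rewrite -I0; apply: eqint => x _ /=; rewrite ger0_norm// ltW.
move/(ae_eq_integral_abs mu mB mgB) => [Z [mZ Z0 hZ]].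
have : (mu B <= mu Z)%E.
 apply: lemu; rewrite ?inE// => x Bx; apply: hZ => /(_ Bx) [] /eqP.
 by rewrite gtF.
by rewrite Z0 muB leF leNgt m0.
Qed.

(** [reducing_matrix] for the mean of [|M x v|^t]. Its lower bound comes from the left inverse [N]:
    [|v| <= |N x| |M x v|], with a positive mean of [(1 + |N x|)^(-t)]. *)
Lemma red_avg (M N : X -> 'M[R]_n) (t C : R) : 0 < t ->
 mmx M ->
 mmx N -> (forall x, N x *m M x = 1%:M) ->
 (forall v, (\int[mu]_(x in B) (enorm (M x *m v) `^ t)%:E <= (C * enorm v `^ t)%:E)%E) ->
 exists2 V, pdsym V & forall v,
  ((enorm (V *m v) `^ t * m)%:E <= ((2 * n%:R) `^ t)%:E * \int[mu]_(x in B) (enorm (M x *m v) `^ t)%:E)%E /\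
  (\int[mu]_(x in B) (enorm (M x *m v) `^ t)%:E <= (n%:R `^ t * n%:R * enorm (V *m v) `^ t * m)%:E)%E.
move=> t0 mM mN NM MC; pose I v := (\int[mu]_(x in B) (enorm (M x *m v) `^ t)%:E)%E.
have mMv v : mfun (fun x => enorm (M x *m v)).
 by apply: menorm => i; apply: mmulmx => // k l.
have mMt v : mfun (fun x => enorm (M x *m v) `^ t) by exact: mpowR.
have I0 v : (0 <= I v)%E by apply: intge0 => x _; rewrite leF pge0.
have If v : I v = (fine (I v))%:E.
 by rewrite fineK// ge0fin//; apply: leltT (MC v) (ltry _).
pose Phi v := fine (I v) / m.
have PhiE v : (Phi v * m)%:E = I v by rewrite divfK ?gtF.
pose g x : R := (1 + cnorm (N x)) `^ (- t).
have N1 x : 0 < 1 + cnorm (N x) by rewrite ltr_wpDr ?cn_ge0.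
have mg : mfun g.
 by apply: mpowR; apply: mfD => //; exact: mcnorm.
have g0 x : 0 < g x by exact: pgt0.
have g1 x : g x <= 1.
 have N1' : 1 <= 1 + cnorm (N x) by rewrite lerDl cn_ge0.
 by rewrite /g powRN invf_le1 ?pgt0; have := le_powR (ltW t0) ler01 N1'; rewrite powR1.
pose c := fine (\int[mu]_(x in B) (g x)%:E)%E.
have cE : (\int[mu]_(x in B) (g x)%:E = c%:E)%E.
 rewrite fineK// ge0fin; last by apply: intge0 => x _; rewrite leF ltW.
 apply: (@leltT _ _ (\int[mu]_(x in B) 1%:E)%E); last by rewrite int_cst// muB ltry.
 by apply: int_le => // x; exact: ltW.
have c0 : 0 < c by rewrite -lte_fin -cE; exact: pos_int_gt0.
have Ilow v : ((enorm v `^ t * c)%:E <= I v)%E.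
 rewrite EFinM -cE -intZ ?pge0//; last by move=> x; exact: ltW.
 apply: int_le => //.
 - exact: mfM.
 - by move=> x; rewrite mge0 ?pge0//.
 move=> x _; rewrite /g powRN lepdM ?pgt0// -powRM ?en_ge0 ?(ltW (N1 x))//.
 rewrite le_powR ?(ltW t0) ?en_ge0// -{1}[v]mul1mx -(NM x) -mulmxA mulrC.
 by apply: leT (en_le_cn _ _) _; rewrite wMr ?en_ge0// lerDr.
have hom k v : Phi (k *: v) = `|k| `^ t * Phi v.
 rewrite mulrA; congr (_ / _).
  suff -> : I (k *: v) = (`|k| `^ t * fine (I v))%:E by [].
  rewrite EFinM -If -intZ //; last by move=> x; exact: pge0.
  by apply: eqint => x _; rewrite -scalemxAr enormZ powRM ?en_ge0.
have sub (v : 'I_n -> 'cV[R]_n) : Phi (\sum_i v i) <= n%:R `^ t * \sum_i Phi (v i).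
 rewrite -mulr_suml mulrA ler_pM2r ?igt0// -leF -If EFinM.
  have -> : ((\sum_i fine (I (v i)))%:E = \sum_i I (v i))%E.
  by rewrite -sumEFin; apply: eq_bigr => i _; rewrite -If.
  rewrite -ge0_integral_sum//; last 2 first.
 - by move=> i; apply/measurable_EFinP; exact: measurable_funTS.
 - by move=> i x _; rewrite leF pge0.
  under [X in (_ <= _ * X)%E]eqint do rewrite sumEFin.
  have ms : mfun (fun x => \sum_i enorm (M x *m v i) `^ t) by exact: msum.
  rewrite -intZ //; last by move=> x; apply: sge0 => i _; exact: pge0.
  apply: int_le => //; first exact: mfM.
  by move=> x; exact: pge0.
  move=> x _; apply: leT (powR_sum_le t0 (fun i => en_ge0 (M x *m v i))).
  rewrite le_powR ?(ltW t0) ?en_ge0// mulmx_sumr.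
  elim/big_ind2: _ => [|a1 a2 b1 b2 h1 h2|//]; first by rewrite enorm0.
  by apply: leT (en_tri _ _) _; exact: lerD.
have bnd v : c / m * enorm v `^ t <= Phi v <= C / m * enorm v `^ t.
 rewrite ![_ / m * _]mulrAC !ler_pM2r ?igt0//; apply/andP; split.
  by rewrite mulrC -leF -If.
  by rewrite -leF -If; exact: MC.
have [V pV hV] := reducing_matrix t0 (dgt0 c0 m0) (pge0 _ _) hom sub bnd.
exists V => // v; have [h1 h2] := hV v; rewrite -/(I v) -PhiE; split.
 by rewrite leF mulrA wMr// ltW.
by rewrite leF wMr// ltW.
Qed.

End averaging.
Lemma dualE {R : realType} (u : R) : 1 < u -> dual u = u / (u - 1).
by move=> u1; rewrite /dual hconj_gt1. Qed.

Lemma dual_gt1 {R : realType} (u : R) : 1 < u -> 1 < dual u.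
by move=> u1; rewrite dualE// ltr_pdivlMr ?subr_gt0// mul1r ltrBlDr ltrDl. Qed.

Lemma dual_add {R : realType} (u : R) : 1 < u -> u^-1 + (dual u)^-1 = 1.
by move=> u1; rewrite dualE// invf_div; field; rewrite gtF// (lt_trans ltr01). Qed.

Section reduced.
Context {R : realType} {dsp} {X : mType dsp}.
Variables (dist : X -> X -> R) (cd : R) (mu : meas X R) (rho : X -> X -> R) (e D : R).
Hypotheses (hX : htype dist cd mu) (e0 : 0 < e)
 (re : pwcmp rho dist e) (ds : dspace rho mu D).
Local Notation b := (qball rho).
Variables (n : nat) (W : X -> 'M[R]_n) (kap : R) (k : nat).
Hypotheses (pW : forall x, pdsym (W x)) (kap0 : 0 < kap) (kapk : 2 * kap <= 2 ^+ k)
 (mW : forall i j, mfun (fun x => W x i j)).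

(** The characteristics are suprema over quasi-metric balls, while the sparse family consists of
    metric balls; each metric ball is put into a quasi-metric one of comparable measure. *)
Lemma dist_ball_around (z : X * R) : 0 < z.2 -> exists2 s, 0 < s &
 exists m, [/\ 0 < m, mu (qball dist z.1 s) = m%:E, m <= D ^+ k * vol rho mu z.1 z.2 &
  b z.1 (kap * z.2) `<=` qball dist z.1 s].
move=> z0; have t0 : 0 < 2 * (kap * z.2) by rewrite !mgt0.
exists ((2 * (kap * z.2)) `^ e^-1); first exact: pgt0.
set s := _ `^ _; have s0 : 0 < s by exact: pgt0.
have /andP[B0 Bf] := htbmu hX z.1 s0.
have BE : mu (qball dist z.1 s) = (fine (mu (qball dist z.1 s)))%:E.
 by rewrite fineK// ge0fin.
exists (fine (mu (qball dist z.1 s))); split => //; first by rewrite -lte_fin -BE.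
- rewrite -leF -BE; apply: (leU (mu (b z.1 (2 * (kap * z.2))))).
  have sE : s `^ e = 2 * (kap * z.2) by rewrite powRVK ?gtF// ltW.
  apply: lemu; rewrite ?inE; [exact: (htbm hX)|exact: (mball ds)|].
  by rewrite -sE; apply: (dbl_sub hX e0 re).
 rewrite (mu_ball ds)//; apply: vol_le => //.
 by rewrite (mtrefl (dsmt ds)) add0r mulrA wMr// ltW.
- have -> : kap * z.2 = 2 * (kap * z.2) / 2 by field.
 exact: (sub_dball hX e0 re t0).
Qed.

Let mpow s := mmxpowR pW mW s.
Let mcpow (s : R) (M : 'M[R]_n) i j : mfun (fun x => (mxpowR (W x) s *m M) i j).
by apply: mmulmx => // a c; exact: mcst. Qed.
Let mpowc (s : R) (M : 'M[R]_n) i j : mfun (fun x => (M *m mxpowR (W x) s) i j).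
by apply: mmulmx => // a c; exact: mcst. Qed.

Lemma int_enpow_le (B : set X) (s t a : R) x : measurable B -> 0 < t ->
 (\int[mu]_(y in B) (opnorm (mxpowR (W y) s *m mxpowR (W x) (- s)) `^ t)%:E <= a%:E)%E ->
 forall v, (\int[mu]_(y in B) (enorm (mxpowR (W y) s *m v) `^ t)%:E <=
  (a * opnorm (mxpowR (W x) s) `^ t * enorm v `^ t)%:E)%E.
move=> mB t0 ha v; pose M y := mxpowR (W y) s *m mxpowR (W x) (- s).
have t0' := ltW t0; have aE : a * opnorm (mxpowR (W x) s) `^ t * enorm v `^ t =
  (opnorm (mxpowR (W x) s) * enorm v) `^ t * a.
 by rewrite powRM ?on_ge0 ?en_ge0// -mulrA mulrC.
apply: (leU (\int[mu]_(y in B) ((opnorm (mxpowR (W x) s) * enorm v) `^ t *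
  (enorm (mxpowR (W y) s *m v) / (opnorm (mxpowR (W x) s) * enorm v)) `^ t)%:E)%E).
 apply: int_le_nm => y; first by rewrite leF pge0.
 move=> _; rewrite leF -powRM ?dge0 ?mge0 ?on_ge0 ?en_ge0//.
 rewrite le_powR ?en_ge0//.
 have [c0|c0] := eqVneq (opnorm (mxpowR (W x) s) * enorm v) 0; last by rewrite mulrC divfK.
 have -> : mxpowR (W y) s *m v = M y *m (mxpowR (W x) s *m v).
  by rewrite mulmxA -(mulmxA _ _ (mxpowR (W x) s)) mxpowRN// mulmx1.
 have -> : mxpowR (W x) s *m v = 0.
  by apply: enorm_eq0; apply/eqP; rewrite eq_le en_ge0 -c0 on_bound.
 by rewrite mulmx0 enorm0 c0.
have mv : mfun (fun y => enorm (mxpowR (W y) s *m v)).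
 by apply: menorm => i; apply: mmulmx => // c l.
rewrite intZ ?pge0//; first last.
- by move=> y; exact: pge0.
- by apply: mpowR; apply: mfM.
rewrite aE (EFinM (_ `^ _)); apply: leMl; first by rewrite leF pge0.
apply: leT ha; apply: int_le_nm => y; first by rewrite leF pge0.
move=> _; rewrite leF le_powR ?dge0 ?mge0 ?on_ge0 ?en_ge0//.
have [c0|c0] := eqVneq (opnorm (mxpowR (W x) s) * enorm v) 0.
 by rewrite c0 invr0 mulr0 on_ge0.
rewrite lepdM ?lt0r ?c0 ?mge0 ?on_ge0 ?en_ge0//.
have -> : mxpowR (W y) s *m v = M y *m (mxpowR (W x) s *m v).
 by rewrite mulmxA -(mulmxA _ _ (mxpowR (W x) s)) mxpowRN// mulmx1.
apply: leT (on_bound _ _) _; rewrite wMl ?on_ge0//; exact: on_bound.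
Qed.

Definition redC (t : R) : R :=
 (n * (n * n))%:R `^ t * (n%:R `^ t * (n%:R * (n%:R `^ t * n%:R))) * D ^+ k.
Definition redC' (u t : R) : R :=
 (1 + (n * (n * n))%:R `^ u * (n%:R `^ t * (n%:R * (2 * n%:R) `^ t)) `^ (u / t)) * D ^+ k.

Let Dk0 : 0 < D ^+ k. Proof. exact: xgt0 (D_gt0 ds). Qed.

(** Take for [V] the inverse of the matrix [U] that reduces [W^(-1/u)] in [L^u']. The dual estimate
    is then free of [A], and the whole characteristic appears in the estimate of
    [W^(1/u) V^(-1)]. *)
Lemma Agt1_reduced (u A : R) : 1 < u -> 0 <= A -> (Aconst_gt1 dist mu u W <= A%:E)%E ->
 forall z : X * R, 0 < z.2 -> exists V, [/\ pdsym V,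
  (\int[mu]_(x in b z.1 (kap * z.2)) (cnorm (mxpowR (W x) u^-1 *m invmx V) `^ u)%:E <=
  (redC' u (dual u) * A * vol rho mu z.1 z.2)%:E)%E &
  (\int[mu]_(x in b z.1 (kap * z.2)) (cnorm (V *m mxpowR (W x) (- u^-1)) `^ dual u)%:E <=
  (redC (dual u) * vol rho mu z.1 z.2)%:E)%E].
move=> u1 A0 WA z z0; have u0 : 0 < u by exact: lt_trans u1.
set t := dual u; have t0 : 0 < t by exact: lt_trans (dual_gt1 u1).
have [s s0 [m [m0 Bm mv zB]]] := dist_ball_around z0; set B := qball dist z.1 s in Bm zB.
have mB : measurable B := htbm hX _ s0.
have mb : measurable (b z.1 (kap * z.2)) := mball ds _ _.
pose P x := mxpowR (W x) u^-1; pose Q x := mxpowR (W x) (- u^-1).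
pose h x := avg mu B (fun y => (opnorm (Q y *m P x) `^ t)%:E).
have h0 x : (0 <= h x)%E.
 rewrite mule_ge0//; first by rewrite inve_ge0 Bm leF ltW.
 by apply: intge0 => y _; rewrite leF pge0.
have hA : (\int[mu]_(x in B) (h x `^ (u / t)) <= (A * m)%:E)%E.
 rewrite EFinM; apply: (avg_le_int Bm m0); apply: leT WA.
 by apply: esupub; exists z.1, s.
(* As the outer mean is finite, the inner one is finite at some point; this makes [W^(-1/u)] locally
   integrable to the power [u']. *)
have [x0 hx0] : exists x, (h x < +oo)%E.
 apply: contrapT => /forallNP hy; have hE x : h x = +oo%E.
  by case: (h x) (h0 x) (hy x) => // y _; rewrite ltry.
 have : (\int[mu]_(x in B) (h x `^ (u / t)) = +oo)%E.
  under eqint do rewrite hE poweRyr ?gtF ?dgt0//.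
  by rewrite integral_cst// [mu B]Bm gt0_mulye// lte_fin.
 by move=> h'; rewrite h' leye_eq in hA.
have hm x : (\int[mu]_(y in B) (opnorm (Q y *m P x) `^ t)%:E <= h x * m%:E)%E.
 by apply: (avg_le_int Bm m0).
have hx0E : h x0 = (fine (h x0))%:E by rewrite fineK// ge0fin.
have := hm x0; rewrite hx0E -EFinM => hx0m.
have QC := @int_enpow_le B (- u^-1) t (fine (h x0) * m) x0 mB t0.
rewrite opprK in QC.
have [U pU hU] := red_avg mB Bm m0 t0 (mpow (- u^-1)) (mpow u^-1)
 (fun x => mxpowRV u^-1 (pW x)) (fun v => leT (QC hx0m v) (lexx _)).
have uU : U \in unitmx by case/mulmx1_unit: (mxpowRN 1 pU); rewrite mxpowR1.
have pV : pdsym (invmx U) by rewrite -mxpowRN1//; exact: mxpowR_pd.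
have Us : U^T = U by case: pU.
have Qs x : (Q x)^T = Q x by exact: mxpowR_sym.
have Ps x : (P x)^T = P x by exact: mxpowR_sym.
exists (invmx U); split => //.
- rewrite invmxK; have t_0 := gtF t0.
 (* The summand 1 keeps [q] positive, so it can be inverted in [key]. *)
 rewrite /redC'; set q := 1 + _.
 have q0 : 0 < q by rewrite ltr_wpDr// mge0 ?pge0.
 have mcP : mfun (fun x => cnorm (P x *m U)).
  by apply: mcnorm => i j; exact: mcpow.
 have mcu : mfun (fun x => cnorm (P x *m U) `^ u) by exact: mpowR.
 have cu0 x : 0 <= cnorm (P x *m U) `^ u by exact: pge0.
 have key x : ((q^-1 * cnorm (P x *m U) `^ u)%:E <= h x `^ (u / t))%E.
  have [->|hxy] := eqVneq (h x) +oo%E; first by rewrite poweRyr ?gtF ?dgt0// leey.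
  have [a hxE] : exists a, h x = a%:E by case: (h x) (h0 x) hxy => // a; exists a.
  have hx0' : 0 <= a by rewrite -leF -hxE.
  rewrite hxE poweR_EFin leF ler_pdivrMl//.
  have col j : enorm (U *m P x *m dmx j 0) `^ t <= (2 * n%:R) `^ t * a.
  rewrite -(ler_pM2r m0) -leF -(mulrA (_ `^ _) a) (EFinM ((2 * n%:R) `^ t)) (EFinM a) -hxE -mulmxA.
  apply: leT (hU _).1 _; apply: leMl; first by rewrite leF pge0.
  apply: leT (hm x); apply: int_le_nm => y.
  by rewrite leF pge0.
  by move=> _; rewrite leF mulmxA le_powR ?(ltW t0) ?en_ge0 ?col_le_on.
  have c1 : cnorm (U *m P x) `^ t <= n%:R `^ t * (n%:R * (2 * n%:R) `^ t) * a.
  apply: leT (powR_sum_le t0 (fun j => en_ge0 _)) _.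
  rewrite -!mulrA wMl ?pge0//; apply: leT (ler_sum _ (fun j _ => col j)) _.
  by rewrite sumr_const card_ord [leRHS]mulr_natl.
  have c2 : cnorm (P x *m U) <= (n * (n * n))%:R * cnorm (U *m P x).
  by have := cn_trmx (U *m P x); rewrite trmx_mul Us Ps.
  apply: leT (le_powR (ltW u0) (cn_ge0 _) c2) _.
  rewrite powRM ?cn_ge0//.
  have -> : cnorm (U *m P x) `^ u = (cnorm (U *m P x) `^ t) `^ (u / t).
  by rewrite -powRrM mulrC divfK ?t_0.
  have ut : 0 <= u / t by rewrite dge0 ?ltW.
  have := le_powR ut (pge0 _ _) c1; rewrite powRM ?mge0 ?pge0// => c3.
  apply: leT (wMl (pge0 _ _) c3) _; rewrite [leLHS]mulrA wMr ?pge0//.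
  by rewrite lerDr.
 apply: (leU (\int[mu]_(x in B) (cnorm (P x *m U) `^ u)%:E)%E); first exact: isub.
 have -> : (\int[mu]_(x in B) (cnorm (P x *m U) `^ u)%:E =
  q%:E * \int[mu]_(x in B) (q^-1 * cnorm (P x *m U) `^ u)%:E)%E.
  rewrite -intZ ?(ltW q0)//; first last.
  + by move=> x; rewrite mge0// ige0 ltW.
  + exact: mfM.
  by apply: eqint => x _; rewrite mulrA divff ?mul1r ?gtF.
 apply: (leU (q%:E * (A * m)%:E)%E).
  apply: leMl; first by rewrite leF ltW.
  apply: leT hA; apply: int_le_nm => x //.
  by rewrite leF mge0// ige0 ltW.
 rewrite -EFinM leF -!mulrA wMl ?(ltW q0)//.
 by rewrite [leRHS]mulrCA wMl.
- have mcQ : mfun (fun x => cnorm (Q x *m invmx U)).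
  by apply: mcnorm => i j; exact: mcpow.
 apply: (leU (\int[mu]_(x in B) ((n * (n * n))%:R `^ t * cnorm (Q x *m invmx U) `^ t)%:E)%E).
  apply: (leU (\int[mu]_(x in B) (cnorm (invmx U *m Q x) `^ t)%:E)%E).
  apply: isub => //; last by move=> x; exact: pge0.
  by apply: mpowR; exact: mcnorm.
  apply: int_le_nm => x; first by rewrite leF pge0.
  move=> _; rewrite leF -powRM ?cn_ge0// le_powR ?(ltW t0) ?cn_ge0//.
  by have := cn_trmx (Q x *m invmx U); rewrite trmx_mul Qs trmx_inv Us.
 rewrite intZ ?pge0//; last 2 first.
 + exact: mpowR.
 + by move=> x; exact: pge0.
 apply: (leU (((n * (n * n))%:R `^ t)%:E * (n%:R `^ t * (n%:R * (n%:R `^ t * n%:R * m)))%:E)%E).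
  apply: leMl; first by rewrite leF pge0.
  apply: int_colnorm => // [i j|j]; first exact: mcpow.
  have := (hU (invmx U *m dmx j 0)).2.
  rewrite mulmxA mulmxV// mul1mx en_delta powR1 mulr1 => h1.
  apply: leT h1; apply: eqW.
  by apply: eqint => x _; rewrite mulmxA.
 rewrite -EFinM leF /redC -!mulrA.
 by rewrite !wMl ?pge0.
Qed.

Definition redC1 : R := n%:R `^ 1 * (n%:R * (n%:R `^ 1 * n%:R)) * D ^+ k.

(** For [u = 1] the roles are exchanged: [V] reduces [W] itself in L^1, and the characteristic
    appears in the essential supremum of [V W^(-1)]. *)
Lemma A1_reduced (A : R) : (Aconst1 dist mu W <= A%:E)%E ->
 forall z : X * R, 0 < z.2 -> exists V, [/\ pdsym V,
  (\int[mu]_(x in b z.1 (kap * z.2)) (cnorm (mxpowR (W x) 1 *m invmx V) `^ 1)%:E <=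
  (redC1 * vol rho mu z.1 z.2)%:E)%E &
  {ae mu, forall x, b z.1 (kap * z.2) x ->
  cnorm (V *m mxpowR (W x) (- 1)) <= n%:R * (2 * n%:R * A)}].
move=> WA z z0; have [s s0 [m [m0 Bm mv zB]]] := dist_ball_around z0.
set B := qball dist z.1 s in Bm zB; have mB : measurable B := htbm hX _ s0.
pose good y := (\int[mu]_(x in B) (opnorm (mxpowR (W x) 1 *m mxpowR (W y) (- 1)) `^ 1)%:E <= (A * m)%:E)%E.
have [Z [mZ Z0 hZ]] : {ae mu, forall y, B y -> good y}.
 have : (ess_sup_on mu B (fun y => avg mu B (fun x => (opnorm (W x *m invmx (W y)))%:E)) <= A%:E)%E.
  by apply: leT WA; apply: esupub; exists z.1, s.
 move=> /ess_supP; apply: filterS => y hy By; move: hy; rewrite patchE mem_set// => hy.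
 rewrite /good EFinM; apply: (avg_le_int Bm m0); apply: leT hy; rewrite /avg.
 by under eqint do rewrite powRr1 ?on_ge0// mxpowR1// mxpowRN1//.
have [x0 hx0] : exists x, good x.
 apply: contrapT => /forallNP hy; have : (mu B <= mu Z)%E.
  by apply: lemu; rewrite ?inE// => x Bx; apply: hZ => /= /(_ Bx); exact: hy.
 by rewrite Z0 [mu B]Bm leF leNgt m0.
have [U pU hU] := red_avg mB Bm m0 ltr01 (mpow 1) (mpow (- 1))
 (fun x => mxpowRN 1 (pW x)) (int_enpow_le mB ltr01 hx0).
have uU : U \in unitmx by case/mulmx1_unit: (mxpowRN 1 pU); rewrite mxpowR1.
exists U; split => //.
- apply: (leU (\int[mu]_(x in B) (cnorm (mxpowR (W x) 1 *m invmx U) `^ 1)%:E)%E).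
  apply: isub => //; [exact: mball ds _ _| |by move=> x; exact: pge0].
  by apply: mpowR; exact: mcnorm.
 apply: (leU (n%:R `^ 1 * (n%:R * (n%:R `^ 1 * n%:R * m)))%:E).
  apply: int_colnorm => // j; have := (hU (invmx U *m dmx j 0)).2.
  rewrite mulmxA mulmxV// mul1mx en_delta powR1 mulr1 => h1.
  apply: leT h1; apply: eqW.
  by apply: eqint => x _; rewrite mulmxA.
 by rewrite leF /redC1 -!mulrA !wMl ?pge0.
- apply: (ae_of_null mZ Z0) => y Zy /zB By.
 have gy : good y by apply: contrapT => h; apply: Zy; apply: hZ => /= /(_ By).
 have col j : enorm (U *m mxpowR (W y) (- 1) *m dmx j 0) <= 2 * n%:R * A.
  rewrite -(ler_pM2r m0) -leF -(mulrA (2 * n%:R)) -mulmxA -[enorm _]powRr1 ?en_ge0//.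
  apply: leT (hU _).1 _.
  rewrite powRr1 ?mge0// (EFinM (2 * n%:R)); apply: leMl; first by rewrite leF mge0.
  apply: leT gy; apply: int_le_nm => x.
  by rewrite leF pge0.
  by move=> _; rewrite leF mulmxA le_powR ?en_ge0 ?col_le_on.
 by apply: leT (ler_sum _ (fun j _ => col j)) _; rewrite sumr_const card_ord [leRHS]mulr_natl.
Qed.

End reduced.

Fact rh_arith {R : rfType} (x : R) : 0 <= x -> x <= 1 -> 1 <= (1 + x) * (1 - x / 2).
nra. Qed.

Fact rh_arith2 {R : rfType} (A d : R) : 1 <= A -> 1 <= d -> (2 * (2 * A * d))^-1 <= 1.
by move=> A1 d1; rewrite invf_le1; nra. Qed.

Fact rh_arith3 {R : comRingType} (x c d y v : R) : x * c * d * y * v = x * c * (d * (y * v)).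
ring. Qed.

Fact rh_arith4 {R : rfType} (d g m v : R) : 0 < d -> 0 <= g -> m <= d * v -> d^-1 * g * m <= g * v.
by move=> d0 g0 h; rewrite mulrAC mulrC wMl// ler_pdivrMl. Qed.

Fact rh_arith5 {R : rfType} (x y z s : R) : x <= y + z -> y < 7 * s -> z < 7 * s -> x < 14 * s.
lra. Qed.

(** By [ln (1 + x) >= x / 2] on [[0, 1]] the gain is at least a constant over [A]; this is the
    source of the linear dependence on the characteristic. *)
Lemma rh_expb {R : realType} (D A : R) th : 2 <= D -> 1 <= A ->
 [/\ 0 < rh_exp D th A, rh_exp D th A <= 1 & (8 * D ^+ th * ln (D ^+ 7))^-1 / A <= rh_exp D th A].
move=> D2 A1; have D1 : 1 <= D by apply: leT D2; rewrite ler1n.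
have Dt : 1 <= D ^+ th by exact: exprn_ege1.
have D7 : 2 <= D ^+ 7.
 by rewrite exprS; apply: leT D2 _; rewrite ler_peMr ?exprn_ege1// (leT ler01).
rewrite /rh_exp; set x := (2 * _)^-1.
have x0 : 0 < x by rewrite igt0 !mgt0// (ltleT ltr01).
have x1 : x <= 1 by exact: rh_arith2.
have L0 : 0 < ln (D ^+ 7) by rewrite ln_gt0// (ltleT _ D7)// ltr1n.
have l0 : x / 2 <= ln (1 + x).
 rewrite -[leLHS]expRK ler_ln ?posrE ?expR_gt0 ?addr_gt0//.
 rewrite -(ler_pM2r (expR_gt0 (- (x / 2)))) -expRD subrr expR0.
 apply: leT (rh_arith (ltW x0) x1) _; rewrite wMl ?age0 ?(ltW x0)//.
 exact: expR_ge1Dx.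
have xA : x / 2 / ln (D ^+ 7) = (8 * D ^+ th * ln (D ^+ 7))^-1 / A.
 rewrite /x; field; rewrite !gtF// ?(ltleT ltr01)//.
split.
- by rewrite dgt0// (ltleT _ l0)// dgt0.
- by rewrite lepdM// mul1r ler_ln ?posrE ?addr_gt0 ?xgt0 ?(ltleT ltr01 D1)//; apply: leT D7; rewrite -[2]/(1 + 1) lerD2l.
- by rewrite -xA ler_pM2r ?igt0.
Qed.

(** * Scalar weights: Fujii-Wilson constants and reverse Hoelder *)

Section weights.
Context {R : realType} {dsp} {X : mType dsp}.
Variables (dist : X -> X -> R) (cd : R) (mu : meas X R) (rho : X -> X -> R) (e D : R).
Hypotheses (hX : htype dist cd mu) (e0 : 0 < e)
 (re : pwcmp rho dist e) (ds : dspace rho mu D).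
Local Notation b := (qball rho).
Let rm := dsmt ds.
Let D0 := D_gt0 ds.
Let D1 : 1 <= D. Proof. by apply: leT (dsC ds); rewrite ler1n. Qed.

Section one_weight.
Variable w : X -> R.
Hypotheses (mw : mfun w) (w0 : forall x, 0 < w x)
 (wf : forall c s, 0 < s -> (\int[mu]_(x in b c s) (w x)%:E < +oo)%E).
Let w0' x : 0 <= w x. Proof. exact: ltW. Qed.
Let mb c s : measurable (b c s) := mball ds c s.

Lemma weight_int c s : 0 < s -> exists2 W0, 0 < W0 & (\int[mu]_(x in b c s) (w x)%:E = W0%:E)%E.
move=> s0; have p := pos_int_gt0 (mb c s) (mu_ball ds c s0) (vgt0 ds c s0) mw w0.
exists (fine (\int[mu]_(x in b c s) (w x)%:E)); first by rewrite fine_gt0// p wf.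
by rewrite fineK// ge0fin ?wf// ltW.
Qed.

(** A quasi-metric ball [B] fits between the metric balls of radii [7 s] and [2^6 s], and each small
    metric ball is enlarged to a quasi-metric one at the cost of [D]. So [G / D] lies below the
    maximal function of [w] cut to [B]. *)
Lemma fw_of_Ainfty (S : R) : 0 <= S -> (Ainfty dist mu w <= S%:E)%E ->
 fwilson rho mu 6 (D * S) w.
move=> S0 hS c s s0 G mG G0 hG.
have s7 : 0 < 2 * (7 * s) by lra.
pose t := (2 * (7 * s)) `^ e^-1; have t0 : 0 < t by exact: pgt0.
pose B := qball dist c t; have mB : measurable B := htbm hX _ t0.
have tE : t `^ e = 2 * (7 * s) by rewrite powRVK ?gtF// ltW.
have sub7 : b c (7 * s) `<=` B.
 have -> : 7 * s = 2 * (7 * s) / 2 by lra.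
 exact: (sub_dball hX e0 re).
have Bsub : B `<=` b c (2 ^+ 6 * s).
 apply: subT (dbl_sub hX e0 re t0) _; rewrite tE; apply: (bsub ds).
 by rewrite (mtrefl rm) add0r mulrA wMr ?(ltW s0)// -natrX -natrM ler_nat.
pose I := (\int[mu]_(x in B) (w x)%:E)%E.
have IW : (I <= \int[mu]_(x in b c (2 ^+ 6 * s)) (w x)%:E)%E by exact: isub.
have s64 : 0 < 2 ^+ 6 * s by lra.
have /andP[B0 Bf] := htbmu hX c t0.
have [i [i0 IE]] : exists i, 0 < i /\ I = i%:E.
 exists (fine I); have BE : mu B = (fine (mu B))%:E by rewrite fineK// ge0fin.
 have Bp : 0 < fine (mu B) by rewrite -lte_fin -BE.
 have I0 := pos_int_gt0 mB BE Bp mw w0; have If : (I < +oo)%E := leltT IW (wf c s64).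
 by rewrite fine_gt0 ?I0// fineK// ge0fin// ltW.
pose Mw x := maximal dist mu (fun y => w y * \1_B y) x.
have Mint : (\int[mu]_(x in B) Mw x <= (S * i)%:E)%E.
 have : (I^-1 * \int[mu]_(x in B) Mw x <= S%:E)%E.
  by apply: leT hS; apply: esupub; exists c, t.
 by rewrite IE inver gtF// muleC lee_pdivrMr//.
have Mw0 x : (0 <= Mw x)%E.
 apply: leT (esupub _); last first.
  exists x, 1; split => //; by rewrite /qball /= (qm_eq0 (htqm hX) x x).2.
 rewrite mule_ge0 ?inve_ge0//; apply: intge0 => y _; exact: normr_ge0.
have key x : b c (5 * s) x -> (((D^-1) * G x)%:E <= Mw x)%E.
 move=> cx; have [->|Gx] := eqVneq (G x) 0; first by rewrite mulr0.
 have Gp : 0 < G x by rewrite lt0r Gx G0.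
 have [c' [s' [s'0 xs sub h]]] := hG x cx Gp.
 have s2 : 0 < 2 * s' by lra.
 pose t' := (2 * s') `^ e^-1; have t'0 : 0 < t' by exact: pgt0.
 have t'E : t' `^ e = 2 * s' by rewrite powRVK ?gtF// ltW.
 have sub' : b c' s' `<=` qball dist c' t'.
  have {1}-> : s' = 2 * s' / 2 by rewrite mulrAC divff ?mul1r.
  exact: (sub_dball hX e0 re).
 apply: leT (esupub _); last by exists c', t'; split => //; exact: sub'.
 have /andP[B'0 B'f] := htbmu hX c' t'0; set B' := qball dist c' t' in sub' B'0 B'f *.
 have mB' : measurable B' := htbm hX _ t'0.
 have BE : mu B' = (fine (mu B'))%:E by rewrite fineK// ge0fin.
 set m := fine _ in BE; have m0 : 0 < m by rewrite -lte_fin -BE.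
 have mv : m <= D * vol rho mu c' s'.
  rewrite -leF -BE; apply: (leU (mu (b c' (2 * s')))).
  by apply: lemu; rewrite ?inE// -t'E; exact: (dbl_sub hX e0 re).
  rewrite (mu_ball ds)// -[D]expr1; apply: vol_le => //.
  by rewrite (mtrefl rm) add0r.
 rewrite /avg BE inver gtF// muleC lee_pdivlMr//.
 apply: (leU (G x * vol rho mu c' s')%:E).
  by rewrite leF; exact: rh_arith4.
 apply: leT h _; apply: (leU (\int[mu]_(y in b c' s') `|w y * \1_B y|%:E)%E).
  apply: eqW; apply: eqint => y; rewrite inE => ys.
  by rewrite indicE mem_set ?mulr1 ?ger0_norm//; exact/sub7/sub.
 apply: isub => //; apply: mcomp => //; exact: mMindic.
apply: (leU (D%:E * \int[mu]_(x in b c (5 * s)) (D^-1 * G x)%:E)%E).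
 rewrite -intZ ?(ltW D0)//; last 2 first.
 - exact: mfM.
 - by move=> x; rewrite mge0// ige0 ltW.
 by apply: eqW; apply: eqint => x _; rewrite mulrA divff ?mul1r// gtF.
rewrite (EFinM D) -muleA; apply: leMl; first by rewrite ltW.
have S0E : (0 <= S%:E)%E by [].
apply: leT (leMl S0E IW); rewrite IE; apply: leT Mint.
have sub5 : b c (5 * s) `<=` B.
 by apply: subT sub7; apply: (bsub ds); rewrite (mtrefl rm) add0r wMr ?(ltW s0)// ler_nat.
rewrite imkcond [leRHS]imkcond; apply: int_le_nm => x.
 by rewrite patchE; case: ifP => // _; rewrite leF mge0// ige0 ltW.
move=> _; rewrite !patchE; case: ifPn => [/set_mem xs|_].
 by rewrite mem_set; [exact: key|exact: sub5].
by case: ifP.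
Qed.

Definition fw_const (c0 : R) : R := D ^+ 7 + D ^+ 15 + D ^+ 17 / c0.

(** The qualitative source of [fwilson]: the test function is below the majorant [Psi] of
    [local_maximal_majorant] on the ball of radius [14 s]. *)
Lemma fw_of_half_mass c0 : 0 < c0 -> half_mass rho mu w c0 ->
 fwilson rho mu 6 (fw_const c0) w.
move=> c00 hm c s s0 G mG G0 hG.
have s14 : 0 < 14 * s by lra.
have s56 : 0 < 4 * (14 * s) by lra.
have [W0 W00 WE] := weight_int c s56.
have [Psi mPsi [Psi0 hPsi PsiW]] := @local_maximal_majorant _ _ _ _ _ _ ds _ _ _ 3 _ mw w0' s14 isT W00 WE c0 c00 hm.
apply: (leU (\int[mu]_(x in b c (14 * s)) Psi x)%E); last first.
 apply: leT PsiW _; rewrite EFinM -WE; apply: leMl.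
  by rewrite leF !age0 ?dge0 ?xge0 ?ltW.
 apply: isub => //; apply: (bsub ds).
 by rewrite (mtrefl rm) add0r mulrA wMr ?(ltW s0)// -natrM -natrX ler_nat.
have sub5 : b c (5 * s) `<=` b c (14 * s).
 by apply: (bsub ds); rewrite (mtrefl rm) add0r wMr ?(ltW s0)// ler_nat.
rewrite imkcond [leRHS]imkcond; apply: int_le_nm => x.
 by rewrite patchE; case: ifP =>  _; rewrite leF.
move=> _; rewrite !patchE; case: ifPn => [/set_mem xs|_]; last by case: ifP.
rewrite mem_set; last exact: sub5.
have [->|Gx] := eqVneq (G x) 0 => //.
have [c' [s' [s'0 xs' sub h]]] := hG x xs ltac:(by rewrite lt0r Gx G0).
(* The radius of a metric ball is not determined by the set; a ball contained in [b c (7 * s)] can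
   always be given a radius at most [14 s]. *)
suff [s2 [s20 s21 bE]] : exists s2, [/\ 0 < s2, s2 <= 14 * s & b c' s2 = b c' s'].
 have v0 := vgt0 ds c' s20.
 have := hPsi x c' s2 (sub5 _ xs) s20 s21; rewrite bE => /(_ xs') h2.
 move: (leT h h2); have -> : vol rho mu c' s' = vol rho mu c' s2 by rewrite /vol bE.
 by rewrite EFinM lee_pmul2r.
have [s'14|s'14] := leP s' (14 * s); first by exists s'.
exists (14 * s); split => //; apply/seteqP; split.
 by apply: (bsub ds); rewrite (mtrefl rm) add0r ltW.
have cc : b c (7 * s) c' by apply: sub; rewrite /qball /= (mtrefl rm).
move=> y /sub; rewrite /qball /= => cy; have := mttri rm c c' y.
by rewrite (mtsym rm c' c) => /rh_arith5; exact.
Qed.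

Definition rhiC : R := 2 * D * (1 + 2 * D ^+ 14) * D ^+ 10.

Lemma reverse_hoelder_ball (A a : R) c t : 1 <= A -> fwilson rho mu 6 A w -> 0 < t -> 0 <= a ->
 (\int[mu]_(x in b c (4 * t)) (w x)%:E <= (a * vol rho mu c t)%:E)%E ->
 (\int[mu]_(x in b c t) (w x `^ (1 + rh_exp D 6 A))%:E <=
  (rhiC * a `^ (1 + rh_exp D 6 A) * vol rho mu c t)%:E)%E.
move=> A1 fw t0 a0 wa; have t4 : 0 < 4 * t by rewrite mgt0.
have [W0 W00 WE] := weight_int c t4; have v0 := vgt0 ds c t0.
move: wa; rewrite WE leF => Wa.
have leb := leb_metr hX e0 re ds mw w0' wf.
have [ep0 ep1 _] := rh_expb 6 (dsC ds) A1.
apply: leT (rev_hold ds mw w0' t0 (isT : (2 < 6)%N) W00 WE D1 A1 leb fw) _.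
set ep := rh_exp _ _ _ in ep0 ep1 *; rewrite leF rh_arith3.
apply: wMl; first by rewrite !mge0 ?age0 ?mge0 ?(ltW D0).
have ap : 0 < a by rewrite -(pmulr_lgt0 _ v0) (ltleT W00).
have Dp : 1 <= D ^+ 10 by exact: exprn_ege1.
rewrite /level0; move: (D ^+ 10) Dp => d d1; have d0 : 0 < d by exact: ltleT d1.
have l0 : d * W0 / vol rho mu c t <= d * a by rewrite -mulrA wMl ?(ltW d0)// lepdM.
have l1 : 0 <= d * W0 / vol rho mu c t by rewrite dge0 ?mge0 ?ltW.
apply: leT (ler_pM (pge0 _ _) (ltW W00) (le_powR (ltW ep0) l1 l0) Wa) _.
rewrite powRM ?(ltW d0) // -mulrA; apply: ler_pM; rewrite ?pge0//.
- by rewrite !mge0 ?pge0 ?(ltW v0).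
- by rewrite -[leRHS]powRr1 ?(ltW d0)// ler_powR.
- by rewrite powRD ?(gtF ap) ?implybT// powRr1 ?(ltW ap)// mulrA [a `^ ep * a]mulrC.
Qed.

End one_weight.
End weights.
Section dualb.
Context {R : realType} {dsp} {X : mType dsp}.
Variable mu : meas X R.

(* The dual formulation of [h] being in [L^u'] on [E] with norm at most [a]; it covers [u = 1]. *)
Definition dualb (E : set X) (h : X -> R) (u a : R) : Prop := forall E' (g : X -> R) (c : R),
 measurable E' -> E' `<=` E -> mfun g -> (forall x, 0 <= g x) -> 0 <= c ->
 (\int[mu]_(x in E') (g x `^ u)%:E <= (c `^ u)%:E)%E ->
 (\int[mu]_(x in E') (h x * g x)%:E <= (a * c)%:E)%E.

Variables (E : set X) (h : X -> R) (a : R).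
Hypotheses (mE : measurable E) (mh : mfun h) (h0 : forall x, 0 <= h x) (a0 : 0 <= a).

Lemma dual_bound_gt1 (u u' : R) : 0 < u -> 0 < u' -> u'^-1 + u^-1 = 1 ->
 (\int[mu]_(x in E) (h x `^ u')%:E <= (a `^ u')%:E)%E -> dualb E h u a.
move=> u0 u'0 uu ha E' g c mE' sE mg g0 c0 gc; apply: (int_hold_le (p := u') (q := u)) => //.
apply: leT ha; apply: isub => //; first exact: mpowR.
by move=> x; exact: pge0.
Qed.

Lemma dual_bound_ae : {ae mu, forall x, E x -> h x <= a} -> dualb E h 1 a.
move=> ha E' g c mE' sE mg g0 c0 gc.
apply: (leU (\int[mu]_(x in E') (a * g x)%:E)%E).
 have mhg : mfun (fun x => h x * g x) by exact: mfM.
 apply: int_le_ae_nm => //.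
 - by apply/measurable_EFinP; exact: measurable_funTS.
 - by move=> x; rewrite leF mge0.
 - by move=> x; rewrite leF mge0.
 - by apply: filterS ha => x hx /sE Ex; rewrite leF wMr// hx.
rewrite intZ// EFinM; apply: leMl => //.
by move: gc; rewrite powRr1//; under eqint do rewrite powRr1//.
Qed.

End dualb.

Fact mass_arith1 {R : rfType} (k a c y V : R) : 0 < V ->
 k * (V / 2) <= a * (V * c) * y -> k <= 2 * a * c * y.
move=> V0 h; rewrite -(ler_pM2r (dgt0 V0 (ltr0n R 2))); apply: leT h _.
by apply: eqW; field.
Qed.

Section reduced_weight.
Context {R : realType} {dsp} {X : mType dsp}.
Variables (rho : X -> X -> R) (mu : meas X R) (D : R).
Hypothesis ds : dspace rho mu D.
Local Notation b := (qball rho).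
Variables (n : nat) (P Q : X -> 'M[R]_n) (u a1 a2 kap : R).
Hypotheses (mP : forall i j, mfun (fun x => P x i j)) (QP : forall x, Q x *m P x = 1%:M)
 (u1 : 1 <= u) (a10 : 0 <= a1) (a20 : 0 <= a2) (kap8 : 8 <= kap)
 (red : forall z : X * R, 0 < z.2 -> exists V, [/\ V \in unitmx,
  (\int[mu]_(x in b z.1 (kap * z.2)) (cnorm (P x *m invmx V) `^ u)%:E <= (a1 * vol rho mu z.1 z.2)%:E)%E &
  dualb mu (b z.1 (kap * z.2)) (fun x => cnorm (V *m Q x)) u (a2 * vol rho mu z.1 z.2 `^ (1 - u^-1))]).
Variable v : 'cV[R]_n.
Hypothesis v0 : v != 0.
Let w x := enorm (P x *m v) `^ u.
Let u0 : 0 < u. Proof. exact: ltleT u1. Qed.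

Lemma mweight : mfun w.
apply: mpowR; apply: menorm => i.
by apply: mmulmx => // k l; exact: mcst.
Qed.

Lemma weight_gt0 x : 0 < w x.
apply: pgt0; apply: en_gt0; apply: contra v0 => /eqP h.
by rewrite -[v]mul1mx -(QP x) -mulmxA h mulmx0.
Qed.

Lemma weight_upper z V : V \in unitmx ->
 (\int[mu]_(x in b z.1 (kap * z.2)) (cnorm (P x *m invmx V) `^ u)%:E <= (a1 * vol rho mu z.1 z.2)%:E)%E ->
 (\int[mu]_(x in b z.1 (kap * z.2)) (w x)%:E <= (enorm (V *m v) `^ u * (a1 * vol rho mu z.1 z.2))%:E)%E.
move=> uV h; have mc : mfun (fun x => cnorm (P x *m invmx V) `^ u).
 apply: mpowR; apply: mcnorm => i j.
 by apply: mmulmx => // k l.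
rewrite EFinM; apply: (leU (\int[mu]_(x in b z.1 (kap * z.2))
  (enorm (V *m v) `^ u * cnorm (P x *m invmx V) `^ u)%:E)%E).
 apply: int_le_nm => x; first by rewrite leF pge0.
 move=> _; rewrite leF -powRM ?en_ge0 ?cn_ge0//.
 rewrite le_powR ?(ltW u0) ?en_ge0// mulrC; apply: leT (en_le_cn _ _).
 by rewrite mulmxA -(mulmxA (P x)) mulVmx// mulmx1.
rewrite intZ ?pge0//; [|exact: mball ds _ _|by move=> x; exact: pge0].
by apply: leMl => //; rewrite leF pge0.
Qed.

Lemma weight_finite c s : 0 < s -> (\int[mu]_(x in b c s) (w x)%:E < +oo)%E.
move=> s0; have [V [uV h _]] := @red (c, s) s0.
apply: leltT (ltry _); apply: leT (weight_upper uV h).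
apply: isub; [exact: mball ds _ _|exact: mball ds _ _|exact: mweight| |].
 by move=> x; exact: pge0.
apply: (bsub ds); rewrite (mtrefl (dsmt ds)) add0r ler_peMl ?(ltW s0)//.
by apply: leT kap8; rewrite ler1n.
Qed.

(** Integrate [|V v| <= |V Q| |P v|] over [E], which has at least half the volume. The dual bound
    for [V Q] estimates [|V v|^u vol] by the weight of [E], while the first bound estimates the
    weight of the dilated ball by [|V v|^u vol]. *)
Lemma weight_half_mass : half_mass rho mu w (1 + a1 * (2 * a2) `^ u)^-1.
move=> c s s0 E mE Ec mass; have [V [uV h1 h2]] := @red (c, s) s0.
have vs := vgt0 ds c s0; set vl := vol rho mu c s in vs mass *.
have c0 : 0 < 1 + a1 * (2 * a2) `^ u by rewrite ltr_wpDr// mge0// pge0.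
have mw := mweight; have w0' x : 0 <= w x by exact: pge0.
have EB : E `<=` b c (kap * s).
 apply: subT Ec _; apply: (bsub ds); rewrite (mtrefl (dsmt ds)) add0r.
 by rewrite ler_peMl ?(ltW s0)//; apply: leT kap8; rewrite ler1n.
set I := (\int[mu]_(x in E) (w x)%:E)%E.
have I0 : (0 <= I)%E by apply: intge0 => x _; rewrite leF.
have If : (I < +oo)%E.
 apply: leltT (weight_finite c (s := kap * s) _); last first.
  by rewrite mgt0// (ltleT _ kap8).
 by apply: isub => //; exact: mball ds _ _.
pose y := fine I; have IE : I = y%:E by rewrite fineK// ge0fin.
have y0 : 0 <= y by exact: fine_ge0.
have key : enorm (V *m v) `^ u * vl <= (2 * a2) `^ u * y.
 have := h2 E (fun x => enorm (P x *m v)) (y `^ u^-1) mE EB _ _ (pge0 _ _).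
 rewrite powRVK ?gtF// -IE lexx => h3.
 have {}h3 : (\int[mu]_(x in E) (cnorm (V *m Q x) * enorm (P x *m v))%:E <=
  (a2 * vl `^ (1 - u^-1) * y `^ u^-1)%:E)%E.
  apply: h3 => // [|x]; last exact: en_ge0.
  by apply: menorm => i; apply: mmulmx => // k l.
 have h4 : enorm (V *m v) * (vl / 2) <= a2 * vl `^ (1 - u^-1) * y `^ u^-1.
  rewrite -leF; apply: leT h3.
  apply: (leU ((enorm (V *m v))%:E * mu E)%E).
  by rewrite EFinM; apply: leMl => //; rewrite leF en_ge0.
  rewrite -int_cst//; apply: int_le_nm => x; first by rewrite leF en_ge0.
  move=> _; apply: leT (en_le_cn _ _).
  by rewrite mulmxA -(mulmxA V) QP mulmx1.
 have vE : vl `^ (1 - u^-1) = vl * vl `^ (- u^-1).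
  by rewrite powRD ?powRr1 ?(ltW vs)// (gtF vs) implybT.
 rewrite vE in h4; have {}h4 := mass_arith1 vs h4.
 have := le_powR (ltW u0) (en_ge0 _) h4.
 rewrite [X in _ <= X -> _]powRM ?mge0 ?pge0//.
 rewrite [X in _ <= X * _ -> _]powRM ?mge0 ?pge0// powRVK ?gtF//.
 have -> : (vl `^ (- u^-1)) `^ u = vl^-1.
  by rewrite -powRrM mulNr mulVf ?gtF// powRN powRr1 ?(ltW vs).
 by rewrite mulrAC -lepdM ?igt0// invrK.
apply: (leU ((1 + a1 * (2 * a2) `^ u)^-1%:E * (enorm (V *m v) `^ u * (a1 * vl))%:E)%E).
 apply: leMl; first by rewrite leF ige0 ltW.
 apply: leT (weight_upper uV h1); apply: isub => //; [exact: mball ds _ _|exact: mball ds _ _|].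
 apply: (bsub ds); rewrite (mtrefl (dsmt ds)) add0r wMr ?(ltW s0)//.
 by apply: leT kap8; rewrite -natrX.
rewrite IE leF ler_pdivrMl// mulrCA.
apply: leT (wMl a10 key) _; rewrite mulrA wMr//.
by rewrite lerDr.
Qed.

End reduced_weight.
(** Isolates the blow-up [1 / tau] of the maximal constant as the exponent [1 + tau] approaches 1,
    with the rest bounded uniformly for [tau <= t0]. *)
Lemma max_const_le {R : realType} (D q a t0 tau : R) k : 1 <= D -> 0 < tau -> tau <= t0 ->
 q / a = 1 + tau -> maxC D q a k <=
  D ^+ 3 * (2 * expR 1) `^ (1 + t0) * (1 + t0) * (D ^+ k) `^ (1 + t0) / tau.
move=> D1 tau0 tt E; rewrite /maxC E [1 + tau - 1]addrC addKr.
have D3 : 0 <= D ^+ 3 by rewrite xge0// (leT ler01).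
have Dk : 1 <= D ^+ k by exact: exprn_ege1.
have e1 : 1 <= 2 * expR 1 :> R by rewrite mulr_ege1 ?ler1n// ltW// expR_gt1.
have h1 : 1 + tau <= 1 + t0 by lra.
have t1 : 0 <= 1 + tau by lra.
move: (D ^+ 3) (D ^+ k) D3 Dk => c d c0 d1; rewrite [leRHS]mulrAC -[X in _ <= X * _](mulrA (c * _)).
apply: ler_pM; rewrite ?pge0//.
- by rewrite !mge0 ?ige0 ?(ltW tau0).
- apply: ler_pM; rewrite ?mge0 ?ige0 ?(ltW tau0)//.
 + by rewrite wMl// ler_powR.
 + by rewrite wMr// ige0 ltW.
- exact: ler_powR.
Qed.

Fact conj_arith {R : rfType} (q : R) : 1 < q -> (q / (q - 1)) / (q / (q - 1) - 1) = q.
by move=> q1; field; apply/andP; split; apply: lt0r_neq0; lra. Qed.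

Fact conj_arith2 {R : rfType} (p ep : R) : 1 < p -> 0 < ep ->
 p / (p - 1) / (p * (1 + ep) / (p * (1 + ep) - 1)) = 1 + ep / ((p - 1) * (1 + ep)).
move=> p1 ep0; have q : 0 < p * (1 + ep) - 1 by nra.
by field; rewrite !lt0r_neq0//; lra.
Qed.

Fact conj_arith3 {R : rfType} (p ep : R) : 1 < p -> 0 < ep -> ep / ((p - 1) * (1 + ep)) <= (p - 1)^-1.
move=> p1 ep0; have p0 : 0 < p - 1 by lra.
by rewrite invfM mulrCA ler_piMr ?ige0 ?(ltW p0)// lepdM; lra.
Qed.

Fact conj_arith4 {R : rfType} (q ep c S : R) : 0 < q -> 0 < ep -> ep <= 1 -> 0 < c -> 0 < S ->
 c^-1 / S <= ep -> (ep / (q * (1 + ep)))^-1 <= 2 * q * c * S.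
move=> q0 ep0 ep1 c0 S0; rewrite -invfM invf_ple ?posrE ?mgt0// => h.
have -> : 2 * q * c * S = q * (2 * (c * S)) by lra.
rewrite invf_div -mulrA wMl ?(ltW q0)//; apply: ler_pM; rewrite ?age0 ?ige0 ?(ltW ep0)//; lra.
Qed.

Fact kernel_arith {R : comRingType} (cs c al mp m0 S : R) :
 2 * cs * (c * al) * mp * (m0 * S) = 2 * cs * c * m0 * mp * al * S.
ring. Qed.

Fact kernel_arith2 {R : comRingType} (x n rc al dk v : R) :
 x * (n * (rc * dk)) * al * v = x * (n * (rc * al * (dk * v))).
ring. Qed.

Fact sdil_arith {R : rfType} (Lam : R) : 1 <= Lam -> 14 <= 5 * Lam + 9.
lra. Qed.

(** * The weighted bound with explicit powers of the constants *)

Section main_bound.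
Context {R : realType} {dsp} {X : mType dsp}.
Variables (dist : X -> X -> R) (cd : R) (mu : meas X R) (rho : X -> X -> R) (e D : R).
Hypotheses (hX : htype dist cd mu) (e0 : 0 < e)
 (re : pwcmp rho dist e) (ds : dspace rho mu D).
Local Notation b := (qball rho).
Local Notation vl z := (vol rho mu z.1 z.2).
Variables (n : nat) (Lam : R).
Hypothesis Lam1 : 1 <= Lam.
Local Notation sd := (sdil Lam).
(** The reverse Hoelder inequality on the ball of radius [sd * z.2] needs the mean over the ball
    four times as large. *)
Let kap := 4 * sd.
Let D1 : 1 <= D. Proof. by apply: leT (dsC ds); rewrite ler1n. Qed.
Let sd14 : 14 <= sd. Proof. exact: sdil_arith. Qed.
Let sd0 : 0 < sd. Proof. exact: ltleT sd14. Qed.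

Definition rhi_colC (t : R) : R :=
 (1 + n%:R) `^ (t * 2) * (n%:R * (rhiC D * D ^+ sdlog Lam)).

Lemma rhiC_ge0 : 0 <= rhiC D.
by rewrite /rhiC !mge0 ?age0 ?mge0 ?xge0 ?(leT ler01 D1). Qed.

Lemma sdil_vol (z : X * R) : 0 < z.2 -> vol rho mu z.1 (sd * z.2) <= D ^+ sdlog Lam * vl z.
move=> z0; apply: vol_le => //; first exact: mgt0.
rewrite (mtrefl (dsmt ds)) add0r wMr ?(ltW z0)//.
rewrite /sdlog; apply: ltW; apply: ltleT (truncnS_gt _) _; rewrite -natrX ler_nat.
exact: ltnW (ltn_expl _ _).
Qed.

(** Applies the scalar reverse Hoelder inequality to the weights [|M x v|^t] with [v] running over
    the columns of [V]. *)
Lemma rhi_colnorm (M N : X -> 'M[R]_n) (V : 'M[R]_n) (t S a : R) (z : X * R) : 0 < t -> 1 <= S ->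
 mmx M -> (forall x, N x *m M x = 1%:M) ->
 (forall v, v != 0 -> fwilson rho mu 6 S (fun x => enorm (M x *m v) `^ t)) ->
 (forall v c s, v != 0 -> 0 < s -> (\int[mu]_(x in b c s) (enorm (M x *m v) `^ t)%:E < +oo)%E) ->
 V \in unitmx -> 0 < z.2 -> 0 <= a ->
 (\int[mu]_(x in b z.1 (kap * z.2)) (cnorm (M x *m V) `^ t)%:E <= (a * vl z)%:E)%E ->
 (\int[mu]_(x in b z.1 (sd * z.2)) (cnorm (M x *m V) `^ (t * (1 + rh_exp D 6 S)))%:E <=
  (rhi_colC t * a `^ (1 + rh_exp D 6 S) * vl z)%:E)%E.
move=> t0 S1 mM NM fw fin uV z0 a0 ha; have [ep0 ep1 _] := rh_expb 6 (dsC ds) S1.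
set ep := rh_exp _ _ _ in ep0 ep1 *.
have sz : 0 < sd * z.2 by exact: mgt0.
have te0 : 0 < t * (1 + ep) by rewrite mgt0// addr_gt0.
have mMV i j : mfun (fun x => (M x *m V) i j).
 by apply: mmulmx => // k l.
have vz := vgt0 ds z.1 z0; have rc := rhiC_ge0.
have Dk : 0 <= D ^+ sdlog Lam by rewrite xge0// (leT ler01).
have col j : (\int[mu]_(x in b z.1 (sd * z.2)) (enorm (M x *m V *m dmx j 0) `^ (t * (1 + ep)))%:E <=
  (rhiC D * a `^ (1 + ep) * (D ^+ sdlog Lam * vl z))%:E)%E.
 pose v : 'cV[R]_n := V *m dmx j 0; have v0 : v != 0.
  apply/eqP => /(congr1 (mulmx (invmx V))); rewrite mulmxA mulVmx// mul1mx mulmx0 => h.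
  by have := en_delta (R := R) j; rewrite h enorm0 => /esym/eqP; rewrite oner_eq0.
 have mv : mfun (fun x => enorm (M x *m v)).
  by apply: menorm => i; apply: mmulmx => // k l.
 have mw := mpowR t mv.
 have w0 x : 0 < enorm (M x *m v) `^ t.
  apply/pgt0/en_gt0; apply: contra v0 => /eqP h.
  by rewrite -[v]mul1mx -(NM x) -mulmxA h mulmx0.
 have := @reverse_hoelder_ball _ _ _ _ _ _ _ _ _ hX e0 re ds _ mw w0 (fun c s => fin v c s v0)
  S a z.1 (sd * z.2) S1 (fw v v0) sz a0.
 rewrite -/ep => h; have vs := sdil_vol z0.
 apply: (leU (rhiC D * a `^ (1 + ep) * vol rho mu z.1 (sd * z.2))%:E); last first.
  by rewrite leF wMl// mge0// pge0.
 apply: leT (h _); last first.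
  apply: (leU (a * vl z)%:E); last first.
  rewrite leF wMl//; apply: (vol_le1 ds) => //.
  rewrite (mtrefl (dsmt ds)) add0r ler_peMl ?(ltW z0)//.
  by apply: leT sd14; rewrite ler1n.
  apply: leT ha; rewrite mulrA; apply: int_le_nm => x.
  by rewrite leF pge0.
  move=> _; rewrite leF mulmxA le_powR ?(ltW t0) ?en_ge0//.
  by rewrite /cnorm (bigD1 j)//= lerDl sge0// => k _; exact: en_ge0.
 by apply: eqW; apply: eqint => x _; rewrite mulmxA powRrM.
apply: leT (int_colnorm (mball ds _ _) te0 mMV col) _.
rewrite leF [leRHS]kernel_arith2; apply: wMr.
 apply: mge0 => //; apply: mge0; first by apply: mge0 => //; exact: pge0.
 by apply: mge0 => //; exact: ltW.
apply: (leU ((1 + n%:R) `^ (t * (1 + ep)))).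
 by rewrite le_powR ?(ltW te0)// lerDr.
by rewrite ler_powR ?lerDl// wMl ?(ltW t0)// -[2]/(1 + 1) lerD2l.
Qed.

Section kernel_side.
Variables (r p u C a1 S b' : R) (T : (X -> R) -> X -> R) (W : X -> 'M[R]_n) (V : X * R -> 'M[R]_n).
Hypotheses (r1 : 1 <= r) (czT : cz_op rho mu r Lam C T) (p1 : 1 < p) (u1 : 1 <= u) (up : u <= p)
 (pW : forall x, pdsym (W x)) (mW : forall i j, mfun (fun x => W x i j))
 (pV : forall z, pdsym (V z)) (a10 : 0 <= a1) (S1 : 1 <= S) (b0 : 0 < b') (bp : b' < p).
Let P x := mxpowR (W x) u^-1.
Hypotheses
 (hV : forall z, 0 < z.2 -> (\int[mu]_(x in b z.1 (kap * z.2)) (cnorm (P x *m invmx (V z)) `^ u)%:E <=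
  (a1 * vl z)%:E)%E)
 (fw : forall v, v != 0 -> fwilson rho mu 6 S (fun x => enorm (P x *m v) `^ u))
 (fin : forall v c s, v != 0 -> 0 < s -> (\int[mu]_(x in b c s) (enorm (P x *m v) `^ u)%:E < +oo)%E).

Definition kerC : R := 2 * sout D Lam C n * ((n * n)%:R * (1 + rhi_colC u)) *
 (D ^+ 3 * (2 * expR 1) `^ (1 + (p - 1)^-1) * (1 + (p - 1)^-1) * (D ^+ 3) `^ (1 + (p - 1)^-1) *
  (2 * (p - 1) * (8 * D ^+ 6 * ln (D ^+ 7)))) `^ (1 - p^-1).

(** Handles the kernel factor once for both parts of the theorem. The estimate of the means of [f]
    stays a hypothesis, because the two parts obtain it by different means and with different
    constants [b'] and [cn]. *)
Lemma weighted_bound (f : X -> 'cV[R]_n) (cn N : R) : 0 <= cn -> 0 <= N ->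
 (forall i, bdsupp rho (fun x => f x i 0)) ->
 (forall z : X * R, 0 < z.2 ->
  ((savg rho mu r Lam f (fun z => mxpowR (V z) (u / p)) z `^ b' * vl z)%:E <=
  \int[mu]_(x in b z.1 (sd * z.2)) ((cn * enorm (mxpowR (W x) p^-1 *m f x)) `^ b')%:E)%E) ->
 (\int[mu]_x (enorm (mxpowR (W x) p^-1 *m f x) `^ p)%:E <= (N `^ p)%:E)%E ->
 (\int[mu]_x (enorm (mxpowR (W x) p^-1 *m vec_op T f x) `^ p)%:E <=
  ((kerC * maxC D p b' (sdlog Lam) `^ p^-1 * a1 `^ p^-1 * S `^ (1 - p^-1) * cn * N) `^ p)%:E)%E.
move=> cn0 N0 bf hN hf.
have [ep0 ep1 epS] := rh_expb 6 (dsC ds) S1; set ep := rh_exp _ _ _ in ep0 ep1 epS.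
have p0 : 0 < p by exact: lt_trans p1.
have u0 : 0 < u by exact: ltleT u1.
have s0 : 0 < u / p by exact: dgt0.
have q1 : 1 < p * (1 + ep) by rewrite (ltleT p1)// ler_peMr ?(ltW p0)// lerDl ltW.
have q0 : 0 < p * (1 + ep) by exact: lt_trans q1.
(* [a] is conjugate to the exponent [p (1 + ep)] reached by the reverse Hoelder inequality; then
   [p' / a = 1 + tau] with [1 / tau] at most a constant times [S]. *)
pose a := p * (1 + ep) / (p * (1 + ep) - 1).
have aE : a / (a - 1) = p * (1 + ep) by exact: conj_arith.
have a1' : 1 < a by rewrite ltr_pdivlMr ?subr_gt0// mul1r ltrBlDr ltrDl.
pose tau := ep / ((p - 1) * (1 + ep)).
have tE : p / (p - 1) / a = 1 + tau by exact: conj_arith2.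
have p10 : 0 < p - 1 by rewrite subr_gt0.
have tau0 : 0 < tau by rewrite dgt0// mgt0// addr_gt0.
have ap : a < p / (p - 1) by rewrite -[ltLHS]mul1r -ltr_pdivlMr ?(lt_trans ltr01)// tE ltrDl.
have cr : 0 <= rhi_colC u.
 by rewrite mge0 ?pge0// mge0// mge0 ?rhiC_ge0// xge0// (leT ler01).
pose C1 := (n * n)%:R * (1 + rhi_colC u) * a1 `^ p^-1.
have C10 : 0 <= C1 by rewrite !mge0 ?pge0 ?age0.
pose K (z : X * R) x := (n * n)%:R * cnorm (P x *m invmx (V z)) `^ (u / p).
have pi z : pdsym (invmx (V z)) by rewrite -mxpowRN1//; exact: mxpowR_pd.
have uV z : V z \in unitmx by case/mulmx1_unit: (mxpowRN 1 (pV z)); rewrite mxpowR1.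
have mP := mmxpowR pW mW u^-1; have mA := mmxpowR pW mW p^-1.
have mc z : mfun (fun x => cnorm (P x *m invmx (V z))).
 by apply: mcnorm => i j; apply: mmulmx => [|k l]; [exact: mP|exact: mcst].
have iV z : invmx (mxpowR (V z) (u / p)) = mxpowR (invmx (V z)) (u / p).
 rewrite -(mxpowRN1 (mxpowR_pd _ (pV z))) -(mxpowRN1 (pV z)) !(mxpowRrM _ _ (pV z)).
 by rewrite mulrN1 mulN1r.
(* The weight in [L^p] is the power [u/p <= 1] of [P], so [on_powM] bounds [W^(1/p) V^(-u/p)] by the
   norm of [P V^(-1)] to the power [u/p]. *)
have AE x : mxpowR (W x) p^-1 = mxpowR (P x) (u / p).
 by rewrite /P (mxpowRrM _ _ (pW x)) mulrA mulVf ?mul1r// gtF.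
pose psi x := cn * enorm (mxpowR (W x) p^-1 *m f x).
have mAf : mfun (fun x => enorm (mxpowR (W x) p^-1 *m f x)).
 by apply: menorm => i; apply: mmulmx => // k l; rewrite ord1; have [] := bf k.
have cN0 : 0 <= cn * N by exact: mge0.
apply: leT (@wsparse_bound _ _ _ _ _ _ ds n r Lam C p a b' C1 T r1 Lam1 czT _ p1 a1' ap b0 bp
 C10 (fun x => mxpowR (W x) p^-1) (fun z => mxpowR (V z) (u / p)) K f psi mA _ _ _ _ bf _ _ hN (cn * N) cN0 _) _.
- move=> E mE; apply: (leb_metr hX e0 re ds) => [|x|c s s0']; [exact: mindic|by []|].
 rewrite intindic//; last exact: mball ds _ _.
 apply: leltT (muB_lty ds c s).
 by apply: lemu; rewrite ?inE//; [exact: measurableI _ _ mE (mball ds _ _)|exact: mball ds _ _].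
- by move=> z; case/mulmx1_unit: (mxpowRN (u / p) (pV z)).
- by move=> z; apply: mfM => //; exact: mpowR.
- move=> z x; rewrite iV AE /K; apply: leT (on_powM _ _ s0 _) _ => //.
 + exact: mxpowR_pd.
 + by rewrite lepdM// mul1r.
 by rewrite wMl// le_powR ?(ltW s0) ?on_ge0//; exact: on_le_cols.
- move=> z z0; rewrite aE.
 have E x : K z x `^ (p * (1 + ep)) = (n * n)%:R `^ (p * (1 + ep)) * cnorm (P x *m invmx (V z)) `^ (u * (1 + ep)).
  by rewrite powRM ?pge0// -powRrM mulrA divfK ?gtF.
 under eqint do rewrite E.
 have mb5 := mball ds z.1 (5 * z.2).
 rewrite intZ ?pge0//; [|exact: mpowR|by move=> x; exact: pge0].
 have hR := rhi_colnorm u0 S1 mP (fun x => mxpowRN u^-1 (pW x)) fw fin _ z0 a10 (hV z0).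
 rewrite -/ep in hR; apply: (leU (((n * n)%:R `^ (p * (1 + ep)))%:E *
  (rhi_colC u * a1 `^ (1 + ep) * vl z)%:E)%E).
  apply: leMl; first by rewrite leF pge0.
  apply: leT (hR _); last by rewrite unitmx_inv.
  apply: isub => //; [exact: mball ds _ _|exact: mpowR|by move=> x; exact: pge0|].
  apply: (bsub ds); rewrite (mtrefl (dsmt ds)) add0r wMr ?(ltW z0)//.
  by apply: leT sd14; rewrite ler_nat.
 rewrite -EFinM leF mulrA wMr ?(ltW (vgt0 ds _ z0))//.
 rewrite /C1 -mulrA [leRHS]powRM ?mge0 ?age0 ?pge0// wMl ?pge0//.
 rewrite powRM ?age0 ?pge0// -powRrM mulrA mulVf ?gtF// mul1r wMr ?pge0//.
 apply: (leU (1 + rhi_colC u)); first by rewrite lerDr.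
 by rewrite -[leLHS]powRr1 ?age0// ler_powR ?lerDl// ltW.
- exact: mfM.
- by move=> x; rewrite mge0 ?en_ge0.
- rewrite /psi; under eqint do rewrite powRM ?en_ge0//.
 rewrite intZ ?pge0//; [|exact: mpowR|by move=> x; exact: pge0].
 by rewrite powRM// EFinM; apply: leMl; rewrite ?leF ?pge0.
have Cs0 : 0 <= sout D Lam C n.
 by apply: leT (slev_le_sout ds czT n); rewrite mge0// ltW// (slev_gt0 ds czT).
have S0 : 0 < S by exact: ltleT S1.
have c80 : 0 < 8 * D ^+ 6 * ln (D ^+ 7).
 rewrite mgt0 ?ln_gt0//; first by rewrite mgt0// xgt0// (ltleT ltr01).
 by rewrite exprn_egt1// (ltleT _ (dsC ds))// ltr1n.
have m2 := max_const_le 3 D1 tau0 (conj_arith3 p1 ep0) tE.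
have m3 := conj_arith4 p10 ep0 ep1 c80 S0 epS; rewrite -/tau in m3.
have pp : 0 <= 1 - p^-1 by rewrite subr_ge0 invf_le1// ltW.
have m20 : 0 <= maxC D (p / (p - 1)) a 3 by apply: (maxC_ge0 ds) => //; exact: lt_trans a1'.
have sc0 : 0 <= sparseC D p a b' C1 (sout D Lam C n) (sdlog Lam).
 apply: mge0 (pge0 _ _); apply: mge0 (pge0 _ _); apply: mge0 => //.
 exact: mge0.
rewrite leF; apply: le_powR; [exact: ltW|exact: mge0|].
rewrite [leLHS]mulrA; apply: (wMr N0); apply: (wMr cn0).
rewrite /sparseC /kerC.
set M0 := D ^+ 3 * _ * _ * _ in m2 *; have M00 : 0 <= M0.
 by rewrite !mge0 ?pge0 ?xge0 ?age0 ?ige0 ?(ltW p10) ?(leT ler01 D1).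
clearbody M0; move: (8 * D ^+ 6 * ln (D ^+ 7)) c80 m3 => k8 k80 m3.
have m4 : maxC D (p / (p - 1)) a 3 `^ (1 - p^-1) <=
  (M0 * (2 * (p - 1) * k8)) `^ (1 - p^-1) * S `^ (1 - p^-1).
 rewrite -powRM ?(ltW S0)//; last by rewrite !mge0 ?(ltW p10)// ltW.
 rewrite le_powR//; apply: leT m2 _; rewrite -mulrA wMl//.
apply: leT (wMl _ m4) _.
 by apply: mge0 (pge0 _ _); apply: mge0 => //; exact: mge0.
rewrite /C1; apply: eqW; exact: kernel_arith.
Qed.

End kernel_side.
End main_bound.

Fact exp_arith1 {R : rfType} (r p u : R) : 0 < r -> 0 < p -> 1 <= u -> u * r < p ->
 let th := u / p * r in [/\ 0 < th, 0 < 1 - th & 0 < th / u + (1 - th)].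
move=> r0 p0 u1 h /=; have th0 : 0 < u / p * r by rewrite mgt0// dgt0; lra.
have th1 : 0 < 1 - u / p * r by rewrite subr_gt0 mulrAC ltr_pdivrMr// mul1r.
by split=> //; rewrite addr_gt0// dgt0//; lra.
Qed.

Fact exp_arith2 {R : rfType} (r p u : R) : 0 < r -> 0 < p -> 1 <= u -> u * r < p ->
 r / (u / p * r / u + (1 - u / p * r)) < p.
move=> r0 p0 u1 h; have [_ _ h3] := exp_arith1 r0 p0 u1 h.
rewrite ltr_pdivrMr// -subr_gt0.
have -> : p * (u / p * r / u + (1 - u / p * r)) - r = p - u * r by field; lra.
by rewrite subr_gt0.
Qed.

Fact exp_arith3 {R : rfType} (r u d : R) : 0 < r -> 1 < u -> 0 < d -> d <= 1 ->
 let t := u / (u - 1) * (1 + d) in let b' := r * (t / (t - 1)) in let tau := (u - 1) * d / (1 + d) in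
 [/\ 1 < t, 0 < b' & b' < u * r] /\ [/\ u * r / b' = 1 + tau, 0 < tau, tau <= u - 1 & tau^-1 <= 2 * (u - 1)^-1 / d].
move=> r0 u1 d0 d1 t b' tau; have u10 : 0 < u - 1 by lra.
have t1 : 1 < t by rewrite /t mulrAC ltr_pdivlMr; nra.
have d2 : 0 < 1 + d by lra.
have t10 : 0 < t - 1 by lra.
have b0 : 0 < b' by rewrite mgt0 ?dgt0; lra.
have tau0 : 0 < tau by rewrite dgt0 ?mgt0.
have E : u * r / b' = 1 + tau.
 by move: t10; rewrite /b' /tau /t => t10; field; nra.
split; split => //.
- by rewrite -[b']mul1r -ltr_pdivlMr//; lra.
- by rewrite lepdM; nra.
- by rewrite invf_div invfM mulrA ler_pM2r ?igt0// ler_pM2r ?igt0//; lra.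
Qed.

Fact savg_arith {R : comRingType} (m c v w j : R) : m * (c * (v * w) * j) = m * c * w * j * v.
ring. Qed.

Lemma savg_pow {R : realType} (a v J u th : R) : 0 <= a -> 0 <= v -> 0 <= J -> 0 < u -> 0 < th ->
 0 < 1 - th -> a `^ th * v `^ (1 - (th / u + (1 - th))) * J `^ (th / u + (1 - th)) =
 (a * v `^ (1 - u^-1) * J `^ u^-1) `^ th * J `^ (1 - th).
move=> a0 v0 J0 u0 t0 t1; rewrite !powRM ?mge0 ?pge0// -!powRrM -!mulrA.
have -> : 1 - (th / u + (1 - th)) = (1 - u^-1) * th by lra.
congr (_ * (_ * _)); have [->|Jn] := eqVneq J 0; last by rewrite powRD ?Jn ?implybT// [u^-1 * _]mulrC.
by rewrite [0 `^ (1 - th)]powR0 ?gtF// mulr0 powR0// gtF// addr_gt0// dgt0.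
Qed.

Fact part_arith1 {R : comRingType} (k m a s x y : R) : k * m * a * s * (x * y) = k * m * x * s * (a * y).
ring. Qed.

Fact part_arith2 {R : comRingType} (k m x c a s : R) : k * m * x * c * a * s = k * m * x * s * (c * a).
ring. Qed.

Fact part_arith3 {R : comRingType} (k m c a s x : R) : k * m * (c * a) * s * x = k * c * a * s * x * m.
ring. Qed.

Fact part_arith4 {R : comRingType} (k m s' c a s x : R) :
 k * c * a * s * x * (m * s') = k * m * c * x * a * s' * s.
ring. Qed.

Lemma rhi_const_pow {R : realType} (m c a t d : R) : 0 <= m -> 0 <= c -> 0 <= a -> 0 <= d -> 1 + d <= t ->
 m `^ t * (c * a `^ (1 + d)) <= (m * ((1 + c) * (1 + a))) `^ t.
move=> m0 c0 a0 d0 dt; rewrite !powRM ?mge0 ?age0// wMl ?pge0// ler_pM ?pge0//.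
 apply: (leU (1 + c)); first by rewrite lerDr.
 by rewrite le1r_powR ?lerDl// (leT _ dt)// lerDl.
apply: (leU ((1 + a) `^ (1 + d))); last by rewrite ler_powR// lerDl.
by rewrite le_powR ?age0// lerDr.
Qed.

Section bounded_functions.
Context {R : realType} {dsp} {X : mType dsp}.
Variables (dist : X -> X -> R) (cd : R) (mu : meas X R) (rho : X -> X -> R) (e D : R).
Hypotheses (hX : htype dist cd mu) (e0 : 0 < e)
 (re : pwcmp rho dist e) (ds : dspace rho mu D).
Local Notation b := (qball rho).
Local Notation vl z := (vol rho mu z.1 z.2).
Variables (n : nat) (Lam r p u C : R) (T : (X -> R) -> X -> R).
Hypotheses (Lam1 : 1 <= Lam) (r1 : 1 <= r) (czT : cz_op rho mu r Lam C T) (rp : r < p)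
 (u1 : 1 <= u) (up : u * r <= p).
Local Notation sd := (sdil Lam).
Local Notation kap := (4 * sd).
Let r0 : 0 < r. Proof. exact: ltleT r1. Qed.
Let p0 : 0 < p. Proof. exact: lt_trans rp. Qed.
Let u0 : 0 < u. Proof. exact: ltleT u1. Qed.

Section one_weight.
Variables (W : X -> 'M[R]_n) (V : X * R -> 'M[R]_n) (f : X -> 'cV[R]_n).
Hypotheses (pW : forall x, pdsym (W x)) (mW : forall i j, mfun (fun x => W x i j))
 (pV : forall z, pdsym (V z)) (bf : forall i, bdsupp rho (fun x => f x i 0)).
Let psi x := enorm (mxpowR (W x) p^-1 *m f x).
Let h z x := cnorm (V z *m mxpowR (W x) (- u^-1)).

Let mpsi : mfun psi.
apply: menorm => i; apply: mmulmx => [|k l]; first exact: mmxpowR.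
by rewrite ord1; have [] := bf k.
Qed.
Let psi0 x : 0 <= psi x. Proof. exact: en_ge0. Qed.
Let mh z : mfun (h z).
apply: mcnorm => i j; apply: mmulmx => [k l|] => //.
exact: mmxpowR.
Qed.
Let h0 z x : 0 <= h z x. Proof. exact: cn_ge0. Qed.

(** Insert [W^(-1/p) W^(1/p)] before [f]: by [on_powM] the integrand of [savg] is at most a constant
    times [h^(r u/p) psi^r]. The hypothesis on such integrals is homogeneous and is solved for the
    power [b']. *)
Lemma savg_bound (c b' : R) : 0 <= c -> 0 < b' -> b' < p -> (\int[mu]_x (psi x `^ p)%:E < +oo)%E ->
 (forall (z : X * R) (J : R), 0 < z.2 -> 0 <= J ->
  (\int[mu]_(x in b z.1 (sd * z.2)) (psi x `^ b')%:E = J%:E)%E ->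
  (\int[mu]_(x in b z.1 (sd * z.2)) (h z x `^ (u / p * r) * psi x `^ r)%:E <=
  (c * vl z `^ (1 - r / b') * J `^ (r / b'))%:E)%E) ->
 forall z : X * R, 0 < z.2 ->
  ((savg rho mu r Lam f (fun z => mxpowR (V z) (u / p)) z `^ b' * vl z)%:E <=
  \int[mu]_(x in b z.1 (sd * z.2)) (((n * n)%:R * c `^ r^-1 * psi x) `^ b')%:E)%E.
move=> c0 b0 bp fin hc z z0; have v0 := vgt0 ds z.1 z0.
have mb : measurable (b z.1 (sd * z.2)) := mball ds _ _.
have mpb : mfun (fun x => psi x `^ b') by exact: mpowR.
have mpp : mfun (fun x => psi x `^ p) by exact: mpowR.
have m1 : mfun (fun _ : X => 1 : R) by [].
set I := (\int[mu]_(x in b z.1 (sd * z.2)) (psi x `^ b')%:E)%E.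
have I0 : (0 <= I)%E by apply: intge0 => x _; rewrite leF pge0.
have If : (I < +oo)%E.
 apply: (@leltT _ _ (\int[mu]_(x in b z.1 (sd * z.2)) (1 + psi x `^ p)%:E)%E).
  apply: int_le_nm => x; first by rewrite leF pge0.
  move=> _; rewrite leF; have := @le_add_powR _ (psi x `^ b') (p / b') (pge0 _ _).
  by rewrite -powRrM [b' * _]mulrC divfK ?gtF// ler_pdivlMr// mul1r; apply; exact: ltW.
 rewrite (intD mu mb m1 mpp (fun=> ler01) (fun=> pge0 _ _)) int_cst//.
 apply: lte_add_pinfty; first by rewrite mul1e; exact: (muB_lty ds).
 by apply: leltT fin; apply: isub => // x; exact: pge0.
pose J := fine I; have IE : I = J%:E by rewrite fineK// ge0fin.
have J0 : 0 <= J by exact: fine_ge0.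
have s0 : 0 < u / p by exact: dgt0.
have s1 : u / p <= 1 by rewrite lepdM// mul1r; apply: leT up; rewrite ler_peMr ?(ltW u0).
have := hc z J z0 J0 IE; set E := (c * _ * _) => hE.
have Sr : savg rho mu r Lam f (fun z => mxpowR (V z) (u / p)) z `^ r * vl z <= (n * n)%:R `^ r * E.
 rewrite -leF -(savgE ds r1 czT (fun z => mxpowR (V z) (u / p)) bf z0) (EFinM (_ `^ _)).
 have nr : (0 <= ((n * n)%:R `^ r)%:E :> \bar R)%E by [].
 apply: leT (leMl nr hE); rewrite -intZ //; first last.
 - by move=> x; rewrite mge0 ?pge0.
 - by apply: mfM; exact: mpowR.
 apply: int_le_nm => x; first by rewrite leF pge0.
 move=> _; rewrite leF powRrM -powRM ?pge0// -powRM ?mge0 ?pge0//.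
 apply: (le_powR (ltW r0) (en_ge0 _)).
 have -> : f x = mxpowR (mxpowR (W x) (- u^-1)) (u / p) *m (mxpowR (W x) p^-1 *m f x).
  by rewrite mulmxA (mxpowRrM _ _ (pW x)) mulNr mulrA mulVf ?mul1r ?gtF// mxpowRN// mul1mx.
 rewrite mulmxA mulrA; apply: leT (on_bound _ _) _; apply: wMr; first exact: psi0.
 apply: leT (on_powM (pV z) (mxpowR_pd _ (pW x)) s0 s1) _; apply: wMl => //.
 by apply: le_powR; [exact: ltW|exact: on_ge0|exact: on_le_cols].
under eqint do rewrite powRM ?mge0 ?pge0//.
rewrite intZ ?pge0//; last by move=> x; exact: pge0.
rewrite -/I IE leF; set S := savg _ _ _ _ _ _ _ in Sr *.
have vE : vl z `^ (1 - r / b') = vl z * vl z `^ (- (r / b')).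
 by rewrite powRD ?powRr1 ?(ltW v0)// (gtF v0) implybT.
have {Sr} : S `^ r <= (n * n)%:R `^ r * c * vl z `^ (- (r / b')) * J `^ (r / b').
 rewrite -(ler_pM2r v0); apply: leT Sr _; rewrite /E vE; apply: eqW.
 exact: savg_arith.
move/(le_powR (ltW (dgt0 b0 r0)) (pge0 _ _)).
rewrite -powRrM [r * _]mulrC divfK ?gtF// !powRM ?mge0 ?pge0// -!powRrM.
rewrite mulNr (_ : r / b' * (b' / r) = 1) ?powRN ?powRr1 ?(ltW v0)//; last by field; rewrite !gtF.
rewrite [r * (b' / r)]mulrC divfK ?gtF// [b' / r]mulrC => h2.
by rewrite -ler_pdivlMr//; apply: leT h2 _; rewrite mulrAC.
Qed.

(** The strict inequality [u r < p] means [th < 1]. The exponent [b'] is the one for which the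
    integrand splits as [(h g)^th (psi^b')^(1 - th)] with [g = psi^(b'/u)], so that the dual bound
    on [h] suffices, also for [u = 1]. *)
Lemma savg_dual_bound (a2 : R) (z : X * R) (J : R) : u * r < p -> 0 <= a2 -> 0 < z.2 -> 0 <= J ->
 dualb mu (b z.1 (kap * z.2)) (h z) u (a2 * vl z `^ (1 - u^-1)) ->
 let th := u / p * r in let b' := r / (th / u + (1 - th)) in
 (\int[mu]_(x in b z.1 (sd * z.2)) (psi x `^ b')%:E = J%:E)%E ->
 (\int[mu]_(x in b z.1 (sd * z.2)) (h z x `^ th * psi x `^ r)%:E <=
  (a2 `^ th * vl z `^ (1 - r / b') * J `^ (r / b'))%:E)%E.
move=> upr a20 z0 J0 db th b' JE; have v0 := vgt0 ds z.1 z0.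
have [th0 th1 et0] := exp_arith1 r0 p0 u1 upr; rewrite -/th in th0 th1 et0.
have rbE : r / b' = th / u + (1 - th) by rewrite invf_div mulrCA divff ?mulr1 ?gtF.
have bE : r = b' / u * th + b' * (1 - th).
 by rewrite mulrAC -mulrA -mulrDr divfK ?gtF.
have thn : th != 0 by lra.
pose g x := psi x `^ (b' / u).
have mg : mfun g by exact: mpowR.
have g0 x : 0 <= g x by exact: pge0.
have mb : measurable (b z.1 (sd * z.2)) := mball ds _ _.
have zz : b z.1 (sd * z.2) `<=` b z.1 (kap * z.2).
 apply: (bsub ds); rewrite (mtrefl (dsmt ds)) add0r -mulrA ler_peMl ?ler1n//.
 by rewrite mge0 ?(ltW z0)// (leT _ (sdil_arith Lam1)).
pose al := a2 * vl z `^ (1 - u^-1) * J `^ u^-1.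
have al0 : 0 <= al by rewrite !mge0 ?pge0.
have hg : (\int[mu]_(x in b z.1 (sd * z.2)) (h z x * g x)%:E <= al%:E)%E.
 apply: db => //; first exact: pge0.
 by rewrite powRVK ?gtF// -JE; under eqint do rewrite -powRrM divfK ?gtF//.
have E1 x : h z x `^ th * psi x `^ r = (h z x * g x) `^ th * (psi x `^ b') `^ (1 - th).
 rewrite powRM// -mulrA; congr (_ * _); rewrite -!powRrM.
 move: (psi x) => y; have [->|y0] := eqVneq y 0; last by rewrite [in LHS]bE powRD// y0 implybT.
 by rewrite !powR0 ?mul0r// ?mulf_eq0 ?invr_eq0 !gtF.
under eqint do rewrite E1.
have -> : a2 `^ th * vl z `^ (1 - r / b') * J `^ (r / b') = al `^ th * J `^ (1 - th).
 by rewrite rbE; apply: savg_pow => //; exact: ltW.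
apply: (int_hold_le (p := th^-1) (q := (1 - th)^-1)); rewrite ?igt0 ?pge0//.
- by apply: mpowR; exact: mfM.
- by apply: mpowR; exact: mpowR.
- by move=> x; exact: pge0.
- by move=> x; exact: pge0.
- lra.
- rewrite [X in (_ <= X%:E)%E](powRK al0 thn); apply: (leT (eqW _) hg).
 by apply: eqint => x _; rewrite (powRK (mge0 (h0 z x) (g0 x)) thn).
- rewrite powRK ?gtF// -JE; apply: eqW; apply: eqint => x _.
 by rewrite powRK ?pge0 ?gtF.
Qed.

(** At the endpoint [u r = p] the factor [h] appears to the first power. Hoelder's inequality with
    an exponent [t > u'], supplied by the reverse Hoelder inequality of the dual weight, leaves
    [psi] with an exponent [b' < p]. *)
Lemma savg_rhi (a3 t : R) (z : X * R) (J : R) : u * r = p -> 1 < t -> 0 <= a3 -> 0 < z.2 -> 0 <= J ->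
 (\int[mu]_(x in b z.1 (sd * z.2)) (h z x `^ t)%:E <= (a3 `^ t * vl z)%:E)%E ->
 let b' := r * (t / (t - 1)) in
 (\int[mu]_(x in b z.1 (sd * z.2)) (psi x `^ b')%:E = J%:E)%E ->
 (\int[mu]_(x in b z.1 (sd * z.2)) (h z x `^ (u / p * r) * psi x `^ r)%:E <=
  (a3 * vl z `^ (1 - r / b') * J `^ (r / b'))%:E)%E.
move=> upr t1 a30 z0 J0 ht b' JE; have v0 := vgt0 ds z.1 z0.
have t0 : 0 < t by lra.
have t10 : 0 < t - 1 by lra.
have mb : measurable (b z.1 (sd * z.2)) := mball ds _ _.
have tE : t^-1 + (t / (t - 1))^-1 = 1 by rewrite invf_div; field; rewrite gtF.
have rbE : r / b' = (t / (t - 1))^-1 by rewrite invfM mulrA divff ?mul1r// gtF.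
have rbE' : 1 - r / b' = t^-1 by lra.
rewrite mulrAC upr divff ?gtF//; under eqint do rewrite powRr1//.
rewrite rbE' rbE; apply: (int_hold_le (p := t) (q := t / (t - 1))) => //.
- exact: mpowR.
- by move=> x; exact: pge0.
- exact: dgt0.
- by rewrite mge0 ?pge0.
- exact: pge0.
- by rewrite powRM ?pge0// powRVK ?(ltW v0) ?gtF.
- rewrite powRVK ?gtF ?dgt0// -JE; apply: eqW; apply: eqint => x _.
 by rewrite -powRrM.
Qed.

End one_weight.
Definition weight_fw (t : R) (P : X -> 'M[R]_n) (S : R) : Prop := forall v, v != 0 ->
 fwilson rho mu 6 S (fun x => enorm (P x *m v) `^ t).
Definition weight_fin (t : R) (P : X -> 'M[R]_n) : Prop := forall v c s, v != 0 -> 0 < s ->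
 (\int[mu]_(x in b c s) (enorm (P x *m v) `^ t)%:E < +oo)%E.

Let D1 : 1 <= D. Proof. by apply: leT (dsC ds); rewrite ler1n. Qed.
Let p1 : 1 < p. Proof. exact: leltT rp. Qed.
Let kap8 : 8 <= kap.
by apply: leT (wMl _ (sdil_arith Lam1)); rewrite -?natrM ?ler_nat. Qed.
Let k := (Num.truncn (2 * kap)).+1.
Let kapk : 2 * kap <= 2 ^+ k.
apply: ltW; apply: ltleT (truncnS_gt _) _; rewrite -natrX ler_nat; exact: ltnW (ltn_expl _ _).
Qed.

(** Gives a Fujii-Wilson constant that is finite but not sharp, uniformly in the vector. It ensures
    that [T] extends even if the scalar characteristic is infinite. *)
Lemma redw_fw (P Q : X -> 'M[R]_n) (t a1 a2 : R) (V : X * R -> 'M[R]_n) :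
 mmx P -> (forall x, Q x *m P x = 1%:M) ->
 1 <= t -> 0 <= a1 -> 0 <= a2 -> (forall z, V z \in unitmx) ->
 (forall z : X * R, 0 < z.2 -> (\int[mu]_(x in b z.1 (kap * z.2))
  (cnorm (P x *m invmx (V z)) `^ t)%:E <= (a1 * vl z)%:E)%E) ->
 (forall z : X * R, 0 < z.2 -> dualb mu (b z.1 (kap * z.2))
  (fun x => cnorm (V z *m Q x)) t (a2 * vl z `^ (1 - t^-1))) ->
 weight_fin t P /\ exists2 S, 1 <= S & weight_fw t P S.
move=> mP QP t1 a10 a20 uV hK hN.
have red z : 0 < z.2 -> exists V, [/\ V \in unitmx, (\int[mu]_(x in b z.1 (kap * z.2))
  (cnorm (P x *m invmx V) `^ t)%:E <= (a1 * vl z)%:E)%E & dualb mu (b z.1 (kap * z.2))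
  (fun x => cnorm (V *m Q x)) t (a2 * vl z `^ (1 - t^-1))].
 by move=> z0; exists (V z); split; [exact: uV|exact: hK|exact: hN].
have fin v c s : 0 < s -> (\int[mu]_(x in b c s) (enorm (P x *m v) `^ t)%:E < +oo)%E.
 exact: (weight_finite ds mP t1 kap8 red).
split; first by move=> v c s _; exact: fin.
have c0 : 0 < (1 + a1 * (2 * a2) `^ t)^-1 by rewrite igt0 ltr_wpDr// mge0 ?pge0.
exists (1 + fw_const D (1 + a1 * (2 * a2) `^ t)^-1).
 by rewrite lerDl !age0 ?dge0 ?xge0 ?(ltW c0) ?(leT ler01 D1).
move=> v v0 c s s0 G mG G0 hG.
have := @fw_of_half_mass _ _ _ _ _ _ ds _ (mweight t mP v) (weight_gt0 t QP v0)
 (fin v) _ c0 (weight_half_mass ds mP QP t1 a10 a20 kap8 red v) c s s0 G mG G0 hG.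
move=> h'; apply: leT h' _; apply: leMr; last by rewrite leF lerDr.
by apply: intge0 => x _; rewrite leF pge0.
Qed.

Lemma dualb_vol (E : set X) (g : X -> R) (t t' a v : R) : measurable E -> mfun g ->
 (forall x, 0 <= g x) -> 0 < t -> 0 < t' -> t^-1 + t'^-1 = 1 -> 0 <= a -> 0 < v ->
 (\int[mu]_(x in E) (g x `^ t')%:E <= (a * v)%:E)%E ->
 dualb mu E g t (a `^ t'^-1 * v `^ (1 - t^-1)).
move=> mE mg g0 t0 t'0 tt a0 v0 ha.
apply: (dual_bound_gt1 mE mg g0 _ t0 t'0); [by rewrite mge0 ?pge0|by rewrite addrC|].
have -> : 1 - t^-1 = t'^-1 by lra.
by rewrite powRM ?pge0// !powRVK ?gtF ?(ltW v0).
Qed.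

Lemma gt1_family (W : X -> 'M[R]_n) (A : R) : 1 < u ->
 (forall x, pdsym (W x)) -> mmx W ->
 0 <= A -> (Aconst dist mu u W <= A%:E)%E -> exists2 V : X * R -> 'M[R]_n, forall z, pdsym (V z) &
  forall z : X * R, 0 < z.2 -> (\int[mu]_(x in b z.1 (kap * z.2))
  (cnorm (mxpowR (W x) u^-1 *m invmx (V z)) `^ u)%:E <= (redC' D n k u (dual u) * A * vl z)%:E)%E /\
  (\int[mu]_(x in b z.1 (kap * z.2)) (cnorm (V z *m mxpowR (W x) (- u^-1)) `^ dual u)%:E <=
  (redC D n k (dual u) * vl z)%:E)%E.
move=> u1' pW mW A0; rewrite /Aconst gtF// => WA.
have kap0 : 0 < kap by exact: ltleT kap8.
have h := Agt1_reduced hX e0 re ds pW kap0 kapk mW u1' A0 WA.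
have /choice[V hV] z : exists V, pdsym V /\ (0 < z.2 -> (\int[mu]_(x in b z.1 (kap * z.2))
  (cnorm (mxpowR (W x) u^-1 *m invmx V) `^ u)%:E <= (redC' D n k u (dual u) * A * vl z)%:E)%E /\
  (\int[mu]_(x in b z.1 (kap * z.2)) (cnorm (V *m mxpowR (W x) (- u^-1)) `^ dual u)%:E <=
  (redC D n k (dual u) * vl z)%:E)%E).
 have [z0|z0] := ltP 0 z.2; last by exists (W z.1); split.
 by have [V [pV h1 h2]] := h z z0; exists V.
by exists V => z; have [] := hV z.
Qed.

Lemma reduced_ge0 t : [/\ 0 <= redC D n k t, 0 <= redC1 D n k & 0 <= redC' D n k u t].
have Dk : 0 <= D ^+ k by rewrite xge0// (leT ler01).
by split; (apply: mge0; last exact: Dk); rewrite ?age0 ?mge0 ?pge0.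
Qed.

(** Only the combination [a1 a2^u] needs to be controlled by [A]; the characteristic sits in [a1]
    when [u > 1] and in [a2] when [u = 1]. *)
Lemma reduced_family : exists2 C0, 0 <= C0 & forall (W : X -> 'M[R]_n) (A : R),
 (forall x, pdsym (W x)) -> mmx W ->
 0 <= A -> (Aconst dist mu u W <= A%:E)%E -> exists a1 a2 (V : X * R -> 'M[R]_n),
 [/\ 0 <= a1 /\ 0 <= a2, a1 * a2 `^ u <= C0 * A, forall z, pdsym (V z),
  forall z : X * R, 0 < z.2 -> (\int[mu]_(x in b z.1 (kap * z.2))
  (cnorm (mxpowR (W x) u^-1 *m invmx (V z)) `^ u)%:E <= (a1 * vl z)%:E)%E &
  forall z : X * R, 0 < z.2 -> dualb mu (b z.1 (kap * z.2))
  (fun x => cnorm (V z *m mxpowR (W x) (- u^-1))) u (a2 * vl z `^ (1 - u^-1))].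
have mhh W V t : (forall x, pdsym (W x)) -> mmx W ->
  mfun (fun x : X => cnorm (V *m mxpowR (W x) t) : R).
 move=> pW mW; apply: mcnorm => i j; apply: mmulmx => [a c|].
  exact: mcst.
 exact: mmxpowR.
have [u1'|u1'] := ltP 1 u; last first.
 have uE : u = 1 by apply/eqP; rewrite eq_le u1'.
 have [_ r10 _] := reduced_ge0 1.
 exists (redC1 D n k * (n%:R * (2 * n%:R))) => [|W A pW mW A0].
  by apply: mge0 => //.
 rewrite /Aconst uE eqxx => WA; have kap0 : 0 < kap by exact: ltleT kap8.
 have h := A1_reduced hX e0 re ds pW kap0 kapk mW WA.
 have a20 : 0 <= n%:R * (2 * n%:R * A) by rewrite !mge0.
 have /choice[V hV] z : exists V, pdsym V /\ (0 < z.2 -> (\int[mu]_(x in b z.1 (kap * z.2))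
  (cnorm (mxpowR (W x) 1 *m invmx V) `^ 1)%:E <= (redC1 D n k * vl z)%:E)%E /\
  {ae mu, forall x, b z.1 (kap * z.2) x -> cnorm (V *m mxpowR (W x) (- 1)) <= n%:R * (2 * n%:R * A)}).
  have [z0|z0] := ltP 0 z.2; last by exists (W z.1); split.
  by have [V [pV h1 h2]] := h z z0; exists V.
 exists (redC1 D n k), (n%:R * (2 * n%:R * A)), V; rewrite powRr1// invr1; split => //.
 - lra.
 - by move=> z; have [] := hV z.
 - by move=> z z0; have [_ /(_ z0)[]] := hV z.
 - move=> z z0; have [_ /(_ z0)[_ h2]] := hV z; rewrite subrr powRr0 mulr1.
  by apply: dual_bound_ae => // [|x]; [exact: mhh|exact: cn_ge0].
have t0 : 0 < dual u by exact: lt_trans (dual_gt1 u1').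
have [rN _ rK] := reduced_ge0 (dual u).
exists (redC' D n k u (dual u) * (redC D n k (dual u) `^ (dual u)^-1) `^ u) => [|W A pW mW A0 WA].
 by rewrite mge0 ?pge0.
have [V pV hV] := gt1_family u1' pW mW A0 WA.
exists (redC' D n k u (dual u) * A), (redC D n k (dual u) `^ (dual u)^-1), V; split => //.
- by rewrite mge0 ?pge0.
- lra.
- by move=> z /hV[].
- move=> z z0; have v0 := vgt0 ds z.1 z0.
 apply: dualb_vol => //; [exact: mball ds _ _|exact: mhh|by move=> x; exact: cn_ge0|exact: dual_add|].
 exact: (hV z z0).2.
Qed.

Definition lp_bound (W : X -> 'M[R]_n) (c : R) : Prop := forall (f : X -> 'cV[R]_n) N,
 (forall i, bdsupp rho (fun x => f x i 0)) -> 0 <= N ->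
 (\int[mu]_x (enorm (mxpowR (W x) p^-1 *m f x) `^ p)%:E <= (N `^ p)%:E)%E ->
 (\int[mu]_x (enorm (mxpowR (W x) p^-1 *m vec_op T f x) `^ p)%:E <= ((c * N) `^ p)%:E)%E.

Let uP : u <= p. Proof. by apply: leT up; rewrite ler_peMr ?(ltW u0). Qed.
Let uV (W : 'M[R]_n) : pdsym W -> W \in unitmx.
by move=> pW; case/mulmx1_unit: (mxpowRN 1 pW); rewrite mxpowR1. Qed.

Lemma kerC_ge0 : 0 <= kerC D n Lam p u C.
have Cs0 : 0 <= sout D Lam C n.
 by apply: leT (slev_le_sout ds czT n); rewrite mge0// ltW// (slev_gt0 ds czT).
apply: mge0 (pge0 _ _); apply: mge0; first exact: mge0.
apply: mge0 => //; apply: age0 => //; apply: mge0 (pge0 _ _) _; apply: mge0 => //.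
by apply: mge0; [exact: rhiC_ge0 ds|rewrite xge0// (leT ler01)].
Qed.

Lemma bounded_part2 : u * r < p -> exists2 C', 0 <= C' & forall (W : X -> 'M[R]_n) (A : R),
 (forall x, pdsym (W x)) -> mmx W ->
 0 <= A -> (Aconst dist mu u W <= A%:E)%E -> let P x := mxpowR (W x) u^-1 in
 [/\ weight_fin u P, exists2 S, 1 <= S & weight_fw u P S &
  forall S, 1 <= S -> weight_fw u P S -> lp_bound W (C' * A `^ p^-1 * S `^ (1 - p^-1))].
move=> upr; have [C0 C00 fam] := reduced_family.
pose th := u / p * r; pose b' := r / (th / u + (1 - th)).
have [th0 th1 et0] := exp_arith1 r0 p0 u1 upr; have b0 : 0 < b' by exact: dgt0.
have bp : b' < p by exact: exp_arith2.
have k0 := kerC_ge0.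
exists (kerC D n Lam p u C * maxC D p b' (sdlog Lam) `^ p^-1 * (n * n)%:R * C0 `^ p^-1).
 by apply: mge0 (pge0 _ _); apply: mge0 => //; exact: mge0 (pge0 _ _).
move=> W A pW mW A0 WA P; have [a1 [a2 [V [[a10 a20] aA pV hK hN]]]] := fam W A pW mW A0 WA.
have mP := mmxpowR pW mW u^-1.
have [fin exS] := redw_fw mP (fun x => mxpowRN _ (pW x)) u1 a10 a20 (fun z => uV (pV z)) hK hN.
split => // S S1 fw f N bf N0 hf.
pose cn := (n * n)%:R * (a2 `^ th) `^ r^-1.
have cn0 : 0 <= cn by exact: mge0 (pge0 _ _).
have hN' := savg_bound pW mW pV bf (pge0 a2 th) b0 bp (leltT hf (ltry _))
 (fun z J z0 J0 => savg_dual_bound pW mW bf upr a20 z0 J0 (hN z z0)).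
apply: leT (weighted_bound hX e0 re ds Lam1 r1 czT p1 u1 uP pW mW pV a10 S1 b0 bp hK fw fin cn0 N0 bf hN' hf) _.
apply: le_powR; first exact: ltW.
 apply: mge0 => //; apply: mge0 => //; do 3![apply: mge0 (pge0 _ _)]; exact: k0.
apply: wMr => //.
(* The two factors come from the kernel side and from the means of [f]; together they form
   [(a1 a2^u)^(1/p)]. *)
have E : a1 `^ p^-1 * (a2 `^ th) `^ r^-1 <= C0 `^ p^-1 * A `^ p^-1.
 rewrite -powRM// -powRrM -mulrA divff ?gtF// mulr1 powRrM -powRM ?pge0//.
 by apply: le_powR => //; [rewrite ige0 ltW|rewrite mge0 ?pge0].
move: (kerC _ _ _ _ _ _) k0 (maxC _ _ _ _) => K K0 M; rewrite part_arith1.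
rewrite part_arith2; apply: wMl => //.
by apply: mge0 (pge0 _ _); apply: mge0 => //; exact: mge0 (pge0 _ _).
Qed.

(** [V] and its inverse serve as reducing matrices for the weight and for its dual. The gain for the
    dual weight makes [b' < p] with a maximal constant of order [S'], and the root [1/p] of it
    enters the bound. *)
Lemma bounded_part1 : 1 < u -> u * r = p -> exists2 C', 0 <= C' & forall (W : X -> 'M[R]_n) (A : R),
 (forall x, pdsym (W x)) -> mmx W ->
 0 <= A -> (Aconst dist mu u W <= A%:E)%E ->
 let P x := mxpowR (W x) u^-1 in let Q x := mxpowR (W x) (- u^-1) in
 [/\ weight_fin u P, exists2 S, 1 <= S & weight_fw u P S,
  weight_fin (dual u) Q, exists2 S, 1 <= S & weight_fw (dual u) Q S &
  forall S S', 1 <= S -> weight_fw u P S -> 1 <= S' -> weight_fw (dual u) Q S' ->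
  lp_bound W (C' * A `^ p^-1 * S' `^ p^-1 * S `^ (1 - p^-1))].
move=> u1' upr; set d := dual u; have d1 : 1 < d by exact: dual_gt1.
have d0 : 0 < d by lra.
have [rN _ rK] := reduced_ge0 d; have k0 := kerC_ge0.
pose aN := (n * (n * n))%:R `^ d * redC D n k d.
have aN0 : 0 <= aN by rewrite mge0.
have rc0 : 0 <= rhi_colC D n Lam d.
 apply: mge0 (pge0 _ _) _; apply: mge0 => //.
 by apply: mge0; [exact: rhiC_ge0 ds|rewrite xge0// (leT ler01)].
pose a3 := (n * (n * n))%:R * ((1 + rhi_colC D n Lam d) * (1 + aN)).
have a30 : 0 <= a3 by apply: mge0 => //; apply: mge0; exact: age0.
have ue : 0 < u - 1 by lra.
pose M1 := D ^+ 3 * (2 * expR 1) `^ (1 + (u - 1)) * (1 + (u - 1)) * (D ^+ sdlog Lam) `^ (1 + (u - 1)).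
have M10 : 0 <= M1.
 by apply: mge0 (pge0 _ _); apply: mge0; [apply: mge0 (pge0 _ _); rewrite xge0// (leT ler01)|rewrite age0 ?ltW].
pose c8 := 8 * D ^+ 6 * ln (D ^+ 7).
have c80 : 0 < c8.
 rewrite mgt0 ?ln_gt0//; first by rewrite mgt0// xgt0// (ltleT ltr01).
 by rewrite exprn_egt1// (ltleT _ (dsC ds))// ltr1n.
pose M2 := M1 * (2 * (u - 1)^-1 * c8).
have M20 : 0 <= M2.
 by apply: mge0 => //; apply: mge0 (ltW c80); rewrite mge0// ige0 ltW.
exists (kerC D n Lam p u C * M2 `^ p^-1 * redC' D n k u d `^ p^-1 * ((n * n)%:R * a3 `^ r^-1)).
 by apply: mge0; [do 2![apply: mge0 (pge0 _ _)]|exact: mge0 (pge0 _ _)].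
move=> W A pW mW A0 WA P Q; have [V pV hV] := gt1_family u1' pW mW A0 WA.
have mP := mmxpowR pW mW u^-1; have mQ := mmxpowR pW mW (- u^-1).
have a10 : 0 <= redC' D n k u d * A by exact: mge0.
have pVi z : pdsym (invmx (V z)) by rewrite -mxpowRN1//; exact: mxpowR_pd.
have mcol (M : 'M[R]_n) t : mfun (fun x => cnorm (M *m mxpowR (W x) t)).
 by apply: mcnorm => i j; apply: mmulmx => [a c|]; [exact: mcst|exact: mmxpowR].
have mcol' (M : 'M[R]_n) t : mfun (fun x => cnorm (mxpowR (W x) t *m M)).
 by apply: mcnorm => i j; apply: mmulmx => [|a c]; [exact: mmxpowR|exact: mcst].
have mb z t : measurable (b z t) := mball ds z t.
have tr (M : 'M[R]_n) t s x : M^T = M -> 0 <= s ->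
  cnorm (M *m mxpowR (W x) t) `^ s <= (n * (n * n))%:R `^ s * cnorm (mxpowR (W x) t *m M) `^ s /\
  cnorm (mxpowR (W x) t *m M) `^ s <= (n * (n * n))%:R `^ s * cnorm (M *m mxpowR (W x) t) `^ s.
 move=> Ms s0; split; (rewrite -powRM; [|by []|exact: cn_ge0]);
  (apply: le_powR s0 (cn_ge0 _) _).
  by have := cn_trmx (mxpowR (W x) t *m M); rewrite trmx_mul (mxpowR_sym _ (pW x)) Ms.
 by have := cn_trmx (M *m mxpowR (W x) t); rewrite trmx_mul (mxpowR_sym _ (pW x)) Ms.
have itr (g g' : X -> R) (E : set X) s a v : measurable E -> mfun g' -> (forall x, 0 <= g' x) ->
  (forall x, g x `^ s <= (n * (n * n))%:R `^ s * g' x `^ s) ->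
  (\int[mu]_(x in E) (g' x `^ s)%:E <= (a * v)%:E)%E ->
  (\int[mu]_(x in E) (g x `^ s)%:E <= ((n * (n * n))%:R `^ s * a * v)%:E)%E.
 move=> mE mg g0 gg ha; rewrite -mulrA (EFinM (_ `^ s)).
 have n0 : (0 <= ((n * (n * n))%:R `^ s)%:E :> \bar R)%E by [].
 apply: leT (leMl n0 ha); rewrite -intZ //; first last.
 - by move=> x; exact: pge0.
 - exact: mpowR.
 by apply: int_le_nm => x; rewrite leF ?pge0.
have Vs z : (V z)^T = V z by case: (pV z).
have Vis z : (invmx (V z))^T = invmx (V z) by case: (pVi z).
have hKQ z : 0 < z.2 -> (\int[mu]_(x in b z.1 (kap * z.2)) (cnorm (Q x *m V z) `^ d)%:E <= (aN * vl z)%:E)%E.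
 move=> z0; apply: (itr _ _ _ _ _ _ (mb _ _) (mcol (V z) _) (fun x => cn_ge0 _) _ (hV z z0).2) => x.
 exact: (tr _ _ _ _ (Vs z) (ltW d0)).2.
have [fin exS] := redw_fw mP (fun x => mxpowRN _ (pW x)) u1 a10 (pge0 _ d^-1) (fun z => uV (pV z))
 (fun z z0 => (hV z z0).1) (fun z z0 => dualb_vol (mb _ _) (mcol (V z) _) (fun x => cn_ge0 _)
  u0 d0 (dual_add u1') rN (vgt0 ds _ z0) (hV z z0).2).
have du : d^-1 + u^-1 = 1 by rewrite addrC dual_add.
have hKQ' z : 0 < z.2 -> (\int[mu]_(x in b z.1 (kap * z.2)) (cnorm (Q x *m invmx (invmx (V z))) `^ d)%:E <= (aN * vl z)%:E)%E.
 by rewrite invmxK; exact: hKQ.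
have [finQ exSQ] := redw_fw mQ (fun x => mxpowRV _ (pW x)) (ltW d1) aN0 (pge0 _ u^-1) (fun z => uV (pVi z))
 hKQ' (fun z z0 => dualb_vol (mb _ _) (mcol (invmx (V z)) _) (fun x => cn_ge0 _)
  d0 u0 du (mge0 (pge0 _ _) a10) (vgt0 ds _ z0)
  (itr _ _ _ _ _ _ (mb _ _) (mcol' (invmx (V z)) _) (fun x => cn_ge0 _)
  (fun x => (tr _ _ _ _ (Vis z) (ltW u0)).1) (hV z z0).1)).
split; [exact: fin|exact: exS|exact: finQ|exact: exSQ|] => S S' S1 fw S'1 fw' f N bf N0 hf.
have [dl0 dl1 dlS] := rh_expb 6 (dsC ds) S'1; set dl := rh_exp _ _ _ in dl0 dl1 dlS.
(* [t = u' (1 + dl)] is the improved exponent of the dual weight, and [p / b' = 1 + tau] with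
   [1 / tau] at most a constant over [dl], that is a constant times [S']. *)
have [] := exp_arith3 r0 u1' dl0 dl1; rewrite -(dualE u1') upr; set t := d * _; set b' := r * _ => -[t1 b0 bp] [pb tau0 tau1 tauV].
have dlt : 1 + dl <= t by rewrite ler_peMl ?age0 // ltW.
have hh z : 0 < z.2 -> (\int[mu]_(x in b z.1 (sd * z.2)) (cnorm (V z *m Q x) `^ t)%:E <= (a3 `^ t * vl z)%:E)%E.
 move=> z0; have := rhi_colnorm hX e0 re ds Lam1 d0 S'1 mQ (fun x => mxpowRV _ (pW x)) fw' finQ (uV (pV z)) z0 aN0 (hKQ z z0).
 move/(itr _ _ _ _ _ _ (mb _ _) (mcol' (V z) _) (fun x => cn_ge0 _) (fun x => (tr _ _ _ _ (Vs z) (ltW (lt_trans ltr01 t1))).1)).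
 move/leT; apply; rewrite leF wMr ?(ltW (vgt0 ds _ z0))//.
 exact: rhi_const_pow (ltW dl0) _.
have hN' := savg_bound pW mW pV bf a30 b0 bp (leltT hf (ltry _))
 (fun z J z0 J0 => savg_rhi pW mW bf upr t1 a30 z0 J0 (hh z z0)).
have cn0 : 0 <= (n * n)%:R * a3 `^ r^-1 by exact: mge0 (pge0 _ _).
apply: leT (weighted_bound hX e0 re ds Lam1 r1 czT p1 u1 uP pW mW pV a10 S1 b0 bp
 (fun z z0 => (hV z z0).1) fw fin cn0 N0 bf hN' hf) _.
have mM : maxC D p b' (sdlog Lam) <= M2 * S'.
 apply: leT (max_const_le _ D1 tau0 tau1 pb) _; rewrite -[leRHS]mulrA; apply: wMl => //.
 apply: leT tauV _; rewrite -[leRHS]mulrA; apply: wMl; first by rewrite mge0// ige0 ltW.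
 rewrite -[c8]invrK -[S' in leRHS]invrK -invfM lef_pV2 ?posrE// mgt0 ?igt0//.
 exact: ltleT.
apply: le_powR; first exact: ltW.
 apply: mge0 => //; apply: mge0 => //; do 3![apply: mge0 (pge0 _ _)]; exact: k0.
have S'0 : 0 <= S' by lra.
apply: wMr => //; rewrite (powRM _ rK A0).
move: (kerC _ _ _ _ _ _) k0 (_ * a3 `^ _) cn0 => K K0 x0 x00; rewrite part_arith3 -part_arith4 -powRM//.
apply: wMl; first by apply: mge0 => //; do 3![apply: mge0 (pge0 _ _)].
by apply: le_powR mM; [rewrite ige0 ltW|exact: (maxC_ge0 ds)].
Qed.
End bounded_functions.

(** * Extension by density *)

Lemma powR_lower_near {R : realType} (y e p : R) : 0 < p -> 0 <= y -> 0 < e ->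
 exists2 d, 0 < d & forall z, 0 <= z -> y <= z + d -> y `^ p <= z `^ p + e.
move=> p0 y0 e0; have [h|h] := leP (y `^ p) e.
 by exists 1 => // z z0 _; rewrite (leT h)// lerDr pge0.
have w0 : 0 <= y `^ p - e by lra.
pose w := (y `^ p - e) `^ p^-1; have wE : w `^ p = y `^ p - e by rewrite powRVK ?gtF.
exists (y - w) => [|z z0 yz].
 rewrite subr_gt0 ltNge; apply/negP => /(le_powR (ltW p0) y0); lra.
by rewrite -lerBlDr -wE; apply: le_powR; rewrite ?(ltW p0) ?pge0//; lra.
Qed.

Lemma pow2_small {R : realType} (e : R) : 0 < e -> exists k0, forall k, (k0 <= k)%N -> 2 ^- k <= e.
move=> e0; exists (Num.truncn e^-1).+1 => k kk; rewrite -[e]invrK lef_pV2 ?posrE ?igt0 //.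
apply: ltW; apply: ltleT (truncnS_gt _) _; rewrite -natrX ler_nat.
by apply: leq_trans kk _; exact: ltnW (ltn_expl _ _).
Qed.

Lemma geometric_cvg {R : realType} (x : nat -> R) (C : R) j0 : 0 <= C ->
 (forall j, (j0 <= j)%N -> `|x j.+1 - x j| <= C * 2 ^- j) -> cvgn x.
move=> C0 h; apply/cauchy_cvgP/cauchy_exP => e e0.
have hk j k : (j0 <= j)%N -> `|x (k + j)%N - x j| <= 2 * C * 2 ^- j.
 move=> jj; suff : `|x (k + j)%N - x j| <= 2 * C * 2 ^- j - 2 * C * 2 ^- (k + j).
  by move/leT; apply; rewrite gerBl !mge0// xge0.
 elim: k => [|k ih]; first by rewrite !subrr normr0.
 have := h (k + j)%N (leq_trans jj (leq_addl _ _)); rewrite addSn exprS invfM.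
 have := ler_normD (x (k + j).+1 - x (k + j)%N) (x (k + j)%N - x j); rewrite addrA subrK; lra.
have [k0 hk0] := @pow2_small R (e / (2 * C + 1)) ltac:(by rewrite dgt0// ltr_wpDl ?mge0).
exists (x (j0 + k0)%N), (j0 + k0)%N => // k /subnK <-; rewrite /ball /= distrC.
apply: leltT (hk _ _ (leq_addr _ _)) _; have := hk0 (j0 + k0)%N (leq_addl _ _).
by rewrite ler_pdivlMr ?ltr_wpDl ?mge0//; apply: ltleT; rewrite mulrC ltr_pM2l ?ltrDl ?igt0 ?xgt0.
Qed.

Lemma powR_add_le {R : realType} (y a c p : R) : 0 < p -> 0 <= y -> 0 <= a -> 0 <= c -> y <= a + c ->
 y `^ p <= 2 `^ p * (a `^ p + c `^ p).
move=> p0 y0 a0 c0 yac; have h z : 0 <= z -> y <= 2 * z -> y `^ p <= 2 `^ p * z `^ p.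
 by move=> z0 yz; rewrite -powRM//; apply: le_powR => //; exact: ltW.
have [ac|ca] := leP a c.
 by apply: leT (h c c0 _) _; [lra|rewrite wMl // lerDr pge0].
by apply: leT (h a a0 _) _; [lra|rewrite wMl ?pge0// lerDl pge0].
Qed.

Lemma cvge0P {R : realType} (u : nat -> \bar R) : (forall k, (0 <= u k)%E) ->
 u k @[k --> \oo] --> (0 : \bar R)%E <->
 forall e : R, 0 < e -> exists k0, forall k, (k0 <= k)%N -> (u k <= e%:E)%E.
move=> u0; split => [/fine_cvgP[F1 /cvgr_lt F2] e e0|h].
 have [k0 _ hk] : \forall k \near \oo, (u k <= e%:E)%E.
  by near=> k; rewrite -(@fineK _ (u k)) ?ltW//; near: k => //; exact: F2.
 by exists k0.
have fu e : 0 < e -> \forall k \near \oo, (u k <= e%:E)%E by move=> /h[k0 hk]; exists k0.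
apply/fine_cvgP; split; [|apply/cvgrPdist_le => e e0]; near=> k.
 by rewrite ge0fin// (@leltT _ _ 1%:E) ?ltry//; near: k; exact: fu.
have h' : (u k <= e%:E)%E by near: k; exact: fu.
by rewrite sub0r normrN ger0_norm -leF fineK// ge0fin// (leltT h') ?ltry.
Unshelve. all: by end_near. Qed.

Lemma ae_finite {R : realType} {dsp} {X : mType dsp}
  (mu : meas X R) (I : finType) (Q : I -> X -> Prop) :
 (forall i, {ae mu, forall x, Q i x}) -> {ae mu, forall x, forall i, Q i x}.
exact: filter_forall. Qed.

(** The errors are so small that the increments of [T] of the truncations remain summable after
    multiplication by [2^k], which gives geometric convergence at almost every point. *)
Lemma truncation_levels {R : realType} (c p : R) : 0 < p -> exists eps : nat -> R,
 [/\ forall k, 0 < eps k, forall k, eps k <= 2 ^- k, forall i j, (j <= i)%N -> eps i <= eps j &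
  forall k, (2 ^+ k) `^ p * (c `^ p * (2 * eps k)) <= 2 ^- k].
move=> p0; have K1 : 1 <= 2 `^ p :> R by rewrite powR_ge1 ?ler1n ?ltW.
have K0 k : 0 < (2 `^ p) ^+ k :> R by [].
have d0 k : 0 < (2 : R) ^+ k by [].
have cp : 0 < c `^ p * 2 + 1 by rewrite ltr_wpDl ?mge0 ?pge0.
have h k : 1 <= (2 `^ p) ^+ k * (c `^ p * 2 + 1).
 by rewrite mulr_ege1 ?exprn_ege1// lerDr mge0 ?pge0.
exists (fun k => (2 ^+ k * ((2 `^ p) ^+ k * (c `^ p * 2 + 1)))^-1); split=> [k|k|i j ji|k].
- by rewrite igt0 !mgt0.
- by rewrite lef_pV2 ?posrE ?mgt0// ler_peMr.
- by rewrite lef_pV2 ?posrE ?mgt0// ler_pM ?mge0 ?(ltW (K0 j)) ?(ltW cp)// ?ler_pM2r// ler_weXn2l// ler1n.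
have -> : (2 ^+ k) `^ p = (2 `^ p) ^+ k :> R by rewrite -powR_mulrn// powRAC powR_mulrn.
move: (_ ^+ k) (K0 k) (2 ^+ k) (d0 k) (c `^ p) (pge0 c p) cp => K K'0 d d'0 a a0 a1.
have -> : K * (a * (2 / (d * (K * (a * 2 + 1))))) = a * 2 / (a * 2 + 1) / d by field; rewrite !gtF.
by rewrite ler_piMl ?ige0 ?(ltW d'0)// lepdM// mul1r lerDl.
Qed.

Section density.
Context {R : realType} {dsp} {X : mType dsp}.
Variables (rho : X -> X -> R) (mu : meas X R) (D : R).
Hypothesis ds : dspace rho mu D.
Variables (n : nat) (p C2 : R) (T : (X -> R) -> X -> R) (P Q : X -> 'M[R]_n).
Hypotheses (p0 : 0 < p) (mP : forall i j, mfun (fun x => P x i j))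
 (QP : forall x, Q x *m P x = 1%:M) (C20 : 0 <= C2)
 (Tlin : forall (a : R) f g, f \in Lfun mu 2%:E -> g \in Lfun mu 2%:E ->
  {ae mu, forall x, T (fun y => a * f y + g y) x = a * T f x + T g x})
 (Tbd : forall f, f \in Lfun mu 2%:E ->
  mfun (T f) /\ (sqint mu (T f) <= C2%:E * sqint mu f)%E).
Implicit Types (f g u v : X -> 'cV[R]_n).
Local Notation bs f := (forall i, bdsupp rho (fun x => f x i 0)).
Local Notation L2 f := (forall i, (fun x => f x i 0) \in Lfun mu 2%:E).

Definition wint f : \bar R := (\int[mu]_x (enorm (P x *m f x) `^ p)%:E)%E.
Definition wbound (c : R) : Prop := forall f N, bs f -> 0 <= N ->
 (wint f <= (N `^ p)%:E)%E -> (wint (vec_op T f) <= ((c * N) `^ p)%:E)%E.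

Lemma mwnorm f : vmeasurable f -> mfun (fun x => enorm (P x *m f x) `^ p).
move=> mf; apply: mpowR; apply: menorm => i.
by apply: mmulmx => // k l; rewrite ord1.
Qed.

Lemma vmeasB f g : vmeasurable f -> vmeasurable g -> vmeasurable (fun x => f x - g x).
move=> mf mg i; have -> : (fun x => (f x - g x) i 0) = (fun x => f x i 0) \- (fun x => g x i 0).
 by apply/funext => x; rewrite !mxE.
exact: mfB.
Qed.

Lemma fatou_wint (G : nat -> X -> 'cV[R]_n) g (B : R) : (forall k, vmeasurable (G k)) ->
 {ae mu, forall x d, 0 < d -> exists k0, forall k, (k0 <= k)%N -> enorm (P x *m (g x - G k x)) <= d} ->
 (forall k, (wint (G k) <= B%:E)%E) -> (wint g <= B%:E)%E.
move=> mG GB hB; apply: (fatou_bound _ _ _ _ hB (cvg_cst _)) => [k|k x|x|].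
- exact: mwnorm.
- exact: pge0.
- exact: pge0.
apply: filterS GB => x hx e e0; have [d d0 hd] := powR_lower_near p0 (en_ge0 (P x *m g x)) e0.
have [k0 hk] := hx d d0; exists k0 => k /hk h; apply: hd (en_ge0 _) _.
by apply: leT (lerD (lexx _) h); rewrite -{1}(subrK (G k x) (g x)) addrC mulmxDr en_tri.
Qed.

Lemma wint_tri f g u : vmeasurable g -> vmeasurable u -> {ae mu, forall x, f x = g x + u x} ->
 (wint f <= (2 `^ p)%:E * (wint g + wint u))%E.
move=> mg mu' fgu; have m1 := mwnorm mg; have m2 := mwnorm mu'.
have p2 x : 0 <= enorm (P x *m g x) `^ p + enorm (P x *m u x) `^ p by rewrite age0 ?pge0.
rewrite /wint -(intD mu measurableT m1 m2 (fun=> pge0 _ _) (fun=> pge0 _ _)).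
rewrite -(intZ mu measurableT (mfD m1 m2) p2 (pge0 2 p)).
case: fgu => Z [mZ Z0 hZ]; apply: (int_le_null measurableT mZ Z0) => [x|x|x _ Zx]; rewrite leF ?pge0//.
 exact: mge0 (pge0 _ _) (p2 x).
have -> : f x = g x + u x by apply: contrapT => h; exact/Zx/hZ.
by rewrite mulmxDr; apply: powR_add_le; rewrite ?en_ge0 ?en_tri.
Qed.

Lemma truncation f (g : X -> R) (e : R) : vmeasurable f -> mfun g -> (forall x, 0 <= g x) ->
 (\int[mu]_x (g x)%:E < +oo)%E -> 0 < e -> exists B, [/\ measurable B,
  bs (fun x => \1_B x *: f x) & (\int[mu]_x (g x * \1_(~` B) x)%:E <= e%:E)%E].
move=> mf mg g0 gf e0.
pose B (k : nat) := qball rho point k%:R `&` ~` [set x | k%:R < enorm (f x)].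
have mB k : measurable (B k).
 apply: measurableI; first exact: (mball ds); apply: measurableC.
 by apply: msuplev; exact: menorm.
have cv : (\int[mu]_x (g x * \1_(~` B k) x)%:E @[k --> \oo] --> \int[mu]_(x in setT) (cst 0 x : \bar R))%E.
 apply: (@dominated_cvg _ _ _ mu setT _ (fun k x => (g x * \1_(~` B k) x)%:E) _ (fun x => (g x)%:E)) => //.
 - by move=> k; apply: mEFin; apply: mMindic => //; exact: measurableC.
 - move=> x _; apply: cvg_near_cst.
  exists (maxn (Num.truncn (rho point x)).+1 (Num.truncn (enorm (f x))).+1) => // k /=.
  rewrite geq_max => /andP[h1 h2]; rewrite indicE memNset ?mulr0// => -[]; split.
  by apply: ltleT (truncnS_gt _) _; rewrite ler_nat.
  by apply/negP; rewrite -leNgt; apply: ltW; apply: ltleT (truncnS_gt _) _; rewrite ler_nat.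
 - apply/integrableP; split; first exact: mEFin.
  by under eqint do rewrite gee0_abs ?leF//.
 - move=> k x _; rewrite gee0_abs leF ?mge0// ler_piMr//.
rewrite integral0 in cv; have [k hk] : exists k, (\int[mu]_x (g x * \1_(~` B k) x)%:E <= e%:E)%E.
 have [|k0 hk] := (cvge0P _).1 cv e e0; last by exists k0; exact: hk.
 by move=> k; apply: intge0 => x _; rewrite leF mge0.
exists (B k); split => // i; split.
- have -> : (fun x => (\1_(B k) x *: f x) i 0) = (fun x => f x i 0 * \1_(B k) x).
  by apply/funext => x; rewrite mxE mulrC.
 exact: mMindic.
- exists k%:R => x; rewrite mxE normrM indicE; case: (boolP (x \in _)) => [/set_mem[_ /= h]|_].
  by rewrite normr1 mul1r; apply: leT (coord_le _ _) _; rewrite leNgt; exact/negP.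
 by rewrite normr0 mul0r.
- by exists point, k%:R => x xk; rewrite mxE indicE memNset ?mul0r// => -[].
Qed.

Lemma vec_opB u v : L2 u -> L2 v ->
 {ae mu, forall x, vec_op T (fun y => u y - v y) x = vec_op T u x - vec_op T v x}.
move=> u2 v2; have h i : {ae mu, forall x, T (fun y => (u y - v y) i 0) x = T (fun y => u y i 0) x - T (fun y => v y i 0) x}.
 apply: filterS (Tlin (-1) (v2 i) (u2 i)) => x; rewrite mulN1r addrC => <-.
 by congr (T _ x); apply/funext => y; rewrite !mxE mulN1r addrC.
by apply: filterS (ae_finite h) => x hx; apply/colP => i; rewrite !mxE hx.
Qed.

Lemma L2B u v : L2 u -> L2 v -> L2 (fun x => u x - v x).
move=> u2 v2 i; have /Lfun2P[mu' su] := u2 i; have /Lfun2P[mv sv] := v2 i; apply/Lfun2P.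
have -> : (fun x => (u x - v x) i 0) = (fun x => 1 * u x i 0 + (-1) * v x i 0).
 by apply/funext => x; rewrite !mxE mul1r mulN1r.
split; first by apply: mfD; exact: mfM.
by apply: leltT (sqint_lin mu _ _ mu' mv) _; rewrite lte_add_pinfty// lte_mul_pinfty// leF mge0 ?sqr_ge0.
Qed.

Lemma vecop_meas u : L2 u -> vmeasurable (vec_op T u).
move=> u2 i; have [m _] := Tbd (u2 i); rewrite (_ : (fun x => _) = T (fun x => u x i 0))//.
by apply/funext => x; rewrite mxE.
Qed.

Lemma L2_of_bs u : bs u -> L2 u.
by move=> bu i; apply/Lfun2P; split; [case: (bu i)|exact: (sqint_bounded ds)]. Qed.

Lemma wint_rle f (B : set X) : (wint (fun x => \1_B x *: f x) <= wint f)%E.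
apply: int_le_nm => x; first by rewrite leF pge0.
move=> _; rewrite -scalemxAr enormZ; apply: le_powR; [exact: ltW|by rewrite mge0 ?en_ge0|].
by rewrite ler_piMl ?en_ge0// nindic.
Qed.

Lemma restrictC f (B : set X) x : f x - \1_B x *: f x = \1_(~` B) x *: f x.
rewrite !indicE in_setC; case: (_ \in _); first by rewrite scale1r subrr scale0r.
by rewrite scale0r subr0 scale1r.
Qed.

Lemma int_en_sqr u : vmeasurable u ->
 (\int[mu]_x (enorm (u x) ^+ 2)%:E = \sum_i sqint mu (fun x => u x i 0%R))%E.
move=> mu'; under eqint do rewrite en_sqr -sumEFin.
rewrite ge0_integral_sum// => [i|i x _]; last by rewrite leF sqr_ge0.
by apply: mEFin; exact: msqr.
Qed.

Lemma vec_op_sqr u : L2 u -> (\int[mu]_x (enorm (vec_op T u x) ^+ 2)%:E <= C2%:E * \int[mu]_x (enorm (u x) ^+ 2)%:E)%E.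
move=> u2; have mu' : vmeasurable u by move=> i; have /Lfun2P[] := u2 i.
rewrite (int_en_sqr (vecop_meas u2)) int_en_sqr// ge0_sume_distrr; last by move=> i _; exact: sqint_ge0.
apply: lee_sum => i _; have [_] := Tbd (u2 i); congr (sqint mu _ <= _)%E.
by apply/funext => x; rewrite mxE.
Qed.

(** Truncations with geometric L^2 error: [T] of them converges almost everywhere by L^2
    boundedness, their weighted norms do not exceed that of [f], and Fatou's lemma passes the bound
    to the limit. *)
Lemma wbound_L2 c f N : wbound c -> L2 f -> 0 <= N -> (wint f <= (N `^ p)%:E)%E ->
 (wint (vec_op T f) <= ((c * N) `^ p)%:E)%E.
move=> hc f2 N0 fN; have mf : vmeasurable f by move=> i; have /Lfun2P[] := f2 i.
pose g x := enorm (f x) ^+ 2; have mg : mfun g.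
 by apply: msqr; exact: menorm.
have gf : (\int[mu]_x (g x)%:E < +oo)%E.
 by rewrite int_en_sqr// lte_sum_pinfty// => i; have /Lfun2P[] := f2 i.
have e0 k : 0 < 2 ^- k / (C2 + 1) :> R by rewrite dgt0 ?ltr_wpDl// xgt0.
have /choice[B hB] k := truncation mf mg (fun x => sqr_ge0 _) gf (e0 k).
pose v k x := \1_(B k) x *: f x; have bv k : bs (v k) by case: (hB k).
pose a k x := enorm (vec_op T f x - vec_op T (v k) x) ^+ 2.
have mTf := vecop_meas f2; have mTv k := vecop_meas (L2_of_bs (bv k)).
apply: (fatou_wint mTv _ (fun k => hc _ _ (bv k) N0 (leT (wint_rle _ _) fN))).
have mD k := vmeasB mTf (mTv k).
have := @ae_vanish _ _ _ mu a (fun k => msqr (menorm (mD k))) (fun k x => sqr_ge0 _).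
have hk k : (\int[mu]_x (a k x)%:E <= (2 ^- k)%:E)%E.
 have [Z [mZ Z0 hZ]] := vec_opB f2 (L2_of_bs (bv k)).
 rewrite (eq_int_null (g := fun x => (enorm (vec_op T (fun x => f x - v k x) x) ^+ 2)%:E) measurableT mZ Z0); first last.
 - by move=> x _ Zx; congr ((enorm _ ^+ 2)%:E); apply/esym; apply: contrapT => h; exact/Zx/hZ.
 - by move=> x; rewrite leF sqr_ge0.
 - by move=> x; rewrite leF sqr_ge0.
 apply: leT (vec_op_sqr (L2B f2 (L2_of_bs (bv k)))) _.
 have [_ _ h] := hB k; rewrite (eqint (fun x => (g x * \1_(~` B k) x)%:E)); last first.
  by move=> x _; rewrite restrictC enormZ exprMn nindic mulrC indicE; case: (_ \in _); rewrite ?expr1n ?expr0n.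
 apply: leT (leMl _ h) _ => //.
 by rewrite leF mulrCA ler_piMr ?ige0 ?xge0// lepdM ?ltr_wpDl// mul1r lerDl.
move/(_ hk); apply: filterS => x hx d d0.
have o1 : 0 < opnorm (P x) + 1 by rewrite ltr_wpDl ?on_ge0.
have [k0 hk0] := hx ((d / (opnorm (P x) + 1)) ^+ 2) (xgt0 _ (dgt0 d0 o1)); exists k0 => k /hk0.
rewrite ler_pXn2r ?nnegrE ?en_ge0 ?dge0 ?(ltW d0) ?(ltW o1)// => h; apply: leT (on_bound _ _) _.
by rewrite ler_pdivlMr// mulrC in h; apply: leT h; rewrite wMr ?en_ge0// lerDl.
Qed.

Local Notation vsub u v := (fun x => u x - v x)%R.

Lemma wboundB c u v (e : R) : 0 <= c -> wbound c -> L2 u -> L2 v -> 0 <= e -> (wint (vsub u v) <= e%:E)%E ->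
 (wint (vsub (vec_op T u) (vec_op T v)) <= (c `^ p * e)%:E)%E.
move=> c0 hc u2 v2 e0 he; have [Z [mZ Z0 hZ]] := vec_opB u2 v2.
have := @wbound_L2 c _ (e `^ p^-1) hc (L2B u2 v2) (pge0 _ _); rewrite powRM ?pge0// powRVK ?gtF//.
move/(_ he); apply: leT; apply: (int_le_null measurableT mZ Z0) => [x|x|x _ Zx]; first 2 last.
 by have -> : vec_op T (fun y => u y - v y) x = vec_op T u x - vec_op T v x by apply: contrapT => h; exact/Zx/hZ.
all: by rewrite leF pge0.
Qed.

Local Notation null F := (forall e : R, 0 < e -> exists k0, forall k, (k0 <= k)%N -> (wint (F k) <= e%:E)%E).

Lemma wnorm_cvg0 (G : nat -> 'cV[R]_n) (g : 'cV[R]_n) x : (forall i, G k i 0 @[k --> \oo] --> g i 0) ->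
 forall d : R, 0 < d -> exists k0, forall k, (k0 <= k)%N -> enorm (P x *m (g - G k)) <= d.
move=> hG d d0; have o1 : 0 < opnorm (P x) + 1 by rewrite ltr_wpDl ?on_ge0.
have e0 : 0 < d / (opnorm (P x) + 1) / (n%:R + 1) by rewrite !dgt0.
have hG' i : \forall k \near \oo, `|g i 0 - G k i 0| <= d / (opnorm (P x) + 1) / (n%:R + 1).
 by move/cvgrPdist_le: (hG i); exact.
have [k0 _ hk] := filter_forall _ hG'.
exists k0 => k /hk /= h; apply: leT (on_bound _ _) _.
have /(enorm_le_comp (a := _)) h' i : `|(g - G k) i 0| <= d / (opnorm (P x) + 1) / (n%:R + 1) by rewrite !mxE.
apply: leT (_ : (opnorm (P x) + 1) * (d / (opnorm (P x) + 1)) <= d); last by rewrite mulrC divfK ?gtF.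
apply: ler_pM; rewrite ?on_ge0 ?en_ge0 ?lerDl//; apply: leT h' _.
by rewrite mulrA lepdM// [n%:R * _]mulrC wMl ?dge0 ?(ltW d0) ?(ltW o1)// lerDl.
Qed.

(** One admissible constant [c] is enough to construct the limit [g]. The last clause bounds [g] by
    every admissible constant, as is needed when the constant varies with the Fujii-Wilson
    parameters while [g] stays the same. *)
Lemma density_limit c f : 0 <= c -> wbound c -> vmeasurable f -> (wint f < +oo)%E -> exists g, [/\ vmeasurable g,
 exists2 v : nat -> X -> 'cV[R]_n, forall k, bs (v k) /\ (wint (v k) <= wint f)%E & null (fun k => vsub (v k) f),
 forall u : nat -> X -> 'cV[R]_n, (forall k, L2 (u k)) -> null (fun k => vsub (u k) f) -> null (fun k => vsub (vec_op T (u k)) g) &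
 forall c' N, wbound c' -> 0 <= N -> (wint f <= (N `^ p)%:E)%E -> (wint g <= ((c' * N) `^ p)%:E)%E].
move=> c0 hc mf ff; have mpsi := mwnorm mf; have psi0 x : 0 <= enorm (P x *m f x) `^ p by exact: pge0.
have [eps [eps0 eps_le eps_anti eps_sum]] := truncation_levels c p0.
have /choice[B hB] k := truncation mf mpsi psi0 ff (eps0 k).
pose v k x := \1_(B k) x *: f x; have bv k : bs (v k) by case: (hB k).
have v2 k := L2_of_bs (bv k); pose G k := vec_op T (v k); have mG k : vmeasurable (G k) := vecop_meas (v2 k).
have mv k : vmeasurable (v k) by move=> i; case: (bv k i).
have mBc k : measurable (~` B k) by apply: measurableC; case: (hB k).
have fv k : (wint (vsub f (v k)) <= (eps k)%:E)%E.
 case: (hB k) => _ _; apply: leT; apply: int_le_nm => x; first by rewrite leF pge0.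
 move=> _; rewrite restrictC leF indicE; case: (_ \in _); rewrite ?scale1r ?mulr1// scale0r mulmx0 enorm0.
 by rewrite powR0 ?gtF// mulr0.
have mt k : mfun (fun x => enorm (P x *m f x) `^ p * \1_(~` B k) x) by exact: mMindic.
have pt k x : 0 <= enorm (P x *m f x) `^ p * \1_(~` B k) x by rewrite mge0.
have vv i j : (j <= i)%N -> (wint (vsub (v i) (v j)) <= (2 * eps j)%:E)%E.
 move=> ji; apply: (leU (\int[mu]_x (enorm (P x *m f x) `^ p * \1_(~` B i) x + enorm (P x *m f x) `^ p * \1_(~` B j) x)%:E)%E).
  apply: int_le_nm => x; first by rewrite leF pge0.
  move=> _; rewrite leF /v !indicE !in_setC.
  by case: (_ \in _); case: (_ \in _); rewrite ?scale1r ?scale0r ?subrr ?subr0 ?mulr0 ?mulr1 ?addr0 ?add0r ?mulmxN ?enormN ?mulmx0 ?enorm0 ?powR0 ?gtF// ?age0 ?pge0.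
 rewrite (intD mu measurableT (mt i) (mt j) (pt i) (pt j)).
 case: (hB i) (hB j) => _ _ hi [_ _ hj]; apply: leT (leeD hi hj) _.
 by rewrite leF mulr2n mulrDl mul1r lerD2r eps_anti.
have e20 k : 0 <= 2 * eps k by rewrite mge0 ?(ltW (eps0 k)).
have GG i j ji := wboundB c0 hc (v2 i) (v2 j) (e20 j) (vv i j ji).
(* Once [a k x <= 1], the increment has weighted norm at most [2^-k]; the inverse matrix [Q x] turns
   this into a geometric bound on the coordinates. *)
pose a k x := (2 ^+ k) `^ p * enorm (P x *m (G k.+1 x - G k x)) `^ p.
have mw k := mwnorm (vmeasB (mG k.+1) (mG k)).
have ma k : mfun (a k) by exact: mfM (mcst _) (mw k).
have a0 k x : 0 <= a k x by rewrite mge0 ?pge0.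
have ha k : (\int[mu]_x (a k x)%:E <= (2 ^- k)%:E)%E.
 rewrite (intZ mu measurableT (mw k) (fun=> pge0 _ _) (pge0 _ _)).
 apply: leT (leMl _ (GG k.+1 k (leqnSn k))) _; first by rewrite leF.
 by rewrite leF eps_sum.
(* The upper limit makes [g] measurable everywhere; almost everywhere it is the true limit. *)
pose g x : 'cV[R]_n := \col_i fine (limn_esup (fun k => (G k x i 0)%:E)).
have mg : vmeasurable g.
 move=> i; have -> : (fun x => g x i 0) = fine \o (fun x => limn_esup (fun k => (G k x i 0)%:E)).
  by apply/funext => x; rewrite mxE.
 apply: mcomp => //; apply: measurable_fun_limn_esup => k; exact/mEFin/mG.
have Gg : {ae mu, forall x i, G k x i 0 @[k --> \oo] --> g x i 0}.
 apply: filterS (ae_vanish ma a0 ha) => x /(_ 1 ltr01)[k0 hk] i.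
 have /cvg_ex[l hl] : cvgn (fun k => G k x i 0).
  apply: (@geometric_cvg _ _ (opnorm (Q x)) k0) => [|k /hk h]; first exact: on_ge0.
  have -> : G k.+1 x i 0 - G k x i 0 = (G k.+1 x - G k x) i 0 by rewrite !mxE.
  apply: leT (coord_le _ _) _; rewrite -[G k.+1 x - _]mul1mx -(QP x) -mulmxA.
  apply: leT (on_bound _ _) _; rewrite wMl ?on_ge0// -[_^-1]mul1r ler_pdivlMr //.
  apply: (powR_inv_le p0); rewrite ?mge0 ?en_ge0 //.
  by rewrite powR1 powRM ?en_ge0 // mulrC.
 have hl' : (G k x i 0)%:E @[k --> \oo] --> l%:E by exact: cvg_comp hl _.
 by rewrite mxE (cvg_limn_einf_sup hl').2.
have vf : null (fun k => vsub (v k) f).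
 move=> e e1; have [k0 hk] := pow2_small e1; exists k0 => k /hk h; apply: leT (_ : (eps k)%:E <= _)%E.
  by apply: leT (fv k); apply: eqW; apply: eqint => x _; rewrite -opprB mulmxN enormN.
 by rewrite leF (leT (eps_le k)).
exists g; split; first exact: mg.
- by exists v; [move=> k; split; [exact: bv|exact: wint_rle]|exact: vf].
- move=> u u2 uf e e1; pose K := 2 `^ p; pose M := K * (c `^ p * (K * 2)) + K * (c `^ p * 2).
 have M0 : 0 <= M by rewrite age0 ?mge0 ?pge0.
 have t0 : 0 < e / (M + 1) by rewrite dgt0// ltr_wpDl.
 have te := ltW t0; set t := e / _ in t0 te; have [j0 hj] := pow2_small t0; have [k0 hk] := uf t t0; exists k0 => k kk.
 have et : eps j0 <= t by rewrite (leT (eps_le _)) ?hj.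
 have mu' : vmeasurable (u k) by move=> i; have /Lfun2P[] := u2 k i.
 have h1 : (wint (vsub (u k) (v j0)) <= (K * (2 * t))%:E)%E.
  apply: leT (wint_tri (vmeasB mu' mf) (vmeasB mf (mv j0)) _) _.
  by apply: aeW => x; rewrite addrA subrK.
  rewrite EFinM leMl // mulrDl mul1r EFinD; apply: leeD (hk k kk) _.
  by rewrite (leT (fv _)).
 have h2 := wboundB c0 hc (u2 k) (v2 j0) _ h1.
 have h3 : (wint (vsub (G j0) g) <= (c `^ p * (2 * t))%:E)%E.
  apply: (fatou_wint (G := fun i => vsub (G j0) (G (i + j0)%N))) => [i||i].
  - exact: vmeasB.
  - apply: filterS Gg => x hx d d0; have [k1 h] := wnorm_cvg0 x hx d0; exists k1 => i ki.
  have -> : G j0 x - g x - (G j0 x - G (i + j0)%N x) = - (g x - G (i + j0)%N x).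
  by rewrite !opprB addrC addrA subrK.
  by rewrite mulmxN enormN h// (leq_trans ki) ?leq_addr.
  - apply: leT (_ : (c `^ p * (2 * eps j0))%:E <= _)%E; last by rewrite leF wMl ?pge0// wMl.
  apply: leT (GG _ _ (leq_addl i j0)); apply: eqW; apply: eqint => x _.
  by rewrite -opprB mulmxN enormN.
 apply: leT (wint_tri (vmeasB (vecop_meas (u2 k)) (mG j0)) (vmeasB (mG j0) mg) _) _.
  by apply: aeW => x; rewrite addrA subrK.
 apply: leT (leMl _ (leeD (h2 _) h3)) _; rewrite ?leF //.
  by apply: mge0; [exact: pge0|exact: mge0].
 rewrite (_ : 2 `^ p * _ = M * t); last by rewrite /M /K; ring.
 by rewrite mulrCA ler_piMr ?(ltW e1)// lepdM ?ltr_wpDl// mul1r lerDl.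
- move=> c' N hc' N0 hN; apply: (fatou_wint mG) => [|k].
  by apply: filterS Gg => x hx d d0; exact: wnorm_cvg0.
 by apply: hc' (bv k) N0 _; exact: leT (wint_rle _ _) hN.
Qed.

End density.

(** * Null sets, scalar characteristics and the conclusion *)

Lemma eq_sup_balls {R : realType} {X : Type} (F G : X -> R -> \bar R) : (forall c s, 0 < s -> F c s = G c s) ->
 ereal_sup [set t | exists c s, 0 < s /\ t = F c s] = ereal_sup [set t | exists c s, 0 < s /\ t = G c s].
move=> FG; congr ereal_sup; apply/seteqP.
by split => _ [c [s [s0 ->]]]; exists c, s; split; rewrite ?FG.
Qed.

Section null_change.
Context {R : realType} {dsp} {X : mType dsp}.
Variables (dist : X -> X -> R) (mu : meas X R) (n : nat) (Z : set X).
Hypotheses (mb : forall c s, 0 < s -> measurable (qball dist c s)) (mZ : measurable Z) (Z0 : mu Z = 0%E).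

Lemma avg_null B (f g : X -> \bar R) : measurable B -> (forall x, (0 <= f x)%E) -> (forall x, (0 <= g x)%E) ->
 (forall x, ~ Z x -> f x = g x) -> avg mu B f = avg mu B g.
by move=> mB f0 g0 fg; congr (_ * _)%E; apply: (eq_int_null mB mZ Z0) => // x _; exact: fg. Qed.

Lemma maximal_null (f g : X -> R) : (forall x, ~ Z x -> f x = g x) -> maximal dist mu f = maximal dist mu g.
move=> fg; apply/funext => x; congr ereal_sup; apply/seteqP; split => _ [c [s [s0 xs ->]]]; exists c, s; split => //;
 by apply: avg_null => [|y|y|y /fg ->]; rewrite ?leF//; exact: mb.
Qed.

Lemma Ainfty_null (v w : X -> R) : (forall x, 0 <= v x) -> (forall x, 0 <= w x) ->
 (forall x, ~ Z x -> v x = w x) -> Ainfty dist mu v = Ainfty dist mu w.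
move=> v0 w0 vw; apply: eq_sup_balls => c s s0.
have -> : (\int[mu]_(x in qball dist c s) (v x)%:E = \int[mu]_(x in qball dist c s) (w x)%:E)%E.
 by apply: (eq_int_null (mb c s0) mZ Z0) => [x|x|x _ /vw ->]; rewrite ?leF.
by rewrite (maximal_null (g := fun y => w y * \1_(qball dist c s) y)) // => y /vw ->.
Qed.

Lemma Asc_null u (V V' : X -> 'M[R]_n) : (forall x, ~ Z x -> V x = V' x) -> Asc dist mu u V = Asc dist mu u V'.
move=> VV; pose F (V : X -> 'M[R]_n) e := Ainfty dist mu (fun x => enorm (mxpowR (V x) u^-1 *m e) `^ u).
have E : F V = F V' by apply/funext => v; apply: Ainfty_null => [x|x|x /VV ->]; rewrite ?pge0.
exact: (f_equal (fun G => ereal_sup [set G e | e in [set e : 'cV[R]_n | e != 0]]) E).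
Qed.

Variables (W W' : X -> 'M[R]_n).
Hypothesis WW : forall x, ~ Z x -> W x = W' x.

Lemma normLp_null p (f : X -> 'cV[R]_n) : normLp mu p W f = normLp mu p W' f.
rewrite /normLp unlock; apply: (f_equal (fun x => poweR x p^-1)).
by apply: (eq_int_null measurableT mZ Z0) => [x|x|x _ /WW ->]; rewrite ?poweR_ge0.
Qed.

Lemma Aconst_null u : Aconst dist mu u W = Aconst dist mu u W'.
rewrite /Aconst; case: (u == 1).
 rewrite /Aconst1.
 apply: eq_sup_balls => c s s0.
 have mB := mb c s0.
 apply: eq_ess_sup; exists Z; split => // y; apply: contra_notP => Zy.
 rewrite /= /patch; case: (y \in _); last by [].
 apply: (avg_null mB) => [x|x|x /WW ->]; first 2 last.
  by rewrite WW.
 1,2: by rewrite leF on_ge0.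
rewrite /Aconst_gt1.
apply: eq_sup_balls => c s s0.
have mB := mb c s0.
apply: (avg_null mB) => [x|x|x Zx]; [exact: poweR_ge0..|apply: (f_equal (fun t => poweR t _))].
apply: (avg_null mB) => [y|y|y Zy]; last by rewrite !WW.
all: by rewrite leF pge0.
Qed.

End null_change.

Lemma Aconst_ge0 {R : realType} {dsp} {X : mType dsp} (dist : X -> X -> R) cd
  (mu : meas X R) n u (W : X -> 'M[R]_n) : htype dist cd mu -> (0 <= Aconst dist mu u W)%E.
move=> hX; have a0 (B : set X) f : (forall x, (0 <= f x)%E) -> (0 <= avg mu B f)%E.
 by move=> f0; rewrite mule_ge0 ?inve_ge0 ?intge0.
rewrite /Aconst; case: ifP => _.
 apply: leT (esupub _); last by exists point, 1; split; [exact: ltr01|reflexivity].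
 apply: ess_sup_gee.
  have /andP[m0 _] := htbmu hX point (@ltr01 R); apply: ltleT m0 _; apply: lemu; rewrite ?inE//.
  by apply: (htbm hX).
 by apply: aeW => y; apply: erestrict_ge0 => z _; apply: a0 => x; rewrite leF on_ge0.
apply: leT (esupub _); last by exists point, 1; split; [exact: ltr01|reflexivity].
by apply: a0 => x; exact: poweR_ge0.
Qed.

Section extension.
Context {R : realType} {dsp} {X : mType dsp}.
Variables (dist : X -> X -> R) (cd : R) (mu : meas X R) (rho : X -> X -> R) (D : R).
Variables (t : \bar R) (T : (X -> R) -> X -> R) (n : nat) (p : R) (W : X -> 'M[R]_n).
Hypotheses (hT : hormander_operator dist cd mu t T) (ds : dspace rho mu D) (p0 : 0 < p)
 (pW : forall x, pdsym (W x)) (mW : forall i j, mfun (fun x => W x i j)).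
Let P x := mxpowR (W x) p^-1.
Local Notation wint := (wint mu p P).

Lemma normLpE f : normLp mu p W f = (wint f `^ p^-1)%E.
rewrite /normLp unlock; apply: (f_equal (fun z => poweR z _)); apply: eqint => x _.
by rewrite /= ger0_norm ?en_ge0.
Qed.

Lemma wint_ge0 f : (0 <= wint f)%E.
by apply: intge0 => x _; rewrite leF pge0. Qed.

Lemma normLp_le f N : 0 <= N -> (normLp mu p W f <= N%:E)%E <-> (wint f <= (N `^ p)%:E)%E.
move=> N0; rewrite normLpE; split => h.
 have := poweR_mono (ltW p0) (poweR_ge0 _ _) h; rewrite -poweRrM mulVf ?gtF// poweRe1//; exact: wint_ge0.
have p1 : 0 <= p^-1 by rewrite ige0 ltW.
by have := poweR_mono p1 (wint_ge0 f) h; rewrite poweR_EFin powRK// gtF.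
Qed.

Lemma cvg_LpP u f : cvg_Lp mu p W u f <->
 forall e : R, 0 < e -> exists k0, forall k, (k0 <= k)%N -> (wint (fun x => (u k x - f x)%R) <= e%:E)%E.
rewrite /cvg_Lp cvge0P; last by move=> k; exact: Lnorm_ge0.
split=> h e e0.
 have [k0 hk] := h _ (pgt0 p^-1 e0); exists k0 => k /hk /normLp_le; rewrite powRVK ?(ltW e0) ?gtF//.
 by apply; exact: pge0.
have [k0 hk] := h _ (pgt0 p e0); exists k0 => k /hk; move/(normLp_le _ (ltW e0)); exact.
Qed.

Lemma L2vecP (f : X -> 'cV[R]_n) : L2vec mu f <-> forall i, (fun x => f x i 0) \in Lfun mu 2%:E.
have E : (Lnorm mu 2%:E (fun x => (enorm (f x))%:E) `^ 2 = \int[mu]_x (enorm (f x) ^+ 2)%:E)%E.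
 by rewrite (Ln2_sqint mu (fun x => enorm (f x))).
split=> [[mf h] i|h].
 apply/Lfun2P; split => //.
 have := poweR_lty 2 h; rewrite E; apply: leltT; apply: int_le_nm => x; first by rewrite leF sqr_ge0.
 by move=> _; rewrite leF -real_normK ?num_real// lerXn2r ?nnegrE ?en_ge0// coord_le.
have mf : vmeasurable f by move=> i; have /Lfun2P[] := h i.
split => //; apply: (@lty_poweRy _ _ 2) => //.
by rewrite E int_en_sqr// lte_sum_pinfty// => i _; have /Lfun2P[] := h i.
Qed.

Lemma ext_ex c (f : X -> 'cV[R]_n) : 0 <= c -> lp_bound mu rho p T W c -> Lp_weighted mu p W f ->
 exists2 g, density_extension mu T p W f g &
  forall c', 0 <= c' -> lp_bound mu rho p T W c' -> (normLp mu p W g <= c'%:E * normLp mu p W f)%E.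
move=> c0 hc [mf ff]; have [C2 C20 Tbd] := horm_sqint hT.
have nf : normLp mu p W f = (fine (normLp mu p W f))%:E by rewrite fineK// ge0fin// Lnorm_ge0.
have N0 : 0 <= fine (normLp mu p W f) by rewrite fine_ge0 ?Lnorm_ge0.
have fN : (wint f <= (fine (normLp mu p W f) `^ p)%:E)%E by apply/normLp_le => //; rewrite -nf.
have [g [mg [v hv vf] ext bd]] := density_limit ds p0 (mmxpowR pW mW p^-1) (fun x => mxpowRN _ (pW x))
 C20 (ho_linear hT) Tbd c0 hc mf (leltT fN (ltry _)).
have gb c' : 0 <= c' -> lp_bound mu rho p T W c' -> (normLp mu p W g <= c'%:E * normLp mu p W f)%E.
 by move=> c'0 hc'; rewrite nf; apply/normLp_le; [exact: mge0|exact: bd].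
exists g => //; split.
- split => //; apply: leltT (gb c c0 hc) _; rewrite nf; exact: ltry.
- exists v; split; last by apply/cvg_LpP.
 move=> k; have [bv wv] := hv k; split.
  split; first by move=> i; case: (bv i).
  exact: leltT ((normLp_le (v k) N0).2 (leT wv fN)) (ltry _).
 by apply/L2vecP; exact: (L2_of_bs ds).
- move=> u [hu uf]; apply/cvg_LpP; apply: ext; last by apply/cvg_LpP.
 by move=> k; apply/L2vecP; case: (hu k).
Qed.

End extension.

(** Putting the identity matrix on a null set makes the weight positive definite everywhere. Norms
    and characteristics do not see the change. *)
Lemma weight_repl {R : realType} {dsp} {X : mType dsp} (dist : X -> X -> R) cd
  (mu : meas X R) T n (W : X -> 'M[R]_n) p : htype dist cd mu -> matrix_weight mu W ->
 exists W', [/\ forall x, pdsym (W' x), forall i j, mfun (fun x => W' x i j),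
  normLp mu p W = normLp mu p W', forall f g, density_extension mu T p W' f g -> density_extension mu T p W f g &
  forall u, Aconst dist mu u W = Aconst dist mu u W' /\ forall F : 'M[R]_n -> 'M[R]_n,
  Asc dist mu u (F \o W) = Asc dist mu u (F \o W')].
move=> hX [mW [Z [mZ Z0 hZ]]]; pose W' x := if x \in Z then 1%:M else W x.
have mb c s : 0 < s -> measurable (qball dist c s) by exact: (htbm hX).
have WW x : ~ Z x -> W x = W' x by move=> Zx; rewrite /W' memNset.
have E : normLp mu p W = normLp mu p W' by apply/funext => g; exact: (normLp_null mZ Z0 WW).
exists W'; split; [ | | |move=> f g|move=> u; split]; last 1 first.
- by move=> F; apply: (Asc_null mb mZ Z0) => x /WW /= ->.
- move=> x; rewrite /W'; case: ifPn => [_|/negP Zx]; last by apply: contrapT => h; apply: Zx; rewrite inE; exact: hZ.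
 split; first exact: trmx1.
 by move=> v v0; rewrite mulmx1 -en_sqr_mx xgt0 ?en_gt0.
- move=> i j; have -> : (fun x => W' x i j) =
  (fun x => (1%:M : 'M[R]_n) i j * \1_Z x + W x i j * \1_(~` Z) x).
  by apply/funext => x; rewrite /W' !indicE in_setC; case: (x \in Z); rewrite ?mulr1 ?mulr0 ?addr0 ?add0r.
 apply: mfD; apply: mMindic => //; exact: measurableC.
- exact: E.
- by rewrite /density_extension /Lp_weighted /cvg_Lp E.
- exact: (Aconst_null mb mZ Z0 WW).
Qed.

Lemma ge0_finite {R : realType} (x : \bar R) : (0 <= x)%E -> (x < +oo)%E -> exists2 a, 0 <= a & x = a%:E.
by case: x => // a; rewrite leF => a0 _; exists a. Qed.

Lemma powR_factor2 {R : realType} (c a D s s' t t' : R) : 0 <= D -> 0 <= s -> 0 <= s' ->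
 c * a * (D * s') `^ t' * (D * s) `^ t = c * D `^ t' * D `^ t * a * (s' `^ t' * s `^ t).
by move=> D0 s0 s'0; rewrite !powRM//; ring. Qed.

Lemma absorb_factor {R : realType} (x y s : \bar R) (K a d : R) : 0 <= K -> 0 <= a -> 1 <= d -> (0 <= y)%E -> (0 <= s)%E ->
 (exists s1 : R, x <= (K * a * s1)%:E * y)%E -> (forall s0 : R, s = s0%:E -> (x <= (K * a * s0)%:E * y)%E) ->
 (x <= (K + 1)%:E * d%:E * a%:E * s * y)%E.
move=> K0 a0 d1 y0 s0 [s1 h1]; have K1 : 0 < K + 1 by rewrite ltr_wpDl.
have d0 : 0 < d by lra.
case: s s0 => [s s0 h|_ _|//].
 apply: leT (h s erefl) _; apply: leMr => //; rewrite leF.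
 apply: wMr => //.
 by apply: wMr => //; apply: leT (_ : K * d <= _); rewrite ?ler_peMr// wMr ?(ltW d0)// lerDl.
have [a00|an] := eqVneq a 0; first by move: h1; rewrite a00 !mulr0 mul0r !mule0 !mul0e.
have [y00|yn] := eqVneq y 0%E; first by move: h1; rewrite y00 !mule0.
by rewrite -!EFinM gt0_muley ?lte_fin ?mgt0// ?lt0r ?an// gt0_mulye ?leey// lt0e yn.
Qed.

(* Both characteristics are at least 1; when one of them is infinite the bound is void unless [a] or [y] vanishes,
 in which case some finite admissible constants give [x <= 0]. *)
Lemma opt_consts {R : realType} (x y A B : \bar R) (F F' : R -> Prop) (c a d D t t' : R) : 0 <= c -> 0 <= a ->
 1 <= d -> 1 <= D -> 0 < t -> 0 < t' -> (0 <= y)%E -> (1 <= A)%E -> (1 <= B)%E ->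
 (forall S : R, A = S%:E -> F (D * S)) -> (forall S : R, B = S%:E -> F' (D * S)) ->
 (exists2 S, 1 <= S & F S) -> (exists2 S, 1 <= S & F' S) ->
 (forall S S', 1 <= S -> F S -> 1 <= S' -> F' S' -> (x <= (c * a * S' `^ t' * S `^ t)%:E * y)%E) ->
 (x <= (c * D `^ t' * D `^ t + 1)%:E * d%:E * a%:E * (B `^ t' * A `^ t) * y)%E.
move=> c0 a0 d1 D1 t0 t'0 y0 A1 B1 hA hB [S1 S11 F1] [S2 S21 F2] h; have D0 : 0 <= D by exact: leT.
have key s s' : 0 <= s -> 0 <= s' -> 1 <= D * s -> F (D * s) -> 1 <= D * s' -> F' (D * s') ->
  (x <= (c * D `^ t' * D `^ t * a * (s' `^ t' * s `^ t))%:E * y)%E.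
 by move=> s0 s'0 s1 hs s'1 hs'; rewrite -powR_factor2//; exact: h.
have Ds (s : R) : (1 <= s%:E)%E -> 0 <= s /\ 1 <= D * s.
 by rewrite leF => s1; rewrite (leT _ s1)// mulr_ege1.
apply: absorb_factor => //; [by rewrite !mge0 ?pge0|by rewrite mule_ge0 ?poweR_ge0| |].
 have mD S : D * (S / D) = S by rewrite mulrC divfK// gtF// (ltleT ltr01).
 exists ((S2 / D) `^ t' * (S1 / D) `^ t).
 by apply: key; rewrite ?mD// dge0// (leT ler01).
move=> s0; case: A A1 hA => [s A1 hA|_ _|//]; last first.
 by rewrite poweRyr ?gtF// gt0_muley// poweR_gt0// (ltleT _ B1).
case: B B1 hB => [s' B1 hB|_ _|//]; last first.
 by rewrite poweRyr ?gtF// gt0_mulye// poweR_gt0// (ltleT _ A1).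
rewrite -EFinM => -[<-]; have [s_0 Ds1] := Ds _ A1; have [s'_0 Ds'1] := Ds _ B1.
by apply: key => //; [exact: hA|exact: hB].
Qed.

Section characteristics.
Context {R : realType} {dsp} {X : mType dsp}.
Variables (dist : X -> X -> R) (cd : R) (mu : meas X R) (rho : X -> X -> R) (e D : R).
Hypotheses (hX : htype dist cd mu) (e0 : 0 < e)
 (re : pwcmp rho dist e) (ds : dspace rho mu D).

(** On a ball the maximal function of the cut weight is at least the mean of the weight over that
    ball. Normalizing this way allows products of characteristics that may be infinite. *)
Lemma Ainfty_ge1 (w : X -> R) : mfun w -> (forall x, 0 < w x) ->
 (forall c s, 0 < s -> (\int[mu]_(x in qball rho c s) (w x)%:E < +oo)%E) -> (1 <= Ainfty dist mu w)%E.
move=> mw w0 wf; pose B := qball dist point 1; have mB : measurable B by apply: (htbm hX).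
have /andP[B0 Boo] := htbmu hX point (@ltr01 R); rewrite -/B in B0 Boo.
have Bm : mu B = (fine (mu B))%:E by rewrite fineK// ge0fin.
have m0 : 0 < fine (mu B) by rewrite -lte_fin -Bm.
have I0 : (0 < \int[mu]_(x in B) (w x)%:E)%E by exact: pos_int_gt0 mB Bm m0 _ mw w0.
have Ioo : (\int[mu]_(x in B) (w x)%:E < +oo)%E.
 apply: leltT (wf point (1 `^ e) (pgt0 _ ltr01)); apply: isub => //.
 - exact: mball ds _ _.
 - by move=> x; exact: ltW.
 - exact: (dbl_sub hX e0 re).
apply: leT (esupub _); last by exists point, 1; split; [exact: ltr01|reflexivity].
rewrite -/B; set I := (\int[mu]_(x in B) _)%E in I0 Ioo *.
have IE : I = (fine I)%:E by rewrite fineK// ge0fin// ltW.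
have i0 : 0 < fine I by rewrite -lte_fin -IE.
apply: (leU (I^-1 * I)%E); first by rewrite IE inver gtF// -EFinM mulVf ?gtF.
apply: leMl; first by rewrite inve_ge0 ltW.
have -> : I = (\int[mu]_(x in B) ((fine (mu B))^-1 * fine I)%:E)%E.
 by rewrite int_cst// Bm -EFinM mulrAC mulVf ?mul1r ?gtF.
apply: int_le_nm => x; first by rewrite leF mge0 ?(ltW i0) .
move=> Bx; apply: esupub; exists point, 1; split; [exact: ltr01|exact: Bx|].
rewrite /avg Bm inver gtF// EFinM -IE; apply: (f_equal (mule _)); apply: eqint => y By.
by rewrite indicE By mulr1 ger0_norm ?ltW.
Qed.

(** A positive dimension supplies a nonzero vector, and with it the lower bound 1; the Fujii-Wilson
    constant is that of [fw_of_Ainfty]. *)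
Lemma fw_of_Asc n (V P Q : X -> 'M[R]_n) u : (0 < n)%N -> (fun x => mxpowR (V x) u^-1) = P ->
 mmx P -> (forall x, Q x *m P x = 1%:M) -> weight_fin mu rho u P ->
 (1 <= Asc dist mu u V)%E /\ forall S : R, Asc dist mu u V = S%:E -> weight_fw mu rho u P (D * S).
move=> n0 VP; subst P; set P := fun x => _; move=> mP QP fin.
have mw v := mweight u mP v; have w0 v v0 := weight_gt0 u QP (v := v) v0.
have le v : v != 0 -> (Ainfty dist mu (fun x => enorm (P x *m v) `^ u)%R <= Asc dist mu u V)%E.
 by move=> v0; apply: esupub; exists v.
have A1 : (1 <= Asc dist mu u V)%E.
 have d0 : (dmx (Ordinal n0) 0 : 'cV[R]_n) != 0 by apply/eqP => /colP/(_ (Ordinal n0)); rewrite !mxE; apply/eqP/oner_neq0.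
 by apply: leT (le _ d0); apply: Ainfty_ge1 => // [x|c s s0]; [exact: w0|exact: fin].
split=> // S SE v v0; apply: (fw_of_Ainfty hX e0 re ds (mw v) (w0 v v0)) => [c s s0||].
- exact: fin.
- by rewrite -leF -SE (leT _ A1).
- by rewrite -SE; exact: le.
Qed.

End characteristics.

Theorem theorem3 (R : realType) (dsp : measure_display) (X : measurableType dsp)
  (dist : X -> X -> R) (cd : R) (mu : {measure set X -> \bar R})
  (hX : homogeneous_type dist cd mu)
  (n : nat) (hn : (0 < n)%N)
  (r p : R) (hr : 1 <= r) (hrp : r < p)
  (T : (X -> R) -> X -> R)
  (hT : hormander_operator dist cd mu (hoelder_conjugate r%:E) T) :
  (exists2 C : R, 0 < C &
  forall W : X -> 'M[R]_n, matrix_weight mu W ->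
  (Aconst dist mu (p / r) W < +oo)%E ->
  forall f : X -> 'cV[R]_n, Lp_weighted mu p W f ->
  exists2 Tf : X -> 'cV[R]_n, density_extension mu T p W f Tf &
  (normLp mu p W Tf <=
  C%:E * Aconst dist mu (p / r) W `^ p^-1
  * Asc dist mu (dual (p / r))
  (fun x => mxpowR (W x) (- (r / p * dual (p / r)))) `^ p^-1
  * Asc dist mu (p / r) W `^ (dual p)^-1
  * normLp mu p W f)%E)
  /\
  (forall q : R, 1 <= q -> q < p -> r < p / q ->
  exists2 C : R, 0 < C &
  forall W : X -> 'M[R]_n, matrix_weight mu W ->
  (Aconst dist mu q W < +oo)%E ->
  forall f : X -> 'cV[R]_n, Lp_weighted mu p W f ->
  exists2 Tf : X -> 'cV[R]_n, density_extension mu T p W f Tf &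
  (normLp mu p W Tf <=
  C%:E * (dual (p / (r * q)))%:E
  * Aconst dist mu q W `^ p^-1
  * Asc dist mu q W `^ (dual p)^-1
  * normLp mu p W f)%E).
have [rho [e e0 [rm re]]] := metrization (htqm hX).
have [D ds] := metrized_doubling hX e0 rm re; have [C cz] := hormander_cz hT erefl hr hX e0 rm re ds.
have Lam1 : 1 <= osc_dil cd e.
 rewrite mulr_ege1 ?ler1n// powR_ge1 ?(ltW e0)// mulr_ege1 ?ler1n//.
 exact: qm_const (htqm hX).
have r0 : 0 < r by lra.
have p0 : 0 < p by lra.
have p1 : 1 < p by lra.
have D1 : 1 <= D by apply: leT (dsC ds); rewrite ler1n.
have pE : (dual p)^-1 = 1 - p^-1 by rewrite -(dual_add p1) addrAC subrr add0r.
have p'0 : 0 < p^-1 by rewrite igt0.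
have th0 : 0 < 1 - p^-1 by rewrite subr_gt0 invf_lt1.
split.
- have u1 : 1 < p / r by rewrite ltr_pdivlMr// mul1r.
 have ur : p / r * r = p by rewrite divfK ?gtF.
 have uV : (p / r)^-1 = r / p by lra.
 have [C' C'0 hC'] := bounded_part1 hX e0 re ds n Lam1 hr cz hrp (ltW u1) (eqW ur) u1 ur.
 set u := p / r in u1 ur uV hC' *; have d1 := dual_gt1 u1.
 exists (C' * D `^ p^-1 * D `^ (1 - p^-1) + 1) => [|W hW WA f hf]; first by rewrite ltr_wpDl ?mge0 ?pge0.
 have [W' [pW mW E ext null]] := weight_repl T p hX hW.
 have [Au Su] := null u; rewrite E Au in WA *; rewrite (Su id : Asc dist mu u W = Asc dist mu u W').
 have [_ /(_ (fun M => mxpowR M (- (r / p * dual u)))) Sd] := null (dual u).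
 rewrite (Sd : Asc dist mu (dual u) (fun x => mxpowR (W x) _) = Asc dist mu (dual u) (fun x => mxpowR (W' x) _)).
 have hf' : Lp_weighted mu p W' f by case: hf => h1; rewrite E => h2; split; [exact: h1|exact: h2].
 have [a a0 AE] := ge0_finite (Aconst_ge0 u W' hX) WA.
 rewrite AE poweR_EFin; have := hC' W' a pW mW a0 (eqW AE).
 move=> [fin [S1 S11 fw1] finQ [S2 S21 fw2] bd].
 have c0 s s' : 0 <= C' * a `^ p^-1 * s' `^ p^-1 * s `^ (1 - p^-1) by rewrite !mge0 ?pge0.
 have [g dg gb] := ext_ex hT ds p0 pW mW (c0 S1 S2) (bd _ _ S11 fw1 S21 fw2) hf'.
 exists g; first exact: ext.
 have [A1 hA] := fw_of_Asc hX e0 re ds hn erefl (mmxpowR pW mW u^-1) (fun x => mxpowRN _ (pW x)) fin.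
 have dn : dual u != 0 by lra.
 (* The power of the dual weight in the statement is such that its root of order [u'] is [W^(-1/u)],
    the matrix function [Q] of [bounded_part1]. *)
 have QE : (fun x => mxpowR (mxpowR (W' x) (- (r / p * dual u))) (dual u)^-1) = (fun x => mxpowR (W' x) (- u^-1)).
  by apply/funext => x; rewrite (mxpowRrM _ _ (pW x)) mulNr uV (mulfK dn).
 have [B1 hB] := fw_of_Asc hX e0 re ds hn QE (mmxpowR pW mW _) (fun x => mxpowRV _ (pW x)) finQ.
 have := @opt_consts R (normLp mu p W' g) (normLp mu p W' f) _ _ _ _ C' (a `^ p^-1) 1 D (1 - p^-1) p^-1 C'0
  (pge0 _ _) (lexx 1) D1 th0 p'0 (Lnorm_ge0 _ _ _) A1 B1 hA hB (ex_intro2 _ _ S1 S11 fw1) (ex_intro2 _ _ S2 S21 fw2)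
  (fun S S' h1 h2 h1' h2' => gb _ (c0 S S') (bd S S' h1 h2 h1' h2')).
 by rewrite mule1 !muleA pE; apply.
move=> q q1 qp rpq; have q0 : 0 < q by exact: ltleT.
have qr : q * r < p by rewrite mulrC -ltr_pdivlMr.
(* [opt_consts] carries the dual exponent as the factor [d], which has to be at least 1. *)
have d1 : 1 <= dual (p / (r * q)).
 by apply: ltW; apply: dual_gt1; rewrite ltr_pdivlMr ?mgt0// mul1r mulrC.
have [C' C'0 hC'] := bounded_part2 hX e0 re ds n Lam1 hr cz hrp q1 (ltW qr) qr.
exists (C' * D `^ 1 * D `^ (1 - p^-1) + 1) => [|W hW WA f hf]; first by rewrite ltr_wpDl ?mge0 ?pge0.
have [W' [pW mW E ext null]] := weight_repl T p hX hW.
have [Aq Sq] := null q; rewrite E Aq in WA *; rewrite (Sq id : Asc dist mu q W = Asc dist mu q W').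
have hf' : Lp_weighted mu p W' f by case: hf => h1; rewrite E => h2; split; [exact: h1|exact: h2].
have [a a0 AE] := ge0_finite (Aconst_ge0 q W' hX) WA.
rewrite AE poweR_EFin; have [fin [S1 S11 fw1] bd] := hC' W' a pW mW a0 (eqW AE).
have c0 s : 0 <= C' * a `^ p^-1 * s `^ (1 - p^-1) by rewrite !mge0 ?pge0.
have [g dg gb] := ext_ex hT ds p0 pW mW (c0 S1) (bd _ S11 fw1) hf'.
exists g; first exact: ext.
have [A1 hA] := fw_of_Asc hX e0 re ds hn erefl (mmxpowR pW mW q^-1) (fun x => mxpowRN _ (pW x)) fin.
have y0 : (0 <= normLp mu p W' f)%E by exact: Lnorm_ge0.
have c1 S S' : 1 <= S' -> ((C' * a `^ p^-1 * S `^ (1 - p^-1))%:E <= (C' * a `^ p^-1 * S' `^ 1 * S `^ (1 - p^-1))%:E)%E.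
 move=> S'1; rewrite leF [leRHS]mulrAC; apply: (ler_peMr (c0 S)); exact: powR_ge1.
(* Only one characteristic is present here: the second one is taken to be 1, with a trivial
   admissibility predicate and exponent 1. *)
have := @opt_consts R (normLp mu p W' g) (normLp mu p W' f) _ 1%E _ (fun=> True) C' (a `^ p^-1) _ D (1 - p^-1) 1 C'0
 (pge0 _ _) d1 D1 th0 ltr01 y0 A1 (lexx _) hA (fun _ _ => I) (ex_intro2 _ _ S1 S11 fw1) (ex_intro2 _ _ 1 (lexx _) I)
 (fun S S' h1 h2 h1' _ => leT (gb _ (c0 S) (bd S h1 h2)) (leMr y0 (c1 S S' h1'))).
by rewrite poweR1r mul1e pE; apply.
Qed.
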